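(* Let $M\ge4$. There exist $\eta_{ap},\delta_{ap}\in(0,1]$ and $C_{ap}>0$, depending only on $M$ and the parameters, such that if $T>0$ and $(u,p,\theta,K)$ is a smooth solution of (P) on $[0,T]\times\mathbb T^3$ with $u(t)$ of mean zero for all $t$, $J_{eq}+K(0,x)$ having spectrum $\{\lambda,\lambda,\nu\}$ for every $x$, and $$(\mathcal E_M+\mathcal F_M)(0)\le\eta_{ap},\qquad \sup_{0\le t\le T}\mathcal E_M(t)+\int_0^T\overline{\mathcal D}_M\le\delta_{ap},$$ then $$\sup_{0\le t\le T}\Big(\mathcal E_{low}(t)(1+t)^{2M-2}+\overline{\mathcal E}_M(t)+\frac{\mathcal F_M(t)}{1+t}\Big)+\int_0^T\mathcal D_M\le C_{ap}(\overline{\mathcal E}_M+\mathcal F_M)(0)$$ and $$\sup_{0\le t\le T}\mathcal E_M^{(K)}(t)\le C_{ap}(\mathcal E_M+\mathcal F_M)(0).$$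
   Context: Let $\mathbb{T}^3=\mathbb{R}^3/\mathbb{Z}^3$. Fix constants $\mu,\kappa,\alpha,\beta,\gamma>0$, $\tau>0$ and $\nu>\lambda>0$; set $\tilde\alpha=\alpha+\tfrac43\beta$, $\tilde\gamma=\beta+\gamma$, $\tilde\tau=\tau/(2\kappa)$, $\omega_{eq}=\tilde\tau e_3$, $J_{eq}=\mathrm{diag}(\lambda,\lambda,\nu)$. $\mathrm{ten}\,w$ is the antisymmetric matrix with $(\mathrm{ten}\,w)v=w\times v$; $\Omega_{eq}=\mathrm{ten}\,\omega_{eq}$, $\Theta=\mathrm{ten}\,\theta$, $[A,B]=AB-BA$. System (P): $\partial_t u+(u\cdot\nabla)u=(\mu+\kappa/2)\Delta u+\kappa\nabla\times\theta-\nabla p$, $\nabla\cdot u=0$, $(J_{eq}+K)(\partial_t\theta+(u\cdot\nabla)\theta)+(\omega_{eq}+\theta)\times\big((J_{eq}+K)(\omega_{eq}+\theta)\big)=\kappa\nabla\times u-2\kappa\theta+(\tilde\alpha-\tilde\gamma)\nabla(\nabla\cdot\theta)+\tilde\gamma\Delta\theta$, $\partial_t K+(u\cdot\nabla)K=[\Omega_{eq}+\Theta,J_{eq}+K]$, $K$ symmetric. $a=(K_{13},K_{23})$. Parabolic norms: $\partial^\alpha=\partial_t^{\alpha_0}\partial_x^{\bar\alpha}$, $|\alpha|_P=2\alpha_0+|\bar\alpha|$, $\|f\|_{P^k}^2=\sum_{|\alpha|_P\le k}\|\partial^\alpha f\|_{L^2}^2$, squared norms of tuples add. Functionals: $\overline{\mathcal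 E}_M=\|(u,\theta,a)\|_{P^{2M}}^2$; $\mathcal E_{low}=\|(u,\theta,a)\|_{P^2}^2+\|\partial_t a\|_{H^1}^2+\|\partial_t^2a\|_{L^2}^2$; $\mathcal E^{(K)}_M=\|K\|_{H^{2M-3}}^2+\|\partial_tK\|_{H^{2M-3}}^2+\|\partial_t^2K\|_{H^{2M-3}}^2+\sum_{j=3}^M\|\partial_t^jK\|_{H^{2M-2j+2}}^2$; $\mathcal E_M=\overline{\mathcal E}_M+\mathcal E_M^{(K)}$; $\mathcal F_M=\|K\|_{H^{2M+1}}^2+\|\partial_tK\|_{H^{2M}}^2+\|\partial_t^2K\|_{H^{2M-2}}^2$; $\overline{\mathcal D}_M=\|(u,\theta)\|_{P^{2M+1}}^2$; $\mathcal D_M=\overline{\mathcal D}_M+\sum_{j=0}^3\|\partial_t^ja\|_{H^{2M-j-1}}^2+\sum_{j=4}^M\|\partial_t^ja\|_{H^{2M-2j+3}}^2$. *)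

(* Defs.v *)
From Stdlib Require Import Reals Lra List.
From Coquelicot Require Import Coquelicot.
Import ListNotations.
Open Scope R_scope.

(** A scalar field on R_t x R^3 : (t, x1, x2, x3) |-> value.
    Fields on T^3 are represented as 1-periodic functions in x1,x2,x3. *)
Definition Field := R -> R -> R -> R -> R.
Definition VField := nat -> Field.          (* components 0,1,2 *)
Definition MField := nat -> nat -> Field.   (* entries (i,j), 0<=i,j<=2 *)

Definition slice (k : nat) (f : Field) (t x y z : R) : R -> R :=
  match k with
  | O => fun s => f s x y z
  | 1%nat => fun s => f t s y z
  | 2%nat => fun s => f t x s z
  | _ => fun s => f t x y s
  end.
Definition coord (k : nat) (t x y z : R) : R :=
  match k with O => t | 1%nat => x | 2%nat => y | _ => z end.

Definition pd (k : nat) (f : Field) : Field :=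
  fun t x y z => Derive (slice k f t x y z) (coord k t x y z).

Definition uncurry4 (f : Field) (p : R * (R * (R * R))) : R :=
  f (fst p) (fst (snd p)) (fst (snd (snd p))) (snd (snd (snd p))).

Definition smooth (f : Field) : Prop :=
  forall ks : list nat,
    let g := fold_right pd f ks in
    (forall p, continuous (uncurry4 g) p) /\
    (forall k t x y z, ex_derive (slice k g t x y z) (coord k t x y z)).

Definition periodic (f : Field) : Prop :=
  forall t x y z,
    f t (x + 1) y z = f t x y z /\ f t x (y + 1) z = f t x y z /\
    f t x y (z + 1) = f t x y z.

Definition dt (f : Field) : Field := pd 0 f.
Definition dx (i : nat) (f : Field) : Field := pd (S i) f.
Definition dpow (k n : nat) (f : Field) : Field := Nat.iter n (pd k) f.
Definition dmulti (a0 a1 a2 a3 : nat) (f : Field) : Field :=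
  dpow 0 a0 (dpow 1 a1 (dpow 2 a2 (dpow 3 a3 f))).

Definition torus_int (f : Field) (t : R) : R :=
  RInt (fun x => RInt (fun y => RInt (fun z => f t x y z) 0 1) 0 1) 0 1.

Definition L2sq (f : Field) (t : R) : R :=
  torus_int (fun t x y z => (f t x y z) ^ 2) t.

Definition Hs_sq (s : nat) (f : Field) (t : R) : R :=
  sum_f_R0 (fun a1 => sum_f_R0 (fun a2 => sum_f_R0 (fun a3 =>
    if (a1 + a2 + a3 <=? s)%nat then L2sq (dmulti 0 a1 a2 a3 f) t else 0)
  s) s) s.

Definition Pk_sq (k : nat) (f : Field) (t : R) : R :=
  sum_f_R0 (fun a0 => sum_f_R0 (fun a1 => sum_f_R0 (fun a2 => sum_f_R0 (fun a3 =>
    if (2 * a0 + a1 + a2 + a3 <=? k)%nat then L2sq (dmulti a0 a1 a2 a3 f) t else 0)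
  k) k) k) k.

Definition sumN (N : Field -> R -> R) (l : list Field) (t : R) : R :=
  fold_right (fun f acc => N f t + acc) 0 l.

Definition comps3 (v : VField) : list Field := [v 0%nat; v 1%nat; v 2%nat].
Definition compsK (K : MField) : list Field :=
  [K 0%nat 0%nat; K 0%nat 1%nat; K 0%nat 2%nat;
   K 1%nat 0%nat; K 1%nat 1%nat; K 1%nat 2%nat;
   K 2%nat 0%nat; K 2%nat 1%nat; K 2%nat 2%nat].
Definition aK (K : MField) : list Field := [K 0%nat 2%nat; K 1%nat 2%nat].
Definition dtl (j : nat) (l : list Field) : list Field := map (dpow 0 j) l.

Definition sum_from (m n : nat) (g : nat -> R) : R :=
  sum_f_R0 (fun j => if (m <=? j)%nat then g j else 0) n.

Definition Ebar (M : nat) (u th : VField) (K : MField) (t : R) : R :=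
  sumN (Pk_sq (2 * M)) (comps3 u ++ comps3 th ++ aK K) t.

Definition Elow (u th : VField) (K : MField) (t : R) : R :=
  sumN (Pk_sq 2) (comps3 u ++ comps3 th ++ aK K) t
  + sumN (Hs_sq 1) (dtl 1 (aK K)) t
  + sumN L2sq (dtl 2 (aK K)) t.

Definition EK (M : nat) (K : MField) (t : R) : R :=
  sumN (Hs_sq (2 * M - 3)) (compsK K) t
  + sumN (Hs_sq (2 * M - 3)) (dtl 1 (compsK K)) t
  + sumN (Hs_sq (2 * M - 3)) (dtl 2 (compsK K)) t
  + sum_from 3 M (fun j => sumN (Hs_sq (2 * M - 2 * j + 2)) (dtl j (compsK K)) t).

Definition EM (M : nat) (u th : VField) (K : MField) (t : R) : R :=
  Ebar M u th K t + EK M K t.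

Definition FM (M : nat) (K : MField) (t : R) : R :=
  sumN (Hs_sq (2 * M + 1)) (compsK K) t
  + sumN (Hs_sq (2 * M)) (dtl 1 (compsK K)) t
  + sumN (Hs_sq (2 * M - 2)) (dtl 2 (compsK K)) t.

Definition Dbar (M : nat) (u th : VField) (t : R) : R :=
  sumN (Pk_sq (2 * M + 1)) (comps3 u ++ comps3 th) t.

Definition DM (M : nat) (u th : VField) (K : MField) (t : R) : R :=
  Dbar M u th t
  + sum_from 0 3 (fun j => sumN (Hs_sq (2 * M - j - 1)) (dtl j (aK K)) t)
  + sum_from 4 M (fun j => sumN (Hs_sq (2 * M - 2 * j + 3)) (dtl j (aK K)) t).

Definition sum3 (g : nat -> R) : R := g 0%nat + g 1%nat + g 2%nat.
Definition cross (a b : nat -> R) (i : nat) : R :=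
  match i with
  | O => a 1%nat * b 2%nat - a 2%nat * b 1%nat
  | 1%nat => a 2%nat * b 0%nat - a 0%nat * b 2%nat
  | _ => a 0%nat * b 1%nat - a 1%nat * b 0%nat
  end.
(** ten w : the antisymmetric matrix with (ten w) v = w x v *)
Definition ten (w : nat -> R) (i j : nat) : R :=
  match i, j with
  | O, 1%nat => - w 2%nat | O, 2%nat => w 1%nat
  | 1%nat, O => w 2%nat | 1%nat, 2%nat => - w 0%nat
  | 2%nat, O => - w 1%nat | 2%nat, 1%nat => w 0%nat
  | _, _ => 0
  end.
Definition mv (A : nat -> nat -> R) (v : nat -> R) (i : nat) : R :=
  sum3 (fun j => A i j * v j).
Definition mm (A B : nat -> nat -> R) (i j : nat) : R :=
  sum3 (fun k => A i k * B k j).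
Definition comm (A B : nat -> nat -> R) (i j : nat) : R := mm A B i j - mm B A i j.
Definition det3 (A : nat -> nat -> R) : R :=
  A 0%nat 0%nat * (A 1%nat 1%nat * A 2%nat 2%nat - A 1%nat 2%nat * A 2%nat 1%nat)
  - A 0%nat 1%nat * (A 1%nat 0%nat * A 2%nat 2%nat - A 1%nat 2%nat * A 2%nat 0%nat)
  + A 0%nat 2%nat * (A 1%nat 0%nat * A 2%nat 1%nat - A 1%nat 1%nat * A 2%nat 0%nat).

Definition Jeq (lam nu : R) (i j : nat) : R :=
  if (i =? j)%nat then (if (i =? 2)%nat then nu else lam) else 0.
Definition omega_eq (kappa tau : R) (i : nat) : R :=
  if (i =? 2)%nat then tau / (2 * kappa) else 0.

Definition lap (f : Field) : Field :=
  fun t x y z => sum3 (fun j => dx j (dx j f) t x y z).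
Definition div (v : VField) : Field :=
  fun t x y z => sum3 (fun j => dx j (v j) t x y z).
Definition curl (v : VField) (i : nat) : Field :=
  fun t x y z =>
  match i with
  | O => dx 1 (v 2%nat) t x y z - dx 2 (v 1%nat) t x y z
  | 1%nat => dx 2 (v 0%nat) t x y z - dx 0 (v 2%nat) t x y z
  | _ => dx 0 (v 1%nat) t x y z - dx 1 (v 0%nat) t x y z
  end.

Definition system_P (mu kappa alpha beta gamma tau lam nu : R)
  (u : VField) (p : Field) (th : VField) (K : MField) (t x y z : R) : Prop :=
  let atil := alpha + 4 / 3 * beta in
  let gtil := beta + gamma in
  let uv := fun i => u i t x y z in
  let thv := fun i => th i t x y z in
  let A := fun i j => Jeq lam nu i j + K i j t x y z in
  let W := fun i => omega_eq kappa tau i + thv i in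
  (forall i, (i < 3)%nat ->
     dt (u i) t x y z + sum3 (fun j => uv j * dx j (u i) t x y z)
     = (mu + kappa / 2) * lap (u i) t x y z + kappa * curl th i t x y z
       - dx i p t x y z) /\
  div u t x y z = 0 /\
  (forall i, (i < 3)%nat ->
     sum3 (fun j => A i j * (dt (th j) t x y z
                             + sum3 (fun k => uv k * dx k (th j) t x y z)))
     + cross W (mv A W) i
     = kappa * curl u i t x y z - 2 * kappa * thv i
       + (atil - gtil) * dx i (div th) t x y z + gtil * lap (th i) t x y z) /\
  (forall i j, (i < 3)%nat -> (j < 3)%nat ->
     dt (K i j) t x y z + sum3 (fun k => uv k * dx k (K i j) t x y z)
     = comm (fun a b => ten W a b) A i j) /\
  (forall i j, (i < 3)%nat -> (j < 3)%nat -> K i j t x y z = K j i t x y z).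

(* Main.v *)
From Stdlib Require Import Reals Lra Lia ZArith List Permutation FunctionalExtensionality
  ProofIrrelevance ClassicalEpsilon.
From Coquelicot Require Import Coquelicot.
Require Import Defs.
Import ListNotations.
Open Scope R_scope.

(** The matrix (J - lam)(J - nu), with J = Jeq + K, is transported by the same commutator equation as J, so the spectral
    constraint persists.  It expresses the other entries of K quadratically through K, so that K is controlled by its
    entries a = (K13, K23).

    After a differentiation, testing the equations of u, theta and a against u, theta and a multiple of a gives a
    parabolic energy whose linear coupling between theta and a cancels and whose dissipation contains u and theta only.
    The rotation part of the theta equation expresses a through u and theta with the loss of one derivative.
    At order 2 all nonlinear terms are absorbed, and interpolation between the dissipation and the bounded energy of
    order 2M gives the decay (1 + t)^-(2M - 2).  At order 2M the only terms not absorbed are those of the transport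
    of a, whose coefficients are controlled by a fractional power of the decaying low norm and are integrable in time.

    The norm of K in H^(2M+1) obeys a transport estimate with integrable coefficients and a source bounded by the
    square root of the dissipation, hence the growth 1 + t of its square.  The remaining norms of time derivatives of K
    follow from its equation. *)

(** * Smooth periodic fields *)

Lemma field_ext (f g : Field) :
  (forall t x y z, f t x y z = g t x y z) -> f = g.
Proof.
  intros H; repeat (apply functional_extensionality; intro); apply H.
Qed.

Lemma smooth_pd k f : smooth f -> smooth (pd k f).
Proof.
  intros H ks; specialize (H (ks ++ [k])); rewrite fold_right_app in H; exact H.
Qed.

Lemma smooth_continuous f : smooth f -> forall p, continuous (uncurry4 f) p.
Proof. intros H; exact (proj1 (H [])). Qed.

Lemma smooth_ex_derive f : smooth f ->
  forall k t x y z, ex_derive (slice k f t x y z) (coord k t x y z).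
Proof. intros H; exact (proj2 (H [])). Qed.

(* Smoothness by coinduction: [P] need only be stable under partial derivatives. *)
Lemma smooth_class (P : Field -> Prop) :
  (forall g, P g -> (forall p, continuous (uncurry4 g) p) /\
    (forall k t x y z, ex_derive (slice k g t x y z) (coord k t x y z)) /\
    (forall k, P (pd k g))) ->
  forall f, P f -> smooth f.
Proof.
  intros H f Hf ks; cbv zeta.
  assert (HP : P (fold_right pd f ks)).
  { induction ks as [|k ks IH]; simpl; [exact Hf | apply H, IH]. }
  destruct (H _ HP) as (Hcont & Hder & _); split; assumption.
Qed.

Definition set_coord (k : nat) (s : R) (p : R * (R * (R * R))) : R * (R * (R * R)) :=
  match p with (t, (x, (y, z))) =>
  match k with
  | O => (s, (x, (y, z)))
  | 1%nat => (t, (s, (y, z)))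
  | 2%nat => (t, (x, (s, z)))
  | _ => (t, (x, (y, s)))
  end end.

Lemma slice_set_coord k f t x y z s : slice k f t x y z s = uncurry4 f (set_coord k s (t, (x, (y, z)))).
Proof. destruct k as [|[|[|k]]]; reflexivity. Qed.

Lemma slice_coord k f t x y z : slice k f t x y z (coord k t x y z) = f t x y z.
Proof. destruct k as [|[|[|k]]]; reflexivity. Qed.

Lemma continuous_pair {U V W : UniformSpace} (f : U -> V) (g : U -> W) x :
  continuous f x -> continuous g x -> continuous (fun u => (f u, g u)) x.
Proof.
  intros Hf Hg. apply (continuous_comp_2 f g (fun a b => (a, b)) x Hf Hg).
  apply (continuous_ext (fun v : V * W => v)); [intros [a b]; reflexivity | apply continuous_id].
Qed.

Ltac continuous_projections :=
  repeat apply continuous_pair;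
  repeat first [ apply continuous_id
               | apply (continuous_comp _ fst); [|apply continuous_fst]
               | apply (continuous_comp _ snd); [|apply continuous_snd] ].

Lemma continuous_set_coord k (q : (R * (R * (R * R))) * R) :
  continuous (fun q : (R * (R * (R * R))) * R => set_coord k (snd q) (fst q)) q.
Proof.
  destruct k as [|[|[|k]]].
  - apply (continuous_ext (fun q => (snd q, (fst (snd (fst q)),
      (fst (snd (snd (fst q))), snd (snd (snd (fst q)))))))); [intros [[t [x [y z]]] s]; reflexivity|].
    continuous_projections.
  - apply (continuous_ext (fun q => (fst (fst q), (snd q,
      (fst (snd (snd (fst q))), snd (snd (snd (fst q)))))))); [intros [[t [x [y z]]] s]; reflexivity|].
    continuous_projections.
  - apply (continuous_ext (fun q => (fst (fst q), (fst (snd (fst q)),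
      (snd q, snd (snd (snd (fst q)))))))); [intros [[t [x [y z]]] s]; reflexivity|].
    continuous_projections.
  - apply (continuous_ext (fun q => (fst (fst q), (fst (snd (fst q)),
      (fst (snd (snd (fst q))), snd q))))); [intros [[t [x [y z]]] s]; reflexivity|].
    continuous_projections.
Qed.

Lemma continuous_slice_joint f (Hf : forall p, continuous (uncurry4 f) p) k q :
  continuous (fun q : (R * (R * (R * R))) * R => uncurry4 f (set_coord k (snd q) (fst q))) q.
Proof. apply (continuous_comp _ (uncurry4 f)); [apply continuous_set_coord | apply Hf]. Qed.

Lemma continuous_slice f (Hf : forall p, continuous (uncurry4 f) p) k t x y z s :
  continuous (slice k f t x y z) s.
Proof.
  apply (continuous_ext (fun s => uncurry4 f (set_coord k s (t, (x, (y, z)))))).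
  { intros u; symmetry; apply slice_set_coord. }
  apply (continuous_comp (fun s => ((t, (x, (y, z))), s)) (fun q => uncurry4 f (set_coord k (snd q) (fst q)))).
  - apply continuous_pair; [apply continuous_const | apply continuous_id].
  - apply continuous_slice_joint, Hf.
Qed.

Lemma continuity_2d_slice2 f (Hf : forall p, continuous (uncurry4 f) p) k l t x y z a b :
  continuity_2d_pt (fun a b => uncurry4 f (set_coord k a (set_coord l b (t, (x, (y, z)))))) a b.
Proof.
  apply continuity_2d_pt_filterlim.
  apply (continuous_comp (fun w : R * R => (set_coord l (snd w) (t, (x, (y, z))), fst w))
          (fun q => uncurry4 f (set_coord k (snd q) (fst q))) (a, b)).
  - apply continuous_pair.
    + apply (continuous_comp (fun w : R * R => ((t, (x, (y, z))), snd w))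
          (fun q => set_coord l (snd q) (fst q))).
      * apply continuous_pair; [apply continuous_const | apply continuous_snd].
      * apply continuous_set_coord.
    + apply continuous_fst.
  - apply continuous_slice_joint, Hf.
Qed.

Lemma pd_const k c : pd k (fun _ _ _ _ => c) = (fun _ _ _ _ => 0).
Proof.
  apply field_ext; intros t x y z; unfold pd; destruct k as [|[|[|k]]]; cbn [slice coord]; apply Derive_const.
Qed.

Lemma smooth_const c : smooth (fun _ _ _ _ => c).
Proof.
  apply (smooth_class (fun g => exists c, g = fun _ _ _ _ => c)); [|exists c; reflexivity].
  intros g [d ->]; split; [|split].
  - intros p; apply continuous_const.
  - intros k t x y z; destruct k as [|[|[|k]]]; apply ex_derive_const.
  - intros k; exists 0; apply pd_const.
Qed.

Definition fadd (f g : Field) : Field := fun t x y z => f t x y z + g t x y z.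
Definition fmul (f g : Field) : Field := fun t x y z => f t x y z * g t x y z.

Lemma slice_fadd k f g t x y z : slice k (fadd f g) t x y z = fun s => slice k f t x y z s + slice k g t x y z s.
Proof. destruct k as [|[|[|k]]]; reflexivity. Qed.

Lemma slice_fmul k f g t x y z : slice k (fmul f g) t x y z = fun s => slice k f t x y z s * slice k g t x y z s.
Proof. destruct k as [|[|[|k]]]; reflexivity. Qed.

Definition pdifferentiable (f : Field) : Prop :=
  (forall p, continuous (uncurry4 f) p) /\
  (forall k t x y z, ex_derive (slice k f t x y z) (coord k t x y z)).

Lemma smooth_pdifferentiable f : smooth f -> pdifferentiable f.
Proof. intros H; exact (H []). Qed.

Lemma pdifferentiable_fadd f g : pdifferentiable f -> pdifferentiable g -> pdifferentiable (fadd f g).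
Proof.
  intros [cont_f der_f] [cont_g der_g]; split.
  - intros p. apply (continuous_plus (uncurry4 f) (uncurry4 g)); auto.
  - intros; rewrite slice_fadd; apply (ex_derive_plus (V := R_NormedModule)); auto.
Qed.

Lemma pdifferentiable_fmul f g : pdifferentiable f -> pdifferentiable g -> pdifferentiable (fmul f g).
Proof.
  intros [cont_f der_f] [cont_g der_g]; split.
  - intros p. apply (continuous_mult (uncurry4 f) (uncurry4 g)); auto.
  - intros; rewrite slice_fmul; apply (ex_derive_mult); auto.
Qed.

Lemma pd_fadd k f g : pdifferentiable f -> pdifferentiable g -> pd k (fadd f g) = fadd (pd k f) (pd k g).
Proof.
  intros [_ der_f] [_ der_g]; apply field_ext; intros t x y z; unfold pd, fadd at 2.
  rewrite slice_fadd; apply Derive_plus; auto.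
Qed.

Lemma pd_fmul k f g : pdifferentiable f -> pdifferentiable g ->
  pd k (fmul f g) = fadd (fmul (pd k f) g) (fmul f (pd k g)).
Proof.
  intros [_ der_f] [_ der_g]; apply field_ext; intros t x y z; unfold fadd, fmul at 2 3, pd.
  rewrite slice_fmul, Derive_mult; auto.
  rewrite !slice_coord; reflexivity.
Qed.

Lemma smooth_fadd f g : smooth f -> smooth g -> smooth (fadd f g).
Proof.
  intros Hf Hg.
  apply (smooth_class (fun h => exists f g, smooth f /\ smooth g /\ h = fadd f g)); [|eauto].
  intros h (f1 & g1 & Hf1 & Hg1 & ->).
  destruct (pdifferentiable_fadd f1 g1) as [Hcont Hder]; try (apply smooth_pdifferentiable; assumption).
  split; [exact Hcont|split;[exact Hder|]].
  intros k; exists (pd k f1), (pd k g1); repeat split; try apply smooth_pd; auto.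
  apply pd_fadd; apply smooth_pdifferentiable; assumption.
Qed.

Inductive sum_of_products : Field -> Prop :=
| sum_of_products_mul f g : smooth f -> smooth g -> sum_of_products (fmul f g)
| sum_of_products_add f g : sum_of_products f -> sum_of_products g -> sum_of_products (fadd f g).

Lemma sum_of_products_stable h : sum_of_products h -> pdifferentiable h /\ forall k, sum_of_products (pd k h).
Proof.
  induction 1 as [f g Hf Hg | f g Hf [Df Pf] Hg [Dg Pg]].
  - split; [apply pdifferentiable_fmul; apply smooth_pdifferentiable; assumption|].
    intros k; rewrite pd_fmul by (apply smooth_pdifferentiable; assumption).
    apply sum_of_products_add; apply sum_of_products_mul; try apply smooth_pd; assumption.
  - split; [apply pdifferentiable_fadd; assumption|].
    intros k; rewrite pd_fadd by assumption; apply sum_of_products_add; auto.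
Qed.

Lemma smooth_fmul f g : smooth f -> smooth g -> smooth (fmul f g).
Proof.
  intros Hf Hg; apply (smooth_class sum_of_products); [|constructor; assumption].
  intros h Hh; destruct (sum_of_products_stable h Hh) as [[Hc Hd] Hpd]; auto.
Qed.

Definition coord_of (k : nat) (p : R * (R * (R * R))) : R :=
  match p with (t, (x, (y, z))) => coord k t x y z end.

Lemma pd_set_coord k f p : uncurry4 (pd k f) p = Derive (fun s => uncurry4 f (set_coord k s p)) (coord_of k p).
Proof.
  destruct p as [t [x [y z]]]; unfold uncurry4 at 1, pd; simpl fst; simpl snd; simpl coord_of.
  apply Derive_ext; intros s; apply slice_set_coord.
Qed.

Lemma ex_derive_set_coord f (Hf : smooth f) k p : ex_derive (fun s => uncurry4 f (set_coord k s p)) (coord_of k p).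
Proof.
  destruct p as [t [x [y z]]]; simpl coord_of.
  apply (ex_derive_ext (slice k f t x y z)); [intros; apply slice_set_coord|].
  apply (smooth_ex_derive f Hf k t x y z).
Qed.

Lemma set_coord_set_coord k a b p : set_coord k a (set_coord k b p) = set_coord k a p.
Proof. destruct p as [t [x [y z]]]; destruct k as [|[|[|k]]]; reflexivity. Qed.

Lemma coord_of_set_coord k a p : coord_of k (set_coord k a p) = a.
Proof. destruct p as [t [x [y z]]]; destruct k as [|[|[|k]]]; reflexivity. Qed.

Lemma set_coord_coord_of k p : set_coord k (coord_of k p) p = p.
Proof. destruct p as [t [x [y z]]]; destruct k as [|[|[|k]]]; reflexivity. Qed.

(* Every index from 3 on denotes the last space direction. *)
Definition same_direction (k l : nat) : Prop := Nat.min k 3 = Nat.min l 3.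

Lemma same_direction_dec k l : {same_direction k l} + {~ same_direction k l}.
Proof. apply Nat.eq_dec. Qed.

Lemma set_coord_swap k l a b p : ~ same_direction k l ->
  set_coord k a (set_coord l b p) = set_coord l b (set_coord k a p).
Proof.
  unfold same_direction.
  destruct p as [t [x [y z]]]; destruct k as [|[|[|k]]]; destruct l as [|[|[|l]]]; try reflexivity; simpl; lia.
Qed.

Lemma pd_same_direction k l f : same_direction k l -> pd k f = pd l f.
Proof.
  intros E; assert (Hmin : forall j, pd (Nat.min j 3) f = pd j f) by (intros [|[|[|j]]]; reflexivity).
  rewrite <- (Hmin k), E; apply Hmin.
Qed.

Lemma is_derive_slice2_l f (Hf : smooth f) k l p a b :
  is_derive (fun s => uncurry4 f (set_coord k s (set_coord l b p))) a
    (uncurry4 (pd k f) (set_coord k a (set_coord l b p))).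
Proof.
  set (q := set_coord k a (set_coord l b p)).
  assert (E : coord_of k q = a) by apply coord_of_set_coord.
  apply (is_derive_ext (fun s => uncurry4 f (set_coord k s q))).
  { intros s; unfold q; rewrite set_coord_set_coord; reflexivity. }
  pose proof (ex_derive_set_coord f Hf k q) as H; rewrite E in H.
  rewrite pd_set_coord, E; apply Derive_correct, H.
Qed.

Lemma is_derive_slice2_r f (Hf : smooth f) k l p a b : ~ same_direction k l ->
  is_derive (fun s => uncurry4 f (set_coord k a (set_coord l s p))) b
    (uncurry4 (pd l f) (set_coord k a (set_coord l b p))).
Proof.
  intros Hkl. rewrite set_coord_swap by assumption.
  apply (is_derive_ext (fun s => uncurry4 f (set_coord l s (set_coord k a p)))).
  { intros s; rewrite (set_coord_swap k l) by assumption; reflexivity. }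
  apply is_derive_slice2_l, Hf.
Qed.

Lemma uncurry4_inj (f g : Field) : (forall p, uncurry4 f p = uncurry4 g p) -> f = g.
Proof. intros H; apply field_ext; intros t x y z; apply (H (t, (x, (y, z)))). Qed.

Lemma continuity_2d_pt_ext_fun f g x y : (forall a b, f a b = g a b) ->
  continuity_2d_pt f x y -> continuity_2d_pt g x y.
Proof. intros H; apply continuity_2d_pt_ext_loc; exists (mkposreal 1 Rlt_0_1); intros; apply H. Qed.

Lemma continuity_2d_slice2_point f (Hf : smooth f) k l p a b :
  continuity_2d_pt (fun a b => uncurry4 f (set_coord k a (set_coord l b p))) a b.
Proof. destruct p as [t [x [y z]]]; apply continuity_2d_slice2, smooth_continuous, Hf. Qed.

Lemma pd_comm k l f : smooth f -> pd k (pd l f) = pd l (pd k f).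
Proof.
  intros Hf.
  destruct (same_direction_dec k l) as [Hkl|Hkl].
  { rewrite (pd_same_direction k l (pd l f)), (pd_same_direction k l f) by assumption; reflexivity. }
  assert (Hpd : forall k, smooth (pd k f)) by (intro; apply smooth_pd, Hf).
  apply uncurry4_inj; intros p.
  set (phi := fun a b => uncurry4 f (set_coord k a (set_coord l b p))).
  assert (Dr : forall a b, is_derive (fun s => phi a s) b (uncurry4 (pd l f) (set_coord k a (set_coord l b p))))
    by (intros; apply is_derive_slice2_r; assumption).
  assert (Dl : forall a b, is_derive (fun s => phi s b) a (uncurry4 (pd k f) (set_coord k a (set_coord l b p))))
    by (intros; apply is_derive_slice2_l; assumption).
  assert (Dlr : forall a b, is_derive (fun a => Derive (fun s => phi a s) b) a
     (uncurry4 (pd k (pd l f)) (set_coord k a (set_coord l b p)))).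
  { intros; apply (is_derive_ext (fun a => uncurry4 (pd l f) (set_coord k a (set_coord l b p)))).
    - intros; symmetry; apply is_derive_unique, Dr.
    - apply is_derive_slice2_l, Hpd. }
  assert (Drl : forall a b, is_derive (fun b => Derive (fun s => phi s b) a) b
     (uncurry4 (pd l (pd k f)) (set_coord k a (set_coord l b p)))).
  { intros; apply (is_derive_ext (fun b => uncurry4 (pd k f) (set_coord k a (set_coord l b p)))).
    - intros; symmetry; apply is_derive_unique, Dl.
    - apply is_derive_slice2_r; [apply Hpd | assumption]. }
  assert (Ep : p = set_coord k (coord_of k p) (set_coord l (coord_of l p) p))
    by (rewrite !set_coord_coord_of; reflexivity).
  rewrite Ep, <- (is_derive_unique _ _ _ (Dlr _ _)), <- (is_derive_unique _ _ _ (Drl _ _)).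
  apply (Schwarz phi).
  - exists (mkposreal 1 Rlt_0_1); intros u v _ _; repeat split; eexists; [apply Dl | apply Dr | apply Dlr | apply Drl].
  - eapply continuity_2d_pt_ext_fun; [intros; symmetry; apply is_derive_unique, Dlr|].
    apply continuity_2d_slice2_point, smooth_pd, Hpd.
  - eapply continuity_2d_pt_ext_fun; [intros; symmetry; apply is_derive_unique, Drl|].
    apply continuity_2d_slice2_point, smooth_pd, Hpd.
Qed.

Lemma tube_lemma (U : UniformSpace) (h : U * R -> R) (Hh : forall q, continuous h q) (p : U) (eps : posreal) :
  exists d : posreal, forall q, ball p d q -> forall s, 0 <= s <= 1 -> Rabs (h (q, s) - h (p, s)) < eps.
Proof.
  assert (Hex : forall s, exists d : posreal, forall q s', ball p d q -> ball s d s' ->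
            Rabs (h (q, s') - h (p, s)) < eps / 2).
  { intros s.
    assert (He : 0 < eps / 2) by (destruct eps; simpl; lra).
    destruct (proj1 (filterlim_locally h (h (p, s))) (Hh (p, s)) (mkposreal _ He)) as [d Hd].
    exists d; intros q s' Hq Hs'; apply (Hd (q, s')); split; assumption. }
  set (delta := fun s => proj1_sig (constructive_indefinite_description _ (Hex s))).
  assert (Hdelta : forall s q s', ball p (delta s) q -> ball s (delta s) s' ->
            Rabs (h (q, s') - h (p, s)) < eps / 2).
  { intros s; unfold delta; destruct (constructive_indefinite_description _ (Hex s)); simpl; assumption. }
  destruct (compactness_value_1d 0 1 delta) as [d Hd].
  exists d; intros q Hq s Hs.
  destruct (Classical_Prop.NNPP _ (Hd s Hs)) as (t & _ & Ht & Hdt).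
  assert (Hball : ball t (delta t) s) by exact Ht.
  replace (h (q, s) - h (p, s)) with ((h (q, s) - h (p, t)) - (h (p, s) - h (p, t))) by ring.
  apply Rle_lt_trans with (1 := Rabs_triang _ _). rewrite Rabs_Ropp.
  assert (near_q := Hdelta t q s (ball_le _ _ _ Hdt _ Hq) Hball).
  assert (near_p := Hdelta t p s (ball_center _ _) Hball).
  destruct eps; simpl in *; lra.
Qed.

Lemma continuous_RInt_param (U : UniformSpace) (h : U * R -> R) (Hh : forall q, continuous h q) (p : U) :
  continuous (fun p => RInt (fun s => h (p, s)) 0 1) p.
Proof.
  assert (Hc : forall p s, continuous (fun s => h (p, s)) s).
  { intros q s; apply (continuous_comp (fun s => (q, s)) h); [|apply Hh].
    apply continuous_pair; [apply continuous_const | apply continuous_id]. }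
  assert (Hi : forall p, ex_RInt (fun s => h (p, s)) 0 1)
    by (intros; apply (ex_RInt_continuous (V := R_CompleteNormedModule)); intros; apply Hc).
  apply filterlim_locally; intros eps.
  assert (He : 0 < eps / 2) by (destruct eps; simpl; lra).
  destruct (tube_lemma U h Hh p (mkposreal _ He)) as [d Hd]; exists d; intros q Hq.
  change (Rabs (RInt (fun s => h (q, s)) 0 1 - RInt (fun s => h (p, s)) 0 1) < eps).
  assert (E : RInt (fun s => h (q, s)) 0 1 - RInt (fun s => h (p, s)) 0 1
     = RInt (fun s => h (q, s) - h (p, s)) 0 1).
  { symmetry; apply (RInt_minus (V := R_CompleteNormedModule)); apply Hi. }
  rewrite E.
  apply Rle_lt_trans with ((1 - 0) * (eps / 2)); [|destruct eps; simpl; lra].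
  apply abs_RInt_le_const; [lra| |].
  - apply (ex_RInt_minus (V := R_NormedModule)); apply Hi.
  - intros s Hs; left; apply (Hd q Hq s Hs).
Qed.

Definition line_int (k : nat) (f : Field) : Field := fun t x y z => RInt (slice k f t x y z) 0 1.

Lemma line_int_set_coord k f p : uncurry4 (line_int k f) p = RInt (fun s => uncurry4 f (set_coord k s p)) 0 1.
Proof.
  destruct p as [t [x [y z]]]; unfold uncurry4 at 1, line_int; simpl fst; simpl snd.
  apply RInt_ext; intros; apply slice_set_coord.
Qed.

Lemma continuous_along f (Hf : forall p, continuous (uncurry4 f) p) k p s :
  continuous (fun s => uncurry4 f (set_coord k s p)) s.
Proof.
  destruct p as [t [x [y z]]].
  apply (continuous_ext (slice k f t x y z)); [intros; apply slice_set_coord|apply continuous_slice, Hf].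
Qed.

Lemma line_int_continuous k f : (forall p, continuous (uncurry4 f) p) ->
  forall p, continuous (uncurry4 (line_int k f)) p.
Proof.
  intros Hf p.
  apply (continuous_ext (fun p => RInt (fun s => uncurry4 f (set_coord k s p)) 0 1)).
  { intros; symmetry; apply line_int_set_coord. }
  apply (continuous_RInt_param _ (fun q => uncurry4 f (set_coord k (snd q) (fst q)))).
  intros; apply continuous_slice_joint, Hf.
Qed.

Lemma is_derive_line_int k l f (Hf : smooth f) p : ~ same_direction k l ->
  is_derive (fun s => uncurry4 (line_int k f) (set_coord l s p)) (coord_of l p) (uncurry4 (line_int k (pd l f)) p).
Proof.
  intros Hkl.
  apply (is_derive_ext (fun a => RInt (fun s => uncurry4 f (set_coord k s (set_coord l a p))) 0 1)).
  { intros; symmetry; apply line_int_set_coord. }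
  assert (Dl : forall a s, is_derive (fun u => uncurry4 f (set_coord k s (set_coord l u p))) a
      (uncurry4 (pd l f) (set_coord k s (set_coord l a p)))).
  { intros; apply is_derive_slice2_r; assumption. }
  rewrite line_int_set_coord.
  replace (RInt (fun s => uncurry4 (pd l f) (set_coord k s p)) 0 1) with
    (RInt (fun s => Derive (fun u => uncurry4 f (set_coord k s (set_coord l u p))) (coord_of l p)) 0 1).
  2:{ apply RInt_ext; intros; rewrite (is_derive_unique _ _ _ (Dl _ _)), set_coord_coord_of; reflexivity. }
  apply (is_derive_RInt_param (fun a s => uncurry4 f (set_coord k s (set_coord l a p)))).
  - exists (mkposreal 1 Rlt_0_1); intros a _ s _; eexists; apply Dl.
  - intros s _.
    apply (continuity_2d_pt_ext_fun (fun a s => uncurry4 (pd l f) (set_coord l a (set_coord k s p)))).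
    { intros; rewrite (is_derive_unique _ _ _ (Dl _ _)), set_coord_swap by (intros E; apply Hkl, eq_sym, E);
        reflexivity. }
    apply continuity_2d_slice2_point, smooth_pd, Hf.
  - exists (mkposreal 1 Rlt_0_1); intros a _.
    apply (ex_RInt_continuous (V := R_CompleteNormedModule)); intros; apply continuous_along, smooth_continuous, Hf.
Qed.

Lemma pd_line_int k l f : smooth f -> ~ same_direction k l -> pd l (line_int k f) = line_int k (pd l f).
Proof.
  intros Hf Hkl; apply uncurry4_inj; intros p; rewrite pd_set_coord.
  apply is_derive_unique, is_derive_line_int; assumption.
Qed.

Lemma line_int_set_coord_same k l f s p : same_direction k l ->
  uncurry4 (line_int k f) (set_coord l s p) = uncurry4 (line_int k f) p.
Proof.
  intros E; rewrite !line_int_set_coord; apply RInt_ext; intros a _; unfold same_direction in E.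
  destruct p as [t [x [y z]]]; destruct k as [|[|[|k]]]; destruct l as [|[|[|l]]]; try reflexivity; simpl in E; lia.
Qed.

Lemma pd_line_int_same k l f : same_direction k l -> pd l (line_int k f) = (fun _ _ _ _ => 0).
Proof.
  intros E; apply uncurry4_inj; intros p; rewrite pd_set_coord.
  rewrite (Derive_ext _ (fun _ => uncurry4 (line_int k f) p)) by (intros; apply line_int_set_coord_same; assumption).
  apply Derive_const.
Qed.

Lemma smooth_line_int k f : smooth f -> smooth (line_int k f).
Proof.
  intros Hf.
  apply (smooth_class (fun g => (exists f, smooth f /\ g = line_int k f) \/ g = fun _ _ _ _ => 0)); [|eauto].
  intros g [(h & Hh & ->)| ->].
  - split; [apply line_int_continuous, smooth_continuous, Hh|split].
    + intros l t x y z.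
      apply (ex_derive_ext (fun s => uncurry4 (line_int k h) (set_coord l s (t, (x, (y, z))))));
        [intros; symmetry; apply slice_set_coord|].
      destruct (same_direction_dec k l) as [E|E].
      * apply (ex_derive_ext (fun _ => uncurry4 (line_int k h) (t, (x, (y, z)))));
          [intros; symmetry; apply line_int_set_coord_same, E | apply ex_derive_const].
      * eexists; apply (is_derive_line_int k l h Hh (t, (x, (y, z))) E).
    + intros l; destruct (same_direction_dec k l) as [E|E].
      * right; apply pd_line_int_same, E.
      * left; exists (pd l h); split; [apply smooth_pd, Hh | apply pd_line_int; assumption].
  - assert (Hz := smooth_const 0).
    split; [apply smooth_continuous, Hz | split; [apply smooth_ex_derive, Hz | intros l; right; apply pd_const]].
Qed.

Lemma periodic_shifts f : periodic f ->
  (forall t x y z, f t (x + 1) y z = f t x y z) /\ (forall t x y z, f t x (y + 1) z = f t x y z) /\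
  (forall t x y z, f t x y (z + 1) = f t x y z).
Proof. intros H; repeat split; intros; apply H. Qed.

Lemma Derive_shift (g : R -> R) x : (forall s, g (s + 1) = g s) -> ex_derive g (x + 1) ->
  Derive g (x + 1) = Derive g x.
Proof.
  intros Hg He. symmetry; apply is_derive_unique.
  apply (is_derive_ext (fun s => g (s + 1))); [assumption|].
  replace (Derive g (x + 1)) with (scal 1 (Derive g (x + 1))) by (unfold scal; simpl; unfold mult; simpl; ring).
  apply (is_derive_comp g (fun s => s + 1)); [apply Derive_correct, He|].
  auto_derive; [trivial | reflexivity].
Qed.

Lemma periodic_pd k f : smooth f -> periodic f -> periodic (pd k f).
Proof.
  intros Hs Hp. destruct (periodic_shifts f Hp) as (per_x & per_y & per_z).
  assert (der_x := fun t x y z => smooth_ex_derive f Hs 1 t x y z).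
  assert (der_y := fun t x y z => smooth_ex_derive f Hs 2 t x y z).
  assert (der_z := fun t x y z => smooth_ex_derive f Hs 3 t x y z).
  intros t x y z; unfold pd; destruct k as [|[|[|k]]]; cbn [slice coord] in *; repeat split;
    try (apply Derive_ext; intros; auto; fail); apply Derive_shift; auto.
Qed.

Lemma periodic_fadd f g : periodic f -> periodic g -> periodic (fadd f g).
Proof.
  intros Hf Hg t x y z; destruct (Hf t x y z) as (fx & fy & fz), (Hg t x y z) as (gx & gy & gz); unfold fadd.
  rewrite fx, fy, fz, gx, gy, gz; auto.
Qed.

Lemma periodic_fmul f g : periodic f -> periodic g -> periodic (fmul f g).
Proof.
  intros Hf Hg t x y z; destruct (Hf t x y z) as (fx & fy & fz), (Hg t x y z) as (gx & gy & gz); unfold fmul.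
  rewrite fx, fy, fz, gx, gy, gz; auto.
Qed.

Lemma periodic_const c : periodic (fun _ _ _ _ => c).
Proof. intros t x y z; auto. Qed.

Lemma periodic_line_int k (f : Field) : periodic f -> periodic (line_int k f).
Proof.
  intros Hp. destruct (periodic_shifts f Hp) as (per_x & per_y & per_z).
  intros t x y z; repeat split; apply RInt_ext; intros s _; destruct k as [|[|[|k]]]; cbn [slice]; auto.
Qed.

Record PField := mkPField {
  field_fun :> R -> R -> R -> R -> R;
  PField_smooth : smooth field_fun;
  PField_periodic : periodic field_fun }.

Lemma PField_ext (f g : PField) : (forall t x y z, f t x y z = g t x y z) -> f = g.
Proof.
  intros H; destruct f as [f f_smooth f_periodic], g as [g g_smooth g_periodic]; simpl in H.
  assert (E : f = g) by (apply field_ext, H). subst g.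
  f_equal; apply proof_irrelevance.
Qed.

(* The operations are sealed so that unification never unfolds them to derivatives and integrals. *)
Lemma Fadd_sig : {h : PField -> PField -> PField | forall f g, field_fun (h f g) = fadd f g}.
Proof.
  exists (fun f g : PField => mkPField (fadd f g) (smooth_fadd _ _ (PField_smooth f) (PField_smooth g))
    (periodic_fadd _ _ (PField_periodic f) (PField_periodic g))); reflexivity.
Qed.
Lemma Fmul_sig : {h : PField -> PField -> PField | forall f g, field_fun (h f g) = fmul f g}.
Proof.
  exists (fun f g : PField => mkPField (fmul f g) (smooth_fmul _ _ (PField_smooth f) (PField_smooth g))
    (periodic_fmul _ _ (PField_periodic f) (PField_periodic g))); reflexivity.
Qed.
Lemma Fconst_sig : {h : R -> PField | forall c, field_fun (h c) = fun _ _ _ _ => c}.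
Proof. exists (fun c => mkPField _ (smooth_const c) (periodic_const c)); reflexivity. Qed.
Lemma D_sig : {h : nat -> PField -> PField | forall k f, field_fun (h k f) = pd k f}.
Proof.
  exists (fun k (f : PField) => mkPField (pd k f) (smooth_pd k f (PField_smooth f))
    (periodic_pd k f (PField_smooth f) (PField_periodic f))); reflexivity.
Qed.
Lemma Avg_sig : {h : nat -> PField -> PField | forall k f, field_fun (h k f) = line_int k f}.
Proof.
  exists (fun k (f : PField) => mkPField (line_int k f) (smooth_line_int k f (PField_smooth f))
    (periodic_line_int k f (PField_periodic f))); reflexivity.
Qed.

Definition Fadd : PField -> PField -> PField := proj1_sig Fadd_sig.
Definition Fmul : PField -> PField -> PField := proj1_sig Fmul_sig.
Definition Fconst : R -> PField := proj1_sig Fconst_sig.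
Definition D : nat -> PField -> PField := proj1_sig D_sig.
Definition Avg : nat -> PField -> PField := proj1_sig Avg_sig.
Definition Fadd_fun : forall f g, field_fun (Fadd f g) = fadd f g := proj2_sig Fadd_sig.
Definition Fmul_fun : forall f g, field_fun (Fmul f g) = fmul f g := proj2_sig Fmul_sig.
Definition Fconst_fun : forall c, field_fun (Fconst c) = fun _ _ _ _ => c := proj2_sig Fconst_sig.
Definition D_fun : forall k f, field_fun (D k f) = pd k f := proj2_sig D_sig.
Definition Avg_fun : forall k f, field_fun (Avg k f) = line_int k f := proj2_sig Avg_sig.
Definition Fopp (f : PField) : PField := Fmul (Fconst (-1)) f.
Definition Fsub (f g : PField) : PField := Fadd f (Fopp g).
Definition Dw (w : list nat) (f : PField) : PField := fold_right D f w.

Declare Scope field_scope.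
Delimit Scope field_scope with fld.
Bind Scope field_scope with PField.
Notation "f + g" := (Fadd f g) : field_scope.
Notation "f * g" := (Fmul f g) : field_scope.
Notation "f - g" := (Fsub f g) : field_scope.
Notation "- f" := (Fopp f) : field_scope.

Lemma Fadd_eval (f g : PField) t x y z : (f + g)%fld t x y z = f t x y z + g t x y z.
Proof. rewrite Fadd_fun; reflexivity. Qed.

Lemma Fmul_eval (f g : PField) t x y z : (f * g)%fld t x y z = f t x y z * g t x y z.
Proof. rewrite Fmul_fun; reflexivity. Qed.

Lemma Fconst_eval c t x y z : Fconst c t x y z = c. Proof. rewrite Fconst_fun; reflexivity. Qed.
Lemma Fopp_eval (f : PField) t x y z : (- f)%fld t x y z = - f t x y z.
Proof. unfold Fopp; rewrite Fmul_eval, Fconst_eval; ring. Qed.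

Lemma Fsub_eval (f g : PField) t x y z : (f - g)%fld t x y z = f t x y z - g t x y z.
Proof. unfold Fsub; rewrite Fadd_eval, Fopp_eval; ring. Qed.

Ltac Feval := repeat rewrite ?Fadd_eval, ?Fmul_eval, ?Fopp_eval, ?Fsub_eval, ?Fconst_eval.

Lemma PField_ring_theory : ring_theory (Fconst 0) (Fconst 1) Fadd Fmul Fsub Fopp eq.
Proof. split; intros; apply PField_ext; intros; Feval; ring. Qed.

Add Ring PField_ring : PField_ring_theory.

Lemma PField_pdifferentiable (f : PField) : pdifferentiable f. Proof. apply smooth_pdifferentiable, PField_smooth. Qed.

Lemma D_add k f g : D k (f + g)%fld = (D k f + D k g)%fld.
Proof. apply PField_ext; intros; Feval; rewrite !D_fun, Fadd_fun, pd_fadd by apply PField_pdifferentiable; reflexivity.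
Qed.

Lemma D_mul k f g : D k (f * g)%fld = (D k f * g + f * D k g)%fld.
Proof. apply PField_ext; intros; Feval; rewrite !D_fun, Fmul_fun, pd_fmul by apply PField_pdifferentiable; reflexivity.
Qed.

Lemma D_const k c : D k (Fconst c) = Fconst 0.
Proof. apply PField_ext; intros; rewrite Fconst_eval, D_fun, Fconst_fun, pd_const; reflexivity. Qed.

Lemma D_opp k f : D k (- f)%fld = (- D k f)%fld.
Proof. unfold Fopp; rewrite D_mul, D_const; ring. Qed.

Lemma D_sub k f g : D k (f - g)%fld = (D k f - D k g)%fld.
Proof. replace (f - g)%fld with (f + - g)%fld by ring. rewrite D_add, D_opp; ring. Qed.

Lemma D_scal k c f : D k (Fconst c * f)%fld = (Fconst c * D k f)%fld.
Proof. rewrite D_mul, D_const; ring. Qed.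

Lemma D_comm k l f : D k (D l f) = D l (D k f).
Proof. apply PField_ext; intros; rewrite !D_fun, pd_comm by apply PField_smooth; reflexivity. Qed.

Lemma D_ge3 k f : D (S (S (S k))) f = D 3 f.
Proof. apply PField_ext; intros; rewrite !D_fun; reflexivity. Qed.

Lemma Dw_add w f g : Dw w (f + g)%fld = (Dw w f + Dw w g)%fld.
Proof. induction w as [|k w IH]; simpl; [reflexivity|]. rewrite IH; apply D_add. Qed.

Lemma Dw_opp w f : Dw w (- f)%fld = (- Dw w f)%fld.
Proof. induction w as [|k w IH]; simpl; [reflexivity|]. rewrite IH; apply D_opp. Qed.

Lemma Dw_sub w f g : Dw w (f - g)%fld = (Dw w f - Dw w g)%fld.
Proof. induction w as [|k w IH]; simpl; [reflexivity|]. rewrite IH; apply D_sub. Qed.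

Lemma Dw_scal w c f : Dw w (Fconst c * f)%fld = (Fconst c * Dw w f)%fld.
Proof. induction w as [|k w IH]; simpl; [reflexivity|]. rewrite IH; apply D_scal. Qed.

Lemma Dw_D w k f : Dw w (D k f) = D k (Dw w f).
Proof. induction w as [|l w IH]; simpl; [reflexivity|]. rewrite IH; apply D_comm. Qed.

Lemma Dw_zero w : Dw w (Fconst 0) = Fconst 0.
Proof. induction w as [|l w IH]; simpl; [reflexivity|]. rewrite IH; apply D_const. Qed.

Lemma Dw_app w1 w2 f : Dw (w1 ++ w2) f = Dw w1 (Dw w2 f).
Proof. apply fold_right_app. Qed.

Lemma Dw_perm w w' f : Permutation w w' -> Dw w f = Dw w' f.
Proof.
  intros H; induction H; simpl; [reflexivity | f_equal; assumption | apply D_comm | congruence].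
Qed.

Lemma Dw_fun w (f : PField) : field_fun (Dw w f) = fold_right pd (field_fun f) w.
Proof. induction w as [|k w IH]; simpl; [reflexivity|]. rewrite D_fun, IH; reflexivity. Qed.

(** * Averages over the torus *)

Lemma ex_RInt_slice (f : PField) k t x y z : ex_RInt (slice k f t x y z) 0 1.
Proof.
  apply (ex_RInt_continuous (V := R_CompleteNormedModule)); intros.
  apply continuous_slice, smooth_continuous, PField_smooth.
Qed.

Lemma RInt_const01 (c : R) : RInt (fun _ => c) 0 1 = c.
Proof. rewrite RInt_const; unfold scal; simpl; unfold mult; simpl; ring. Qed.

Lemma Avg_eval k f t x y z : Avg k f t x y z = RInt (slice k f t x y z) 0 1.
Proof. rewrite Avg_fun; reflexivity. Qed.

Lemma Avg_add k f g : Avg k (f + g)%fld = (Avg k f + Avg k g)%fld.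
Proof.
  apply PField_ext; intros; Feval; rewrite !Avg_eval, Fadd_fun, slice_fadd.
  apply (RInt_plus (V := R_CompleteNormedModule)); apply ex_RInt_slice.
Qed.

Lemma Avg_scal k c f : Avg k (Fconst c * f)%fld = (Fconst c * Avg k f)%fld.
Proof.
  apply PField_ext; intros; Feval; rewrite !Avg_eval, Fmul_fun, Fconst_fun, slice_fmul.
  transitivity (RInt (fun s => scal c (slice k f t x y z s)) 0 1).
  - apply RInt_ext; intros; destruct k as [|[|[|k]]]; reflexivity.
  - apply (RInt_scal (V := R_CompleteNormedModule)), ex_RInt_slice.
Qed.

Lemma Avg_const k c : Avg k (Fconst c) = Fconst c.
Proof.
  apply PField_ext; intros; rewrite Avg_eval, Fconst_eval, Fconst_fun, <- (RInt_const01 c) at 1.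
  apply RInt_ext; intros; destruct k as [|[|[|k]]]; reflexivity.
Qed.

Lemma Avg_le k (f g : PField) t : (forall x y z, f t x y z <= g t x y z) ->
  forall x y z, Avg (S k) f t x y z <= Avg (S k) g t x y z.
Proof.
  intros Hfg x y z; rewrite !Avg_eval.
  apply RInt_le; [lra | apply ex_RInt_slice | apply ex_RInt_slice | intros s _; destruct k as [|[|k]]; apply Hfg].
Qed.

Lemma D_Avg k l f : ~ same_direction k l -> D l (Avg k f) = Avg k (D l f).
Proof.
  intros Hkl; apply PField_ext; intros.
  rewrite D_fun, !Avg_fun, D_fun, pd_line_int by (assumption || apply PField_smooth); reflexivity.
Qed.

Lemma D_Avg_same k f : D k (Avg k f) = Fconst 0.
Proof.
  apply PField_ext; intros; rewrite D_fun, Avg_fun, Fconst_eval, pd_line_int_same by reflexivity; reflexivity.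
Qed.

Lemma ex_derive_slice (f : PField) k t x y z s : ex_derive (slice k f t x y z) s.
Proof.
  assert (Hf := smooth_ex_derive f (PField_smooth f) k).
  destruct k as [|[|[|k]]]; [apply (Hf s x y z) | apply (Hf t s y z) | apply (Hf t x s z) | apply (Hf t x y s)].
Qed.

Lemma Derive_slice (f : PField) k t x y z s : Derive (slice k f t x y z) s = slice k (D k f) t x y z s.
Proof. rewrite D_fun; destruct k as [|[|[|k]]]; reflexivity. Qed.

Lemma continuous_Derive_slice (f : PField) k t x y z s : continuous (Derive (slice k f t x y z)) s.
Proof.
  apply (continuous_ext (slice k (D k f) t x y z)); [intros; symmetry; apply Derive_slice|].
  apply continuous_slice, smooth_continuous, PField_smooth.
Qed.

Lemma slice_periodic (f : PField) k t x y z s : slice (S k) f t x y z (s + 1) = slice (S k) f t x y z s.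
Proof.
  destruct (periodic_shifts f (PField_periodic f)) as (Px & Py & Pz); destruct k as [|[|k]]; cbn [slice]; auto.
Qed.

Lemma Avg_D_same k f : Avg (S k) (D (S k) f) = Fconst 0.
Proof.
  apply PField_ext; intros; rewrite Avg_eval, Fconst_eval.
  rewrite (RInt_ext _ (Derive (slice (S k) f t x y z))) by (intros; symmetry; apply Derive_slice).
  rewrite RInt_Derive; [|intros; apply ex_derive_slice | intros; apply continuous_Derive_slice].
  rewrite <- (slice_periodic f k t x y z 0), Rplus_0_l; ring.
Qed.

Definition Tint (f : PField) (t : R) : R := Avg 1 (Avg 2 (Avg 3 f)) t 0 0 0.

Lemma Tint_point f t x y z : Tint f t = Avg 1 (Avg 2 (Avg 3 f)) t x y z.
Proof. unfold Tint; rewrite !Avg_fun; reflexivity. Qed.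

Lemma Tint_torus_int f t : Tint f t = torus_int f t.
Proof. unfold Tint; rewrite !Avg_fun; reflexivity. Qed.

Lemma Tint_le (f g : PField) t : (forall x y z, f t x y z <= g t x y z) -> Tint f t <= Tint g t.
Proof. intros Hfg; unfold Tint; repeat (apply Avg_le; intros); apply Hfg. Qed.

Lemma Tint_ext (f g : PField) t : (forall x y z, f t x y z = g t x y z) -> Tint f t = Tint g t.
Proof. intros E; apply Rle_antisym; apply Tint_le; intros; rewrite E; lra. Qed.

Lemma Tint_add f g t : Tint (f + g)%fld t = Tint f t + Tint g t.
Proof. unfold Tint; rewrite !Avg_add; Feval; reflexivity. Qed.

Lemma Tint_scal c f t : Tint (Fconst c * f)%fld t = c * Tint f t.
Proof. unfold Tint; rewrite !Avg_scal; Feval; reflexivity. Qed.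

Lemma Tint_opp f t : Tint (- f)%fld t = - Tint f t.
Proof. unfold Fopp; rewrite Tint_scal; ring. Qed.

Lemma Tint_sub f g t : Tint (f - g)%fld t = Tint f t - Tint g t.
Proof. unfold Fsub; rewrite Tint_add, Tint_opp; ring. Qed.

Lemma Tint_const c t : Tint (Fconst c) t = c.
Proof. unfold Tint; rewrite !Avg_const; apply Fconst_eval. Qed.

Lemma Tint_nonneg (f : PField) t : (forall x y z, 0 <= f t x y z) -> 0 <= Tint f t.
Proof. intros Hf; rewrite <- (Tint_const 0 t); apply Tint_le; intros; Feval; apply Hf. Qed.

Lemma Tint_D i (f : PField) t : Tint (D (S i) f) t = 0.
Proof.
  assert (zero_avg : Avg 1 (Avg 2 (Avg 3 (D (S i) f))) = Fconst 0); [|unfold Tint; rewrite zero_avg; apply Fconst_eval].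
  destruct i as [|[|i]].
  - rewrite <- (D_Avg 3), <- (D_Avg 2) by discriminate; apply (Avg_D_same 0).
  - rewrite <- (D_Avg 3), (Avg_D_same 1) by discriminate; apply Avg_const.
  - rewrite D_ge3, (Avg_D_same 2), !Avg_const; reflexivity.
Qed.

Lemma Tint_derive (f : PField) t : is_derive (Tint f) t (Tint (D 0 f) t).
Proof.
  unfold Tint at 2; rewrite <- !(D_Avg _ 0) by discriminate; rewrite D_fun.
  apply Derive_correct, (ex_derive_slice (Avg 1 (Avg 2 (Avg 3 f))) 0 t 0 0 0).
Qed.

Definition inner (f g : PField) (t : R) : R := Tint (f * g)%fld t.
Definition normsq (f : PField) (t : R) : R := inner f f t.
Definition norm2 (f : PField) (t : R) : R := sqrt (normsq f t).

Lemma L2sq_normsq (f : PField) t : L2sq f t = normsq f t.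
Proof.
  unfold normsq, inner, L2sq; rewrite Tint_torus_int; unfold torus_int.
  apply RInt_ext; intros; apply RInt_ext; intros; apply RInt_ext; intros; rewrite Fmul_eval; simpl; ring.
Qed.

Lemma normsq_nonneg f t : 0 <= normsq f t.
Proof. apply Tint_nonneg; intros; Feval; apply Rle_0_sqr. Qed.

Lemma inner_sym f g t : inner f g t = inner g f t.
Proof. unfold inner; f_equal; ring. Qed.

Lemma inner_add_l f g h t : inner (f + g)%fld h t = inner f h t + inner g h t.
Proof. unfold inner; rewrite <- Tint_add; f_equal; ring. Qed.

Lemma inner_add_r f g h t : inner h (f + g)%fld t = inner h f t + inner h g t.
Proof. unfold inner; rewrite <- Tint_add; f_equal; ring. Qed.

Lemma inner_sub_l f g h t : inner (f - g)%fld h t = inner f h t - inner g h t.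
Proof. unfold inner; rewrite <- Tint_sub; f_equal; ring. Qed.

Lemma inner_sub_r f g h t : inner h (f - g)%fld t = inner h f t - inner h g t.
Proof. unfold inner; rewrite <- Tint_sub; f_equal; ring. Qed.

Lemma inner_opp_r f h t : inner h (- f)%fld t = - inner h f t.
Proof. unfold inner; rewrite <- Tint_opp; f_equal; ring. Qed.

Lemma inner_scal_l c f h t : inner (Fconst c * f)%fld h t = c * inner f h t.
Proof. unfold inner; rewrite <- Tint_scal; f_equal; ring. Qed.

Lemma inner_scal_r c f h t : inner h (Fconst c * f)%fld t = c * inner h f t.
Proof. unfold inner; rewrite <- Tint_scal; f_equal; ring. Qed.

Lemma inner_0_r f t : inner f (Fconst 0) t = 0.
Proof. replace (Fconst 0) with (Fconst 0 * Fconst 0)%fld by ring; rewrite inner_scal_r; ring. Qed.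

Lemma inner_mul_swap f g h t : inner f (g * h)%fld t = inner g (f * h)%fld t.
Proof. unfold inner; f_equal; ring. Qed.

Lemma inner_D i f g t : inner (D (S i) f) g t = - inner f (D (S i) g) t.
Proof.
  assert (H := Tint_D i (f * g)%fld t). rewrite D_mul, Tint_add in H. unfold inner; lra.
Qed.

Lemma inner_D_r i f g t : inner f (D (S i) g) t = - inner g (D (S i) f) t.
Proof. rewrite inner_sym, inner_D; reflexivity. Qed.

Lemma inner_ext (f g f' g' : PField) t : (forall x y z, f t x y z = f' t x y z) ->
  (forall x y z, g t x y z = g' t x y z) ->
  inner f g t = inner f' g' t.
Proof. intros Ef Eg; apply Tint_ext; intros; Feval; rewrite Ef, Eg; reflexivity. Qed.

Lemma inner_derive f g t : is_derive (inner f g) t (inner (D 0 f) g t + inner f (D 0 g) t).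
Proof.
  unfold inner; rewrite <- Tint_add, <- D_mul. apply Tint_derive.
Qed.

Lemma normsq_derive f t : is_derive (normsq f) t (2 * inner f (D 0 f) t).
Proof.
  replace (2 * inner f (D 0 f) t) with (inner (D 0 f) f t + inner f (D 0 f) t)
    by (rewrite (inner_sym (D 0 f)); ring).
  apply inner_derive.
Qed.

Lemma normsq_ext (f g : PField) t : (forall x y z, f t x y z = g t x y z) -> normsq f t = normsq g t.
Proof. intros E; apply inner_ext; exact E. Qed.

Lemma norm2_nonneg f t : 0 <= norm2 f t. Proof. apply sqrt_pos. Qed.

Lemma norm2_sqr f t : norm2 f t * norm2 f t = normsq f t. Proof. apply sqrt_sqrt, normsq_nonneg. Qed.

Lemma discriminant_le a b c : 0 <= a -> 0 <= c -> (forall r, 0 <= a + 2 * r * b + r * r * c) -> b * b <= a * c.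
Proof.
  intros Ha Hc Hr; destruct (Req_dec c 0) as [->|Nc].
  - destruct (Req_dec b 0) as [->|Nb]; [lra|exfalso].
    specialize (Hr (- (a + 1) / (2 * b))).
    replace (a + 2 * (- (a + 1) / (2 * b)) * b + - (a + 1) / (2 * b) * (- (a + 1) / (2 * b)) * 0)
      with (-1) in Hr by (field; assumption).
    lra.
  - specialize (Hr (- b / c)); assert (Hmul := Rmult_le_pos _ _ Hr Hc).
    replace ((a + 2 * (- b / c) * b + - b / c * (- b / c) * c) * c) with (a * c - b * b) in Hmul by (field; assumption).
    lra.
Qed.

Lemma cauchy_schwarz f g t : Rabs (inner f g t) <= norm2 f t * norm2 g t.
Proof.
  apply Rsqr_incr_0_var; [|apply Rmult_le_pos; apply norm2_nonneg].
  rewrite <- Rsqr_abs; unfold Rsqr.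
  replace (norm2 f t * norm2 g t * (norm2 f t * norm2 g t))
    with ((norm2 f t * norm2 f t) * (norm2 g t * norm2 g t)) by ring.
  rewrite !norm2_sqr; apply discriminant_le; try apply normsq_nonneg; intros r.
  assert (Hexp := normsq_nonneg (f + Fconst r * g)%fld t); unfold normsq in *.
  rewrite inner_add_l, !inner_add_r, !inner_scal_l, !inner_scal_r, (inner_sym g f) in Hexp; lra.
Qed.

Lemma norm2_le f t B : 0 <= B -> normsq f t <= B * B -> norm2 f t <= B.
Proof. intros HB Hf; unfold norm2; rewrite <- (sqrt_square B) by assumption. apply sqrt_le_1_alt, Hf. Qed.

Lemma norm2_triang f g t : norm2 (f + g)%fld t <= norm2 f t + norm2 g t.
Proof.
  assert (Nf := norm2_nonneg f t); assert (Ng := norm2_nonneg g t).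
  apply norm2_le; [lra|]; unfold normsq.
  rewrite inner_add_l, !inner_add_r, (inner_sym g f).
  fold (normsq f t) (normsq g t); rewrite <- !norm2_sqr.
  assert (CS := cauchy_schwarz f g t); apply Rabs_le_between in CS; nra.
Qed.

Lemma norm2_scal c f t : norm2 (Fconst c * f)%fld t = Rabs c * norm2 f t.
Proof.
  unfold norm2, normsq; rewrite inner_scal_l, inner_scal_r.
  rewrite <- sqrt_Rsqr_abs, <- sqrt_mult; [f_equal; unfold Rsqr; ring | apply Rle_0_sqr | apply normsq_nonneg].
Qed.

Lemma norm2_ext (f g : PField) t : (forall x y z, f t x y z = g t x y z) -> norm2 f t = norm2 g t.
Proof. intros E; unfold norm2; f_equal; apply normsq_ext, E. Qed.

Lemma norm2_mul_sup (f g : PField) t B : 0 <= B -> (forall x y z, Rabs (f t x y z) <= B) ->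
  norm2 (f * g)%fld t <= B * norm2 g t.
Proof.
  intros HB Hf; apply norm2_le; [apply Rmult_le_pos; [assumption|apply norm2_nonneg]|].
  replace (B * norm2 g t * (B * norm2 g t)) with (B * B * (norm2 g t * norm2 g t)) by ring.
  rewrite norm2_sqr; unfold normsq, inner; rewrite <- Tint_scal; apply Tint_le; intros x y z; Feval.
  assert (Hff : f t x y z * f t x y z <= B * B) by (specialize (Hf x y z); apply Rabs_le_between in Hf; nra).
  assert (Hgg : 0 <= g t x y z * g t x y z) by apply Rle_0_sqr; nra.
Qed.

(** * Sobolev and Poincare inequalities *)

Lemma ex_RInt_cont (g : R -> R) a b : (forall s, continuous g s) -> ex_RInt g a b.
Proof. intros Hg; apply (ex_RInt_continuous (V := R_CompleteNormedModule)); intros; apply Hg. Qed.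

Lemma RInt_subinterval_le (q : R -> R) a b : (forall s, continuous q s) -> (forall s, 0 <= q s) ->
  0 <= a <= b -> b <= 1 -> RInt q a b <= RInt q 0 1.
Proof.
  intros Hc Hq [Ha Hab] Hb.
  rewrite <- (RInt_Chasles (V := R_CompleteNormedModule) q 0 a 1) by (apply ex_RInt_cont, Hc).
  rewrite <- (RInt_Chasles (V := R_CompleteNormedModule) q a b 1) by (apply ex_RInt_cont, Hc).
  assert (Hleft := RInt_ge_0 q 0 a Ha (ex_RInt_cont _ _ _ Hc) (fun s _ => Hq s)).
  assert (Hright := RInt_ge_0 q b 1 Hb (ex_RInt_cont _ _ _ Hc) (fun s _ => Hq s)).
  unfold plus; simpl; lra.
Qed.

Lemma RInt_linear01 (f g : R -> R) a b : (forall s, continuous f s) -> (forall s, continuous g s) ->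
  RInt (fun s => a * f s + b * g s) 0 1 = a * RInt f 0 1 + b * RInt g 0 1.
Proof.
  intros Hf Hg.
  assert (Ef := RInt_scal (V := R_CompleteNormedModule) f 0 1 a (ex_RInt_cont f 0 1 Hf)).
  assert (Eg := RInt_scal (V := R_CompleteNormedModule) g 0 1 b (ex_RInt_cont g 0 1 Hg)).
  change (a * RInt f 0 1) with (scal a (RInt f 0 1)); change (b * RInt g 0 1) with (scal b (RInt g 0 1)).
  rewrite <- Ef, <- Eg; apply (RInt_plus (V := R_CompleteNormedModule));
    apply (ex_RInt_scal (V := R_CompleteNormedModule)), ex_RInt_cont; assumption.
Qed.

Lemma continuous_Rabs_comp (g : R -> R) s : continuous g s -> continuous (fun s => Rabs (g s)) s.
Proof. intros Hg; apply (continuous_comp g Rabs); [exact Hg | apply continuous_Rabs]. Qed.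

Section C1_function.
Variable phi : R -> R.
Hypothesis ex_derive_phi : forall s, ex_derive phi s.
Hypothesis continuous_Derive_phi : forall s, continuous (Derive phi) s.

Lemma oscillation_le x y : 0 <= y <= x -> x <= 1 ->
  Rabs (phi x - phi y) <= RInt (fun s => Rabs (Derive phi s)) 0 1.
Proof.
  intros Hy Hx; rewrite <- (RInt_Derive phi y x) by (intros; auto).
  apply Rle_trans with (RInt (fun s => Rabs (Derive phi s)) y x).
  - apply abs_RInt_le; [lra | apply ex_RInt_cont; assumption].
  - apply RInt_subinterval_le; auto; intros; [apply continuous_Rabs_comp; auto | apply Rabs_pos].
Qed.

Lemma deviation_le x : 0 <= x <= 1 -> Rabs (phi x - RInt phi 0 1) <= RInt (fun s => Rabs (Derive phi s)) 0 1.
Proof.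
  intros Hx; assert (continuous_phi : forall s, continuous phi s) by (intros; apply (ex_derive_continuous phi); auto).
  assert (E : phi x - RInt phi 0 1 = RInt (fun s => phi x * 1 + (-1) * phi s) 0 1).
  { rewrite RInt_linear01, RInt_const01; auto; [ring|]; intros; apply continuous_const. }
  rewrite E; rewrite <- (Rmult_1_l (RInt (fun s => Rabs _) 0 1)).
  replace 1 with (1 - 0) at 2 by ring; apply abs_RInt_le_const; [lra| |].
  - apply ex_RInt_cont; intros; apply (continuous_plus (fun s => phi x * 1) (fun s => -1 * phi s));
      [apply continuous_const | apply (continuous_mult (fun _ => -1) phi); auto; apply continuous_const].
  - intros s Hs; destruct (Rle_dec s x) as [L|L].
    + replace (phi x * 1 + -1 * phi s) with (phi x - phi s) by ring; apply oscillation_le; lra.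
    + replace (phi x * 1 + -1 * phi s) with (- (phi s - phi x)) by ring.
      rewrite Rabs_Ropp; apply oscillation_le; lra.
Qed.

End C1_function.

Lemma jensen01 (g : R -> R) : (forall s, continuous g s) -> (RInt g 0 1) ^ 2 <= RInt (fun s => g s * g s) 0 1.
Proof.
  intros Hg; set (m := RInt g 0 1).
  assert (Hgg : forall s, continuous (fun s => g s * g s) s) by (intros; apply (continuous_mult g g); auto).
  assert (Hc : forall s, continuous (fun s => (-2 * m) * g s + (m * m) * 1) s).
  { intros s; apply (continuous_plus (fun s => -2 * m * g s) (fun s => m * m * 1)); [|apply continuous_const].
    apply (continuous_mult (fun _ => -2 * m) g); [apply continuous_const|auto]. }
  assert (Hvar : 0 <= RInt (fun s => 1 * (g s * g s) + 1 * ((-2 * m) * g s + (m * m) * 1)) 0 1).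
  { apply RInt_ge_0; [lra| |intros s _; assert (Hsq := Rle_0_sqr (g s - m)); unfold Rsqr in Hsq; lra].
    apply ex_RInt_cont; intros.
    apply (continuous_plus (fun s => 1 * (g s * g s)) (fun s => 1 * ((-2 * m) * g s + (m * m) * 1)));
      apply (continuous_mult (fun _ => 1)); auto; apply continuous_const. }
  rewrite RInt_linear01, RInt_linear01, RInt_const01 in Hvar; auto; [|intros; apply continuous_const].
  fold m in Hvar; simpl; lra.
Qed.

Lemma poincare01 (phi : R -> R) x : (forall s, ex_derive phi s) -> (forall s, continuous (Derive phi) s) ->
  0 <= x <= 1 -> (phi x - RInt phi 0 1) ^ 2 <= RInt (fun s => Derive phi s * Derive phi s) 0 1.
Proof.
  intros Hd Hc Hx.
  apply Rle_trans with (RInt (fun s => Rabs (Derive phi s)) 0 1 ^ 2).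
  - rewrite <- pow2_abs; apply pow_incr; split; [apply Rabs_pos | apply deviation_le; assumption].
  - eapply Rle_trans; [apply jensen01; intros; apply continuous_Rabs_comp, Hc|].
    apply Req_le, RInt_ext; intros; rewrite <- Rabs_mult; apply Rabs_right, Rle_ge, Rle_0_sqr.
Qed.

Lemma periodic_shift_Z (phi : R -> R) : (forall s, phi (s + 1) = phi s) -> forall z s, phi (s + IZR z) = phi s.
Proof.
  intros Hper.
  assert (Hn : forall n s, phi (s + INR n) = phi s).
  { induction n as [|n IH]; intros s; [simpl; f_equal; ring|].
    rewrite S_INR; replace (s + (INR n + 1)) with ((s + INR n) + 1) by ring; rewrite Hper; apply IH. }
  intros z s; destruct (ZArith_dec.Z_le_dec 0 z) as [L|L].
  - rewrite <- (Z2Nat.id z) by assumption; rewrite <- INR_IZR_INZ; apply Hn.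
  - rewrite <- (Hn (Z.to_nat (- z)) (s + IZR z)); f_equal; rewrite INR_IZR_INZ, Z2Nat.id by lia.
    rewrite opp_IZR; ring.
Qed.

Lemma periodic_reduce (phi : R -> R) x : (forall s, phi (s + 1) = phi s) -> exists r, 0 <= r <= 1 /\ phi x = phi r.
Proof.
  intros Hper; exists (x - IZR (Int_part x)); split.
  - destruct (base_Int_part x); lra.
  - rewrite <- (periodic_shift_Z phi Hper (- Int_part x)%Z x); f_equal; rewrite opp_IZR; ring.
Qed.

Lemma poincare_Avg k (f : PField) t x y z :
  (f t x y z - Avg (S k) f t x y z) ^ 2 <= Avg (S k) (D (S k) f * D (S k) f)%fld t x y z.
Proof.
  set (phi := slice (S k) f t x y z).
  assert (Ef : f t x y z = phi (coord (S k) t x y z)) by (symmetry; apply slice_coord).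
  destruct (periodic_reduce phi (coord (S k) t x y z) (slice_periodic f k t x y z)) as (r & Hr & Er).
  rewrite Ef, Er, !Avg_eval.
  eapply Rle_trans; [apply (poincare01 phi r);
    [intros; apply ex_derive_slice | intros; apply continuous_Derive_slice | assumption]|].
  apply Req_le; rewrite Fmul_fun, slice_fmul; apply RInt_ext; intros; unfold phi; rewrite Derive_slice; reflexivity.
Qed.

Lemma jensen_Avg k (f : PField) t x y z : (Avg k f t x y z) ^ 2 <= Avg k (f * f)%fld t x y z.
Proof.
  rewrite !Avg_eval, Fmul_fun, slice_fmul.
  apply (jensen01 (slice k f t x y z)); intros; apply continuous_slice, smooth_continuous, PField_smooth.
Qed.

Lemma sobolev_Avg k (f : PField) t x y z :
  (f * f)%fld t x y z <= Avg (S k) (Fconst 2 * (f * f + D (S k) f * D (S k) f))%fld t x y z.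
Proof.
  assert (HP := poincare_Avg k f t x y z); assert (HJ := jensen_Avg (S k) f t x y z).
  rewrite Avg_scal, Avg_add; Feval.
  set (m := Avg (S k) f t x y z) in *.
  assert (Hsq := pow2_ge_0 (f t x y z - m - m)); simpl in *; lra.
Qed.

Definition lsum (l : list R) : R := fold_right Rplus 0 l.
Definition Fsum (l : list PField) : PField := fold_right Fadd (Fconst 0) l.

Lemma lsum_nonneg {I} (l : list I) (f : I -> R) : (forall i, 0 <= f i) -> 0 <= lsum (map f l).
Proof. intros H; induction l as [|i l IH]; simpl; [lra | specialize (H i); lra]. Qed.

Lemma lsum_app l1 l2 : lsum (l1 ++ l2) = lsum l1 + lsum l2.
Proof. induction l1 as [|a l IH]; simpl; [ring | rewrite IH; ring]. Qed.

Lemma Fsum_app l1 l2 : Fsum (l1 ++ l2) = (Fsum l1 + Fsum l2)%fld.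
Proof. induction l1 as [|f l IH]; simpl; [ring | rewrite IH; ring]. Qed.

Lemma lsum_scal {I} (l : list I) (f : I -> R) c : lsum (map (fun i => c * f i) l) = c * lsum (map f l).
Proof. induction l as [|i l IH]; simpl; [ring | rewrite IH; ring]. Qed.

Lemma Tint_Fsum {I} (l : list I) (f : I -> PField) t : Tint (Fsum (map f l)) t = lsum (map (fun i => Tint (f i) t) l).
Proof. induction l as [|i l IH]; simpl; [apply Tint_const | rewrite Tint_add, IH; reflexivity]. Qed.

Fixpoint rev_subwords (dirs : list nat) : list (list nat) :=
  match dirs with
  | [] => [[]]
  | k :: dirs => rev_subwords dirs ++ map (fun w => w ++ [k]) (rev_subwords dirs)
  end.

Fixpoint Avgs (dirs : list nat) (f : PField) : PField :=
  match dirs with [] => f | k :: dirs => Avg k (Avgs dirs f) end.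

Lemma Avgs_double_sum dirs c f g :
  Avgs dirs (Fconst (2 * c) * (f + g))%fld = (Fconst 2 * (Avgs dirs (Fconst c * f) + Avgs dirs (Fconst c * g)))%fld.
Proof.
  replace (Fconst (2 * c) * (f + g))%fld with (Fconst 2 * (Fconst c * f + Fconst c * g))%fld
    by (apply PField_ext; intros; Feval; ring).
  induction dirs as [|k dirs IH]; simpl; [reflexivity | rewrite IH, Avg_scal, Avg_add; reflexivity].
Qed.

(* Iterates [sobolev_Avg]: one derivative is spent in each direction of averaging. *)
Lemma sobolev_Avgs dirs f t : ~ In 0%nat dirs -> forall x y z, (f * f)%fld t x y z <=
  Avgs dirs (Fconst (2 ^ length dirs) * Fsum (map (fun w => Dw w f * Dw w f)%fld (rev_subwords dirs)))%fld t x y z.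
Proof.
  revert f; induction dirs as [|[|k] dirs IH]; intros f Hdirs x y z.
  - unfold Fsum; cbn; Feval; simpl; lra.
  - exfalso; apply Hdirs; left; reflexivity.
  - eapply Rle_trans; [apply (sobolev_Avg k)|]; apply Avg_le; clear x y z; intros x y z.
    fold Avgs; cbn [rev_subwords length].
    assert (IHf := IH f (fun I => Hdirs (or_intror I)) x y z).
    assert (IHD := IH (D (S k) f) (fun I => Hdirs (or_intror I)) x y z).
    rewrite map_app, map_map, Fsum_app.
    rewrite (map_ext (fun w => Dw (w ++ [S k]) f * Dw (w ++ [S k]) f)%fld
      (fun w => Dw w (D (S k) f) * Dw w (D (S k) f))%fld) by (intros; rewrite Dw_app; reflexivity).
    change (2 ^ S (length dirs)) with (2 * 2 ^ length dirs); rewrite Avgs_double_sum; revert IHf IHD; Feval; lra.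
Qed.

Lemma sobolev (f : PField) t x y z :
  (f t x y z) ^ 2 <= 8 * lsum (map (fun w => normsq (Dw w f) t) (rev_subwords [1; 2; 3]%nat)).
Proof.
  assert (Hs := sobolev_Avgs [1; 2; 3]%nat f t ltac:(simpl; intuition discriminate) x y z).
  cbn [Avgs] in Hs; rewrite <- Tint_point, Tint_scal, Tint_Fsum in Hs.
  revert Hs; Feval; simpl (2 ^ _); simpl (_ ^ 2); intros Hs; unfold normsq, inner; lra.
Qed.

Lemma Avg_flat k f : D (S k) f = Fconst 0 -> Avg (S k) f = f.
Proof.
  intros Df; apply PField_ext; intros.
  assert (HP := poincare_Avg k f t x y z); rewrite Df in HP.
  replace (Fconst 0 * Fconst 0)%fld with (Fconst 0) in HP by ring; rewrite Avg_const, Fconst_eval in HP.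
  assert (Hsq := pow2_ge_0 (f t x y z - Avg (S k) f t x y z)).
  assert (Hz : f t x y z - Avg (S k) f t x y z = 0) by (apply Rsqr_0_uniq; unfold Rsqr; simpl in *; lra).
  lra.
Qed.

Lemma jensen_Avg_D k l f t x y z : ~ same_direction k l ->
  (D l (Avg k f) * D l (Avg k f))%fld t x y z <= Avg k (D l f * D l f)%fld t x y z.
Proof.
  intros Hkl; rewrite D_Avg by assumption; assert (HJ := jensen_Avg k (D l f) t x y z); Feval; simpl in HJ; lra.
Qed.

(* Telescoping through the successive averages over the third, second and first coordinate. *)
Lemma poincare_pointwise (f : PField) t x y z : Tint f t = 0 ->
  (f * f)%fld t x y z <= (Fconst 3 * (Avg 3 (D 3 f * D 3 f) + Avg 2 (Avg 3 (D 2 f * D 2 f))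
    + Avg 1 (Avg 2 (Avg 3 (D 1 f * D 1 f)))))%fld t x y z.
Proof.
  intros Hmean; rewrite (Tint_point f t x y z) in Hmean.
  assert (third := poincare_Avg 2 f t x y z).
  assert (second : (Avg 3 f t x y z - Avg 2 (Avg 3 f) t x y z) ^ 2 <= Avg 2 (Avg 3 (D 2 f * D 2 f)%fld) t x y z).
  { eapply Rle_trans; [apply (poincare_Avg 1)|]; apply Avg_le; intros; apply jensen_Avg_D; discriminate. }
  assert (first : (Avg 2 (Avg 3 f) t x y z - Avg 1 (Avg 2 (Avg 3 f)) t x y z) ^ 2
                  <= Avg 1 (Avg 2 (Avg 3 (D 1 f * D 1 f)%fld)) t x y z).
  { eapply Rle_trans; [apply (poincare_Avg 0)|]; apply Avg_le; intros.
    eapply Rle_trans; [apply jensen_Avg_D; discriminate|]; apply Avg_le; intros; apply jensen_Avg_D; discriminate. }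
  rewrite Hmean in first; Feval; revert third second first.
  generalize (f t x y z) (Avg 3 f t x y z) (Avg 2 (Avg 3 f) t x y z); intros a b c third second first.
  assert (Hac := pow2_ge_0 (a - b - (b - c))); assert (Hab := pow2_ge_0 (a - b - c)).
  assert (Hbc := pow2_ge_0 (b - c - c)); nra.
Qed.

Lemma poincare (f : PField) t : Tint f t = 0 ->
  normsq f t <= 3 * (normsq (D 1 f) t + normsq (D 2 f) t + normsq (D 3 f) t).
Proof.
  intros Hmean; eapply Rle_trans; [apply Tint_le; intros; apply poincare_pointwise, Hmean|].
  apply Req_le; rewrite Tint_scal, !Tint_add; unfold normsq, inner, Tint.
  set (g3 := (D 3 f * D 3 f)%fld); set (g2 := (D 2 f * D 2 f)%fld); set (g1 := (D 1 f * D 1 f)%fld).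
  assert (flat3 : forall g, D 3 (Avg 3 g) = Fconst 0) by (intros; apply D_Avg_same).
  assert (flat32 : forall g, D 3 (Avg 2 (Avg 3 g)) = Fconst 0)
    by (intros; rewrite D_Avg, flat3 by discriminate; apply Avg_const).
  assert (flat321 : forall g, D 3 (Avg 1 (Avg 2 (Avg 3 g))) = Fconst 0)
    by (intros; rewrite D_Avg, flat32 by discriminate; apply Avg_const).
  assert (flat21 : forall g, D 2 (Avg 1 (Avg 2 (Avg 3 g))) = Fconst 0)
    by (intros; rewrite D_Avg, D_Avg_same by discriminate; apply Avg_const).
  rewrite (Avg_flat 2 (Avg 3 g3)), (Avg_flat 2 (Avg 2 (Avg 3 g2))), (Avg_flat 1 (Avg 2 (Avg 3 g2))) by
    auto using D_Avg_same.
  rewrite (Avg_flat 2 (Avg 1 _)), (Avg_flat 1 (Avg 1 _)), (Avg_flat 0 (Avg 1 _)) by auto using D_Avg_same.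
  ring.
Qed.

Lemma normsq_zero_D i (f : PField) t : normsq f t = 0 -> normsq (D (S i) f) t = 0.
Proof.
  intros Hf; assert (Hnn := normsq_nonneg (D (S i) f) t).
  assert (CS := cauchy_schwarz f (D (S i) (D (S i) f)) t).
  assert (Nf : norm2 f t = 0) by (unfold norm2; rewrite Hf; apply sqrt_0).
  rewrite Nf, Rmult_0_l in CS; apply Rabs_le_between in CS.
  unfold normsq in *; rewrite inner_D in *; lra.
Qed.

Lemma normsq_zero_eval (f : PField) t : normsq f t = 0 -> forall x y z, f t x y z = 0.
Proof.
  intros Hf x y z; assert (Hs := sobolev f t x y z).
  cbn [rev_subwords app map lsum fold_right Dw] in Hs.
  rewrite Hf, !normsq_zero_D in Hs by (repeat apply normsq_zero_D; exact Hf).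
  assert (Hsq := pow2_ge_0 (f t x y z)).
  apply Rsqr_0_uniq; unfold Rsqr; simpl in *; lra.
Qed.

(** * Equality on a time interval *)

Lemma Derive_zero_on (g : R -> R) T t : 0 < T -> (forall s, 0 <= s <= T -> g s = 0) -> 0 <= t <= T ->
  ex_derive g t -> Derive g t = 0.
Proof.
  intros HT Hg Ht [l Hl]; rewrite (is_derive_unique g t l Hl); apply is_derive_Reals in Hl.
  destruct (Req_dec l 0) as [E|E]; [assumption|exfalso].
  destruct (Hl (Rabs l) (Rabs_pos_lt _ E)) as [d Hd].
  set (h := Rmin (d / 2) (T / 2)).
  assert (Hhd : h <= d / 2) by apply Rmin_l; assert (HhT : h <= T / 2) by apply Rmin_r.
  assert (Hh : 0 < h < d) by (split; [apply Rmin_pos|]; destruct d as [d dp]; simpl in *; lra).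
  assert (step : forall e, Rabs e = h -> 0 <= t + e <= T -> False).
  { intros e He Hte; assert (e <> 0) by (intros ->; rewrite Rabs_R0 in He; lra).
    specialize (Hd e ltac:(assumption) ltac:(lra)); rewrite !Hg in Hd by lra.
    replace ((0 - 0) / e - l) with (- l) in Hd by (field; assumption); rewrite Rabs_Ropp in Hd; lra. }
  destruct (Rle_dec t (T / 2)).
  - apply (step h); [apply Rabs_right; lra | lra].
  - apply (step (- h)); [rewrite Rabs_Ropp; apply Rabs_right; lra | lra].
Qed.

Definition eq_on (T : R) (f g : PField) : Prop := forall t x y z, 0 <= t <= T -> f t x y z = g t x y z.

Lemma eq_on_zero_D T k f : 0 < T -> eq_on T f (Fconst 0) -> eq_on T (D k f) (Fconst 0).
Proof.
  intros HT Hf t x y z Ht.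
  assert (Hz : forall t x y z, 0 <= t <= T -> f t x y z = 0)
    by (intros; rewrite Hf, Fconst_eval by assumption; reflexivity).
  assert (Hd := ex_derive_slice f k t x y z (coord k t x y z)).
  rewrite Fconst_eval, D_fun; unfold pd; destruct k as [|[|[|k]]]; cbn [slice coord] in *;
    [apply (Derive_zero_on _ T); auto | | |];
    rewrite (Derive_ext _ (fun _ => 0)) by (intros; auto); apply Derive_const.
Qed.

Lemma eq_on_D T k f g : 0 < T -> eq_on T f g -> eq_on T (D k f) (D k g).
Proof.
  intros HT Hfg t x y z Ht.
  assert (Hz : eq_on T (f - g)%fld (Fconst 0)) by (intros s a b c Hs; Feval; rewrite Hfg by assumption; ring).
  assert (HD := eq_on_zero_D T k _ HT Hz t x y z Ht); rewrite D_sub in HD; revert HD; Feval; lra.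
Qed.

Lemma eq_on_Dw T w f g : 0 < T -> eq_on T f g -> eq_on T (Dw w f) (Dw w g).
Proof. intros HT H; induction w as [|k w IH]; simpl; [assumption | apply eq_on_D; assumption]. Qed.

Lemma Tint_zero_dt (f : PField) T n : 0 < T -> (forall t, 0 <= t <= T -> Tint f t = 0) ->
  forall t, 0 <= t <= T -> Tint (Dw (repeat 0%nat n) f) t = 0.
Proof.
  intros HT H. induction n as [|n IH]; intros t Ht; simpl; [apply H, Ht|].
  rewrite <- (is_derive_unique _ _ _ (Tint_derive (Dw (repeat 0%nat n) f) t)).
  apply (Derive_zero_on _ T); auto. eexists; apply Tint_derive.
Qed.

(** * Finite sums *)

Lemma lsum_le {I} (l : list I) (f g : I -> R) : (forall i, In i l -> f i <= g i) -> lsum (map f l) <= lsum (map g l).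
Proof.
  induction l as [|i l IH]; intros Hfg; simpl; [lra|].
  apply Rplus_le_compat; [apply Hfg; left; reflexivity | apply IH; intros; apply Hfg; right; assumption].
Qed.

Lemma lsum_add {I} (l : list I) (f g : I -> R) : lsum (map (fun i => f i + g i) l) = lsum (map f l) + lsum (map g l).
Proof. induction l as [|i l IH]; simpl; [ring | rewrite IH; ring]. Qed.

Lemma lsum_term {I} (l : list I) (f : I -> R) i : (forall i, 0 <= f i) -> In i l -> f i <= lsum (map f l).
Proof.
  intros Hf; induction l as [|j l IH]; intros []; simpl.
  - subst; assert (Hl := lsum_nonneg l f Hf); lra.
  - specialize (IH H); specialize (Hf j); lra.
Qed.

Lemma lsum_Rabs_le {I} (l : list I) (f : I -> R) : Rabs (lsum (map f l)) <= lsum (map (fun i => Rabs (f i)) l).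
Proof.
  induction l as [|i l IH]; simpl; [rewrite Rabs_R0; lra|].
  eapply Rle_trans; [apply Rabs_triang|]; apply Rplus_le_compat_l, IH.
Qed.

Lemma lsum_const {I} (l : list I) c : lsum (map (fun _ => c) l) = INR (length l) * c.
Proof. induction l as [|i l IH]; cbn [map length]; [simpl; ring | rewrite S_INR; simpl; rewrite IH; ring]. Qed.

Lemma lsum_flat_map {I J} (l : list I) (f : I -> list J) (h : J -> R) :
  lsum (map h (flat_map f l)) = lsum (map (fun i => lsum (map h (f i))) l).
Proof. induction l as [|i l IH]; simpl; [reflexivity|]; rewrite map_app, lsum_app, IH; reflexivity. Qed.

Lemma lsum_derive {I} (l : list I) (f : I -> R -> R) (d : I -> R) t :
  (forall i, In i l -> is_derive (f i) t (d i)) ->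
  is_derive (fun t => lsum (map (fun i => f i t) l)) t (lsum (map d l)).
Proof.
  induction l as [|i l IH]; intros Hd; simpl; [apply (is_derive_const (V := R_NormedModule))|].
  apply (is_derive_plus (V := R_NormedModule));
    [apply Hd; left; reflexivity | apply IH; intros; apply Hd; right; assumption].
Qed.

(* For each [i], [2 f i S <= n (f i)^2 + S^2 / n], where [S] is the sum. *)
Lemma lsum_sqr_le {I} (l : list I) (f : I -> R) :
  lsum (map f l) * lsum (map f l) <= INR (length l) * lsum (map (fun i => f i * f i) l).
Proof.
  destruct (Req_dec (INR (length l)) 0) as [Hz|Hz].
  { destruct l; [simpl; lra|].
    exfalso; cbn [length] in Hz; rewrite S_INR in Hz; assert (P := pos_INR (length l)); lra. }
  set (n := INR (length l)) in *; set (S := lsum (map f l)); set (q := lsum (map (fun i => f i * f i) l)).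
  assert (Hn : 0 < n) by (assert (P := pos_INR (length l)); unfold n in *; lra).
  assert (Hsum : 0 <= lsum (map (fun i => (n * f i - S) * (n * f i - S)) l))
    by (apply lsum_nonneg; intros; apply Rle_0_sqr).
  assert (E : lsum (map (fun i => (n * f i - S) * (n * f i - S)) l) = n * (n * q - S * S)).
  { rewrite (map_ext _ (fun i => n * n * (f i * f i) + ((- 2 * n * S) * f i + S * S))) by (intros; ring).
    rewrite !lsum_add, !lsum_scal, lsum_const; fold S q n; ring. }
  rewrite E in Hsum; apply Rmult_le_reg_l with n; [assumption | lra].
Qed.

Ltac case_lt3 i := destruct i as [|[|[|i]]]; [| | |exfalso; lia].

Lemma sum3_ext f g : (forall i, (i < 3)%nat -> f i = g i) -> sum3 f = sum3 g.
Proof. intros E; unfold sum3; rewrite !E by lia; reflexivity. Qed.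

Lemma sum3_le f g : (forall i, (i < 3)%nat -> f i <= g i) -> sum3 f <= sum3 g.
Proof. intros Hfg; unfold sum3; repeat apply Rplus_le_compat; apply Hfg; lia. Qed.

Lemma sum3_nonneg f : (forall i, (i < 3)%nat -> 0 <= f i) -> 0 <= sum3 f.
Proof. intros Hf; unfold sum3; repeat apply Rplus_le_le_0_compat; apply Hf; lia. Qed.

Lemma sum3_term f i : (forall i, (i < 3)%nat -> 0 <= f i) -> (i < 3)%nat -> f i <= sum3 f.
Proof.
  intros Hf Hi; assert (f0 := Hf 0%nat ltac:(lia)); assert (f1 := Hf 1%nat ltac:(lia)).
  assert (f2 := Hf 2%nat ltac:(lia)); unfold sum3; case_lt3 i; lra.
Qed.

Lemma sum3_add f g : sum3 (fun i => f i + g i) = sum3 f + sum3 g.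
Proof. unfold sum3; ring. Qed.

Lemma sum3_sub f g : sum3 (fun i => f i - g i) = sum3 f - sum3 g.
Proof. unfold sum3; ring. Qed.

Lemma sum3_scal c f : sum3 (fun i => c * f i) = c * sum3 f.
Proof. unfold sum3; ring. Qed.

Lemma sum3_Rabs_le f : Rabs (sum3 f) <= sum3 (fun i => Rabs (f i)).
Proof.
  unfold sum3; eapply Rle_trans; [apply Rabs_triang|]; apply Rplus_le_compat_r, Rabs_triang.
Qed.

Lemma sum3_derive (f : nat -> R -> R) (d : nat -> R) t : (forall i, is_derive (f i) t (d i)) ->
  is_derive (fun t => sum3 (fun i => f i t)) t (sum3 d).
Proof. intros Hd; unfold sum3; repeat apply (is_derive_plus (V := R_NormedModule)); apply Hd. Qed.

Definition Fsum3 (f : nat -> PField) : PField := (f 0%nat + f 1%nat + f 2%nat)%fld.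

Lemma Fsum3_eval f t x y z : Fsum3 f t x y z = sum3 (fun i => f i t x y z).
Proof. unfold Fsum3; Feval; reflexivity. Qed.

Lemma Dw_Fsum3 w f : Dw w (Fsum3 f) = Fsum3 (fun i => Dw w (f i)).
Proof. unfold Fsum3; rewrite !Dw_add; reflexivity. Qed.

Lemma Tint_Fsum3 f t : Tint (Fsum3 f) t = sum3 (fun i => Tint (f i) t).
Proof. unfold Fsum3; rewrite !Tint_add; reflexivity. Qed.

Lemma inner_Fsum3_r f g t : inner f (Fsum3 g) t = sum3 (fun i => inner f (g i) t).
Proof. unfold Fsum3; rewrite !inner_add_r; reflexivity. Qed.

Lemma inner_Fsum3_l f g t : inner (Fsum3 f) g t = sum3 (fun i => inner (f i) g t).
Proof. unfold Fsum3; rewrite !inner_add_l; reflexivity. Qed.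

(** * Words of derivatives and the Leibniz rule *)

(* A word is the list of the directions of successive derivatives, 0 being time; [ord] is its parabolic order. *)
Definition weight (k : nat) : nat := match k with O => 2%nat | _ => 1%nat end.
Fixpoint ord (w : list nat) : nat := match w with [] => O | k :: w => (weight k + ord w)%nat end.
Fixpoint splits (w : list nat) : list (list nat * list nat) :=
  match w with
  | [] => [([], [])]
  | k :: w => map (fun p => (k :: fst p, snd p)) (splits w) ++ map (fun p => (fst p, k :: snd p)) (splits w)
  end.

Lemma ord_app w1 w2 : ord (w1 ++ w2) = (ord w1 + ord w2)%nat.
Proof. induction w1 as [|k w IH]; simpl; [reflexivity | rewrite IH; lia]. Qed.

Lemma ord_perm w w' : Permutation w w' -> ord w = ord w'.
Proof. intros H; induction H; simpl; lia. Qed.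

Lemma splits_perm w p : In p (splits w) -> Permutation (fst p ++ snd p) w.
Proof.
  revert p; induction w as [|k w IH]; simpl; intros p H.
  - destruct H as [<-|[]]; constructor.
  - apply in_app_or in H; destruct H as [H|H]; apply in_map_iff in H; destruct H as (q & <- & Hq); simpl.
    + constructor; apply IH, Hq.
    + rewrite <- Permutation_middle. constructor; apply IH, Hq.
Qed.

Lemma splits_ord w p : In p (splits w) -> (ord (fst p) + ord (snd p) = ord w)%nat.
Proof. intros H; rewrite <- ord_app; apply ord_perm, splits_perm, H. Qed.

Lemma Fsum_map_add {A} (l : list A) (f g : A -> PField) :
  Fsum (map (fun a => f a + g a)%fld l) = (Fsum (map f l) + Fsum (map g l))%fld.
Proof. induction l as [|a l IH]; simpl; [ring | rewrite IH; ring]. Qed.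

Lemma D_Fsum {A} k (l : list A) (f : A -> PField) : D k (Fsum (map f l)) = Fsum (map (fun a => D k (f a)) l).
Proof. induction l as [|a l IH]; simpl; [apply D_const | rewrite D_add, IH; reflexivity]. Qed.

Lemma Fsum_filter {A} (P : A -> bool) (l : list A) (f : A -> PField) :
  Fsum (map f l) = (Fsum (map f (filter P l)) + Fsum (map f (filter (fun a => negb (P a)) l)))%fld.
Proof. induction l as [|a l IH]; simpl; [ring|]. rewrite IH; destruct (P a); simpl; ring. Qed.

Definition leibniz_term (f g : PField) (p : list nat * list nat) : PField := (Dw (fst p) f * Dw (snd p) g)%fld.

Lemma leibniz w f g : Dw w (f * g)%fld = Fsum (map (leibniz_term f g) (splits w)).
Proof.
  induction w as [|k w IH]; simpl.
  - unfold leibniz_term; simpl; ring.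
  - rewrite IH, D_Fsum, map_app, Fsum_app, !map_map, <- Fsum_map_add.
    f_equal; apply map_ext; intros [w1 w2]; unfold leibniz_term; simpl; apply D_mul.
Qed.

Definition is_nil (w : list nat) : bool := match w with [] => true | _ => false end.

Lemma splits_nil_l w : filter (fun p => is_nil (fst p)) (splits w) = [([], w)].
Proof.
  induction w as [|k w IH]; cbn [splits]; [reflexivity|].
  rewrite filter_app, !filter_map_swap; cbn [fst is_nil]; rewrite filter_false, IH; reflexivity.
Qed.

Lemma splits_nil_r w : filter (fun p => is_nil (snd p)) (splits w) = [(w, [])].
Proof.
  induction w as [|k w IH]; cbn [splits]; [reflexivity|].
  rewrite filter_app, !filter_map_swap; cbn [snd is_nil]; rewrite filter_false, IH; reflexivity.
Qed.

(* These terms make up the commutator of [Dw w] with multiplication by the first factor. *)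
Definition proper_l_splits (w : list nat) : list (list nat * list nat) :=
  filter (fun p => negb (is_nil (fst p))) (splits w).

Lemma leibniz_commutator w f g :
  Dw w (f * g)%fld = (f * Dw w g + Fsum (map (leibniz_term f g) (proper_l_splits w)))%fld.
Proof.
  rewrite leibniz, (Fsum_filter (fun p => is_nil (fst p))), splits_nil_l.
  unfold leibniz_term at 1, proper_l_splits; simpl; ring.
Qed.

Lemma proper_l_splits_in w p : In p (proper_l_splits w) -> In p (splits w) /\ (1 <= ord (fst p))%nat.
Proof.
  unfold proper_l_splits; intros Hp; apply filter_In in Hp; destruct Hp as [Hin Hnil]; split; [assumption|].
  destruct p as [[|k w1] w2]; simpl in *; [discriminate|]. destruct k; simpl; lia.
Qed.

Definition proper_splits (w : list nat) : list (list nat * list nat) :=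
  filter (fun p => negb (is_nil (snd p))) (proper_l_splits w).

Lemma filter_comm {A} (P Q : A -> bool) l : filter P (filter Q l) = filter Q (filter P l).
Proof.
  induction l as [|a l IH]; simpl; [reflexivity|].
  destruct (P a) eqn:EP; destruct (Q a) eqn:EQ; simpl; rewrite ?EP, ?EQ, IH; reflexivity.
Qed.

Lemma leibniz_proper w f g : Dw w (f * g)%fld =
  (f * Dw w g + (if is_nil w then Fconst 0 else Dw w f * g)
   + Fsum (map (leibniz_term f g) (proper_splits w)))%fld.
Proof.
  rewrite leibniz_commutator, (Fsum_filter (fun p => is_nil (snd p))).
  unfold proper_splits; unfold proper_l_splits at 1; rewrite filter_comm, splits_nil_r.
  destruct w as [|k w]; cbn [filter is_nil negb fst map Fsum fold_right]; unfold leibniz_term at 1; cbn [fst snd];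
    simpl; ring.
Qed.

Lemma proper_splits_in w p : In p (proper_splits w) ->
  In p (splits w) /\ (length (fst p) < length w)%nat /\ (length (snd p) < length w)%nat.
Proof.
  intros Hp; apply filter_In in Hp; destruct Hp as [Hp Hr]; apply filter_In in Hp; destruct Hp as [Hp Hl].
  split; [assumption|]; assert (Hlen := Permutation_length (splits_perm w p Hp)); rewrite length_app in Hlen.
  destruct p as [[|k v] [|l w']]; simpl in *; try discriminate; lia.
Qed.

Lemma Fsum_Rabs_le (l : list PField) t x y z : Rabs (Fsum l t x y z) <= lsum
  (map (fun f : PField => Rabs (f t x y z)) l).
Proof.
  induction l as [|f l IH]; simpl; Feval; [rewrite Rabs_R0; lra|].
  eapply Rle_trans; [apply Rabs_triang | lra].
Qed.

(** * Comparison up to constants *)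

Definition lesssim {X : Type} (A B : X -> R) : Prop := exists C, 0 <= C /\ forall s, A s <= C * B s.
Notation "A <~ B" := (lesssim A B) (at level 70).
Definition bigO {X : Type} (A B : X -> R) : Prop := (fun s => Rabs (A s)) <~ B.
Definition nonneg {X : Type} (B : X -> R) : Prop := forall s, 0 <= B s.

Section Comparison.
Context {X : Type}.
Implicit Types A B C E : X -> R.

Lemma nonneg_mul A B : nonneg A -> nonneg B -> nonneg (fun s => A s * B s).
Proof. intros HA HB s; apply Rmult_le_pos; auto. Qed.

Lemma lesssim_le A B : (forall s, A s <= B s) -> A <~ B.
Proof. intros HAB; exists 1; split; [lra | intros; rewrite Rmult_1_l; apply HAB]. Qed.

Lemma lesssim_trans A B C : A <~ B -> B <~ C -> A <~ C.
Proof.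
  intros (c & Hc & HAB) (d & Hd & HBC); exists (c * d); split; [apply Rmult_le_pos; assumption|].
  intros s; eapply Rle_trans; [apply HAB|]; rewrite Rmult_assoc; apply Rmult_le_compat_l; auto.
Qed.

Lemma lesssim_ext A B C : (forall s, A s = B s) -> B <~ C -> A <~ C.
Proof. intros E (c & Hc & HBC); exists c; split; [assumption|]; intros; rewrite E; apply HBC. Qed.

Lemma lesssim_add A B C : A <~ C -> B <~ C -> (fun s => A s + B s) <~ C.
Proof.
  intros (c & Hc & HA) (d & Hd & HB); exists (c + d); split; [lra|].
  intros s; specialize (HA s); specialize (HB s); lra.
Qed.

Lemma lesssim_scal A C c : 0 <= c -> A <~ C -> (fun s => c * A s) <~ C.
Proof.
  intros Hc (d & Hd & HA); exists (c * d); split; [apply Rmult_le_pos; assumption|].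
  intros s; rewrite Rmult_assoc; apply Rmult_le_compat_l; auto.
Qed.

Lemma lesssim_mul A B C E : nonneg A -> nonneg B -> A <~ C -> B <~ E -> (fun s => A s * B s) <~ (fun s => C s * E s).
Proof.
  intros HA HB (c & Hc & HAC) (d & Hd & HBE); exists (c * d); split; [apply Rmult_le_pos; assumption|].
  intros s; replace (c * d * (C s * E s)) with ((c * C s) * (d * E s)) by ring; apply Rmult_le_compat; auto.
Qed.

Lemma lesssim_sqrt A B : nonneg B -> A <~ B -> (fun s => sqrt (A s)) <~ (fun s => sqrt (B s)).
Proof.
  intros HB (c & Hc & HA); exists (sqrt c); split; [apply sqrt_pos|]; intros s.
  rewrite <- sqrt_mult by auto; apply sqrt_le_1_alt, HA.
Qed.

Lemma lesssim_of_sqr A B : nonneg A -> nonneg B -> (fun s => A s * A s) <~ (fun s => B s * B s) -> A <~ B.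
Proof.
  intros HA HB HAB; apply lesssim_sqrt in HAB; [|intros s; apply Rle_0_sqr].
  destruct HAB as (c & Hc & HAB); exists c; split; [assumption|]; intros s; specialize (HAB s).
  rewrite !sqrt_square in HAB; auto.
Qed.

Lemma lesssim_zero C : nonneg C -> (fun _ => 0) <~ C.
Proof. intros HC; exists 0; split; [lra|]; intros; lra. Qed.

Lemma lesssim_lsum {I} (l : list I) (A : I -> X -> R) C : nonneg C -> (forall i, In i l -> A i <~ C) ->
  (fun s => lsum (map (fun i => A i s) l)) <~ C.
Proof.
  intros HC; induction l as [|i l IH]; intros HA; simpl; [apply lesssim_zero, HC|].
  apply lesssim_add; [apply HA; left; reflexivity | apply IH; intros; apply HA; right; assumption].
Qed.

Lemma lesssim_sum_f_R0 (g : nat -> X -> R) n C : (forall i, (i <= n)%nat -> g i <~ C) ->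
  (fun s => sum_f_R0 (fun i => g i s) n) <~ C.
Proof.
  intros Hg; induction n as [|n IH]; simpl; [apply Hg; lia|].
  apply lesssim_add; [apply IH; intros; apply Hg; lia | apply Hg; lia].
Qed.

Lemma lesssim_if (b : bool) A C : nonneg C -> (b = true -> A <~ C) -> (fun s => if b then A s else 0) <~ C.
Proof. intros HC HA; destruct b; [apply HA; reflexivity | apply lesssim_zero, HC]. Qed.

Lemma lesssim_sum_from (g : nat -> X -> R) m n C : nonneg C -> (forall i, (m <= i <= n)%nat -> g i <~ C) ->
  (fun s => sum_from m n (fun i => g i s)) <~ C.
Proof.
  intros HC Hg; unfold sum_from; apply (lesssim_sum_f_R0 (fun i s => if (m <=? i)%nat then g i s else 0)).
  intros i Hi; apply lesssim_if; [assumption|]; intros E; apply Nat.leb_le in E; apply Hg; lia.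
Qed.

Lemma bigO_le A B C : bigO A B -> B <~ C -> bigO A C.
Proof. apply lesssim_trans. Qed.

Lemma bigO_lesssim A B : bigO A B -> A <~ B.
Proof. apply lesssim_trans, lesssim_le; intros; apply Rle_abs. Qed.

Lemma bigO_ext A B C : (forall s, A s = B s) -> bigO B C -> bigO A C.
Proof. intros E; apply lesssim_ext; intros s; rewrite E; reflexivity. Qed.

Lemma bigO_zero C : nonneg C -> bigO (fun _ => 0) C.
Proof. intros HC; apply (lesssim_ext _ (fun _ => 0)); [intros; apply Rabs_R0 | apply lesssim_zero, HC]. Qed.

Lemma bigO_add A B C : bigO A C -> bigO B C -> bigO (fun s => A s + B s) C.
Proof.
  intros HA HB; eapply lesssim_trans; [|apply lesssim_add; [exact HA | exact HB]].
  apply lesssim_le; intros; apply Rabs_triang.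
Qed.

Lemma bigO_scal c A C : bigO A C -> bigO (fun s => c * A s) C.
Proof.
  intros HA; apply (lesssim_ext _ (fun s => Rabs c * Rabs (A s))); [intros; apply Rabs_mult|].
  apply lesssim_scal; [apply Rabs_pos | exact HA].
Qed.

Lemma bigO_opp A C : bigO A C -> bigO (fun s => - A s) C.
Proof. intros HA; apply (bigO_ext _ (fun s => -1 * A s)); [intros; ring | apply bigO_scal, HA]. Qed.

Lemma bigO_sub A B C : bigO A C -> bigO B C -> bigO (fun s => A s - B s) C.
Proof. intros HA HB; apply (bigO_add A (fun s => - B s)); [exact HA | apply bigO_opp, HB]. Qed.

Lemma bigO_sum3 (g : nat -> X -> R) C : (forall i, (i < 3)%nat -> bigO (g i) C) ->
  bigO (fun s => sum3 (fun i => g i s)) C.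
Proof. intros Hg; unfold sum3; apply bigO_add; [apply bigO_add|]; apply Hg; lia. Qed.

Lemma bigO_lsum {I} (l : list I) (A : I -> X -> R) C : nonneg C -> (forall i, In i l -> bigO (A i) C) ->
  bigO (fun s => lsum (map (fun i => A i s) l)) C.
Proof.
  intros HC HA; eapply lesssim_trans; [apply lesssim_le; intros; apply lsum_Rabs_le|].
  apply (lesssim_lsum l (fun i s => Rabs (A i s))); assumption.
Qed.

End Comparison.

Section Families.
Context {X : Type} (tm : X -> R).
Implicit Types (f g h : X -> PField) (A B C : X -> R).

Definition L2_bounded f B : Prop := (fun s => norm2 (f s) (tm s)) <~ B.
Definition sup_bounded f B : Prop := exists c, 0 <= c /\ forall s x y z, Rabs (f s (tm s) x y z) <= c * B s.

Lemma L2_bounded_le f A B : L2_bounded f A -> A <~ B -> L2_bounded f B.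
Proof. apply lesssim_trans. Qed.

Lemma sup_bounded_le f A B : sup_bounded f A -> A <~ B -> sup_bounded f B.
Proof.
  intros (c & Hc & Hf) (d & Hd & HAB); exists (c * d); split; [apply Rmult_le_pos; assumption|].
  intros s x y z; apply Rle_trans with (1 := Hf s x y z). rewrite Rmult_assoc; apply Rmult_le_compat_l; auto.
Qed.

Lemma L2_bounded_ext (f g : X -> PField) B : (forall s x y z, f s (tm s) x y z = g s (tm s) x y z) -> L2_bounded g B ->
  L2_bounded f B.
Proof. intros E; apply lesssim_ext; intros s; apply norm2_ext; intros; apply E. Qed.

Lemma L2_bounded_add f g B : L2_bounded f B -> L2_bounded g B -> L2_bounded (fun s => f s + g s)%fld B.
Proof.
  intros Hf Hg. eapply lesssim_trans; [apply lesssim_le; intros s; apply norm2_triang | apply lesssim_add; assumption].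
Qed.

Lemma L2_bounded_scal c f B : L2_bounded f B -> L2_bounded (fun s => Fconst c * f s)%fld B.
Proof.
  intros H. apply (lesssim_ext _ (fun s => Rabs c * norm2 (f s) (tm s))); [intros; apply norm2_scal|].
  apply lesssim_scal; [apply Rabs_pos | assumption].
Qed.

Lemma L2_bounded_opp f B : L2_bounded f B -> L2_bounded (fun s => - f s)%fld B.
Proof. apply (L2_bounded_scal (-1)). Qed.

Lemma L2_bounded_sub f g B : L2_bounded f B -> L2_bounded g B -> L2_bounded (fun s => f s - g s)%fld B.
Proof. intros Hf Hg; apply (L2_bounded_add f (fun s => - g s)%fld); [assumption | apply L2_bounded_opp, Hg]. Qed.

Lemma L2_bounded_zero B : nonneg B -> L2_bounded (fun _ => Fconst 0) B.
Proof.
  intros H; apply (lesssim_ext _ (fun _ => 0)); [|apply lesssim_zero, H].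
  intros s; replace (Fconst 0) with (Fconst 0 * Fconst 0)%fld by ring. rewrite norm2_scal, Rabs_R0; ring.
Qed.

Lemma L2_bounded_Fsum {I} (l : list I) (f : I -> X -> PField) B : nonneg B ->
  (forall i, In i l -> L2_bounded (f i) B) ->
  L2_bounded (fun s => Fsum (map (fun i => f i s) l)) B.
Proof.
  intros HB; induction l as [|i l IH]; intros Hf; simpl; [apply L2_bounded_zero, HB|].
  apply L2_bounded_add; [apply Hf; left; reflexivity | apply IH; intros; apply Hf; right; assumption].
Qed.

Lemma sup_bounded_ext f g B : (forall s x y z, f s (tm s) x y z = g s (tm s) x y z) ->
  sup_bounded g B -> sup_bounded f B.
Proof. intros E (c & Hc & Hg); exists c; split; [assumption|]; intros; rewrite E; apply Hg. Qed.

Lemma sup_bounded_mul f g A B : nonneg A -> nonneg B -> sup_bounded f A -> sup_bounded g B ->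
  sup_bounded (fun s => f s * g s)%fld (fun s => A s * B s).
Proof.
  intros HA HB (c & Hc & Hf) (d & Hd & Hg); exists (c * d); split; [apply Rmult_le_pos; assumption|].
  intros s x y z; Feval; rewrite Rabs_mult; replace (c * d * (A s * B s)) with ((c * A s) * (d * B s)) by ring.
  apply Rmult_le_compat; try apply Rabs_pos; auto.
Qed.

Lemma L2_bounded_mul_sup_l f g A B : nonneg A -> nonneg B -> sup_bounded f A -> L2_bounded g B ->
  L2_bounded (fun s => f s * g s)%fld (fun s => A s * B s).
Proof.
  intros HA HB (c & Hc & Hf) (d & Hd & Hg). exists (c * d); split; [apply Rmult_le_pos; assumption|].
  intros s. replace (c * d * (A s * B s)) with ((c * A s) * (d * B s)) by ring.
  apply Rle_trans with ((c * A s) * norm2 (g s) (tm s)).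
  - apply norm2_mul_sup; [apply Rmult_le_pos; auto | intros; apply Hf].
  - apply Rmult_le_compat_l; [apply Rmult_le_pos; auto | apply Hg].
Qed.

Lemma L2_bounded_mul_sup_r f g A B : nonneg A -> nonneg B -> L2_bounded f A -> sup_bounded g B ->
  L2_bounded (fun s => f s * g s)%fld (fun s => A s * B s).
Proof.
  intros HA HB Hf Hg. apply (L2_bounded_le _ (fun s => B s * A s)).
  - apply (L2_bounded_ext _ (fun s => g s * f s)%fld); [intros; Feval; ring|]. apply L2_bounded_mul_sup_l; assumption.
  - apply lesssim_le; intros; lra.
Qed.

Lemma L2_bounded_mul_unit_l f g B : nonneg B -> sup_bounded f (fun _ => 1) -> L2_bounded g B ->
  L2_bounded (fun s => f s * g s)%fld B.
Proof.
  intros HB Hf Hg; apply (L2_bounded_le _ (fun s => 1 * B s)); [|apply lesssim_le; intros; lra].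
  apply L2_bounded_mul_sup_l; auto; intros s; lra.
Qed.

Lemma L2_bounded_mul_unit_r f g B : nonneg B -> L2_bounded f B -> sup_bounded g (fun _ => 1) ->
  L2_bounded (fun s => f s * g s)%fld B.
Proof.
  intros HB Hf Hg; apply (L2_bounded_ext _ (fun s => g s * f s)%fld); [intros; Feval; ring|].
  apply L2_bounded_mul_unit_l; assumption.
Qed.

Lemma L2_bounded_sqrt f B : nonneg B -> (fun s => normsq (f s) (tm s)) <~ B -> L2_bounded f (fun s => sqrt (B s)).
Proof. apply lesssim_sqrt. Qed.

Lemma normsq_lesssim f B : nonneg B -> L2_bounded f B -> (fun s => normsq (f s) (tm s)) <~ (fun s => B s * B s).
Proof.
  intros HB H. apply (lesssim_ext _ (fun s => norm2 (f s) (tm s) * norm2 (f s) (tm s)));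
    [intros; symmetry; apply norm2_sqr|].
  apply lesssim_mul; try (intros s; apply norm2_nonneg); assumption.
Qed.

Lemma L2_bounded_of_normsq f B : nonneg B -> (fun s => normsq (f s) (tm s)) <~ (fun s => B s * B s) -> L2_bounded f B.
Proof.
  intros HB Hf; apply lesssim_of_sqr; [intros s; apply norm2_nonneg | assumption|].
  apply (lesssim_ext _ (fun s => normsq (f s) (tm s))); [intros; apply norm2_sqr | exact Hf].
Qed.

Lemma sup_bounded_sobolev f B : nonneg B ->
  (forall w, In w (rev_subwords [1; 2; 3]%nat) -> L2_bounded (fun s => Dw w (f s)) B) -> sup_bounded f B.
Proof.
  intros HB Hf.
  assert (Hsum : (fun s => lsum (map (fun w => normsq (Dw w (f s)) (tm s)) (rev_subwords [1; 2; 3]%nat)))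
                 <~ (fun s => B s * B s)).
  { apply (lesssim_lsum (rev_subwords [1; 2; 3]%nat) (fun w s => normsq (Dw w (f s)) (tm s))).
    - intros s; apply Rle_0_sqr.
    - intros w Hw; apply (normsq_lesssim (fun s => Dw w (f s))); auto. }
  destruct Hsum as (c & Hc & Hsum); exists (sqrt (8 * c)); split; [apply sqrt_pos|]; intros s x y z.
  rewrite <- (sqrt_Rsqr (B s)) by auto; rewrite <- sqrt_mult by (try lra; apply Rle_0_sqr).
  rewrite <- sqrt_Rsqr_abs; apply sqrt_le_1_alt; unfold Rsqr.
  assert (Hs := sobolev (f s) (tm s) x y z); specialize (Hsum s); simpl (_ ^ 2) in Hs; lra.
Qed.

Lemma L2_bounded_pointwise (l : list (X -> PField)) f B c : nonneg B -> 0 <= c ->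
  (forall s x y z, Rabs (f s (tm s) x y z) <= c * lsum (map (fun g : X -> PField => Rabs (g s (tm s) x y z)) l)) ->
  (forall g, In g l -> L2_bounded g B) -> L2_bounded f B.
Proof.
  intros HB Hc Hf Hl; apply L2_bounded_of_normsq; [assumption|].
  apply lesssim_trans with (fun s => lsum (map (fun g : X -> PField => normsq (g s) (tm s)) l)).
  - exists (c * c * INR (length l)); split; [apply Rmult_le_pos; [apply Rle_0_sqr | apply pos_INR]|]; intros s.
    unfold normsq at 2, inner; rewrite <- (Tint_Fsum l (fun g => g s * g s)%fld), <- Tint_scal.
    apply Tint_le; intros x y z; rewrite Fmul_eval, Fmul_eval, Fconst_eval.
    set (v := fun g : X -> PField => Rabs (g s (tm s) x y z)).
    assert (E : Fsum (map (fun g : X -> PField => g s * g s)%fld l) (tm s) x y z = lsum (map (fun g => v g * v g) l)).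
    { unfold v; clear; induction l as [|g l IH]; simpl; Feval; [reflexivity|]; rewrite IH, <- Rabs_mult.
      rewrite Rabs_right by apply Rle_ge, Rle_0_sqr; reflexivity. }
    rewrite E, Rmult_assoc; apply Rle_trans with (c * c * (lsum (map v l) * lsum (map v l))).
    + rewrite <- (Rabs_right (_ * _)), Rabs_mult by apply Rle_ge, Rle_0_sqr.
      replace (c * c * (lsum (map v l) * lsum (map v l))) with ((c * lsum (map v l)) * (c * lsum (map v l))) by ring.
      apply Rmult_le_compat; try apply Rabs_pos; apply Hf.
    + apply Rmult_le_compat_l; [apply Rle_0_sqr | apply lsum_sqr_le].
  - apply (lesssim_lsum l (fun (g : X -> PField) s => normsq (g s) (tm s))); [intros s; apply Rle_0_sqr|].
    intros g Hg; apply normsq_lesssim; auto.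
Qed.

Lemma sup_bounded_pointwise (l : list (X -> PField)) f B c : nonneg B -> 0 <= c ->
  (forall s x y z, Rabs (f s (tm s) x y z) <= c * lsum (map (fun g : X -> PField => Rabs (g s (tm s) x y z)) l)) ->
  (forall g, In g l -> sup_bounded g B) -> sup_bounded f B.
Proof.
  intros HB Hc Hf Hl.
  assert (Hsum : exists d, 0 <= d /\ forall s x y z,
    lsum (map (fun g : X -> PField => Rabs (g s (tm s) x y z)) l) <= d * B s).
  { clear Hf; induction l as [|g l IH]; simpl; [exists 0; split; [lra | intros; lra]|].
    destruct IH as (d & Hd & IH); [intros; apply Hl; right; assumption|].
    destruct (Hl g (or_introl eq_refl)) as (e & He & Hg).
    exists (e + d); split; [lra|]; intros s x y z; specialize (IH s x y z); specialize (Hg s x y z); lra. }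
  destruct Hsum as (d & Hd & Hsum); exists (c * d); split; [apply Rmult_le_pos; assumption|].
  intros s x y z; eapply Rle_trans; [apply Hf|]; rewrite Rmult_assoc; apply Rmult_le_compat_l; auto.
Qed.

Lemma bigO_inner f g A B : nonneg A -> nonneg B -> L2_bounded f A -> L2_bounded g B ->
  bigO (fun s => inner (f s) (g s) (tm s)) (fun s => A s * B s).
Proof.
  intros HA HB Hf Hg; eapply lesssim_trans; [apply lesssim_le; intros s; apply cauchy_schwarz|].
  apply lesssim_mul; auto; intros s; apply norm2_nonneg.
Qed.

Lemma bigO_inner_mul f g h A B C : nonneg A -> nonneg B -> nonneg C ->
  sup_bounded f A -> L2_bounded g B -> L2_bounded h C ->
  bigO (fun s => inner (f s) (g s * h s)%fld (tm s)) (fun s => A s * (B s * C s)).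
Proof.
  intros HA HB HC Hf Hg Hh.
  apply (bigO_ext _ (fun s => inner (g s) (f s * h s)%fld (tm s))); [intros; apply inner_mul_swap|].
  eapply bigO_le; [apply (bigO_inner g (fun s => f s * h s)%fld B (fun s => A s * C s)); auto using nonneg_mul|].
  - apply L2_bounded_mul_sup_l; assumption.
  - apply lesssim_le; intros; lra.
Qed.

Definition Dw_bounded (Q : list nat -> Prop) B f : Prop := forall w, Q w -> L2_bounded (fun s => Dw w (f s)) B.

Definition order_le (n : nat) (w : list nat) : Prop := (ord w <= n)%nat.

Lemma Dw_bounded_incl (Q R : list nat -> Prop) B f : (forall w, R w -> Q w) -> Dw_bounded Q B f -> Dw_bounded R B f.
Proof. intros HQR Hf w Hw; apply Hf, HQR, Hw. Qed.

Lemma Dw_bounded_mono n m B f : (m <= n)%nat -> Dw_bounded (order_le n) B f -> Dw_bounded (order_le m) B f.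
Proof. intros Hm; apply Dw_bounded_incl; unfold order_le; intros; lia. Qed.

Lemma Dw_bounded_le Q A B f : A <~ B -> Dw_bounded Q A f -> Dw_bounded Q B f.
Proof. intros HAB Hf w Hw; eapply L2_bounded_le; [apply Hf, Hw | exact HAB]. Qed.

Lemma Dw_bounded_ext Q B f g : (forall s, f s = g s) -> Dw_bounded Q B g -> Dw_bounded Q B f.
Proof. intros E Hg w Hw; apply (L2_bounded_ext _ (fun s => Dw w (g s))); [intros; rewrite E; reflexivity | auto]. Qed.

Lemma Dw_bounded_zero Q B : nonneg B -> Dw_bounded Q B (fun _ => Fconst 0).
Proof.
  intros HB w _; apply (L2_bounded_ext _ (fun _ => Fconst 0)); [intros; rewrite Dw_zero; reflexivity|].
  apply L2_bounded_zero, HB.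
Qed.

Lemma Dw_bounded_add Q B f g : Dw_bounded Q B f -> Dw_bounded Q B g -> Dw_bounded Q B (fun s => f s + g s)%fld.
Proof.
  intros Hf Hg w Hw; apply (L2_bounded_ext _ (fun s => Dw w (f s) + Dw w (g s))%fld);
    [intros; rewrite Dw_add; reflexivity | apply L2_bounded_add; auto].
Qed.

Lemma Dw_bounded_scal Q B c f : Dw_bounded Q B f -> Dw_bounded Q B (fun s => Fconst c * f s)%fld.
Proof.
  intros Hf w Hw; apply (L2_bounded_ext _ (fun s => Fconst c * Dw w (f s))%fld);
    [intros; rewrite Dw_scal; reflexivity | apply L2_bounded_scal; auto].
Qed.

Lemma Dw_bounded_unscal Q B c f : c <> 0 -> Dw_bounded Q B (fun s => Fconst c * f s)%fld -> Dw_bounded Q B f.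
Proof.
  intros Hc Hf; apply (Dw_bounded_ext Q B f (fun s => Fconst (/ c) * (Fconst c * f s))%fld).
  - intros s; apply PField_ext; intros; Feval; field; assumption.
  - apply Dw_bounded_scal, Hf.
Qed.

Lemma Dw_bounded_opp Q B f : Dw_bounded Q B f -> Dw_bounded Q B (fun s => - f s)%fld.
Proof. apply (Dw_bounded_scal Q B (-1)). Qed.

Lemma Dw_bounded_sub Q B f g : Dw_bounded Q B f -> Dw_bounded Q B g -> Dw_bounded Q B (fun s => f s - g s)%fld.
Proof. intros Hf Hg; apply (Dw_bounded_add Q B f (fun s => - g s)%fld); [assumption | apply Dw_bounded_opp, Hg]. Qed.

Lemma Dw_bounded_Fsum3 Q B (f : nat -> X -> PField) : (forall i, (i < 3)%nat -> Dw_bounded Q B (f i)) ->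
  Dw_bounded Q B (fun s => Fsum3 (fun i => f i s)).
Proof. intros Hf; unfold Fsum3; apply Dw_bounded_add; [apply Dw_bounded_add|]; apply Hf; lia. Qed.

Lemma Dw_bounded_D (Q R : list nat -> Prop) B k f : (forall w, R w -> Q (k :: w)) ->
  Dw_bounded Q B f -> Dw_bounded R B (fun s => D k (f s)).
Proof.
  intros HQR Hf w Hw; apply (L2_bounded_ext _ (fun s => Dw (k :: w) (f s))); [intros; rewrite Dw_D; reflexivity|].
  apply Hf, HQR, Hw.
Qed.

Lemma Dw_bounded_order_D n m B k f : (weight k + m <= n)%nat ->
  Dw_bounded (order_le n) B f -> Dw_bounded (order_le m) B (fun s => D k (f s)).
Proof. intros Hk; apply Dw_bounded_D; unfold order_le; simpl; intros; lia. Qed.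

Lemma sup_bounded_Dw n B f w : nonneg B -> Dw_bounded (order_le n) B f -> (ord w + 3 <= n)%nat ->
  sup_bounded (fun s => Dw w (f s)) B.
Proof.
  intros HB Hf Hw; apply sup_bounded_sobolev; [assumption|]; intros v Hv.
  apply (L2_bounded_ext _ (fun s => Dw (v ++ w) (f s))); [intros; rewrite Dw_app; reflexivity|].
  apply Hf; unfold order_le; rewrite ord_app; assert (ord v <= 3)%nat; [|lia].
  repeat (destruct Hv as [<-|Hv]; [simpl; lia|]); destruct Hv.
Qed.

(* One factor of each Leibniz term is estimated in the sup norm and the other in L^2. *)
Lemma Dw_bounded_leibniz_sum (l : list (list nat * list nat)) A B f g : nonneg A -> nonneg B ->
  (forall p, In p l ->
     (sup_bounded (fun s => Dw (fst p) (f s)) A /\ L2_bounded (fun s => Dw (snd p) (g s)) B) \/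
     (L2_bounded (fun s => Dw (fst p) (f s)) A /\ sup_bounded (fun s => Dw (snd p) (g s)) B)) ->
  L2_bounded (fun s => Fsum (map (leibniz_term (f s) (g s)) l)) (fun s => A s * B s).
Proof.
  intros HA HB Hfg; apply (L2_bounded_Fsum l (fun p s => leibniz_term (f s) (g s) p)); [apply nonneg_mul; assumption|].
  intros p Hp; destruct (Hfg p Hp) as [[Hf Hg]|[Hf Hg]];
    [apply L2_bounded_mul_sup_l | apply L2_bounded_mul_sup_r]; assumption.
Qed.

Lemma leibniz_factors n m A B f g v w : nonneg A -> nonneg B ->
  Dw_bounded (order_le n) A f -> Dw_bounded (order_le m) B g ->
  ((ord v + 3 <= n /\ ord w <= m) \/ (ord v <= n /\ ord w + 3 <= m))%nat ->
  (sup_bounded (fun s => Dw v (f s)) A /\ L2_bounded (fun s => Dw w (g s)) B) \/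
  (L2_bounded (fun s => Dw v (f s)) A /\ sup_bounded (fun s => Dw w (g s)) B).
Proof.
  intros HA HB Hf Hg [[Hv Hw]|[Hv Hw]]; [left | right]; split; auto.
  - apply (sup_bounded_Dw n); assumption.
  - apply (sup_bounded_Dw m); assumption.
Qed.

Lemma L2_bounded_leibniz_term n m A B f g p : nonneg A -> nonneg B ->
  Dw_bounded (order_le n) A f -> Dw_bounded (order_le m) B g ->
  ((ord (fst p) + 3 <= n /\ ord (snd p) <= m) \/ (ord (fst p) <= n /\ ord (snd p) + 3 <= m))%nat ->
  L2_bounded (fun s => leibniz_term (f s) (g s) p) (fun s => A s * B s).
Proof.
  intros HA HB Hf Hg Hp; destruct (leibniz_factors n m A B f g (fst p) (snd p)) as [[Sf Lg]|[Lf Sg]]; auto.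
  - apply L2_bounded_mul_sup_l; assumption.
  - apply L2_bounded_mul_sup_r; assumption.
Qed.

Lemma Dw_bounded_mul k n m A B f g : nonneg A -> nonneg B ->
  Dw_bounded (order_le n) A f -> Dw_bounded (order_le m) B g ->
  (forall b c, (b + c <= k)%nat -> ((b + 3 <= n /\ c <= m) \/ (b <= n /\ c + 3 <= m))%nat) ->
  Dw_bounded (order_le k) (fun s => A s * B s) (fun s => f s * g s)%fld.
Proof.
  intros HA HB Hf Hg Hnm w Hw.
  apply (L2_bounded_ext _ (fun s => Fsum (map (leibniz_term (f s) (g s)) (splits w))));
    [intros; rewrite leibniz; reflexivity|].
  apply Dw_bounded_leibniz_sum; auto; intros p Hp; apply (leibniz_factors n m); auto.
  apply Hnm; rewrite (splits_ord w p Hp); exact Hw.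
Qed.

Lemma commutator_L2_bounded n m A B f g w : nonneg A -> nonneg B ->
  Dw_bounded (order_le n) A f -> Dw_bounded (order_le m) B g ->
  (forall b c, (b + c = ord w)%nat -> (1 <= b)%nat -> ((b + 3 <= n /\ c <= m) \/ (b <= n /\ c + 3 <= m))%nat) ->
  L2_bounded (fun s => Dw w (f s * g s) - f s * Dw w (g s))%fld (fun s => A s * B s).
Proof.
  intros HA HB Hf Hg Hnm.
  apply (L2_bounded_ext _ (fun s => Fsum (map (leibniz_term (f s) (g s)) (proper_l_splits w)))).
  { intros s x y z; rewrite leibniz_commutator; Feval; ring. }
  apply Dw_bounded_leibniz_sum; auto; intros p Hp; apply proper_l_splits_in in Hp; destruct Hp as [Hp Hpos].
  apply (leibniz_factors n m); auto; apply Hnm; [apply splits_ord, Hp | exact Hpos].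
Qed.

End Families.

(** * The norms of the statement in terms of words *)

Definition sorted_word (a0 a1 a2 a3 : nat) : list nat :=
  repeat 0%nat a0 ++ repeat 1%nat a1 ++ repeat 2%nat a2 ++ repeat 3%nat a3.

Lemma dpow_fold_right k n (f : Field) : dpow k n f = fold_right pd f (repeat k n).
Proof. induction n as [|n IH]; simpl; [reflexivity|]; unfold dpow in *; simpl; rewrite IH; reflexivity. Qed.

Lemma dpow_Dw k n (f : PField) : dpow k n f = Dw (repeat k n) f.
Proof. rewrite Dw_fun; apply dpow_fold_right. Qed.

Lemma dmulti_Dw a0 a1 a2 a3 (f : PField) : dmulti a0 a1 a2 a3 f = Dw (sorted_word a0 a1 a2 a3) f.
Proof. unfold dmulti, sorted_word; rewrite Dw_fun, !dpow_fold_right, !fold_right_app; reflexivity. Qed.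

Lemma ord_repeat k n : ord (repeat k n) = (weight k * n)%nat.
Proof. induction n as [|n IH]; simpl; [lia | rewrite IH; lia]. Qed.

Lemma ord_sorted_word a0 a1 a2 a3 : ord (sorted_word a0 a1 a2 a3) = (2 * a0 + a1 + a2 + a3)%nat.
Proof. unfold sorted_word; rewrite !ord_app, !ord_repeat; simpl; lia. Qed.

Lemma in_sorted_word k a0 a1 a2 a3 : In k (sorted_word a0 a1 a2 a3) -> (k <= 3)%nat /\ (k = 0%nat -> (0 < a0)%nat).
Proof.
  unfold sorted_word; intros H.
  repeat (apply in_app_or in H; destruct H as [H|H]);
    try (apply repeat_spec in H; lia).
  assert (E := repeat_spec _ _ _ H); subst k; split; [lia | intros _; destruct a0; [destruct H | lia]].
Qed.

Lemma word_sorting w : exists a0 a1 a2 a3, Permutation (map (Nat.min 3) w) (sorted_word a0 a1 a2 a3).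
Proof.
  induction w as [|k w (a0 & a1 & a2 & a3 & IH)]; [exists 0%nat, 0%nat, 0%nat, 0%nat; constructor|].
  destruct k as [|[|[|k]]]; cbn [map Nat.min].
  - exists (S a0), a1, a2, a3; constructor; exact IH.
  - exists a0, (S a1), a2, a3; apply Permutation_cons_app; exact IH.
  - exists a0, a1, (S a2), a3; unfold sorted_word in *; rewrite app_assoc in *; apply Permutation_cons_app; exact IH.
  - exists a0, a1, a2, (S a3); unfold sorted_word in *; rewrite !app_assoc in *; apply Permutation_cons_app; exact IH.
Qed.

Lemma Dw_map_min w f : Dw (map (Nat.min 3) w) f = Dw w f.
Proof.
  induction w as [|k w IH]; [reflexivity|].
  change (D (Nat.min 3 k) (Dw (map (Nat.min 3) w) f) = D k (Dw w f)); rewrite IH.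
  destruct k as [|[|[|k]]]; [reflexivity.. | symmetry; apply D_ge3].
Qed.

Lemma ord_map_min w : ord (map (Nat.min 3) w) = ord w.
Proof.
  induction w as [|k w IH]; [reflexivity|].
  change (weight (Nat.min 3 k) + ord (map (Nat.min 3) w) = weight k + ord w)%nat; rewrite IH.
  destruct k as [|[|[|k]]]; reflexivity.
Qed.

Lemma Dw_sorted_word w : exists a0 a1 a2 a3, ord w = (2 * a0 + a1 + a2 + a3)%nat /\
  (forall f, Dw w f = Dw (sorted_word a0 a1 a2 a3) f) /\ (~ In 0%nat w -> a0 = 0%nat).
Proof.
  destruct (word_sorting w) as (a0 & a1 & a2 & a3 & Hw); exists a0, a1, a2, a3; split; [|split].
  - rewrite <- ord_sorted_word, <- (ord_perm _ _ Hw), ord_map_min; reflexivity.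
  - intros f; rewrite <- (Dw_perm _ _ f Hw), Dw_map_min; reflexivity.
  - intros Hspace; destruct a0 as [|a0]; [reflexivity|exfalso; apply Hspace].
    assert (Hin := Permutation_in 0%nat (Permutation_sym Hw) (or_introl eq_refl)).
    apply in_map_iff in Hin; destruct Hin as ([|k] & Ek & Hk); [exact Hk | discriminate].
Qed.

Lemma sum_f_R0_term_le (g : nat -> R) n i a : (forall j, 0 <= g j) -> (i <= n)%nat -> a <= g i -> a <= sum_f_R0 g n.
Proof.
  intros Hg Hi Ha; apply Rle_trans with (1 := Ha); clear Ha; induction n as [|n IH]; simpl.
  - replace i with 0%nat by lia; lra.
  - destruct (Nat.eq_dec i (S n)) as [->|N].
    + assert (0 <= sum_f_R0 g n) by (apply cond_pos_sum; assumption); lra.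
    + specialize (IH ltac:(lia)); specialize (Hg (S n)); lra.
Qed.

Lemma L2sq_dmulti a0 a1 a2 a3 (f : PField) t :
  L2sq (dmulti a0 a1 a2 a3 f) t = normsq (Dw (sorted_word a0 a1 a2 a3) f) t.
Proof. rewrite dmulti_Dw; apply L2sq_normsq. Qed.

Lemma if_L2sq_dmulti_nonneg (b : bool) a0 a1 a2 a3 (f : PField) t : 0 <= if b then L2sq (dmulti a0 a1 a2 a3 f) t else 0.
Proof. destruct b; [rewrite L2sq_dmulti; apply normsq_nonneg | lra]. Qed.

Lemma Pk_sq_nonneg k (f : PField) t : 0 <= Pk_sq k f t.
Proof. unfold Pk_sq; repeat (apply cond_pos_sum; intros); apply if_L2sq_dmulti_nonneg. Qed.

Lemma Hs_sq_nonneg k (f : PField) t : 0 <= Hs_sq k f t.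
Proof. unfold Hs_sq; repeat (apply cond_pos_sum; intros); apply if_L2sq_dmulti_nonneg. Qed.

Lemma normsq_le_Pk_sq w k (f : PField) t : (ord w <= k)%nat -> normsq (Dw w f) t <= Pk_sq k f t.
Proof.
  intros Hw; destruct (Dw_sorted_word w) as (a0 & a1 & a2 & a3 & Eo & Ew & _); unfold Pk_sq.
  apply (sum_f_R0_term_le _ k a0); [intros; repeat (apply cond_pos_sum; intros); apply if_L2sq_dmulti_nonneg | lia|].
  apply (sum_f_R0_term_le _ k a1); [intros; repeat (apply cond_pos_sum; intros); apply if_L2sq_dmulti_nonneg | lia|].
  apply (sum_f_R0_term_le _ k a2); [intros; repeat (apply cond_pos_sum; intros); apply if_L2sq_dmulti_nonneg | lia|].
  apply (sum_f_R0_term_le _ k a3); [intros; apply if_L2sq_dmulti_nonneg | lia|].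
  rewrite L2sq_dmulti, Ew; replace (_ <=? k)%nat with true by (symmetry; apply Nat.leb_le; lia); lra.
Qed.

Lemma normsq_le_Hs_sq w k (f : PField) t : (ord w <= k)%nat -> ~ In 0%nat w -> normsq (Dw w f) t <= Hs_sq k f t.
Proof.
  intros Hw Hspace; destruct (Dw_sorted_word w) as (a0 & a1 & a2 & a3 & Eo & Ew & Ea0); unfold Hs_sq.
  specialize (Ea0 Hspace); subst a0.
  apply (sum_f_R0_term_le _ k a1); [intros; repeat (apply cond_pos_sum; intros); apply if_L2sq_dmulti_nonneg | lia|].
  apply (sum_f_R0_term_le _ k a2); [intros; repeat (apply cond_pos_sum; intros); apply if_L2sq_dmulti_nonneg | lia|].
  apply (sum_f_R0_term_le _ k a3); [intros; apply if_L2sq_dmulti_nonneg | lia|].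
  rewrite L2sq_dmulti, Ew; replace (_ <=? k)%nat with true by (symmetry; apply Nat.leb_le; lia); lra.
Qed.

Lemma Pk_sq_lesssim {X} (tm : X -> R) k (f : X -> PField) (B : X -> R) : nonneg B ->
  (forall w, (ord w <= k)%nat -> (fun s => normsq (Dw w (f s)) (tm s)) <~ B) -> (fun s => Pk_sq k (f s) (tm s)) <~ B.
Proof.
  intros HB Hf; unfold Pk_sq; repeat (apply lesssim_sum_f_R0; intros).
  apply lesssim_if; [assumption|]; intros E; apply Nat.leb_le in E.
  eapply lesssim_ext; [intros s; apply L2sq_dmulti|]; apply Hf; rewrite ord_sorted_word; assumption.
Qed.

Lemma Hs_sq_lesssim {X} (tm : X -> R) k (f : X -> PField) (B : X -> R) : nonneg B ->
  (forall w, (ord w <= k)%nat -> ~ In 0%nat w -> (fun s => normsq (Dw w (f s)) (tm s)) <~ B) ->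
  (fun s => Hs_sq k (f s) (tm s)) <~ B.
Proof.
  intros HB Hf; unfold Hs_sq; repeat (apply lesssim_sum_f_R0; intros).
  apply lesssim_if; [assumption|]; intros E; apply Nat.leb_le in E.
  eapply lesssim_ext; [intros s; apply L2sq_dmulti|].
  apply Hf; [rewrite ord_sorted_word; lia | intros I; apply in_sorted_word in I; lia].
Qed.

Lemma normsq_continuous f t : continuous (normsq f) t.
Proof. apply (ex_derive_continuous (normsq f)); eexists; apply normsq_derive. Qed.

Lemma sum_f_R0_continuous (g : nat -> R -> R) n t : (forall i, continuous (g i) t) ->
  continuous (fun t => sum_f_R0 (fun i => g i t) n) t.
Proof.
  intros Hg; induction n as [|n IH]; simpl; [apply Hg|].
  apply (continuous_plus (fun t => sum_f_R0 (fun i => g i t) n) (g (S n))); [exact IH | apply Hg].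
Qed.

Lemma if_continuous (b : bool) (g : R -> R) t : continuous g t -> continuous (fun t => if b then g t else 0) t.
Proof. intros Hg; destruct b; [exact Hg | apply continuous_const]. Qed.

Lemma sum_from_continuous m n (g : nat -> R -> R) t : (forall j, continuous (g j) t) ->
  continuous (fun t => sum_from m n (fun j => g j t)) t.
Proof.
  intros Hg; unfold sum_from; apply (sum_f_R0_continuous (fun j t => if (m <=? j)%nat then g j t else 0)).
  intros j; apply if_continuous, Hg.
Qed.

Lemma L2sq_dmulti_continuous a0 a1 a2 a3 (f : PField) t : continuous (L2sq (dmulti a0 a1 a2 a3 f)) t.
Proof.
  apply (continuous_ext (normsq (Dw (sorted_word a0 a1 a2 a3) f))); [|apply normsq_continuous].
  intros r; symmetry; apply L2sq_dmulti.
Qed.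

Lemma Pk_sq_continuous k (f : PField) t : continuous (Pk_sq k f) t.
Proof.
  unfold Pk_sq; apply sum_f_R0_continuous; intros a0; apply sum_f_R0_continuous; intros a1.
  apply sum_f_R0_continuous; intros a2; apply sum_f_R0_continuous; intros a3.
  apply if_continuous, L2sq_dmulti_continuous.
Qed.

Lemma Hs_sq_continuous k (f : PField) t : continuous (Hs_sq k f) t.
Proof.
  unfold Hs_sq; apply sum_f_R0_continuous; intros a1.
  apply sum_f_R0_continuous; intros a2; apply sum_f_R0_continuous; intros a3.
  apply if_continuous, L2sq_dmulti_continuous.
Qed.

Section Norms_of_tuples.
Context (N : Field -> R -> R).

Lemma sumN_nonneg (l : list PField) t : (forall f : PField, 0 <= N f t) -> 0 <= sumN N (map field_fun l) t.
Proof. intros HN; induction l as [|f l IH]; simpl; [lra|]; apply Rplus_le_le_0_compat; [apply HN | exact IH]. Qed.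

Lemma sumN_term (l : list PField) f t : (forall f : PField, 0 <= N f t) -> In f l ->
  N f t <= sumN N (map field_fun l) t.
Proof.
  intros HN; induction l as [|g l IH]; intros []; cbn [sumN map fold_right]; fold (sumN N (map field_fun l) t).
  - subst; assert (Hl := sumN_nonneg l t HN); lra.
  - specialize (IH H); specialize (HN g); lra.
Qed.

Lemma sumN_continuous (l : list PField) t : (forall f : PField, continuous (N f) t) ->
  continuous (sumN N (map field_fun l)) t.
Proof.
  intros HN; induction l as [|f l IH]; [apply continuous_const|].
  apply (continuous_plus (V := R_NormedModule)); [apply HN | exact IH].
Qed.

Lemma sumN_lesssim {X} (tm : X -> R) (l : list (X -> PField)) (B : X -> R) : nonneg B ->
  (forall f, In f l -> (fun s => N (f s) (tm s)) <~ B) ->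
  (fun s => sumN N (map field_fun (map (fun f => f s) l)) (tm s)) <~ B.
Proof.
  intros HB Hl; induction l as [|f l IH]; simpl; [apply lesssim_zero, HB|].
  apply lesssim_add; [apply Hl; left; reflexivity | apply IH; intros; apply Hl; right; assumption].
Qed.

Lemma dtl_Dw n (l : list PField) : dtl n (map field_fun l) = map field_fun (map (Dw (repeat 0%nat n)) l).
Proof. unfold dtl; rewrite !map_map; apply map_ext; intros; apply dpow_Dw. Qed.

End Norms_of_tuples.

Lemma Dw_bounded_of_Pk_sq {X} (tm : X -> R) k (l : list (X -> PField)) f (B : X -> R) : In f l -> nonneg B ->
  (forall s, sumN (Pk_sq k) (map field_fun (map (fun f => f s) l)) (tm s) <= B s) ->
  Dw_bounded tm (order_le k) (fun s => sqrt (B s)) f.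
Proof.
  intros Hf HB Hl w Hw; apply L2_bounded_sqrt; [assumption|]; apply lesssim_le; intros s.
  eapply Rle_trans; [|apply Hl]; eapply Rle_trans; [apply normsq_le_Pk_sq, Hw|].
  apply sumN_term; [intros; apply Pk_sq_nonneg | apply (in_map (fun f => f s)), Hf].
Qed.

(** * Solutions *)

Definition crossF (a b : nat -> PField) (i : nat) : PField :=
  match i with
  | O => (a 1%nat * b 2%nat - a 2%nat * b 1%nat)%fld
  | 1%nat => (a 2%nat * b 0%nat - a 0%nat * b 2%nat)%fld
  | _ => (a 0%nat * b 1%nat - a 1%nat * b 0%nat)%fld
  end.

Definition tenF (w : nat -> PField) (i j : nat) : PField :=
  match i, j with
  | O, 1%nat => (- w 2%nat)%fld | O, 2%nat => w 1%nat
  | 1%nat, O => w 2%nat | 1%nat, 2%nat => (- w 0%nat)%fld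
  | 2%nat, O => (- w 1%nat)%fld | 2%nat, 1%nat => w 0%nat
  | _, _ => Fconst 0
  end.

Definition mvF (A : nat -> nat -> PField) (v : nat -> PField) (i : nat) : PField := Fsum3 (fun j => A i j * v j)%fld.
Definition commF (A B : nat -> nat -> PField) (i j : nat) : PField :=
  (Fsum3 (fun k => A i k * B k j) - Fsum3 (fun k => B i k * A k j))%fld.
Definition lapF (f : PField) : PField := Fsum3 (fun j => D (S j) (D (S j) f)).
Definition divF (v : nat -> PField) : PField := Fsum3 (fun j => D (S j) (v j)).
Definition curlF (v : nat -> PField) (i : nat) : PField :=
  match i with
  | O => (D 2 (v 2%nat) - D 3 (v 1%nat))%fld
  | 1%nat => (D 3 (v 0%nat) - D 1 (v 2%nat))%fld
  | _ => (D 1 (v 1%nat) - D 2 (v 0%nat))%fld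
  end.

Definition advF (u : nat -> PField) (f : PField) : PField := Fsum3 (fun k => u k * D (S k) f)%fld.

Class Coefficients := mkCoefficients {
  mu : R; kappa : R; alpha : R; beta : R; gamma : R; tau : R; lam : R; nu : R; M : nat;
  mu_pos : 0 < mu; kappa_pos : 0 < kappa; alpha_pos : 0 < alpha; beta_pos : 0 < beta; gamma_pos : 0 < gamma;
  tau_pos : 0 < tau; lam_pos : 0 < lam; lam_nu : lam < nu; M_ge : (4 <= M)%nat }.

Section Solutions.
Context {P : Coefficients}.

Definition tau_tilde : R := tau / (2 * kappa).
Definition alpha_tilde : R := alpha + 4 / 3 * beta.
Definition gamma_tilde : R := beta + gamma.
Definition gap : R := nu - lam.
(* Below this size of [K] the quadratic constraint determines the remaining entries by absorption, and the matrix
   [Jeq + K] stays coercive. *)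
Definition K_threshold : R := Rmin gap lam / 20.

Lemma tau_tilde_pos : 0 < tau_tilde.
Proof. unfold tau_tilde; apply Rdiv_lt_0_compat; [apply tau_pos | assert (Hk := kappa_pos); lra]. Qed.
Lemma alpha_tilde_pos : 0 < alpha_tilde.
Proof. unfold alpha_tilde; assert (Ha := alpha_pos); assert (Hb := beta_pos); lra. Qed.
Lemma gamma_tilde_pos : 0 < gamma_tilde.
Proof. unfold gamma_tilde; assert (Hg := gamma_pos); assert (Hb := beta_pos); lra. Qed.
Lemma gap_pos : 0 < gap.
Proof. unfold gap; assert (Hln := lam_nu); lra. Qed.
Lemma K_threshold_pos : 0 < K_threshold.
Proof. apply Rdiv_lt_0_compat; [apply Rmin_pos; [apply gap_pos | apply lam_pos] | lra]. Qed.
Lemma K_threshold_gap : K_threshold <= gap / 20.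
Proof. unfold K_threshold; assert (Hmin := Rmin_l gap lam); lra. Qed.
Lemma K_threshold_lam : K_threshold <= lam / 20.
Proof. unfold K_threshold; assert (Hmin := Rmin_r gap lam); lra. Qed.

Definition Jeq_diag (i : nat) : R := if (i =? 2)%nat then nu else lam.
Definition JeqF (i j : nat) : PField := Fconst (Jeq lam nu i j).
Definition omegaF (i : nat) : PField := if (i =? 2)%nat then Fconst tau_tilde else Fconst 0.

(* The linear part of the gyroscopic term omega x J omega at the equilibrium. *)
Definition gyro_linear (th : nat -> PField) (K : nat -> nat -> PField) (i : nat) : PField :=
  match i with
  | O => (Fconst (tau_tilde * gap) * th 1%nat - Fconst (tau_tilde * tau_tilde) * K 1%nat 2%nat)%fld
  | 1%nat => (Fconst (tau_tilde * tau_tilde) * K 0%nat 2%nat - Fconst (tau_tilde * gap) * th 0%nat)%fld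
  | _ => Fconst 0
  end.

(* The quadratic and cubic part of the gyroscopic term, once [gyro_linear] is removed. *)
Definition gyro_nonlinear (th : nat -> PField) (K : nat -> nat -> PField) (i : nat) : PField :=
  (crossF th (fun j => Fconst tau_tilde * K j 2%nat) i + crossF omegaF (mvF K th) i
   + crossF th (fun j => Fconst (Jeq_diag j) * th j) i + crossF th (mvF K th) i)%fld.
Definition theta_nonlinear (u th : nat -> PField) (K : nat -> nat -> PField) (i : nat) : PField :=
  (Fconst (Jeq_diag i) * advF u (th i) + Fsum3 (fun j => K i j * advF u (th j)) + gyro_nonlinear th K i)%fld.
Definition K_nonlinear (u th : nat -> PField) (K : nat -> nat -> PField) (i j : nat) : PField :=
  (commF (tenF th) K i j - advF u (K i j))%fld.

(* [sol_K_block] and [sol_K_corner] are the diagonal blocks of (J - lam)(J - nu) = 0, the form in which the spectral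
   constraint is used. *)
Record Solution := mkSolution {
  sol_u : nat -> PField; sol_p : PField; sol_th : nat -> PField; sol_K : nat -> nat -> PField;
  sol_T : R; sol_size : R;
  sol_T_pos : 0 < sol_T;
  sol_momentum : forall i, (i < 3)%nat -> eq_on sol_T (D 0 (sol_u i))
    (Fconst (mu + kappa / 2) * lapF (sol_u i) + Fconst kappa * curlF sol_th i
     - D (S i) sol_p - advF sol_u (sol_u i))%fld;
  sol_divergence : eq_on sol_T (divF sol_u) (Fconst 0);
  sol_microrotation : forall i, (i < 3)%nat -> eq_on sol_T
    (Fconst (Jeq_diag i) * D 0 (sol_th i) + Fsum3 (fun j => sol_K i j * D 0 (sol_th j)))%fld
    (Fconst kappa * curlF sol_u i - Fconst (2 * kappa) * sol_th i
     + Fconst (alpha_tilde - gamma_tilde) * D (S i) (divF sol_th) + Fconst gamma_tilde * lapF (sol_th i)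
     - gyro_linear sol_th sol_K i - theta_nonlinear sol_u sol_th sol_K i)%fld;
  sol_inertia : forall i j, (i < 3)%nat -> (j < 3)%nat -> eq_on sol_T (D 0 (sol_K i j))
    (commF (tenF omegaF) sol_K i j + commF (tenF sol_th) JeqF i j + K_nonlinear sol_u sol_th sol_K i j)%fld;
  sol_K_sym : forall i j, (i < 3)%nat -> (j < 3)%nat -> eq_on sol_T (sol_K i j) (sol_K j i);
  sol_K_block : forall i j, (i < 2)%nat -> (j < 2)%nat ->
    eq_on sol_T (Fconst gap * sol_K i j)%fld (Fsum3 (fun k => sol_K i k * sol_K k j)%fld);
  sol_K_corner : eq_on sol_T (Fconst gap * sol_K 2%nat 2%nat)%fld
    (- Fsum3 (fun k => sol_K 2%nat k * sol_K k 2%nat)%fld)%fld;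
  sol_u_mean : forall t i, 0 <= t <= sol_T -> (i < 3)%nat -> Tint (sol_u i) t = 0;
  sol_K_small : forall t x y z i j, 0 <= t <= sol_T -> (i < 3)%nat -> (j < 3)%nat ->
    Rabs (sol_K i j t x y z) <= K_threshold;
  sol_size_bounds : 0 <= sol_size <= 1;
  sol_energy : forall t, 0 <= t <= sol_T -> Ebar M (fun i => sol_u i) (fun i => sol_th i) (fun i j => sol_K i j) t
    <= sol_size * sol_size }.

Definition Energy (S : Solution) (t : R) : R :=
  Ebar M (fun i => sol_u S i) (fun i => sol_th S i) (fun i j => sol_K S i j) t.
Definition Diss (N : nat) (S : Solution) (t : R) : R :=
  sumN (Pk_sq (N + 1)) (comps3 (fun i => sol_u S i) ++ comps3 (fun i => sol_th S i)) t.

(* A state is a solution with a time, so that [A <~ B] between functions of states is a bound uniform in both. *)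
Record State := mkState { sol :> Solution; time : R; time_ok : 0 <= time <= sol_T sol }.

Definition u_at (i : nat) (s : State) : PField := sol_u s i.
Definition th_at (i : nat) (s : State) : PField := sol_th s i.
Definition K_at (i j : nat) (s : State) : PField := sol_K s i j.
Definition energy (s : State) : R := Energy s (time s).
Definition diss (N : nat) (s : State) : R := Diss N s (time s).
Definition sqrt_energy (s : State) : R := sqrt (energy s).
Definition sqrt_diss (N : nat) (s : State) : R := sqrt (diss N s).
Definition size_at (s : State) : R := sol_size s.

Definition u_th_fields : list (State -> PField) := [u_at 0; u_at 1; u_at 2; th_at 0; th_at 1; th_at 2].
Definition u_th_a_fields : list (State -> PField) := u_th_fields ++ [K_at 0 2; K_at 1 2].

Lemma energy_sumN s : energy s = sumN (Pk_sq (2 * M)) (map field_fun (map (fun f => f s) u_th_a_fields)) (time s).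
Proof. reflexivity. Qed.
Lemma diss_sumN N s : diss N s = sumN (Pk_sq (N + 1)) (map field_fun (map (fun f => f s) u_th_fields)) (time s).
Proof. reflexivity. Qed.

Lemma Energy_nonneg S t : 0 <= Energy S t.
Proof.
  apply (sumN_nonneg (Pk_sq (2 * M)) [sol_u S 0; sol_u S 1; sol_u S 2; sol_th S 0; sol_th S 1; sol_th S 2;
    sol_K S 0 2; sol_K S 1 2]%nat); intros; apply Pk_sq_nonneg.
Qed.
Lemma Diss_nonneg N S t : 0 <= Diss N S t.
Proof.
  apply (sumN_nonneg (Pk_sq (N + 1)) [sol_u S 0; sol_u S 1; sol_u S 2; sol_th S 0; sol_th S 1; sol_th S 2]%nat).
  intros; apply Pk_sq_nonneg.
Qed.
Lemma Diss_continuous N S t : continuous (Diss N S) t.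
Proof.
  apply (sumN_continuous (Pk_sq (N + 1)) [sol_u S 0; sol_u S 1; sol_u S 2; sol_th S 0; sol_th S 1; sol_th S 2]%nat).
  intros; apply Pk_sq_continuous.
Qed.

Lemma energy_nonneg : nonneg energy. Proof. intros s; exact (Energy_nonneg s (time s)). Qed.
Lemma diss_nonneg N : nonneg (diss N). Proof. intros s; exact (Diss_nonneg N s (time s)). Qed.
Lemma sqrt_energy_nonneg : nonneg sqrt_energy. Proof. intros s; apply sqrt_pos. Qed.
Lemma sqrt_diss_nonneg N : nonneg (sqrt_diss N). Proof. intros s; apply sqrt_pos. Qed.
Lemma size_at_nonneg : nonneg size_at. Proof. intros s; apply sol_size_bounds. Qed.
Lemma one_nonneg : nonneg (fun _ : State => 1). Proof. intros s; lra. Qed.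
Lemma sqrt_energy_sqr s : sqrt_energy s * sqrt_energy s = energy s. Proof. apply sqrt_sqrt, energy_nonneg. Qed.
Lemma sqrt_diss_sqr N s : sqrt_diss N s * sqrt_diss N s = diss N s. Proof. apply sqrt_sqrt, diss_nonneg. Qed.

Lemma sqrt_energy_sqr_lesssim : (fun s => sqrt_energy s * sqrt_energy s) <~ energy.
Proof. apply lesssim_le; intros s; rewrite sqrt_energy_sqr; lra. Qed.
Lemma sqrt_diss_sqr_lesssim N : (fun s => sqrt_diss N s * sqrt_diss N s) <~ diss N.
Proof. apply lesssim_le; intros s; rewrite sqrt_diss_sqr; lra. Qed.

Lemma sqrt_energy_le_size s : sqrt_energy s <= size_at s.
Proof.
  unfold sqrt_energy; rewrite <- (sqrt_square (size_at s)) by apply size_at_nonneg.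
  apply sqrt_le_1_alt; exact (sol_energy s (time s) (time_ok s)).
Qed.
Lemma sqrt_energy_size : sqrt_energy <~ size_at. Proof. apply lesssim_le, sqrt_energy_le_size. Qed.
Lemma size_one : size_at <~ (fun _ => 1). Proof. apply lesssim_le; intros s; apply sol_size_bounds. Qed.
Lemma sqrt_energy_one : sqrt_energy <~ (fun _ => 1).
Proof. apply (lesssim_trans _ size_at); [apply sqrt_energy_size | apply size_one]. Qed.

Lemma in_u_th_fields i : (i < 3)%nat -> In (u_at i) u_th_fields /\ In (th_at i) u_th_fields.
Proof. intros Hi; case_lt3 i; split; simpl; auto 7. Qed.

Lemma u_th_fields_ind (Q : (State -> PField) -> Prop) :
  (forall i, (i < 3)%nat -> Q (u_at i)) -> (forall i, (i < 3)%nat -> Q (th_at i)) -> forall f, In f u_th_fields -> Q f.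
Proof.
  intros Hu Hth f Hf.
  destruct Hf as [<-|[<-|[<-|[<-|[<-|[<-|[]]]]]]]; [apply Hu; lia.. | | | ]; apply Hth; lia.
Qed.

Lemma Dw_bounded_energy f : In f u_th_a_fields -> Dw_bounded time (order_le (2 * M)) sqrt_energy f.
Proof.
  intros Hf; apply (Dw_bounded_of_Pk_sq time _ u_th_a_fields); [exact Hf | apply energy_nonneg|].
  intros s; rewrite energy_sumN; apply Rle_refl.
Qed.
Lemma Dw_bounded_u i : (i < 3)%nat -> Dw_bounded time (order_le (2 * M)) sqrt_energy (u_at i).
Proof. intros Hi; apply Dw_bounded_energy, in_or_app; left; apply in_u_th_fields, Hi. Qed.
Lemma Dw_bounded_th i : (i < 3)%nat -> Dw_bounded time (order_le (2 * M)) sqrt_energy (th_at i).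
Proof. intros Hi; apply Dw_bounded_energy, in_or_app; left; apply in_u_th_fields, Hi. Qed.
Lemma Dw_bounded_a i : (i < 2)%nat -> Dw_bounded time (order_le (2 * M)) sqrt_energy (K_at i 2).
Proof. intros Hi; apply Dw_bounded_energy, in_or_app; right; destruct i as [|[|i]]; simpl; auto; lia. Qed.

Lemma Dw_bounded_diss N f : In f u_th_fields -> Dw_bounded time (order_le (N + 1)) (sqrt_diss N) f.
Proof.
  intros Hf; apply (Dw_bounded_of_Pk_sq time _ u_th_fields); [exact Hf | apply diss_nonneg|].
  intros s; rewrite diss_sumN; apply Rle_refl.
Qed.
Lemma Dw_bounded_u_diss N i : (i < 3)%nat -> Dw_bounded time (order_le (N + 1)) (sqrt_diss N) (u_at i).
Proof. intros Hi; apply Dw_bounded_diss, in_u_th_fields, Hi. Qed.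
Lemma Dw_bounded_th_diss N i : (i < 3)%nat -> Dw_bounded time (order_le (N + 1)) (sqrt_diss N) (th_at i).
Proof. intros Hi; apply Dw_bounded_diss, in_u_th_fields, Hi. Qed.

Lemma u_sup i w : (i < 3)%nat -> (ord w + 3 <= 2 * M)%nat -> sup_bounded time (fun s => Dw w (u_at i s)) sqrt_energy.
Proof. intros Hi; apply sup_bounded_Dw; [apply sqrt_energy_nonneg | apply Dw_bounded_u, Hi]. Qed.
Lemma th_sup i w : (i < 3)%nat -> (ord w + 3 <= 2 * M)%nat -> sup_bounded time (fun s => Dw w (th_at i s)) sqrt_energy.
Proof. intros Hi; apply sup_bounded_Dw; [apply sqrt_energy_nonneg | apply Dw_bounded_th, Hi]. Qed.
Lemma sup_bounded_one f : sup_bounded time f sqrt_energy -> sup_bounded time f (fun _ => 1).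
Proof. intros Hf; eapply sup_bounded_le; [exact Hf | apply sqrt_energy_one]. Qed.

Lemma Dw_bounded_eq_on Q B (f g : State -> PField) : (forall s : State, eq_on (sol_T s) (f s) (g s)) ->
  Dw_bounded time Q B g -> Dw_bounded time Q B f.
Proof.
  intros E Hg w Hw; apply (L2_bounded_ext time _ (fun s => Dw w (g s))); [|apply Hg, Hw].
  intros s x y z; apply (eq_on_Dw _ w _ _ (sol_T_pos s) (E s)), time_ok.
Qed.

End Solutions.

(** * The inertia perturbation is controlled by its off-diagonal block *)

Lemma leibniz_proper_Rabs_le w (f g : PField) t x y z k : Rabs (f t x y z) <= k -> Rabs (g t x y z) <= k ->
  Rabs (Dw w (f * g)%fld t x y z) <= k * (Rabs (Dw w g t x y z) + Rabs (Dw w f t x y z))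
     + lsum (map (fun p => Rabs (leibniz_term f g p t x y z)) (proper_splits w)).
Proof.
  intros Hf Hg; rewrite leibniz_proper; Feval.
  assert (Hsum := Fsum_Rabs_le (map (leibniz_term f g) (proper_splits w)) t x y z); rewrite map_map in Hsum.
  assert (Hl : Rabs (f t x y z * Dw w g t x y z) <= k * Rabs (Dw w g t x y z))
    by (rewrite Rabs_mult; apply Rmult_le_compat_r; [apply Rabs_pos | assumption]).
  assert (Hr : Rabs ((if is_nil w then Fconst 0 else Dw w f * g)%fld t x y z) <= k * Rabs (Dw w f t x y z)).
  { assert (Hk : 0 <= k) by (eapply Rle_trans; [apply Rabs_pos | exact Hf]).
    destruct (is_nil w); Feval; [rewrite Rabs_R0; apply Rmult_le_pos; [assumption | apply Rabs_pos]|].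
    rewrite Rabs_mult, Rmult_comm; apply Rmult_le_compat_r; [apply Rabs_pos | assumption]. }
  eapply Rle_trans; [apply Rabs_triang|]; apply Rplus_le_compat; [|exact Hsum].
  eapply Rle_trans; [apply Rabs_triang|]; lra.
Qed.

(* The entries that the quadratic constraint expresses through products. *)
Definition block_indices : list (nat * nat) := [(0, 0); (0, 1); (1, 0); (1, 1); (2, 2)]%nat.

Lemma block_indices_lt3 p : In p block_indices -> (fst p < 3 /\ snd p < 3)%nat.
Proof. intros Hp; repeat (destruct Hp as [<-|Hp]; [simpl; lia|]); destruct Hp. Qed.

Lemma symmetric_absorption (v r : nat -> nat -> R) :
  (forall i j, 0 <= v i j) -> (forall i j, 0 <= r i j) -> (forall i j, (i < 3)%nat -> (j < 3)%nat -> v i j = v j i) ->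
  (forall p, In p block_indices -> v (fst p) (snd p)
     <= 1 / 20 * sum3 (fun k => v k (snd p) + v (fst p) k) + r (fst p) (snd p)) ->
  forall i j, (i < 3)%nat -> (j < 3)%nat ->
  v i j <= 4 * (v 0%nat 2%nat + v 1%nat 2%nat) + 10 * lsum (map (fun p => r (fst p) (snd p)) block_indices).
Proof.
  intros Hv Hr Hs Hb i j Hi Hj.
  assert (b00 := Hb (0, 0)%nat ltac:(simpl; auto)); assert (b01 := Hb (0, 1)%nat ltac:(simpl; auto)).
  assert (b10 := Hb (1, 0)%nat ltac:(simpl; auto)); assert (b11 := Hb (1, 1)%nat ltac:(simpl; auto)).
  assert (b22 := Hb (2, 2)%nat ltac:(simpl; auto 6)).
  assert (s20 := Hs 2%nat 0%nat ltac:(lia) ltac:(lia)); assert (s21 := Hs 2%nat 1%nat ltac:(lia) ltac:(lia)).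
  unfold block_indices, sum3 in *; cbn [fst snd map lsum fold_right] in *; rewrite s20, s21 in *.
  assert (v00 := Hv 0%nat 0%nat); assert (v01 := Hv 0%nat 1%nat); assert (v10 := Hv 1%nat 0%nat).
  assert (v11 := Hv 1%nat 1%nat); assert (v22 := Hv 2%nat 2%nat).
  assert (v02 := Hv 0%nat 2%nat); assert (v12 := Hv 1%nat 2%nat).
  assert (r00 := Hr 0%nat 0%nat); assert (r01 := Hr 0%nat 1%nat); assert (r10 := Hr 1%nat 0%nat).
  assert (r11 := Hr 1%nat 1%nat); assert (r22 := Hr 2%nat 2%nat).
  clear Hb Hs Hv Hr; case_lt3 i; case_lt3 j; rewrite ?s20, ?s21; lra.
Qed.

Section Block_control.
Context {P : Coefficients}.

Lemma sol_K_quadratic (S : Solution) p : In p block_indices -> exists sign, Rabs sign = 1 /\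
  eq_on (sol_T S) (Fconst gap * sol_K S (fst p) (snd p))%fld
    (Fconst sign * Fsum3 (fun k => sol_K S (fst p) k * sol_K S k (snd p)))%fld.
Proof.
  intros Hp; assert (block : forall i j, (i < 2)%nat -> (j < 2)%nat -> exists sign, Rabs sign = 1 /\
    eq_on (sol_T S) (Fconst gap * sol_K S i j)%fld (Fconst sign * Fsum3 (fun k => sol_K S i k * sol_K S k j))%fld).
  { intros i j Hi Hj; exists 1; split; [apply Rabs_R1|].
    intros t x y z Ht; rewrite (sol_K_block S i j Hi Hj t x y z Ht); Feval; ring. }
  repeat (destruct Hp as [<-|Hp]; [try (apply block; simpl; lia)|]); [|destruct Hp].
  exists (-1); split; [rewrite Rabs_left; lra|]; intros t x y z Ht.
  cbn [fst snd]; rewrite (sol_K_corner S t x y z Ht); reflexivity.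
Qed.

Definition K_products (w : list nat) (p : nat * nat) : list (State -> PField) :=
  flat_map (fun k => map (fun q s => leibniz_term (K_at (fst p) k s) (K_at k (snd p) s) q) (proper_splits w))
    [0; 1; 2]%nat.
Definition K_controls (w : list nat) : list (State -> PField) :=
  (fun s => Dw w (K_at 0 2 s)) :: (fun s => Dw w (K_at 1 2 s)) :: flat_map (K_products w) block_indices.

Lemma K_block_pointwise w p (s : State) x y z : In p block_indices ->
  let v := fun i j => Rabs (Dw w (K_at i j s) (time s) x y z) in
  v (fst p) (snd p) <= 1 / 20 * sum3 (fun k => v k (snd p) + v (fst p) k)
    + / gap * lsum (map (fun g : State -> PField => Rabs (g s (time s) x y z)) (K_products w p)).
Proof.
  intros Hp v; assert (Hg := gap_pos); assert (Hk := K_threshold_gap).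
  destruct (block_indices_lt3 p Hp) as [Hi Hj]; destruct (sol_K_quadratic s p Hp) as (sign & Hsign & Hquad).
  assert (Hprod : forall k, (k < 3)%nat ->
    Rabs (Dw w (K_at (fst p) k s * K_at k (snd p) s)%fld (time s) x y z) <= gap / 20 * (v k (snd p) + v (fst p) k)
      + lsum (map (fun q => Rabs (leibniz_term (K_at (fst p) k s) (K_at k (snd p) s) q (time s) x y z))
          (proper_splits w))).
  { intros k Hk3; apply leibniz_proper_Rabs_le; (eapply Rle_trans; [apply sol_K_small | exact Hk]); auto;
      apply time_ok. }
  assert (E := eq_on_Dw _ w _ _ (sol_T_pos s) Hquad (time s) x y z (time_ok s)).
  rewrite !Dw_scal in E; revert E; Feval; intros E.
  assert (Ev : gap * v (fst p) (snd p)
               = Rabs (Dw w (Fsum3 (fun k => K_at (fst p) k s * K_at k (snd p) s)%fld) (time s) x y z)).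
  { unfold v, K_at; rewrite <- (Rabs_right gap), <- Rabs_mult, E, Rabs_mult, Hsign by lra; ring. }
  assert (Hle : gap * v (fst p) (snd p) <= gap / 20 * sum3 (fun k => v k (snd p) + v (fst p) k)
    + lsum (map (fun g : State -> PField => Rabs (g s (time s) x y z)) (K_products w p))).
  { rewrite Ev, Dw_Fsum3, Fsum3_eval; eapply Rle_trans; [apply sum3_Rabs_le|].
    eapply Rle_trans; [apply sum3_le; intros k Hk3; apply Hprod, Hk3|].
    rewrite sum3_add, sum3_scal; apply Rplus_le_compat_l, Req_le; unfold K_products.
    rewrite lsum_flat_map; unfold sum3; cbn [map lsum fold_right]; rewrite !map_map, Rplus_0_r, Rplus_assoc;
      reflexivity. }
  apply Rmult_le_reg_l with gap; [assumption|]; eapply Rle_trans; [exact Hle|]; apply Req_le; field; lra.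
Qed.

Definition K_control_const : R := 4 + 10 / gap.

Lemma K_control_const_pos : 0 <= K_control_const.
Proof. assert (Hg := Rdiv_lt_0_compat 10 gap ltac:(lra) gap_pos); unfold K_control_const; lra. Qed.

Lemma K_pointwise w i j (s : State) x y z : (i < 3)%nat -> (j < 3)%nat ->
  Rabs (Dw w (K_at i j s) (time s) x y z) <=
  K_control_const * lsum (map (fun g : State -> PField => Rabs (g s (time s) x y z)) (K_controls w)).
Proof.
  intros Hi Hj; assert (Hg := gap_pos).
  set (v := fun i j => Rabs (Dw w (K_at i j s) (time s) x y z)).
  set (r := fun i j => lsum (map (fun g : State -> PField => Rabs (g s (time s) x y z)) (K_products w (i, j)))).
  assert (Hr : forall i j, 0 <= r i j) by (intros; apply lsum_nonneg; intros; apply Rabs_pos).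
  assert (Hinv : 0 < / gap) by (apply Rinv_0_lt_compat, Hg).
  eapply Rle_trans; [apply (symmetric_absorption v (fun i j => / gap * r i j)); [| | | |exact Hi|exact Hj]|].
  - intros; apply Rabs_pos.
  - intros; apply Rmult_le_pos; [lra | apply Hr].
  - intros a b Ha Hb; unfold v; f_equal.
    apply (eq_on_Dw _ w _ _ (sol_T_pos s) (sol_K_sym s a b Ha Hb) (time s) x y z (time_ok s)).
  - intros [a b] Hp; apply (K_block_pointwise w (a, b) s x y z Hp).
  - rewrite lsum_scal; unfold K_controls, K_control_const; cbn [map lsum fold_right].
    fold (lsum (map (fun g : State -> PField => Rabs (g s (time s) x y z)) (flat_map (K_products w) block_indices))).
    rewrite lsum_flat_map.
    set (l := lsum (map (fun p => r (fst p) (snd p)) block_indices)).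
    change (4 * (v 0%nat 2%nat + v 1%nat 2%nat) + 10 * (/ gap * l)
            <= (4 + 10 / gap) * (v 0%nat 2%nat + (v 1%nat 2%nat + l))).
    assert (Hl : 0 <= l) by (apply lsum_nonneg; intros; apply Hr).
    assert (v02_nonneg : 0 <= v 0%nat 2%nat) by apply Rabs_pos;
      assert (v12_nonneg : 0 <= v 1%nat 2%nat) by apply Rabs_pos.
    assert (Hlg : 0 <= / gap * (v 0%nat 2%nat + v 1%nat 2%nat)) by (apply Rmult_le_pos; lra).
    unfold Rdiv; nra.
Qed.

Lemma K_controls_in w g : In g (K_controls w) ->
  g = (fun s => Dw w (K_at 0 2 s)) \/ g = (fun s => Dw w (K_at 1 2 s)) \/
  exists i k j p, (i < 3)%nat /\ (k < 3)%nat /\ (j < 3)%nat /\ In p (proper_splits w) /\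
    g = fun s => leibniz_term (K_at i k s) (K_at k j s) p.
Proof.
  intros [<-|[<-|Hg]]; [left; reflexivity | right; left; reflexivity | right; right].
  apply in_flat_map in Hg; destruct Hg as (p & Hp & Hg); apply in_flat_map in Hg; destruct Hg as (k & Hk & Hg).
  apply in_map_iff in Hg; destruct Hg as (q & <- & Hq); destruct (block_indices_lt3 p Hp) as [Hi Hj].
  exists (fst p), k, (snd p), q; repeat split; auto; repeat (destruct Hk as [<-|Hk]; [lia|]); destruct Hk.
Qed.

(* Induction on the word: by [K_pointwise], up to products of lower derivatives every entry is bounded by the two
   entries of [a]. *)
Lemma K_sup w i j : (ord w + 3 <= 2 * M)%nat -> (i < 3)%nat -> (j < 3)%nat ->
  sup_bounded time (fun s => Dw w (K_at i j s)) sqrt_energy.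
Proof.
  remember (length w) as n eqn:En; revert w En i j.
  induction n as [n IH] using (well_founded_induction lt_wf); intros w En i j Hw Hi Hj.
  assert (Ha : forall i, (i < 2)%nat -> sup_bounded time (fun s => Dw w (K_at i 2 s)) sqrt_energy).
  { intros k Hk; apply (sup_bounded_Dw time (2 * M)); [apply sqrt_energy_nonneg | apply Dw_bounded_a, Hk | exact Hw]. }
  apply (sup_bounded_pointwise time (K_controls w) _ _ K_control_const);
    [apply sqrt_energy_nonneg | apply K_control_const_pos | intros; apply K_pointwise; assumption|].
  intros g Hg; apply K_controls_in in Hg; destruct Hg as [->|[->|(i' & k & j' & p & Hi' & Hk & Hj' & Hp & ->)]];
    [apply Ha; lia | apply Ha; lia|].
  apply proper_splits_in in Hp; destruct Hp as (Hp & Hl & Hr); assert (E := splits_ord w p Hp).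
  apply (sup_bounded_le time _ (fun s => 1 * sqrt_energy s)); [|apply lesssim_le; intros; lra].
  apply sup_bounded_mul; [apply one_nonneg | apply sqrt_energy_nonneg | |].
  - apply sup_bounded_one, (IH (length (fst p))); auto; lia.
  - apply (IH (length (snd p))); auto; lia.
Qed.

Lemma Dw_bounded_K_of_a n B : (n <= 2 * M + 2)%nat -> nonneg B ->
  (forall i, (i < 2)%nat -> Dw_bounded time (order_le n) B (K_at i 2)) ->
  forall i j, (i < 3)%nat -> (j < 3)%nat -> Dw_bounded time (order_le n) B (K_at i j).
Proof.
  intros Hn HB Ha i j Hi Hj w; assert (HM := M_ge); remember (length w) as m eqn:Em; revert w Em i j Hi Hj.
  induction m as [m IH] using (well_founded_induction lt_wf); intros w Em i j Hi Hj Hw; unfold order_le in *.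
  apply (L2_bounded_pointwise time (K_controls w) _ _ K_control_const);
    [exact HB | apply K_control_const_pos | intros; apply K_pointwise; assumption|].
  intros g Hg; apply K_controls_in in Hg; destruct Hg as [->|[->|(i' & k & j' & p & Hi' & Hk & Hj' & Hp & ->)]];
    [apply Ha; auto; lia | apply Ha; auto; lia|].
  apply proper_splits_in in Hp; destruct Hp as (Hp & Hl & Hr); assert (E := splits_ord w p Hp).
  destruct (Nat.le_gt_cases (ord (fst p) + 3) (2 * M)) as [Hlow|Hlow].
  - apply L2_bounded_mul_unit_l; [exact HB | apply sup_bounded_one, K_sup; auto|].
    apply (IH (length (snd p))); auto; lia.
  - apply L2_bounded_mul_unit_r; [exact HB | | apply sup_bounded_one, K_sup; auto; lia].
    apply (IH (length (fst p))); auto; lia.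
Qed.

Lemma Dw_bounded_K i j : (i < 3)%nat -> (j < 3)%nat -> Dw_bounded time (order_le (2 * M)) sqrt_energy (K_at i j).
Proof. apply Dw_bounded_K_of_a; [lia | apply sqrt_energy_nonneg | apply Dw_bounded_a]. Qed.

End Block_control.

(** * Nonlinear terms *)

Section Nonlinear.
Context {P : Coefficients}.

(* The energy estimate is closed at these two orders only. *)
Definition level (N : nat) : Prop := N = 2%nat \/ N = (2 * M)%nat.

Lemma level_low : level 2. Proof. left; reflexivity. Qed.
Lemma level_high : level (2 * M). Proof. right; reflexivity. Qed.

Definition size_diss (N : nat) (s : State) : R := size_at s * sqrt_diss N s.

Lemma size_diss_nonneg N : nonneg (size_diss N).
Proof. apply nonneg_mul; [apply size_at_nonneg | apply sqrt_diss_nonneg]. Qed.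
Lemma size_diss_le N : size_diss N <~ sqrt_diss N.
Proof.
  apply lesssim_le; intros s; rewrite <- Rmult_1_l; apply Rmult_le_compat_r;
    [apply sqrt_diss_nonneg | apply sol_size_bounds].
Qed.
Lemma sqrt_energy_diss N : (fun s => sqrt_energy s * sqrt_diss N s) <~ size_diss N.
Proof.
  apply lesssim_le; intros s; apply Rmult_le_compat_r; [apply sqrt_diss_nonneg | apply sqrt_energy_le_size].
Qed.

Lemma Dw_bounded_mul_diss N n f g : level N -> (n <= N <= n + 1)%nat ->
  Dw_bounded time (order_le (2 * M)) sqrt_energy f -> Dw_bounded time (order_le n) (sqrt_diss N) g ->
  Dw_bounded time (order_le n) (size_diss N) (fun s => f s * g s)%fld.
Proof.
  intros HN Hn Hf Hg; eapply Dw_bounded_le; [apply sqrt_energy_diss|].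
  apply (Dw_bounded_mul time n (2 * M) n); auto; [apply sqrt_energy_nonneg | apply sqrt_diss_nonneg|].
  intros b c Hbc; assert (HM := M_ge); destruct HN as [-> | ->]; lia.
Qed.

Lemma Dw_bounded_mul_size_diss N f g : level N ->
  Dw_bounded time (order_le (2 * M)) sqrt_energy f -> Dw_bounded time (order_le N) (size_diss N) g ->
  Dw_bounded time (order_le N) (size_diss N) (fun s => f s * g s)%fld.
Proof.
  intros HN Hf Hg; apply (Dw_bounded_le time _ (fun s => 1 * size_diss N s)); [apply lesssim_le; intros; lra|].
  apply (Dw_bounded_mul time N (2 * M) N); auto;
    [apply one_nonneg | apply size_diss_nonneg | eapply Dw_bounded_le; [apply sqrt_energy_one | exact Hf]|].
  intros b c Hbc; assert (HM := M_ge); destruct HN as [-> | ->]; lia.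
Qed.

Lemma Dw_bounded_adv N f : level N -> Dw_bounded time (order_le (N + 1)) (sqrt_diss N) f ->
  Dw_bounded time (order_le N) (size_diss N) (fun s => advF (sol_u s) (f s)).
Proof.
  intros HN Hf; apply (Dw_bounded_Fsum3 time _ _ (fun k s => sol_u s k * D (S k) (f s))%fld); intros k Hk.
  apply (Dw_bounded_mul_diss N N (u_at k) (fun s => D (S k) (f s))); auto; [lia | apply Dw_bounded_u, Hk|].
  apply (Dw_bounded_order_D time (N + 1)); [simpl; lia | exact Hf].
Qed.

Lemma Dw_bounded_th_low N n i : (n <= N + 1)%nat -> (i < 3)%nat ->
  Dw_bounded time (order_le n) (sqrt_diss N) (th_at i).
Proof. intros Hn Hi; apply (Dw_bounded_mono time (N + 1)); [exact Hn | apply Dw_bounded_th_diss, Hi]. Qed.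

Lemma Dw_bounded_K_th N i : level N -> (i < 3)%nat ->
  Dw_bounded time (order_le N) (size_diss N) (fun s => mvF (sol_K s) (sol_th s) i).
Proof.
  intros HN Hi; apply (Dw_bounded_Fsum3 time _ _ (fun j s => sol_K s i j * sol_th s j)%fld); intros j Hj.
  apply (Dw_bounded_mul_diss N N (K_at i j) (th_at j)); auto;
    [lia | apply Dw_bounded_K; auto | apply Dw_bounded_th_low; lia].
Qed.

Lemma Dw_bounded_cross Q B (a b : State -> nat -> PField) i :
  (forall j k, (j < 3)%nat -> (k < 3)%nat -> Dw_bounded time Q B (fun s => a s j * b s k)%fld) ->
  Dw_bounded time Q B (fun s => crossF (a s) (b s) i).
Proof. intros Hab; unfold crossF; destruct i as [|[|i]]; apply Dw_bounded_sub; apply Hab; lia. Qed.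

Lemma Dw_bounded_gyro_nonlinear N i : level N -> (i < 3)%nat ->
  Dw_bounded time (order_le N) (size_diss N) (fun s => gyro_nonlinear (sol_th s) (sol_K s) i).
Proof.
  intros HN Hi; unfold gyro_nonlinear; apply Dw_bounded_add; [apply Dw_bounded_add; [apply Dw_bounded_add|]|].
  - apply (Dw_bounded_cross _ _ (fun s => sol_th s) (fun s j => Fconst tau_tilde * sol_K s j 2%nat)%fld);
      intros j k Hj Hk.
    apply (Dw_bounded_ext time _ _ _ (fun s => Fconst tau_tilde * (K_at k 2 s * th_at j s))%fld);
      [intros s; unfold K_at, th_at; ring|].
    apply Dw_bounded_scal, Dw_bounded_mul_diss; auto; [lia | apply Dw_bounded_K; auto | apply Dw_bounded_th_low; lia].
  - apply (Dw_bounded_cross _ _ (fun s => omegaF) (fun s => mvF (sol_K s) (sol_th s))); intros j k Hj Hk.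
    unfold omegaF; destruct (j =? 2)%nat; apply (Dw_bounded_scal time); apply Dw_bounded_K_th; auto.
  - apply (Dw_bounded_cross _ _ (fun s => sol_th s) (fun s j => Fconst (Jeq_diag j) * sol_th s j)%fld);
      intros j k Hj Hk.
    apply (Dw_bounded_ext time _ _ _ (fun s => Fconst (Jeq_diag k) * (th_at j s * th_at k s))%fld);
      [intros s; unfold th_at; ring|].
    apply Dw_bounded_scal, Dw_bounded_mul_diss; auto; [lia | apply Dw_bounded_th; auto | apply Dw_bounded_th_low; lia].
  - apply (Dw_bounded_cross _ _ (fun s => sol_th s) (fun s => mvF (sol_K s) (sol_th s))); intros j k Hj Hk.
    apply (Dw_bounded_mul_size_diss N (th_at j)); auto; [apply Dw_bounded_th, Hj | apply Dw_bounded_K_th; auto].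
Qed.

Lemma Dw_bounded_theta_nonlinear N i : level N -> (i < 3)%nat ->
  Dw_bounded time (order_le N) (size_diss N) (fun s => theta_nonlinear (sol_u s) (sol_th s) (sol_K s) i).
Proof.
  intros HN Hi; unfold theta_nonlinear; apply Dw_bounded_add; [apply Dw_bounded_add|].
  - apply Dw_bounded_scal, (Dw_bounded_adv N (th_at i)); auto; apply Dw_bounded_th_diss, Hi.
  - apply (Dw_bounded_Fsum3 time _ _ (fun j s => sol_K s i j * advF (sol_u s) (sol_th s j))%fld); intros j Hj.
    apply (Dw_bounded_mul_size_diss N (K_at i j)); auto; [apply Dw_bounded_K; auto|].
    apply (Dw_bounded_adv N (th_at j)); auto; apply Dw_bounded_th_diss, Hj.
  - apply Dw_bounded_gyro_nonlinear; auto.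
Qed.

Lemma Dw_bounded_lap_th N i : (1 <= N)%nat -> (i < 3)%nat ->
  Dw_bounded time (order_le (N - 1)) (sqrt_diss N) (fun s => lapF (sol_th s i)).
Proof.
  intros HN Hi; apply (Dw_bounded_Fsum3 time _ _ (fun j s => D (S j) (D (S j) (sol_th s i)))); intros j Hj.
  apply (Dw_bounded_order_D time N (N - 1) _ (S j) (fun s => D (S j) (sol_th s i))); [simpl; lia|].
  apply (Dw_bounded_order_D time (N + 1) N _ (S j) (th_at i)); [simpl; lia | apply Dw_bounded_th_diss, Hi].
Qed.

Lemma Dw_bounded_grad_div_th N i : (1 <= N)%nat ->
  Dw_bounded time (order_le (N - 1)) (sqrt_diss N) (fun s => D (S i) (divF (sol_th s))).
Proof.
  intros HN; apply (Dw_bounded_order_D time N (N - 1) _ (S i) (fun s => divF (sol_th s))); [simpl; lia|].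
  apply (Dw_bounded_Fsum3 time _ _ (fun j s => D (S j) (sol_th s j))); intros j Hj.
  apply (Dw_bounded_order_D time (N + 1) N _ (S j) (th_at j)); [simpl; lia | apply Dw_bounded_th_diss, Hj].
Qed.

Lemma Dw_bounded_curl_u N i : Dw_bounded time (order_le N) (sqrt_diss N) (fun s => curlF (sol_u s) i).
Proof.
  assert (Hd : forall j k, (j < 3)%nat -> Dw_bounded time (order_le N) (sqrt_diss N) (fun s => D (S k) (sol_u s j))).
  { intros j k Hj; apply (Dw_bounded_order_D time (N + 1) N _ (S k) (u_at j));
      [simpl; lia | apply Dw_bounded_u_diss, Hj]. }
  unfold curlF; destruct i as [|[|i]]; apply Dw_bounded_sub; apply Hd; lia.
Qed.

(* The rotation components of the microrotation equation express [a] through dissipated quantities. *)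
Lemma Dw_bounded_gyro_linear N i : level N -> (i < 3)%nat ->
  Dw_bounded time (order_le (N - 1)) (sqrt_diss N) (fun s => gyro_linear (sol_th s) (sol_K s) i).
Proof.
  intros HN Hi; assert (HM := M_ge); assert (HN2 : (2 <= N)%nat) by (destruct HN as [-> | ->]; lia).
  apply (Dw_bounded_eq_on _ _ _ (fun s => Fconst kappa * curlF (sol_u s) i - Fconst (2 * kappa) * sol_th s i
     + Fconst (alpha_tilde - gamma_tilde) * D (S i) (divF (sol_th s)) + Fconst gamma_tilde * lapF (sol_th s i)
     - theta_nonlinear (sol_u s) (sol_th s) (sol_K s) i
     - (Fconst (Jeq_diag i) * D 0 (sol_th s i) + Fsum3 (fun j => sol_K s i j * D 0 (sol_th s j))))%fld).
  { intros s t x y z Ht; assert (E := sol_microrotation s i Hi t x y z Ht); revert E; Feval; lra. }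
  assert (Hdt : forall j, (j < 3)%nat -> Dw_bounded time (order_le (N - 1)) (sqrt_diss N) (fun s => D 0 (sol_th s j))).
  { intros j Hj; apply (Dw_bounded_order_D time (N + 1) _ _ 0 (th_at j)); [simpl; lia | apply Dw_bounded_th_diss, Hj]. }
  apply Dw_bounded_sub; [apply Dw_bounded_sub|].
  - apply Dw_bounded_add; [apply Dw_bounded_add; [apply Dw_bounded_sub|]|]; apply Dw_bounded_scal.
    + apply (Dw_bounded_mono time N); [lia | apply Dw_bounded_curl_u].
    + apply (Dw_bounded_th_low N (N - 1) i); lia.
    + apply Dw_bounded_grad_div_th; lia.
    + apply Dw_bounded_lap_th; lia.
  - eapply Dw_bounded_le; [apply (size_diss_le N)|].
    apply (Dw_bounded_mono time N); [lia | apply Dw_bounded_theta_nonlinear; auto].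
  - apply Dw_bounded_add; [apply Dw_bounded_scal, Hdt, Hi|].
    apply (Dw_bounded_Fsum3 time _ _ (fun j s => sol_K s i j * D 0 (sol_th s j))%fld); intros j Hj.
    eapply Dw_bounded_le; [apply (size_diss_le N)|].
    apply (Dw_bounded_mul_diss N (N - 1) (K_at i j)); auto; [lia | apply Dw_bounded_K; auto].
Qed.

Lemma Dw_bounded_a_diss N i : level N -> (i < 2)%nat -> Dw_bounded time (order_le (N - 1)) (sqrt_diss N) (K_at i 2).
Proof.
  intros HN Hi; assert (Ht := tau_tilde_pos).
  apply (Dw_bounded_unscal time _ _ (tau_tilde * tau_tilde)); [nra|].
  destruct i as [|[|i]]; [| |lia].
  - apply (Dw_bounded_ext time _ _ _
      (fun s => gyro_linear (sol_th s) (sol_K s) 1 + Fconst (tau_tilde * gap) * th_at 0 s)%fld);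
      [intros s; unfold gyro_linear, K_at, th_at; ring|].
    apply Dw_bounded_add; [apply Dw_bounded_gyro_linear; auto | apply Dw_bounded_scal, Dw_bounded_th_low; lia].
  - apply (Dw_bounded_ext time _ _ _
      (fun s => Fconst (tau_tilde * gap) * th_at 1 s - gyro_linear (sol_th s) (sol_K s) 0)%fld);
      [intros s; unfold gyro_linear, K_at, th_at; ring|].
    apply Dw_bounded_sub; [apply Dw_bounded_scal, Dw_bounded_th_low; lia | apply Dw_bounded_gyro_linear; auto].
Qed.

Lemma Dw_bounded_K_diss N i j : level N -> (i < 3)%nat -> (j < 3)%nat ->
  Dw_bounded time (order_le (N - 1)) (sqrt_diss N) (K_at i j).
Proof.
  intros HN Hi Hj; assert (HM := M_ge).
  apply Dw_bounded_K_of_a; auto; [destruct HN as [-> | ->]; lia | apply sqrt_diss_nonneg|].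
  intros k Hk; apply Dw_bounded_a_diss; assumption.
Qed.

Lemma commutator_K_dt_th N w i j : level N -> (ord w <= N)%nat -> (i < 3)%nat -> (j < 3)%nat ->
  L2_bounded time (fun s => Dw w (K_at i j s * D 0 (th_at j s)) - K_at i j s * Dw w (D 0 (th_at j s)))%fld
    (size_diss N).
Proof.
  intros HN Hw Hi Hj; assert (HM := M_ge); eapply L2_bounded_le; [|apply sqrt_energy_diss].
  apply (commutator_L2_bounded time (2 * M) (N - 1) sqrt_energy (sqrt_diss N) (K_at i j) (fun s => D 0 (th_at j s)));
    [apply sqrt_energy_nonneg | apply sqrt_diss_nonneg | apply Dw_bounded_K; auto| |].
  - apply (Dw_bounded_order_D time (N + 1)); [destruct HN as [-> | ->]; simpl; lia | apply Dw_bounded_th_diss, Hj].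
  - intros b c Hbc Hb; destruct HN as [-> | ->]; lia.
Qed.

End Nonlinear.

(** * The energy identity *)

Lemma Dw_lap w f : Dw w (lapF f) = lapF (Dw w f).
Proof. unfold lapF, Fsum3; rewrite !Dw_add, !Dw_D; reflexivity. Qed.

Lemma Dw_div w v : Dw w (divF v) = divF (fun i => Dw w (v i)).
Proof. unfold divF, Fsum3; rewrite !Dw_add, !Dw_D; reflexivity. Qed.

Lemma Dw_curl w v i : Dw w (curlF v i) = curlF (fun i => Dw w (v i)) i.
Proof. unfold curlF; destruct i as [|[|i]]; rewrite Dw_sub, !Dw_D; reflexivity. Qed.

Lemma Dw_tenF w v i j : Dw w (tenF v i j) = tenF (fun i => Dw w (v i)) i j.
Proof. destruct i as [|[|[|i]]]; destruct j as [|[|[|j]]]; cbn [tenF]; auto using Dw_opp, Dw_zero. Qed.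

Lemma Dw_scal_r w f c : Dw w (f * Fconst c)%fld = (Dw w f * Fconst c)%fld.
Proof. replace (f * Fconst c)%fld with (Fconst c * f)%fld by ring; rewrite Dw_scal; ring. Qed.

Lemma inner_eq_on_r T f g h t : eq_on T g h -> 0 <= t <= T -> inner f g t = inner f h t.
Proof. intros E Ht; apply inner_ext; [reflexivity | intros; apply E, Ht]. Qed.

Definition grad_sq (v : nat -> PField) (t : R) : R := sum3 (fun i => sum3 (fun j => normsq (D (S j) (v i)) t)).

Lemma grad_sq_nonneg v t : 0 <= grad_sq v t.
Proof. apply sum3_nonneg; intros; apply sum3_nonneg; intros; apply normsq_nonneg. Qed.

Lemma grad_sq_term v t i k : (i < 3)%nat -> (k < 3)%nat -> normsq (D (S k) (v i)) t <= grad_sq v t.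
Proof.
  intros Hi Hk; eapply Rle_trans; [|apply (sum3_term _ i);
    [intros; apply sum3_nonneg; intros; apply normsq_nonneg | exact Hi]].
  apply (sum3_term (fun k => normsq (D (S k) (v i)) t)); [intros; apply normsq_nonneg | exact Hk].
Qed.

Lemma inner_D_comm i j f g t : inner (D (S i) f) (D (S j) g) t = inner (D (S j) f) (D (S i) g) t.
Proof. rewrite inner_D, D_comm, <- inner_D; reflexivity. Qed.

Lemma curl_div_grad v t : sum3 (fun i => normsq (curlF v i) t) + normsq (divF v) t = grad_sq v t.
Proof.
  unfold grad_sq, normsq, sum3, divF, Fsum3; cbn [curlF].
  repeat rewrite ?inner_add_l, ?inner_add_r, ?inner_sub_l, ?inner_sub_r.
  generalize (v 0%nat) (v 1%nat) (v 2%nat); intros v0 v1 v2.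
  rewrite (inner_sym (D 2 v1) (D 1 v0)), (inner_sym (D 3 v2) (D 1 v0)), (inner_sym (D 3 v2) (D 2 v1)).
  rewrite (inner_sym (D 3 v1) (D 2 v2)), (inner_sym (D 1 v2) (D 3 v0)), (inner_sym (D 2 v0) (D 1 v1)).
  rewrite (inner_D_comm 1 2 v2 v1), (inner_D_comm 2 0 v0 v2), (inner_D_comm 0 1 v1 v0).
  rewrite (inner_sym (D 3 v2) (D 2 v1)), (inner_sym (D 2 v1) (D 1 v0)); ring.
Qed.

Lemma inner_curl_sym u v t : sum3 (fun i => inner (u i) (curlF v i) t) = sum3 (fun i => inner (v i) (curlF u i) t).
Proof.
  unfold sum3; cbn [curlF]; rewrite !inner_sub_r.
  rewrite (inner_D_r 1 (u 0%nat)), (inner_D_r 2 (u 0%nat)), (inner_D_r 2 (u 1%nat)).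
  rewrite (inner_D_r 0 (u 1%nat)), (inner_D_r 0 (u 2%nat)), (inner_D_r 1 (u 2%nat)); ring.
Qed.

Lemma inner_lap f t : inner f (lapF f) t = - sum3 (fun j => normsq (D (S j) f) t).
Proof. unfold lapF, normsq; rewrite inner_Fsum3_r; unfold sum3; rewrite !(inner_D_r _ f); ring. Qed.

Lemma sum3_inner_lap v t : sum3 (fun i => inner (v i) (lapF (v i)) t) = - grad_sq v t.
Proof. unfold grad_sq, sum3; rewrite !inner_lap; unfold sum3; ring. Qed.

Lemma sum3_inner_grad v p t : sum3 (fun i => inner (v i) (D (S i) p) t) = - inner (divF v) p t.
Proof. unfold divF; rewrite inner_Fsum3_l; unfold sum3; rewrite !inner_D; ring. Qed.

Lemma inner_young f g t r : 0 < r -> 2 * inner f g t <= r * normsq f t + / r * normsq g t.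
Proof.
  intros Hr; assert (Hsq := normsq_nonneg (Fconst r * f - g)%fld t); unfold normsq in *.
  repeat rewrite ?inner_sub_l, ?inner_sub_r, ?inner_scal_l, ?inner_scal_r in Hsq; rewrite (inner_sym g f) in Hsq.
  apply Rmult_le_reg_l with r; [assumption|].
  replace (r * (r * inner f f t + / r * inner g g t)) with (r * r * inner f f t + inner g g t) by (field; lra); lra.
Qed.

Section Energy_identity.
Context {P : Coefficients}.

Lemma tenF_omegaF i j : tenF omegaF i j = Fconst (ten (omega_eq kappa tau) i j).
Proof.
  destruct i as [|[|[|i]]]; destruct j as [|[|[|j]]]; try reflexivity;
    apply PField_ext; intros; cbn [tenF ten omegaF omega_eq Nat.eqb]; Feval; reflexivity.
Qed.

Lemma Dw_commF_omegaF w K i j :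
  Dw w (commF (tenF omegaF) K i j) = commF (tenF omegaF) (fun i j => Dw w (K i j)) i j.
Proof. unfold commF, Fsum3; rewrite !tenF_omegaF, Dw_sub, !Dw_add, !Dw_scal, !Dw_scal_r; reflexivity. Qed.

Lemma commF_tenF_Jeq v i j : (i < 3)%nat -> (j < 3)%nat ->
  commF (tenF v) JeqF i j = (Fconst (Jeq_diag j - Jeq_diag i) * tenF v i j)%fld.
Proof.
  intros Hi Hj; apply PField_ext; intros; unfold commF, Fsum3, JeqF.
  case_lt3 i; case_lt3 j; cbn [tenF Jeq Jeq_diag Nat.eqb]; Feval; unfold Jeq, Jeq_diag; cbn [Nat.eqb]; ring.
Qed.

Definition Dw_u (S : Solution) (w : list nat) (i : nat) : PField := Dw w (sol_u S i).
Definition Dw_th (S : Solution) (w : list nat) (i : nat) : PField := Dw w (sol_th S i).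
Definition Dw_K (S : Solution) (w : list nat) (i j : nat) : PField := Dw w (sol_K S i j).

Definition remainder_u (S : Solution) w i : PField := Dw w (advF (sol_u S) (sol_u S i)).
Definition remainder_th (S : Solution) w i : PField :=
  (Dw w (theta_nonlinear (sol_u S) (sol_th S) (sol_K S) i)
   + Fsum3 (fun j => Dw w (sol_K S i j * D 0 (sol_th S j)) - sol_K S i j * Dw w (D 0 (sol_th S j))))%fld.
Definition remainder_K (S : Solution) w i j : PField := Dw w (K_nonlinear (sol_u S) (sol_th S) (sol_K S) i j).

Lemma Dw_momentum S w i : (i < 3)%nat -> eq_on (sol_T S) (D 0 (Dw_u S w i))
  (Fconst (mu + kappa / 2) * lapF (Dw_u S w i) + Fconst kappa * curlF (Dw_th S w) i
   - D (Datatypes.S i) (Dw w (sol_p S)) - remainder_u S w i)%fld.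
Proof.
  intros Hi; assert (E := eq_on_Dw _ w _ _ (sol_T_pos S) (sol_momentum S i Hi)).
  rewrite Dw_D, !Dw_sub, Dw_add, !Dw_scal, Dw_lap, Dw_curl, Dw_D in E; exact E.
Qed.

Lemma Dw_divergence S w : eq_on (sol_T S) (divF (Dw_u S w)) (Fconst 0).
Proof. assert (E := eq_on_Dw _ w _ _ (sol_T_pos S) (sol_divergence S)); rewrite Dw_div, Dw_zero in E; exact E. Qed.

Lemma Dw_gyro_linear w th K i :
  Dw w (gyro_linear th K i) = gyro_linear (fun i => Dw w (th i)) (fun i j => Dw w (K i j)) i.
Proof. unfold gyro_linear; destruct i as [|[|i]]; [| |apply Dw_zero]; rewrite Dw_sub, !Dw_scal; reflexivity. Qed.

Lemma Dw_microrotation S w i : (i < 3)%nat -> eq_on (sol_T S)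
  (Fconst (Jeq_diag i) * D 0 (Dw_th S w i) + Fsum3 (fun j => sol_K S i j * D 0 (Dw_th S w j)))%fld
  (Fconst kappa * curlF (Dw_u S w) i - Fconst (2 * kappa) * Dw_th S w i
   + Fconst (alpha_tilde - gamma_tilde) * D (Datatypes.S i) (divF (Dw_th S w))
   + Fconst gamma_tilde * lapF (Dw_th S w i) - gyro_linear (Dw_th S w) (Dw_K S w) i - remainder_th S w i)%fld.
Proof.
  intros Hi t x y z Ht; assert (E := eq_on_Dw _ w _ _ (sol_T_pos S) (sol_microrotation S i Hi) t x y z Ht).
  unfold Fsum3 in E.
  rewrite !Dw_sub, !Dw_add, Dw_sub, !Dw_scal, Dw_lap, Dw_curl, !Dw_D, Dw_div, Dw_gyro_linear in E.
  unfold remainder_th, Dw_u, Dw_th, Dw_K, Fsum3; rewrite !Dw_D; revert E; Feval; lra.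
Qed.

Lemma Dw_inertia S w i j : (i < 3)%nat -> (j < 3)%nat -> eq_on (sol_T S) (D 0 (Dw_K S w i j))
  (commF (tenF omegaF) (Dw_K S w) i j + Fconst (Jeq_diag j - Jeq_diag i) * tenF (Dw_th S w) i j
   + remainder_K S w i j)%fld.
Proof.
  intros Hi Hj; assert (E := eq_on_Dw _ w _ _ (sol_T_pos S) (sol_inertia S i j Hi Hj)).
  rewrite commF_tenF_Jeq, Dw_D, !Dw_add, Dw_scal, Dw_commF_omegaF, Dw_tenF in E by assumption; exact E.
Qed.

Lemma Dw_a0_equation S w : eq_on (sol_T S) (D 0 (Dw_K S w 0 2))
  (Fconst gap * Dw_th S w 1 - Fconst tau_tilde * Dw_K S w 1 2 + remainder_K S w 0 2)%fld.
Proof.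
  intros t x y z Ht; rewrite (Dw_inertia S w 0 2 ltac:(lia) ltac:(lia) t x y z Ht).
  unfold commF, Fsum3, gap; cbn [tenF omegaF Jeq_diag Nat.eqb]; Feval; unfold Jeq_diag; cbn [Nat.eqb]; ring.
Qed.

Lemma Dw_a1_equation S w : eq_on (sol_T S) (D 0 (Dw_K S w 1 2))
  (Fconst tau_tilde * Dw_K S w 0 2 - Fconst gap * Dw_th S w 0 + remainder_K S w 1 2)%fld.
Proof.
  intros t x y z Ht; rewrite (Dw_inertia S w 1 2 ltac:(lia) ltac:(lia) t x y z Ht).
  unfold commF, Fsum3, gap; cbn [tenF omegaF Jeq_diag Nat.eqb]; Feval; unfold Jeq_diag; cbn [Nat.eqb]; ring.
Qed.

(* With this weight the coupling of theta and [a] is antisymmetric. *)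
Definition a_weight : R := tau_tilde * tau_tilde / gap.

Lemma a_weight_pos : 0 < a_weight.
Proof. assert (Ht := tau_tilde_pos); apply Rdiv_lt_0_compat; [nra | apply gap_pos]. Qed.

(* Including [K] in the inertia avoids losing a derivative on the time derivative of theta. *)
Definition energy_density (S : Solution) (w : list nat) : PField :=
  (Fconst (1 / 2) * Fsum3 (fun i => Dw_u S w i * Dw_u S w i)
   + Fconst (1 / 2) * Fsum3 (fun i => Fconst (Jeq_diag i) * (Dw_th S w i * Dw_th S w i))
   + Fconst (1 / 2) * Fsum3 (fun i => Fsum3 (fun j => sol_K S i j * (Dw_th S w i * Dw_th S w j)))
   + Fconst (a_weight / 2) * (Dw_K S w 0 2 * Dw_K S w 0 2 + Dw_K S w 1 2 * Dw_K S w 1 2))%fld.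

Definition energy_density_dt (S : Solution) (w : list nat) : PField :=
  (Fsum3 (fun i => Dw_u S w i * D 0 (Dw_u S w i))
   + Fsum3 (fun i => Dw_th S w i *
       (Fconst (Jeq_diag i) * D 0 (Dw_th S w i) + Fsum3 (fun j => sol_K S i j * D 0 (Dw_th S w j))))
   + Fconst (1 / 2) * Fsum3 (fun i => Fsum3 (fun j => (D 0 (sol_K S i j) * Dw_th S w i) * Dw_th S w j))
   + Fconst a_weight * (Dw_K S w 0 2 * D 0 (Dw_K S w 0 2) + Dw_K S w 1 2 * D 0 (Dw_K S w 1 2)))%fld.

Definition word_energy (S : Solution) (w : list nat) (t : R) : R := Tint (energy_density S w) t.
Definition word_energy_dt (S : Solution) (w : list nat) (t : R) : R := Tint (energy_density_dt S w) t.

Lemma D_energy_density S w : eq_on (sol_T S) (D 0 (energy_density S w)) (energy_density_dt S w).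
Proof.
  intros t x y z Ht; unfold energy_density, energy_density_dt, Fsum3.
  assert (sym10 := sol_K_sym S 1%nat 0%nat ltac:(lia) ltac:(lia) t x y z Ht).
  assert (sym20 := sol_K_sym S 2%nat 0%nat ltac:(lia) ltac:(lia) t x y z Ht).
  assert (sym21 := sol_K_sym S 2%nat 1%nat ltac:(lia) ltac:(lia) t x y z Ht).
  repeat rewrite ?D_add, ?D_scal, ?D_mul, ?D_const; Feval; rewrite sym10, sym20, sym21; field.
Qed.

Lemma word_energy_derive S w t : 0 <= t <= sol_T S -> is_derive (word_energy S w) t (word_energy_dt S w t).
Proof.
  intros Ht; unfold word_energy_dt; rewrite <- (Tint_ext (D 0 (energy_density S w)))
    by (intros; apply D_energy_density, Ht).
  apply Tint_derive.
Qed.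

Lemma momentum_balance S w t : 0 <= t <= sol_T S ->
  sum3 (fun i => inner (Dw_u S w i) (D 0 (Dw_u S w i)) t)
  = - (mu + kappa / 2) * grad_sq (Dw_u S w) t + kappa * sum3 (fun i => inner (Dw_th S w i) (curlF (Dw_u S w) i) t)
    - sum3 (fun i => inner (Dw_u S w i) (remainder_u S w i) t).
Proof.
  intros Ht; set (U := Dw_u S w).
  rewrite (sum3_ext _ (fun i => (mu + kappa / 2) * inner (U i) (lapF (U i)) t + kappa * inner (U i)
    (curlF (Dw_th S w) i) t
    - inner (U i) (D (Datatypes.S i) (Dw w (sol_p S))) t - inner (U i) (remainder_u S w i) t)).
  - rewrite !sum3_sub, sum3_add, !sum3_scal, sum3_inner_grad, (inner_curl_sym U).
    rewrite (inner_sym (divF U)), (inner_eq_on_r _ _ _ _ t (Dw_divergence S w) Ht), inner_0_r.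
    rewrite sum3_inner_lap; ring.
  - intros i Hi; unfold U; rewrite (inner_eq_on_r _ _ _ _ t (Dw_momentum S w i Hi) Ht).
    rewrite !inner_sub_r, inner_add_r, !inner_scal_r; reflexivity.
Qed.

Lemma microrotation_balance S w t : 0 <= t <= sol_T S ->
  sum3 (fun i => inner (Dw_th S w i)
    (Fconst (Jeq_diag i) * D 0 (Dw_th S w i) + Fsum3 (fun j => sol_K S i j * D 0 (Dw_th S w j)))%fld t)
  = kappa * sum3 (fun i => inner (Dw_th S w i) (curlF (Dw_u S w) i) t) - 2 * kappa * sum3
    (fun i => normsq (Dw_th S w i) t)
    - (alpha_tilde - gamma_tilde) * normsq (divF (Dw_th S w)) t - gamma_tilde * grad_sq (Dw_th S w) t
    - tau_tilde * tau_tilde * (inner (Dw_th S w 1) (Dw_K S w 0 2) t - inner (Dw_th S w 0) (Dw_K S w 1 2) t)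
    - sum3 (fun i => inner (Dw_th S w i) (remainder_th S w i) t).
Proof.
  intros Ht; set (U := Dw_u S w); set (Th := Dw_th S w).
  rewrite (sum3_ext _ (fun i => kappa * inner (Th i) (curlF U i) t - 2 * kappa * normsq (Th i) t
    + (alpha_tilde - gamma_tilde) * inner (Th i) (D (Datatypes.S i) (divF Th)) t + gamma_tilde * inner (Th i)
        (lapF (Th i)) t
    - inner (Th i) (gyro_linear Th (Dw_K S w) i) t - inner (Th i) (remainder_th S w i) t)).
  - rewrite !sum3_sub, !sum3_add, sum3_sub, !sum3_scal, sum3_inner_grad; fold (normsq (divF Th) t).
    rewrite sum3_inner_lap.
    assert (coupling : sum3 (fun i => inner (Th i) (gyro_linear Th (Dw_K S w) i) t)
      = tau_tilde * tau_tilde * (inner (Th 1%nat) (Dw_K S w 0 2) t - inner (Th 0%nat) (Dw_K S w 1 2) t)).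
    { unfold sum3; cbn [gyro_linear]; rewrite !inner_sub_r, !inner_scal_r, inner_0_r, (inner_sym (Th 1%nat) (Th 0%nat));
        ring. }
    rewrite coupling; ring.
  - intros i Hi; unfold Th, U; rewrite (inner_eq_on_r _ _ _ _ t (Dw_microrotation S w i Hi) Ht).
    rewrite !inner_sub_r, !inner_add_r, !inner_sub_r, !inner_scal_r; reflexivity.
Qed.

Definition transport_a (S : Solution) w t : R :=
  inner (Dw_K S w 0 2) (remainder_K S w 0 2) t + inner (Dw_K S w 1 2) (remainder_K S w 1 2) t.

Lemma a_balance S w t : 0 <= t <= sol_T S ->
  inner (Dw_K S w 0 2) (D 0 (Dw_K S w 0 2)) t + inner (Dw_K S w 1 2) (D 0 (Dw_K S w 1 2)) t
  = gap * (inner (Dw_th S w 1) (Dw_K S w 0 2) t - inner (Dw_th S w 0) (Dw_K S w 1 2) t) + transport_a S w t.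
Proof.
  intros Ht; rewrite (inner_eq_on_r _ _ _ _ t (Dw_a0_equation S w) Ht),
    (inner_eq_on_r _ _ _ _ t (Dw_a1_equation S w) Ht).
  rewrite !inner_add_r, !inner_sub_r, !inner_scal_r; unfold transport_a.
  rewrite (inner_sym (Dw_K S w 1 2) (Dw_K S w 0 2)), (inner_sym (Dw_K S w 0 2) (Dw_th S w 1)),
    (inner_sym (Dw_K S w 1 2) (Dw_th S w 0)); ring.
Qed.

Definition remainder (S : Solution) w t : R :=
  1 / 2 * sum3 (fun i => sum3 (fun j => inner (D 0 (sol_K S i j) * Dw_th S w i)%fld (Dw_th S w j) t))
  - sum3 (fun i => inner (Dw_u S w i) (remainder_u S w i) t) - sum3
      (fun i => inner (Dw_th S w i) (remainder_th S w i) t).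

Lemma energy_identity S w t : 0 <= t <= sol_T S ->
  word_energy_dt S w t = - (mu + kappa / 2) * grad_sq (Dw_u S w) t
    + 2 * kappa * sum3 (fun i => inner (Dw_th S w i) (curlF (Dw_u S w) i) t)
    - 2 * kappa * sum3 (fun i => normsq (Dw_th S w i) t)
    - (alpha_tilde - gamma_tilde) * normsq (divF (Dw_th S w)) t - gamma_tilde * grad_sq (Dw_th S w) t
    + remainder S w t + a_weight * transport_a S w t.
Proof.
  intros Ht.
  assert (expand : word_energy_dt S w t = sum3 (fun i => inner (Dw_u S w i) (D 0 (Dw_u S w i)) t)
    + sum3 (fun i => inner (Dw_th S w i)
        (Fconst (Jeq_diag i) * D 0 (Dw_th S w i) + Fsum3 (fun j => sol_K S i j * D 0 (Dw_th S w j)))%fld t)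
    + 1 / 2 * sum3 (fun i => sum3 (fun j => inner (D 0 (sol_K S i j) * Dw_th S w i)%fld (Dw_th S w j) t))
    + a_weight * (inner (Dw_K S w 0 2) (D 0 (Dw_K S w 0 2)) t + inner (Dw_K S w 1 2) (D 0 (Dw_K S w 1 2)) t)).
  { unfold word_energy_dt, energy_density_dt; rewrite !Tint_add, !Tint_scal, !Tint_add, !Tint_Fsum3.
    unfold inner, sum3; rewrite !Tint_Fsum3; unfold sum3; ring. }
  rewrite expand, momentum_balance, microrotation_balance, a_balance by assumption; unfold remainder.
  assert (antisym : a_weight * gap = tau_tilde * tau_tilde) by (unfold a_weight; field; assert (Hg := gap_pos); lra).
  rewrite Rmult_plus_distr_l, <- (Rmult_assoc a_weight gap), antisym; ring.
Qed.

Definition diss_const : R :=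
  Rmin (mu / 2) (Rmin (2 * kappa * mu / (kappa + mu)) (Rmin alpha_tilde gamma_tilde)).

Lemma diss_const_pos : 0 < diss_const.
Proof.
  assert (Hm := mu_pos); assert (Hk := kappa_pos); repeat apply Rmin_pos;
    [lra | apply Rdiv_lt_0_compat; nra | apply alpha_tilde_pos | apply gamma_tilde_pos].
Qed.

Lemma diss_const_le : diss_const <= mu / 2 /\ diss_const <= 2 * kappa * mu / (kappa + mu)
  /\ diss_const <= alpha_tilde /\ diss_const <= gamma_tilde.
Proof.
  unfold diss_const; set (a := mu / 2); set (b := 2 * kappa * mu / (kappa + mu)).
  assert (Ha := Rmin_l a (Rmin b (Rmin alpha_tilde gamma_tilde))).
  assert (Hb := Rmin_l b (Rmin alpha_tilde gamma_tilde)); assert (Hc := Rmin_l alpha_tilde gamma_tilde).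
  assert (Ha' := Rmin_r a (Rmin b (Rmin alpha_tilde gamma_tilde))).
  assert (Hb' := Rmin_r b (Rmin alpha_tilde gamma_tilde)); assert (Hc' := Rmin_r alpha_tilde gamma_tilde).
  repeat split; lra.
Qed.

Definition word_diss (S : Solution) w t : R :=
  grad_sq (Dw_u S w) t + sum3 (fun i => normsq (Dw_th S w i) t) + grad_sq (Dw_th S w) t.

(* Young's inequality on the coupling term, with a weight that leaves part of both dissipations. *)
Lemma curl_coupling_le U Th t :
  2 * kappa * sum3 (fun i => inner (Th i) (curlF U i) t)
  <= 2 * kappa * kappa / (kappa + mu) * sum3 (fun i => normsq (Th i) t) + (kappa + mu) / 2 * grad_sq U t.
Proof.
  assert (Hm := mu_pos); assert (Hk := kappa_pos).
  assert (young : forall i, 2 * kappa * inner (Th i) (curlF U i) t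
    <= 2 * kappa * kappa / (kappa + mu) * normsq (Th i) t + (kappa + mu) / 2 * normsq (curlF U i) t).
  { intros i; assert (Hr : 0 < 2 * kappa / (kappa + mu)) by (apply Rdiv_lt_0_compat; lra).
    assert (weighted := inner_young (Th i) (curlF U i) t _ Hr).
    replace (2 * kappa * kappa / (kappa + mu) * normsq (Th i) t + (kappa + mu) / 2 * normsq (curlF U i) t)
      with (kappa * (2 * kappa / (kappa + mu) * normsq (Th i) t + / (2 * kappa / (kappa + mu)) * normsq (curlF U i) t))
      by (field; lra).
    nra. }
  rewrite <- curl_div_grad, <- !sum3_scal.
  eapply Rle_trans; [apply sum3_le; intros i _; apply young|].
  rewrite sum3_add, !sum3_scal; assert (Hd := normsq_nonneg (divF U) t); nra.
Qed.

Lemma energy_ineq S w t : 0 <= t <= sol_T S ->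
  word_energy_dt S w t <= - diss_const * word_diss S w t + remainder S w t + a_weight * transport_a S w t.
Proof.
  intros Ht; rewrite energy_identity by assumption; unfold word_diss.
  set (U := Dw_u S w); set (Th := Dw_th S w); set (c := diss_const).
  assert (Hm := mu_pos); assert (Hk := kappa_pos).
  destruct diss_const_le as (cmu & ckappa & calpha & cgamma); fold c in cmu, ckappa, calpha, cgamma.
  assert (coupling := curl_coupling_le U Th t).
  assert (split_kappa : 2 * kappa * mu / (kappa + mu) = 2 * kappa - 2 * kappa * kappa / (kappa + mu)) by (field; lra).
  assert (diss_u : - (mu + kappa / 2) * grad_sq U t + (kappa + mu) / 2 * grad_sq U t <= - c * grad_sq U t)
    by (assert (Hn := grad_sq_nonneg U t); nra).
  assert (diss_th : 2 * kappa * kappa / (kappa + mu) * sum3 (fun i => normsq (Th i) t)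
    - 2 * kappa * sum3 (fun i => normsq (Th i) t) <= - c * sum3 (fun i => normsq (Th i) t)).
  { assert (Hn : 0 <= sum3 (fun i => normsq (Th i) t)) by (apply sum3_nonneg; intros; apply normsq_nonneg).
    rewrite split_kappa in ckappa; nra. }
  assert (diss_grad_th : - (alpha_tilde - gamma_tilde) * normsq (divF Th) t - gamma_tilde * grad_sq Th t
    <= - c * grad_sq Th t).
  { rewrite <- (curl_div_grad Th); assert (Hd := normsq_nonneg (divF Th) t).
    assert (Hc : 0 <= sum3 (fun i => normsq (curlF Th i) t)) by (apply sum3_nonneg; intros; apply normsq_nonneg); nra. }
  lra.
Qed.

Lemma u_remainder_bigO N w i : level N -> (ord w <= N)%nat -> (i < 3)%nat ->
  bigO (fun s : State => inner (Dw_u s w i) (remainder_u s w i) (time s)) (fun s => sqrt_diss N s * size_diss N s).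
Proof.
  intros HN Hw Hi; apply (bigO_inner time (fun s => Dw_u s w i) (fun s => remainder_u s w i));
    [apply sqrt_diss_nonneg | apply size_diss_nonneg | |].
  - apply (Dw_bounded_u_diss N i Hi w); unfold order_le; lia.
  - apply (Dw_bounded_adv N (u_at i) HN (Dw_bounded_u_diss N i Hi) w Hw).
Qed.

Lemma th_remainder_bigO N w i : level N -> (ord w <= N)%nat -> (i < 3)%nat ->
  bigO (fun s : State => inner (Dw_th s w i) (remainder_th s w i) (time s)) (fun s => sqrt_diss N s * size_diss N s).
Proof.
  intros HN Hw Hi; apply (bigO_inner time (fun s => Dw_th s w i) (fun s => remainder_th s w i));
    [apply sqrt_diss_nonneg | apply size_diss_nonneg | apply (Dw_bounded_th_diss N i Hi w); unfold order_le; lia|].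
  apply L2_bounded_add; [apply (Dw_bounded_theta_nonlinear N i HN Hi w Hw)|].
  apply L2_bounded_add; [apply L2_bounded_add|]; apply (commutator_K_dt_th N w i); auto; lia.
Qed.

Lemma dt_K_remainder_bigO N w i j : (ord w <= N)%nat -> (i < 3)%nat -> (j < 3)%nat ->
  bigO (fun s : State => inner (D 0 (sol_K s i j) * Dw_th s w i)%fld (Dw_th s w j) (time s))
    (fun s => sqrt_diss N s * size_diss N s).
Proof.
  intros Hw Hi Hj; assert (HM := M_ge).
  assert (Hth : forall l, (l < 3)%nat -> L2_bounded time (fun s : State => Dw_th s w l) (sqrt_diss N))
    by (intros l Hl; apply (Dw_bounded_th_diss N l Hl w); unfold order_le; lia).
  apply (bigO_ext _ (fun s : State => inner (Dw_th s w j) (D 0 (sol_K s i j) * Dw_th s w i)%fld (time s)));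
    [intros; apply inner_sym|].
  apply (bigO_inner time (fun s : State => Dw_th s w j) (fun s : State => D 0 (sol_K s i j) * Dw_th s w i)%fld);
    [apply sqrt_diss_nonneg | apply size_diss_nonneg | apply Hth, Hj|].
  apply (L2_bounded_mul_sup_l time _ _ size_at); [apply size_at_nonneg | apply sqrt_diss_nonneg | | apply Hth, Hi].
  eapply sup_bounded_le; [apply (K_sup [0%nat] i j); simpl; auto; lia | apply sqrt_energy_size].
Qed.

Lemma remainder_bigO N w : level N -> (ord w <= N)%nat ->
  bigO (fun s : State => remainder s w (time s)) (fun s => size_at s * diss N s).
Proof.
  intros HN Hw; apply (bigO_le _ (fun s => sqrt_diss N s * size_diss N s));
    [|apply lesssim_le; intros s; unfold size_diss; rewrite <- sqrt_diss_sqr; lra].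
  apply bigO_sub; [apply bigO_sub; [apply bigO_scal|]|].
  - apply (bigO_sum3 (fun i (s : State) => sum3
      (fun j => inner (D 0 (sol_K s i j) * Dw_th s w i)%fld (Dw_th s w j) (time s)))).
    intros i Hi; apply (bigO_sum3 (fun j (s : State) =>
      inner (D 0 (sol_K s i j) * Dw_th s w i)%fld (Dw_th s w j) (time s))).
    intros j Hj; apply dt_K_remainder_bigO; auto.
  - apply (bigO_sum3 (fun i (s : State) => inner (Dw_u s w i) (remainder_u s w i) (time s))).
    intros i Hi; apply u_remainder_bigO; auto.
  - apply (bigO_sum3 (fun i (s : State) => inner (Dw_th s w i) (remainder_th s w i) (time s))).
    intros i Hi; apply th_remainder_bigO; auto.
Qed.

End Energy_identity.

(** * Summation over words and coercivity *)

Definition words (N : nat) : list (list nat) :=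
  filter (fun w => (ord w <=? N)%nat)
    (flat_map (fun a0 => flat_map (fun a1 => flat_map (fun a2 => map (sorted_word a0 a1 a2)
      (seq 0 (N + 1))) (seq 0 (N + 1))) (seq 0 (N + 1))) (seq 0 (N + 1))).

Lemma words_ord w N : In w (words N) -> (ord w <= N)%nat.
Proof. intros Hw; apply filter_In in Hw; apply Nat.leb_le, Hw. Qed.

Lemma sorted_word_in_words a0 a1 a2 a3 N : (2 * a0 + a1 + a2 + a3 <= N)%nat -> In (sorted_word a0 a1 a2 a3) (words N).
Proof.
  intros Ha; apply filter_In; split; [|apply Nat.leb_le; rewrite ord_sorted_word; exact Ha].
  apply in_flat_map; exists a0; split; [apply in_seq; lia|].
  apply in_flat_map; exists a1; split; [apply in_seq; lia|].
  apply in_flat_map; exists a2; split; [apply in_seq; lia|].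
  apply in_map, in_seq; lia.
Qed.

Lemma word_space_letter_or_time w N : (ord w <= N + 1)%nat ->
  (exists v k, (k < 3)%nat /\ In v (words N) /\ forall f, Dw w f = D (S k) (Dw v f)) \/
  (exists n, (2 * n <= ord w)%nat /\ forall f, Dw w f = Dw (repeat 0%nat n) f).
Proof.
  intros Hw; destruct (Dw_sorted_word w) as (a0 & a1 & a2 & a3 & Eo & Ew & _).
  assert (extract : forall k b1 b2 b3, (k < 3)%nat -> (2 * a0 + b1 + b2 + b3 <= N)%nat ->
    Permutation (sorted_word a0 a1 a2 a3) (S k :: sorted_word a0 b1 b2 b3) ->
    exists v k, (k < 3)%nat /\ In v (words N) /\ forall f, Dw w f = D (S k) (Dw v f)).
  { intros k b1 b2 b3 Hk Hb Hperm; exists (sorted_word a0 b1 b2 b3), k; split; [exact Hk|split].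
    - apply sorted_word_in_words; exact Hb.
    - intros f; rewrite Ew; apply (Dw_perm _ _ f Hperm). }
  destruct a1 as [|a1]; [destruct a2 as [|a2]; [destruct a3 as [|a3]|]|].
  - right; exists a0; split; [lia | intros f; rewrite Ew; unfold sorted_word; simpl; rewrite !app_nil_r; reflexivity].
  - left; apply (extract 2%nat 0%nat 0%nat a3); [lia | lia | apply Permutation_sym, Permutation_middle].
  - left; apply (extract 1%nat 0%nat a2 a3); [lia | lia | apply Permutation_sym, Permutation_middle].
  - left; apply (extract 0%nat a1 a2 a3); [lia | lia | apply Permutation_sym, Permutation_middle].
Qed.

Lemma quadratic_form_le (a : nat -> nat -> R) (v : nat -> R) k :
  (forall i j, (i < 3)%nat -> (j < 3)%nat -> Rabs (a i j) <= k) ->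
  Rabs (sum3 (fun i => sum3 (fun j => a i j * (v i * v j)))) <= 3 * k * sum3 (fun i => v i * v i).
Proof.
  intros Ha; eapply Rle_trans; [apply sum3_Rabs_le|].
  apply Rle_trans with (sum3 (fun i => sum3 (fun j => k * ((v i * v i + v j * v j) / 2)))).
  - apply sum3_le; intros i Hi; eapply Rle_trans; [apply sum3_Rabs_le|]; apply sum3_le; intros j Hj.
    rewrite Rabs_mult; apply Rmult_le_compat; try apply Rabs_pos; [apply Ha; assumption|].
    assert (Hm := Rle_0_sqr (v i - v j)); assert (Hp := Rle_0_sqr (v i + v j)); unfold Rsqr in *.
    apply Rabs_le; lra.
  - unfold sum3; apply Req_le; field.
Qed.

Section Coercivity.
Context {P : Coefficients}.

Definition sol_fields (S : Solution) : list PField :=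
  [sol_u S 0; sol_u S 1; sol_u S 2; sol_th S 0; sol_th S 1; sol_th S 2; sol_K S 0 2; sol_K S 1 2]%nat.

Definition word_normsq (S : Solution) w t : R := lsum (map (fun f => normsq (Dw w f) t) (sol_fields S)).

Lemma word_normsq_nonneg S w t : 0 <= word_normsq S w t.
Proof. apply lsum_nonneg; intros; apply normsq_nonneg. Qed.

Lemma word_diss_nonneg S w t : 0 <= word_diss S w t.
Proof.
  apply Rplus_le_le_0_compat; [apply Rplus_le_le_0_compat|]; try apply grad_sq_nonneg.
  apply sum3_nonneg; intros; apply normsq_nonneg.
Qed.

Definition energy_lower : R := Rmin (1 / 2) (Rmin (lam / 4) (a_weight / 2)).
Definition energy_upper : R := 1 / 2 + nu + a_weight / 2.

Lemma energy_lower_pos : 0 < energy_lower.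
Proof. assert (Hl := lam_pos); assert (Ha := a_weight_pos); repeat apply Rmin_pos; lra. Qed.

Lemma energy_upper_pos : 0 < energy_upper.
Proof. assert (Hl := lam_pos); assert (Hn := lam_nu); assert (Ha := a_weight_pos); unfold energy_upper; lra. Qed.

Lemma energy_lower_le : energy_lower <= 1 / 2 /\ energy_lower <= lam / 4 /\ energy_lower <= a_weight / 2.
Proof.
  assert (Hl := Rmin_l (1 / 2) (Rmin (lam / 4) (a_weight / 2)));
    assert (Hr := Rmin_r (1 / 2) (Rmin (lam / 4) (a_weight / 2))).
  assert (Hl' := Rmin_l (lam / 4) (a_weight / 2)); assert (Hr' := Rmin_r (lam / 4) (a_weight / 2)).
  unfold energy_lower; repeat split; lra.
Qed.

Lemma inertia_bounds (S : Solution) t x y z (v : nat -> R) : 0 <= t <= sol_T S ->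
  lam / 2 * sum3 (fun i => v i * v i)
    <= sum3 (fun i => Jeq_diag i * (v i * v i)) + sum3 (fun i => sum3 (fun j => sol_K S i j t x y z * (v i * v j)))
    <= 2 * nu * sum3 (fun i => v i * v i).
Proof.
  intros Ht; assert (Hl := lam_pos); assert (Hn := lam_nu).
  assert (HK := quadratic_form_le (fun i j => sol_K S i j t x y z) v K_threshold
    (fun i j Hi Hj => sol_K_small S t x y z i j Ht Hi Hj)).
  apply Rabs_le_between in HK.
  assert (Hsq : forall i, 0 <= v i * v i) by (intros; apply Rle_0_sqr).
  set (q := sum3 (fun i => v i * v i)) in *.
  assert (Hq : 0 <= q) by (apply sum3_nonneg; intros; apply Hsq).
  assert (Hthr : K_threshold * q <= lam / 20 * q) by (apply Rmult_le_compat_r; [exact Hq | apply K_threshold_lam]).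
  assert (HJ : lam * q <= sum3 (fun i => Jeq_diag i * (v i * v i)) <= nu * q).
  { unfold q; rewrite <- !sum3_scal; split; apply sum3_le; intros i _; apply Rmult_le_compat_r; auto;
      unfold Jeq_diag; destruct (i =? 2)%nat; lra. }
  assert (Hlq : lam * q <= nu * q) by (apply Rmult_le_compat_r; lra); lra.
Qed.

Lemma energy_density_bounds S w t x y z : 0 <= t <= sol_T S ->
  let normsq_density := Fsum (map (fun f => Dw w f * Dw w f)%fld (sol_fields S)) t x y z in
  energy_lower * normsq_density <= energy_density S w t x y z <= energy_upper * normsq_density.
Proof.
  intros Ht; cbv zeta; destruct (inertia_bounds S t x y z (fun i => Dw_th S w i t x y z) Ht) as [Jlow Jup].
  assert (Hl := lam_pos); assert (Hn := lam_nu); assert (Hc := a_weight_pos).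
  destruct energy_lower_le as (c_u & c_th & c_a); unfold energy_density, Fsum3 in *; unfold sum3 in Jlow, Jup.
  cbn [sol_fields map Fsum fold_right]; Feval; revert Jlow Jup; Feval.
  change (Dw w (sol_u S ?i)) with (Dw_u S w i); change (Dw w (sol_th S ?i)) with (Dw_th S w i).
  change (Dw w (sol_K S ?i ?j)) with (Dw_K S w i j).
  assert (Hsq : forall r, 0 <= r * r) by (intros; apply Rle_0_sqr).
  generalize (Hsq (Dw_u S w 0 t x y z)) (Hsq (Dw_u S w 1 t x y z)) (Hsq (Dw_u S w 2 t x y z))
    (Hsq (Dw_th S w 0 t x y z)) (Hsq (Dw_th S w 1 t x y z)) (Hsq (Dw_th S w 2 t x y z))
    (Hsq (Dw_K S w 0 2 t x y z)) (Hsq (Dw_K S w 1 2 t x y z)); intros u0 u1 u2 th0 th1 th2 a0 a1 Jlow Jup.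
  set (q_u := Dw_u S w 0 t x y z * Dw_u S w 0 t x y z + Dw_u S w 1 t x y z * Dw_u S w 1 t x y z
    + Dw_u S w 2 t x y z * Dw_u S w 2 t x y z).
  set (q_th := Dw_th S w 0 t x y z * Dw_th S w 0 t x y z + Dw_th S w 1 t x y z * Dw_th S w 1 t x y z
    + Dw_th S w 2 t x y z * Dw_th S w 2 t x y z) in *.
  set (q_a := Dw_K S w 0 2 t x y z * Dw_K S w 0 2 t x y z + Dw_K S w 1 2 t x y z * Dw_K S w 1 2 t x y z).
  assert (Hu : energy_lower * q_u <= 1 / 2 * q_u) by (apply Rmult_le_compat_r; unfold q_u; lra).
  assert (Hth : energy_lower * q_th <= lam / 4 * q_th) by (apply Rmult_le_compat_r; unfold q_th; lra).
  assert (Ha : energy_lower * q_a <= a_weight / 2 * q_a) by (apply Rmult_le_compat_r; unfold q_a; lra).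
  assert (Nu : 0 <= (nu + a_weight / 2) * q_u) by (apply Rmult_le_pos; unfold q_u; lra).
  assert (Nth : 0 <= (1 / 2 + a_weight / 2) * q_th) by (apply Rmult_le_pos; unfold q_th; lra).
  assert (Na : 0 <= (1 / 2 + nu) * q_a) by (apply Rmult_le_pos; unfold q_a; lra).
  unfold energy_upper, q_u, q_th, q_a in *; split; lra.
Qed.

Lemma word_energy_bounds S w t : 0 <= t <= sol_T S ->
  energy_lower * word_normsq S w t <= word_energy S w t <= energy_upper * word_normsq S w t.
Proof.
  intros Ht; unfold word_normsq, normsq, inner; rewrite <- (Tint_Fsum (sol_fields S) (fun f => Dw w f * Dw w f)%fld).
  rewrite <- !Tint_scal; unfold word_energy; split; apply Tint_le; intros x y z; rewrite Fmul_eval, Fconst_eval;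
    apply energy_density_bounds, Ht.
Qed.

Definition lyapunov (N : nat) (S : Solution) (t : R) : R := lsum (map (fun w => word_energy S w t) (words N)).
Definition lyapunov_dt (N : nat) (S : Solution) (t : R) : R := lsum (map (fun w => word_energy_dt S w t) (words N)).
Definition words_normsq (N : nat) (S : Solution) (t : R) : R := lsum (map (fun w => word_normsq S w t) (words N)).
Definition words_diss (N : nat) (S : Solution) (t : R) : R := lsum (map (fun w => word_diss S w t) (words N)).
Definition words_transport_a (N : nat) (S : Solution) (t : R) : R := lsum (map (fun w => transport_a S w t) (words N)).

Lemma lyapunov_derive N S t : 0 <= t <= sol_T S -> is_derive (lyapunov N S) t (lyapunov_dt N S t).
Proof. intros Ht; apply (lsum_derive (words N) (word_energy S)); intros w _; apply word_energy_derive, Ht. Qed.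

Lemma lyapunov_bounds N S t : 0 <= t <= sol_T S ->
  energy_lower * words_normsq N S t <= lyapunov N S t <= energy_upper * words_normsq N S t.
Proof.
  intros Ht; unfold lyapunov, words_normsq; rewrite <- !lsum_scal.
  split; apply lsum_le; intros w _; apply word_energy_bounds, Ht.
Qed.

Lemma words_normsq_nonneg N S t : 0 <= words_normsq N S t.
Proof. apply lsum_nonneg; intros; apply word_normsq_nonneg. Qed.
Lemma words_diss_nonneg N S t : 0 <= words_diss N S t.
Proof. apply lsum_nonneg; intros; apply word_diss_nonneg. Qed.
Lemma lyapunov_nonneg N S t : 0 <= t <= sol_T S -> 0 <= lyapunov N S t.
Proof.
  intros Ht; eapply Rle_trans; [|apply lyapunov_bounds, Ht].
  apply Rmult_le_pos; [left; apply energy_lower_pos | apply words_normsq_nonneg].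
Qed.

Lemma normsq_le_words_normsq N S w f t : (ord w <= N)%nat -> In f (sol_fields S) ->
  normsq (Dw w f) t <= words_normsq N S t.
Proof.
  intros Hw Hf; destruct (Dw_sorted_word w) as (a0 & a1 & a2 & a3 & Eo & Ew & _); rewrite Ew.
  apply Rle_trans with (word_normsq S (sorted_word a0 a1 a2 a3) t).
  - apply (lsum_term (sol_fields S) (fun f => normsq (Dw (sorted_word a0 a1 a2 a3) f) t));
      [intros; apply normsq_nonneg | exact Hf].
  - apply (lsum_term (words N) (fun w => word_normsq S w t));
      [intros; apply word_normsq_nonneg | apply sorted_word_in_words; lia].
Qed.

Definition sqrt_words_normsq (N : nat) (s : State) : R := sqrt (words_normsq N s (time s)).

Lemma sqrt_words_normsq_nonneg N : nonneg (sqrt_words_normsq N).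
Proof. intros s; apply sqrt_pos. Qed.

Lemma sqrt_words_normsq_sqr N s : sqrt_words_normsq N s * sqrt_words_normsq N s = words_normsq N s (time s).
Proof. apply sqrt_sqrt, words_normsq_nonneg. Qed.

Lemma Dw_bounded_words_normsq N f : In f u_th_a_fields -> Dw_bounded time (order_le N) (sqrt_words_normsq N) f.
Proof.
  intros Hf w Hw; apply L2_bounded_sqrt; [intros s; apply words_normsq_nonneg|]; apply lesssim_le; intros s.
  apply (normsq_le_words_normsq N s w (f s) (time s) Hw); exact (in_map (fun f => f s) u_th_a_fields f Hf).
Qed.

Lemma Pk_sq_lesssim_Dw_bounded k B f : nonneg B -> Dw_bounded time (order_le k) B f ->
  (fun s => Pk_sq k (f s) (time s)) <~ (fun s => B s * B s).
Proof.
  intros HB Hf; apply Pk_sq_lesssim; [intros s; apply Rle_0_sqr|]; intros w Hw.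
  apply (normsq_lesssim time (fun s => Dw w (f s))); [exact HB | apply Hf, Hw].
Qed.

Lemma sumN_Pk_sq_lesssim k B l : nonneg B -> (forall f, In f l -> Dw_bounded time (order_le k) B f) ->
  (fun s => sumN (Pk_sq k) (map field_fun (map (fun f => f s) l)) (time s)) <~ (fun s => B s * B s).
Proof.
  intros HB Hl; apply (sumN_lesssim (Pk_sq k) time l); [intros s; apply Rle_0_sqr|].
  intros f Hf; apply Pk_sq_lesssim_Dw_bounded; auto.
Qed.

Lemma energy_lesssim_words : energy <~ (fun s : State => words_normsq (2 * M) s (time s)).
Proof.
  eapply lesssim_trans; [|apply lesssim_le; intros s; apply Req_le, sqrt_words_normsq_sqr].
  apply (lesssim_ext _ _ _ energy_sumN), sumN_Pk_sq_lesssim;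
    [apply sqrt_words_normsq_nonneg | apply Dw_bounded_words_normsq].
Qed.

Lemma words_lesssim_energy N : (N <= 2 * M)%nat -> (fun s : State => words_normsq N s (time s)) <~ energy.
Proof.
  intros HN; eapply lesssim_trans; [|apply sqrt_energy_sqr_lesssim].
  apply (lesssim_lsum (words N) (fun w (s : State) => word_normsq s w (time s))); [intros s; apply Rle_0_sqr|].
  intros w Hw; apply words_ord in Hw.
  apply (lesssim_ext _ (fun s => lsum (map (fun f => normsq (Dw w (f s)) (time s)) u_th_a_fields))); [reflexivity|].
  apply (lesssim_lsum u_th_a_fields (fun f s => normsq (Dw w (f s)) (time s))); [intros s; apply Rle_0_sqr|].
  intros f Hf; apply (normsq_lesssim time (fun s => Dw w (f s))); [apply sqrt_energy_nonneg|].
  apply (Dw_bounded_energy f Hf); unfold order_le; lia.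
Qed.

Lemma word_diss_le_words_diss N S w t : In w (words N) -> word_diss S w t <= words_diss N S t.
Proof. intros Hw; apply (lsum_term (words N) (fun w => word_diss S w t)); [intros; apply word_diss_nonneg | exact Hw].
Qed.

(* Purely temporal derivatives of the velocity have mean zero, whence Poincare's inequality. *)
Lemma normsq_le_words_diss N S w i t : level N -> 0 <= t <= sol_T S -> (ord w <= N + 1)%nat -> (i < 3)%nat ->
  normsq (Dw w (sol_u S i)) t <= 9 * words_diss N S t /\ normsq (Dw w (sol_th S i)) t <= 9 * words_diss N S t.
Proof.
  intros HN Ht Hw Hi; assert (HM := M_ge).
  assert (part : forall v, In v (words N) -> grad_sq (Dw_u S v) t + sum3 (fun i => normsq (Dw_th S v i) t)
    + grad_sq (Dw_th S v) t <= words_diss N S t) by (intros v Hv; apply (word_diss_le_words_diss N S v t Hv)).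
  assert (th_nonneg : forall v, 0 <= sum3 (fun i => normsq (Dw_th S v i) t))
    by (intros; apply sum3_nonneg; intros; apply normsq_nonneg).
  destruct (word_space_letter_or_time w N Hw) as [(v & k & Hk & Hv & Ew)|(n & Hn & Ew)]; rewrite !Ew.
  - specialize (part v Hv); specialize (th_nonneg v).
    assert (Hgu := grad_sq_nonneg (Dw_u S v) t); assert (Hgth := grad_sq_nonneg (Dw_th S v) t).
    assert (Hu := grad_sq_term (Dw_u S v) t i k Hi Hk); assert (Hth := grad_sq_term (Dw_th S v) t i k Hi Hk).
    unfold Dw_u, Dw_th in *; split; lra.
  - assert (Hv : In (repeat 0%nat n) (words N)).
    { replace (repeat 0%nat n) with (sorted_word n 0 0 0)
        by (unfold sorted_word; simpl; rewrite !app_nil_r; reflexivity).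
      apply sorted_word_in_words; destruct HN as [-> | ->]; lia. }
    specialize (part _ Hv); specialize (th_nonneg (repeat 0%nat n)).
    assert (Hgu := grad_sq_nonneg (Dw_u S (repeat 0%nat n)) t);
      assert (Hgth := grad_sq_nonneg (Dw_th S (repeat 0%nat n)) t).
    assert (mean : Tint (Dw (repeat 0%nat n) (sol_u S i)) t = 0)
      by (apply (Tint_zero_dt _ (sol_T S)); [apply sol_T_pos | intros; apply sol_u_mean; assumption | exact Ht]).
    assert (Hpoin := poincare _ _ mean).
    assert (grad_term := fun k Hk => grad_sq_term (Dw_u S (repeat 0%nat n)) t i k Hi Hk).
    assert (d1 := grad_term 0%nat ltac:(lia)); assert (d2 := grad_term 1%nat ltac:(lia));
      assert (d3 := grad_term 2%nat ltac:(lia)).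
    assert (Hth := sum3_term (fun i => normsq (Dw_th S (repeat 0%nat n) i) t) i (fun _ _ => normsq_nonneg _ _) Hi).
    unfold Dw_u, Dw_th in *; split; lra.
Qed.

Lemma diss_lesssim_words_diss N : level N -> diss N <~ (fun s : State => words_diss N s (time s)).
Proof.
  intros HN; assert (Hnn : nonneg (fun s : State => words_diss N s (time s))) by (intros s; apply words_diss_nonneg).
  apply (lesssim_ext _ _ _ (diss_sumN N)), (sumN_lesssim (Pk_sq (N + 1)) time u_th_fields); [exact Hnn|].
  apply u_th_fields_ind; intros i Hi; (apply Pk_sq_lesssim; [exact Hnn|]); intros w Hw; exists 9;
    (split; [lra|]); intros s; apply (normsq_le_words_diss N s w i (time s) HN (time_ok s) Hw Hi).
Qed.

Lemma lyapunov_dt_le N : level N -> exists c C, 0 < c /\ 0 <= C /\ forall s : State,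
  lyapunov_dt N s (time s) <= - c * diss N s + C * (size_at s * diss N s) + a_weight * words_transport_a N s (time s).
Proof.
  intros HN; destruct (diss_lesssim_words_diss N HN) as (d & Hd & Hdiss).
  assert (Hrem : bigO (fun s : State => lsum (map (fun w => remainder s w (time s)) (words N)))
    (fun s => size_at s * diss N s)).
  { apply (bigO_lsum (words N) (fun w (s : State) => remainder s w (time s)));
      [apply nonneg_mul; [apply size_at_nonneg | apply diss_nonneg]|].
    intros w Hw; apply remainder_bigO; [exact HN | apply words_ord, Hw]. }
  apply bigO_lesssim in Hrem; destruct Hrem as (C & HC & Hrem); assert (Hc := diss_const_pos).
  exists (diss_const / (d + 1)), C; split; [apply Rdiv_lt_0_compat; lra|split; [exact HC|]]; intros s.
  specialize (Hrem s); specialize (Hdiss s); assert (Hg := words_diss_nonneg N s (time s)).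
  assert (Hsum : lyapunov_dt N s (time s) <= - diss_const * words_diss N s (time s)
    + lsum (map (fun w => remainder s w (time s)) (words N)) + a_weight * words_transport_a N s (time s)).
  { unfold lyapunov_dt, words_diss, words_transport_a; rewrite <- !lsum_scal, <- !lsum_add.
    apply lsum_le; intros w _; apply energy_ineq, time_ok. }
  assert (Hle : diss_const / (d + 1) * diss N s <= diss_const * words_diss N s (time s)).
  { apply Rmult_le_reg_r with (d + 1); [lra|].
    replace (diss_const / (d + 1) * diss N s * (d + 1)) with (diss_const * diss N s) by (field; lra).
    rewrite Rmult_assoc; apply Rmult_le_compat_l; [lra|]; lra. }
  lra.
Qed.

End Coercivity.

(** * Differential inequalities *)

Lemma derivative_le_affine (f df : R -> R) T B : (forall t, 0 <= t <= T -> is_derive f t (df t)) ->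
  (forall t, 0 <= t <= T -> df t <= B) -> forall t, 0 <= t <= T -> f t <= f 0 + B * t.
Proof.
  intros Hf Hdf t Ht; destruct (Req_dec t 0) as [->|N]; [lra|].
  destruct (MVT_gen f 0 t df) as (c & Hc & E).
  - intros x Hx; rewrite Rmin_left, Rmax_right in Hx by lra; apply Hf; lra.
  - intros x Hx; rewrite Rmin_left, Rmax_right in Hx by lra.
    apply derivable_continuous_pt; exists (df x); apply is_derive_Reals, Hf; lra.
  - rewrite Rmin_left, Rmax_right in Hc by lra; specialize (Hdf c ltac:(lra)).
    assert (df c * (t - 0) <= B * t) by (rewrite Rminus_0_r; apply Rmult_le_compat_r; lra); lra.
Qed.

Lemma derivative_le_integral (f df g : R -> R) T c : (forall t, 0 <= t <= T -> is_derive f t (df t)) ->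
  (forall t, continuous g t) -> (forall t, 0 <= t <= T -> df t <= - c * g t) ->
  forall t, 0 <= t <= T -> f t + c * RInt g 0 t <= f 0.
Proof.
  intros Hf Hg Hdf t Ht.
  assert (Hsum : forall t, 0 <= t <= T -> is_derive (fun t => f t + c * RInt g 0 t) t (df t + c * g t)).
  { intros s Hs; apply (is_derive_plus (V := R_NormedModule) f (fun t => c * RInt g 0 t)); [apply Hf, Hs|].
    apply (is_derive_scal (fun t => RInt g 0 t)), (is_derive_RInt g (fun t => RInt g 0 t) 0); [|apply Hg].
    exists (mkposreal 1 Rlt_0_1); intros; apply (RInt_correct (V := R_CompleteNormedModule)), ex_RInt_cont, Hg. }
  assert (Hle := derivative_le_affine _ _ T 0 Hsum (fun s Hs => ltac:(specialize (Hdf s Hs); lra)) t Ht).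
  cbv beta in Hle; rewrite (RInt_point (V := R_CompleteNormedModule)) in Hle; unfold zero in Hle; simpl in Hle; lra.
Qed.

Lemma absorb_le C c e d : 0 < c -> 0 <= C -> 0 <= e <= c / (2 * (C + 1)) -> 0 <= d -> C * (e * d) <= c / 2 * d.
Proof.
  intros Hc HC He Hd; rewrite <- Rmult_assoc; apply Rmult_le_compat_r; [exact Hd|].
  apply Rle_trans with ((C + 1) * (c / (2 * (C + 1)))); [apply Rmult_le_compat; lra | apply Req_le; field; lra].
Qed.

(* The interpolation inequality is used with [rho = sigma * tau]. *)
Lemma optimised_interpolation c Ci m tau y d e : 0 < c -> 0 < Ci ->
  let n := INR (S m) in let sigma := c / (2 * Ci * n) in
  0 < tau -> 1 <= sigma * tau -> 0 <= d ->
  (forall rho, 0 < rho -> y <= Ci * ((1 + rho) * d + (/ rho) ^ m * e)) ->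
  n * tau ^ m * y <= c * tau ^ S m * d + c / (2 * sigma) * (/ sigma) ^ m * e.
Proof.
  intros Hc HCi n sigma Htau Hst Hd Hy.
  assert (Hn : 0 < n) by (apply lt_0_INR; lia).
  assert (Hsigma : 0 < sigma) by (apply Rdiv_lt_0_compat; [lra | apply Rmult_lt_0_compat; lra]).
  assert (Htm : 0 < tau ^ m) by (apply pow_lt, Htau).
  assert (Hle : y <= Ci * (2 * (sigma * tau) * d + (/ (sigma * tau)) ^ m * e)).
  { eapply Rle_trans; [apply (Hy (sigma * tau)); lra|]; apply Rmult_le_compat_l; [lra|]; nra. }
  apply Rle_trans with (n * tau ^ m * (Ci * (2 * (sigma * tau) * d + (/ (sigma * tau)) ^ m * e))).
  { apply Rmult_le_compat_l; [apply Rmult_le_pos; lra | exact Hle]. }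
  apply Req_le; rewrite Rinv_mult, Rpow_mult_distr.
  assert (Hinv : tau ^ m * (/ tau) ^ m = 1) by (rewrite <- Rpow_mult_distr, Rinv_r, pow1 by lra; reflexivity).
  replace (n * tau ^ m * (Ci * (2 * (sigma * tau) * d + (/ sigma) ^ m * (/ tau) ^ m * e)))
    with (2 * Ci * n * sigma * (tau * tau ^ m) * d + n * Ci * (/ sigma) ^ m * e * (tau ^ m * (/ tau) ^ m)) by ring.
  assert (Ec : 2 * Ci * n * sigma = c) by (unfold sigma; field; lra).
  assert (En : c / (2 * sigma) = n * Ci) by (unfold sigma; field; repeat split; lra).
  rewrite Hinv, Ec, En; simpl; ring.
Qed.

Lemma is_derive_shifted_pow b m t : is_derive (fun t => (t + b) ^ S m) t (INR (S m) * (t + b) ^ m).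
Proof.
  replace (INR (S m) * (t + b) ^ m) with (INR (S m) * 1 * (t + b) ^ pred (S m)) by (simpl pred; ring).
  apply (is_derive_pow (fun t => t + b) (S m) t 1); auto_derive; [trivial | reflexivity].
Qed.

Lemma weighted_decay b m C y y0 e t : 1 <= b -> 0 <= C -> 0 <= y -> 0 <= y0 -> 0 <= e -> 0 <= t ->
  (t + b) ^ S m * y <= b ^ S m * y0 + C * e * t -> y * (1 + t) ^ m <= (b ^ S m + C) * (y0 + e).
Proof.
  intros Hb HC Hy Hy0 He Ht Hle; set (tau := t + b) in *; assert (Htau : 1 <= tau) by (unfold tau; lra).
  apply Rle_trans with (y * tau ^ m); [apply Rmult_le_compat_l; [exact Hy|]; apply pow_incr; unfold tau; lra|].
  apply Rmult_le_reg_l with tau; [lra|].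
  replace (tau * (y * tau ^ m)) with (tau ^ S m * y) by (simpl; ring); eapply Rle_trans; [exact Hle|].
  assert (Hbm : 0 < b ^ S m) by (apply pow_lt; lra); set (q := b ^ S m) in *; clearbody q.
  assert (Hinit : 1 * (q * y0) <= tau * (q * y0)) by (apply Rmult_le_compat_r; [apply Rmult_le_pos; lra | lra]).
  assert (Hlin : t * (C * e) <= tau * (C * e))
    by (apply Rmult_le_compat_r; [apply Rmult_le_pos; lra | unfold tau; lra]).
  assert (0 <= tau * (C * y0)) by (repeat apply Rmult_le_pos; lra).
  assert (0 <= tau * (q * e)) by (repeat apply Rmult_le_pos; lra); lra.
Qed.

(* The interpolation hypothesis, optimised in [rho], gives y' <= - c y^(1 + 1/m). *)
Lemma algebraic_decay (c Ci : R) (m : nat) : 0 < c -> 0 < Ci -> exists C, 0 < C /\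
  forall (y dy d : R -> R) (T e : R), 0 <= e ->
  (forall t, 0 <= t <= T -> 0 <= y t) ->
  (forall t, 0 <= t <= T -> is_derive y t (dy t)) ->
  (forall t, 0 <= t <= T -> dy t <= - c * d t) ->
  (forall t, 0 <= t <= T -> 0 <= d t) ->
  (forall t rho, 0 <= t <= T -> 0 < rho -> y t <= Ci * ((1 + rho) * d t + (/ rho) ^ m * e)) ->
  forall t, 0 <= t <= T -> y t * (1 + t) ^ m <= C * (y 0 + e).
Proof.
  intros Hc HCi; set (n := INR (S m)); set (sigma := c / (2 * Ci * n)).
  assert (Hn : 0 < n) by (apply lt_0_INR; lia).
  assert (Hsigma : 0 < sigma) by (apply Rdiv_lt_0_compat; [lra | apply Rmult_lt_0_compat; lra]).
  assert (Hinv : 0 < / sigma) by (apply Rinv_0_lt_compat, Hsigma).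
  set (b := 1 + / sigma); assert (Hb : 1 <= b) by (unfold b; lra).
  set (C := c / (2 * sigma) * (/ sigma) ^ m).
  assert (HC : 0 < C) by (apply Rmult_lt_0_compat; [apply Rdiv_lt_0_compat; lra | apply pow_lt; assumption]).
  exists (b ^ S m + C); split; [assert (0 < b ^ S m) by (apply pow_lt; lra); lra|].
  intros y dy d T e He Hy Hdy Hdiss Hd Hint t Ht.
  apply weighted_decay; try lra; [apply Hy, Ht | apply Hy; lra|].
  replace (b ^ S m * y 0) with ((0 + b) ^ S m * y 0) by (rewrite Rplus_0_l; reflexivity).
  apply (derivative_le_affine (fun t => (t + b) ^ S m * y t)
    (fun t => n * (t + b) ^ m * y t + (t + b) ^ S m * dy t) T (C * e)); [| |exact Ht]; clear t Ht; intros t Ht.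
  - apply (is_derive_mult (fun t => (t + b) ^ S m) y t);
      [apply is_derive_shifted_pow | apply Hdy, Ht | intros; apply Rmult_comm].
  - assert (Hst : 1 <= sigma * (t + b)).
    { assert (E : sigma * b = sigma + 1) by (unfold b; field; lra); nra. }
    assert (Hopt := optimised_interpolation c Ci m (t + b) (y t) (d t) e Hc HCi ltac:(lra) Hst (Hd t Ht)
      (fun rho => Hint t rho Ht)).
    assert (Hdt : (t + b) ^ S m * dy t <= (t + b) ^ S m * (- c * d t))
      by (apply Rmult_le_compat_l; [left; apply pow_lt; lra | apply Hdiss, Ht]).
    fold n sigma C in Hopt; lra.
Qed.

Definition decay_weight (t : R) : R := / ((1 + t) * sqrt (1 + t)).

Lemma decay_weight_pos t : 0 <= t -> 0 < decay_weight t.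
Proof. intros Ht; apply Rinv_0_lt_compat, Rmult_lt_0_compat; [lra | apply sqrt_lt_R0; lra]. Qed.

Lemma inv_sqrt_bounds t : 0 <= t -> 0 < / sqrt (1 + t) <= 1.
Proof.
  intros Ht; assert (Hs : 1 <= sqrt (1 + t)) by (rewrite <- sqrt_1 at 1; apply sqrt_le_1_alt; lra).
  split; [apply Rinv_0_lt_compat; lra|]; apply Rmult_le_reg_l with (sqrt (1 + t)); [lra|]; rewrite Rinv_r; lra.
Qed.

(* The weight 1 + (1 + t)^(-1/2) absorbs error terms with coefficient (1 + t)^(-3/2). *)
Lemma absorbing_weight_derive t : 0 <= t -> is_derive (fun t => 1 + / sqrt (1 + t)) t (- (1 / 2) * decay_weight t).
Proof.
  intros Ht; assert (Hs : 0 < sqrt (1 + t)) by (apply sqrt_lt_R0; lra).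
  auto_derive; [split; [lra | split; [lra | trivial]]|].
  unfold decay_weight; set (q := sqrt (1 + t)) in *; assert (E : 1 + t = q * q) by (unfold q; rewrite sqrt_sqrt; lra).
  rewrite E; field; lra.
Qed.

Lemma integrable_gronwall (y dy d : R -> R) T c : 0 <= c ->
  (forall t, 0 <= t <= T -> is_derive y t (dy t)) -> (forall t, 0 <= t <= T -> 0 <= y t) ->
  (forall t, continuous d t) -> (forall t, 0 <= d t) ->
  (forall t, 0 <= t <= T -> dy t <= - c * d t + 1 / 4 * decay_weight t * y t) ->
  forall t, 0 <= t <= T -> y t + c * RInt d 0 t <= 2 * y 0.
Proof.
  intros Hc Hy Hnn Hcont Hd Hdy t Ht; set (f := fun r => (1 + / sqrt (1 + r)) * y r).
  assert (Hle : f t + c * RInt d 0 t <= f 0).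
  { apply (derivative_le_integral f (fun r => - (1 / 2) * decay_weight r * y r + (1 + / sqrt (1 + r)) * dy r) d T c);
      [|exact Hcont| |exact Ht]; intros r Hr.
    - apply (is_derive_mult (fun r => 1 + / sqrt (1 + r)) y r);
        [apply absorbing_weight_derive; lra | apply Hy, Hr | intros; apply Rmult_comm].
    - destruct (inv_sqrt_bounds r ltac:(lra)) as [mpos mle]; set (m := / sqrt (1 + r)) in *.
      assert (Hwy : 0 <= decay_weight r * y r) by (apply Rmult_le_pos;
        [left; apply decay_weight_pos; lra | apply Hnn, Hr]).
      assert (Hcd : 0 <= c * d r) by (apply Rmult_le_pos; auto).
      assert (Hm : (1 + m) * dy r <= (1 + m) * (- c * d r + 1 / 4 * decay_weight r * y r))
        by (apply Rmult_le_compat_l; [lra | apply Hdy, Hr]).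
      nra. }
  destruct (inv_sqrt_bounds 0 ltac:(lra)) as [_ m0]; destruct (inv_sqrt_bounds t ltac:(lra)) as [mt _].
  assert (y0 := Hnn 0 ltac:(lra)); assert (yt := Hnn t Ht); unfold f in Hle.
  assert (f 0 <= 2 * y 0) by (unfold f; apply Rmult_le_compat_r; lra).
  assert (0 <= / sqrt (1 + t) * y t) by (apply Rmult_le_pos; lra); unfold f in *; lra.
Qed.

(* The additional weight 1 - r / (1 + T) pays for the forcing by Young's inequality, at the price of the factor 1 + T. *)
Lemma forced_growth (y dy d : R -> R) T C : 0 <= T ->
  (forall t, 0 <= t <= T -> is_derive y t (dy t)) -> (forall t, 0 <= t <= T -> 0 <= y t) ->
  (forall t, continuous d t) -> (forall t, 0 <= d t) -> 0 <= C ->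
  (forall t, 0 <= t <= T -> dy t <= 1 / 6 * decay_weight t * y t + C * (sqrt (y t) * sqrt (d t))) ->
  y T <= 3 * y 0 + 9 / 4 * C * C * (1 + T) * RInt d 0 T.
Proof.
  intros HT Hy Hnn Hcont Hd HC Hdy; set (h := / (1 + T)); set (Q := 9 / 4 * C * C * (1 + T)).
  assert (Hh : 0 < h) by (apply Rinv_0_lt_compat; lra); assert (Eh : h * (1 + T) = 1) by (apply Rinv_l; lra).
  set (wt := fun r => (1 + / sqrt (1 + r)) + (1 - h * r)).
  assert (Hwt : forall r, 0 <= r <= T -> 1 <= wt r <= 3).
  { intros r Hr; destruct (inv_sqrt_bounds r ltac:(lra)) as [mpos mle]; unfold wt.
    assert (0 <= h * r) by (apply Rmult_le_pos; lra); assert (h * r <= h * T) by (apply Rmult_le_compat_l; lra); lra. }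
  assert (Hle : wt T * y T + - Q * RInt d 0 T <= wt 0 * y 0).
  { apply (derivative_le_integral (fun r => wt r * y r)
      (fun r => (- (1 / 2) * decay_weight r - h) * y r + wt r * dy r) d T (- Q)); [|exact Hcont| |lra]; intros r Hr.
    - apply (is_derive_mult wt y r); [|apply Hy, Hr | intros; apply Rmult_comm].
      apply (is_derive_plus (V := R_NormedModule) (fun r => 1 + / sqrt (1 + r)) (fun r => 1 - h * r));
        [apply absorbing_weight_derive; lra | auto_derive; [trivial | ring]].
    - specialize (Hdy r Hr); specialize (Hwt r Hr); set (a := sqrt (y r)) in *; set (b := sqrt (d r)) in *.
      assert (Ea : a * a = y r) by (apply sqrt_sqrt, Hnn, Hr); assert (Eb : b * b = d r) by (apply sqrt_sqrt, Hd).
      assert (Ha : 0 <= a) by apply sqrt_pos; assert (Hb : 0 <= b) by apply sqrt_pos.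
      assert (Hw := decay_weight_pos r ltac:(lra)).
      assert (young : 3 * (C * (a * b)) <= h * (a * a) + Q * (b * b)).
      { assert (Sq : 0 <= (h * a - 3 / 2 * C * b) * (h * a - 3 / 2 * C * b)) by apply Rle_0_sqr.
        apply Rmult_le_reg_l with h; [assumption|].
        replace (h * (h * (a * a) + Q * (b * b))) with (h * h * (a * a) + 9 / 4 * C * C * (h * (1 + T)) * (b * b))
          by (unfold Q; ring).
        rewrite Eh; lra. }
      rewrite <- Ea, <- Eb in *; set (g := 1 / 6 * decay_weight r * (a * a) + C * (a * b)) in *.
      assert (Hg : 0 <= g) by (unfold g; apply Rplus_le_le_0_compat; repeat apply Rmult_le_pos; lra).
      assert (wt r * dy r <= 3 * g).
      { apply Rle_trans with (wt r * g); [apply Rmult_le_compat_l; lra | apply Rmult_le_compat_r; lra]. }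
      unfold g in *; lra. }
  assert (y0 := Hnn 0 ltac:(lra)); assert (yT := Hnn T ltac:(lra)).
  assert (wt 0 * y 0 <= 3 * y 0) by (apply Rmult_le_compat_r; [exact y0 | apply Hwt; lra]).
  assert (1 * y T <= wt T * y T) by (apply Rmult_le_compat_r; [exact yT | apply Hwt; lra]); lra.
Qed.

(** * Homogeneous Sobolev norms *)

Fixpoint Hdot_sq (k : nat) (f : PField) (t : R) : R :=
  match k with O => normsq f t | S k => Hdot_sq k (D 1 f) t + Hdot_sq k (D 2 f) t + Hdot_sq k (D 3 f) t end.

Lemma Hdot_sq_nonneg k f t : 0 <= Hdot_sq k f t.
Proof.
  revert f; induction k as [|k IH]; intros f; simpl;
    [apply normsq_nonneg | repeat apply Rplus_le_le_0_compat; apply IH].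
Qed.

Lemma log_convex_add a1 b1 c1 a2 b2 c2 : 0 <= b1 -> 0 <= c1 -> 0 <= b2 -> 0 <= c2 ->
  a1 * a1 <= b1 * c1 -> a2 * a2 <= b2 * c2 -> (a1 + a2) * (a1 + a2) <= (b1 + b2) * (c1 + c2).
Proof.
  intros Hb1 Hc1 Hb2 Hc2 conv1 conv2.
  assert (P12 : 0 <= b1 * c2) by (apply Rmult_le_pos; assumption).
  assert (P21 : 0 <= b2 * c1) by (apply Rmult_le_pos; assumption).
  assert (cross : 2 * (a1 * a2) <= b1 * c2 + b2 * c1); [|lra].
  destruct (Rle_dec (a1 * a2) 0) as [L|L]; [lra|].
  apply Rsqr_incr_0_var; [|lra]; unfold Rsqr.
  assert (Hm : (a1 * a1) * (a2 * a2) <= (b1 * c1) * (b2 * c2)) by (apply Rmult_le_compat; auto; apply Rle_0_sqr).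
  assert (Sq : 0 <= (b1 * c2 - b2 * c1) * (b1 * c2 - b2 * c1)) by apply Rle_0_sqr; nra.
Qed.

Lemma Hdot_sq_1_lap f t : Hdot_sq 1 f t = - inner f (lapF f) t.
Proof. rewrite inner_lap; simpl; unfold sum3; ring. Qed.

Lemma Hdot_sq_2_lap f t : Hdot_sq 2 f t = normsq (lapF f) t.
Proof.
  assert (parts : forall i j, inner (D (S i) (D (S i) f)) (D (S j) (D (S j) f)) t = normsq (D (S j) (D (S i) f)) t).
  { intros; unfold normsq; rewrite inner_D, (D_comm (S i) (S j)), inner_sym, inner_D, Ropp_involutive.
    rewrite (D_comm (S i) (S j)); reflexivity. }
  unfold normsq at 1, lapF, Fsum3; repeat rewrite ?inner_add_l, ?inner_add_r; rewrite !parts; simpl; ring.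
Qed.

Lemma Hdot_sq_log_convex k f t : Hdot_sq (S k) f t * Hdot_sq (S k) f t <= Hdot_sq k f t * Hdot_sq (S (S k)) f t.
Proof.
  revert f; induction k as [|k IH]; intros f.
  - rewrite Hdot_sq_2_lap, Hdot_sq_1_lap; change (Hdot_sq 0 f t) with (normsq f t).
    rewrite <- (norm2_sqr f), <- (norm2_sqr (lapF f)).
    replace (- inner f (lapF f) t * - inner f (lapF f) t) with (Rabs (inner f (lapF f) t) * Rabs (inner f (lapF f) t))
      by (rewrite <- Rabs_mult, Rabs_right; [ring | apply Rle_ge, Rle_0_sqr]).
    replace (norm2 f t * norm2 f t * (norm2 (lapF f) t * norm2 (lapF f) t))
      with ((norm2 f t * norm2 (lapF f) t) * (norm2 f t * norm2 (lapF f) t)) by ring.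
    apply Rmult_le_compat; try apply Rabs_pos; apply cauchy_schwarz.
  - change (Hdot_sq (S ?j) f t) with (Hdot_sq j (D 1 f) t + Hdot_sq j (D 2 f) t + Hdot_sq j (D 3 f) t).
    assert (nn := fun j i => Hdot_sq_nonneg j (D i f) t).
    apply log_convex_add; auto using Rplus_le_le_0_compat; apply log_convex_add; auto using Rplus_le_le_0_compat.
Qed.

Lemma log_convex_skip a b c d e : 0 <= a -> 0 <= b -> 0 <= c -> 0 <= d -> 0 <= e ->
  b * b <= a * c -> c * c <= b * d -> d * d <= c * e -> c * c <= a * e.
Proof.
  intros Ha Hb Hc Hd He Hac Hbd Hce; destruct (Req_dec c 0) as [->|N];
    [assert (0 <= a * e) by (apply Rmult_le_pos; assumption); lra|].
  assert (Pc : 0 < c * c) by (apply Rmult_lt_0_compat; lra); apply Rmult_le_reg_l with (c * c); [assumption|].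
  assert (Hcc : (c * c) * (c * c) <= (b * d) * (b * d)) by (apply Rmult_le_compat; lra).
  assert (Hbbdd : (b * b) * (d * d) <= (a * c) * (c * e)) by (apply Rmult_le_compat; auto; apply Rle_0_sqr); lra.
Qed.

Lemma Hdot_sq_4_interp f t : Hdot_sq 4 f t * Hdot_sq 4 f t <= Hdot_sq 2 f t * Hdot_sq 6 f t.
Proof.
  apply (log_convex_skip _ (Hdot_sq 3 f t) _ (Hdot_sq 5 f t)); try apply Hdot_sq_nonneg; apply Hdot_sq_log_convex.
Qed.

(* If the ratio of consecutive norms exceeds [rho] once, by log-convexity it does so ever after. *)
Lemma Hdot_sq_interp m f t rho : 0 < rho -> Hdot_sq 2 f t <= rho * Hdot_sq 1 f t + (/ rho) ^ m * Hdot_sq (m + 2) f t.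
Proof.
  intros Hr; assert (nn := fun j => Hdot_sq_nonneg j f t).
  destruct (Rle_dec (Hdot_sq 2 f t) (rho * Hdot_sq 1 f t)) as [L|L].
  { assert (0 <= (/ rho) ^ m * Hdot_sq (m + 2) f t); [|lra].
    apply Rmult_le_pos; [apply pow_le; left; apply Rinv_0_lt_compat, Hr | apply nn]. }
  assert (ratio : forall k, rho * Hdot_sq (S k) f t <= Hdot_sq (S (S k)) f t).
  { induction k as [|k IH]; [lra|].
    assert (conv := Hdot_sq_log_convex (S k) f t); assert (n1 := nn (S k)); assert (n2 := nn (S (S k)));
      assert (n3 := nn (S (S (S k)))).
    destruct (Req_dec (Hdot_sq (S (S k)) f t) 0) as [Z|Z]; [rewrite Z; lra|].
    assert (p2 : 0 < Hdot_sq (S (S k)) f t) by lra; assert (p1 : 0 < Hdot_sq (S k) f t) by nra.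
    apply Rmult_le_reg_l with (Hdot_sq (S k) f t); [assumption|]; nra. }
  assert (power : forall k, rho ^ k * Hdot_sq 2 f t <= Hdot_sq (k + 2) f t).
  { induction k as [|k IH]; simpl (_ ^ _); [simpl (0 + 2)%nat; lra|].
    replace (S k + 2)%nat with (S (S (S k))) by lia; specialize (ratio (S k)).
    replace (k + 2)%nat with (S (S k)) in IH by lia; assert (0 <= rho) by lra; nra. }
  assert (Hp : 0 < rho ^ m) by (apply pow_lt, Hr); rewrite pow_inv.
  assert (Hle : Hdot_sq 2 f t <= / rho ^ m * Hdot_sq (m + 2) f t).
  { apply Rmult_le_reg_l with (rho ^ m); [assumption|]; rewrite <- Rmult_assoc, Rinv_r by lra; specialize (power m);
      lra. }
  assert (0 <= rho * Hdot_sq 1 f t) by (apply Rmult_le_pos; [lra | apply nn]); lra.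
Qed.

Lemma normsq_le_Hdot_sq w f t : ~ In 0%nat w -> normsq (Dw w f) t <= Hdot_sq (length w) f t.
Proof.
  revert f; induction w as [|k w IH]; intros f Hw; cbn [length Hdot_sq]; [apply Rle_refl|].
  change (Dw (k :: w) f) with (D k (Dw w f)); rewrite <- Dw_D.
  eapply Rle_trans; [apply IH; intros I; apply Hw; right; exact I|].
  assert (nn := fun i => Hdot_sq_nonneg (length w) (D i f) t).
  assert (n1 := nn 1%nat); assert (n2 := nn 2%nat); assert (n3 := nn 3%nat).
  destruct k as [|[|[|k]]]; [exfalso; apply Hw; left; reflexivity | lra | lra | rewrite (D_ge3 k f); lra].
Qed.

Lemma Hdot_sq_lesssim {X} (tm : X -> R) k n (f : X -> PField) (B : X -> R) : nonneg B -> (k <= n)%nat ->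
  Dw_bounded tm (order_le n) B f -> (fun s => Hdot_sq k (f s) (tm s)) <~ (fun s => B s * B s).
Proof.
  intros HB; revert n f; induction k as [|k IH]; intros n f Hk Hf; simpl.
  - apply normsq_lesssim; [assumption|]; apply (Hf []); unfold order_le; simpl; lia.
  - destruct n as [|n]; [lia|].
    assert (HD : forall i, (fun s => Hdot_sq k (D (S i) (f s)) (tm s)) <~ (fun s => B s * B s)).
    { intros i; apply (IH n (fun s => D (S i) (f s))); [lia|].
      apply (Dw_bounded_order_D tm (S n)); [simpl; lia | exact Hf]. }
    apply lesssim_add; [apply lesssim_add|]; apply HD.
Qed.

Lemma Rabs_inner_Dw w f h t : ~ In 0%nat w -> Rabs (inner f (Dw w h) t) = Rabs (inner (Dw (rev w) f) h t).
Proof.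
  revert f; induction w as [|[|k] w IH]; intros f Hw; cbn [rev]; [reflexivity | exfalso; apply Hw; left; reflexivity|].
  rewrite Dw_app; cbn [Dw fold_right]; rewrite <- IH by (intros I; apply Hw; right; assumption).
  change (fold_right D h w) with (Dw w h); rewrite inner_D_r, Rabs_Ropp, inner_sym; reflexivity.
Qed.

(** * Decay of the low-order energy *)

Section Transport.
Context {P : Coefficients}.

Definition K_nonlinear_at (i j : nat) (s : State) : PField := K_nonlinear (sol_u s) (sol_th s) (sol_K s) i j.

Lemma K_nonlinear_ind (Q : (State -> PField) -> Prop) :
  Q (fun _ => Fconst 0) -> (forall f g, Q f -> Q g -> Q (fun s => f s + g s)%fld) ->
    (forall f, Q f -> Q (fun s => - f s)%fld) ->
  (forall l k j, (l < 3)%nat -> (k < 3)%nat -> (j < 3)%nat -> Q (fun s => th_at l s * K_at k j s)%fld) ->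
  forall i j, (i < 3)%nat -> (j < 3)%nat -> Q (fun s => advF (sol_u s) (K_at i j s)) -> Q (K_nonlinear_at i j).
Proof.
  intros Qzero Qadd Qopp Qth i j Hi Hj Qadv.
  assert (Qext : forall f g : State -> PField, (forall s, f s = g s) -> Q g -> Q f).
  { intros f g E; replace f with g; [auto | apply functional_extensionality; intros; symmetry; apply E]. }
  assert (ten_K : forall a b k l, (a < 3)%nat -> (b < 3)%nat -> (k < 3)%nat -> (l < 3)%nat ->
     Q (fun s => tenF (sol_th s) a b * sol_K s k l)%fld).
  { intros a b k l Ha Hb Hk Hl.
    assert (zero : Q (fun s => Fconst 0 * sol_K s k l)%fld)
      by (apply (Qext _ (fun _ => Fconst 0)); [intros; ring | exact Qzero]).
    assert (plus : forall n, (n < 3)%nat -> Q (fun s => sol_th s n * sol_K s k l)%fld)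
      by (intros; apply (Qth n k l); assumption).
    assert (minus : forall n, (n < 3)%nat -> Q (fun s => - sol_th s n * sol_K s k l)%fld).
    { intros n Hn; apply (Qext _ (fun s => - (sol_th s n * sol_K s k l))%fld); [intros; ring | apply Qopp, plus, Hn]. }
    case_lt3 a; case_lt3 b; simpl; first [exact zero | apply plus; lia | apply minus; lia]. }
  assert (K_ten : forall a b k l, (a < 3)%nat -> (b < 3)%nat -> (k < 3)%nat -> (l < 3)%nat ->
     Q (fun s => sol_K s k l * tenF (sol_th s) a b)%fld).
  { intros a b k l Ha Hb Hk Hl; apply (Qext _ (fun s => tenF (sol_th s) a b * sol_K s k l)%fld);
      [intros; ring | apply ten_K; assumption]. }
  unfold K_nonlinear_at, K_nonlinear, commF, Fsum3, Fsub.
  apply Qadd; [apply Qadd; [|apply Qopp]|apply Qopp, Qadv]; (apply Qadd; [apply Qadd|]);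
    first [apply ten_K; lia | apply K_ten; lia].
Qed.

Lemma remainder_K_bigO w (f : State -> PField) B i j : nonneg B -> (i < 3)%nat -> (j < 3)%nat ->
  (forall l k m, (l < 3)%nat -> (k < 3)%nat -> (m < 3)%nat ->
     bigO (fun s => inner (f s) (Dw w (th_at l s * K_at k m s)%fld) (time s)) B) ->
  bigO (fun s => inner (f s) (Dw w (advF (sol_u s) (K_at i j s))) (time s)) B ->
  bigO (fun s : State => inner (f s) (remainder_K s w i j) (time s)) B.
Proof.
  intros HB Hi Hj Hth Hadv.
  apply (K_nonlinear_ind (fun h => bigO (fun s => inner (f s) (Dw w (h s)) (time s)) B)); auto.
  - apply (bigO_ext _ (fun _ => 0)); [|apply bigO_zero, HB]; intros s; rewrite Dw_zero; apply inner_0_r.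
  - intros g h Hg Hh; eapply bigO_ext; [intros s; rewrite Dw_add; apply inner_add_r | apply bigO_add; assumption].
  - intros g Hg; eapply bigO_ext; [intros s; rewrite Dw_opp; apply inner_opp_r | apply bigO_opp, Hg].
Qed.

Lemma words_transport_a_bigO N B : nonneg B ->
  (forall w i, (ord w <= N)%nat -> (i < 2)%nat ->
     bigO (fun s : State => inner (Dw w (K_at i 2 s)) (remainder_K s w i 2) (time s)) B) ->
  bigO (fun s : State => words_transport_a N s (time s)) B.
Proof.
  intros HB Ha; apply (bigO_lsum (words N) (fun w (s : State) => transport_a s w (time s))); [exact HB|].
  intros w Hw; apply words_ord in Hw; apply bigO_add; [apply (Ha w 0%nat) | apply (Ha w 1%nat)]; auto; lia.
Qed.

End Transport.

Section Low_order_decay.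
Context {P : Coefficients}.

Lemma L2_bounded_K_nonlinear i j : (i < 3)%nat -> (j < 3)%nat -> L2_bounded time (K_nonlinear_at i j) (sqrt_diss 2).
Proof.
  intros Hi Hj; assert (HM := M_ge).
  apply (K_nonlinear_ind (fun f => L2_bounded time f (sqrt_diss 2))); auto.
  - apply L2_bounded_zero, sqrt_diss_nonneg.
  - intros; apply L2_bounded_add; assumption.
  - intros; apply L2_bounded_opp; assumption.
  - intros l k m Hl Hk Hm; apply L2_bounded_mul_unit_l; [apply sqrt_diss_nonneg | |].
    + eapply sup_bounded_le; [apply (th_sup l []); [exact Hl | simpl; lia] | apply sqrt_energy_one].
    + apply (Dw_bounded_K_diss 2 k m level_low Hk Hm []); unfold order_le; simpl; lia.
  - assert (adv : forall k, (k < 3)%nat -> L2_bounded time (fun s => sol_u s k * D (S k) (K_at i j s))%fld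
      (sqrt_diss 2)).
    { intros k Hk; apply L2_bounded_mul_unit_l; [apply sqrt_diss_nonneg | |].
      + eapply sup_bounded_le; [apply (u_sup k []); [exact Hk | simpl; lia] | apply sqrt_energy_one].
      + apply (Dw_bounded_K_diss 2 i j level_low Hi Hj [S k]); unfold order_le; simpl; lia. }
    apply L2_bounded_add; [apply L2_bounded_add|]; apply adv; lia.
Qed.

Lemma L2_bounded_dt_a i : (i < 2)%nat -> L2_bounded time (fun s => D 0 (K_at i 2 s)) (sqrt_diss 2).
Proof.
  intros Hi.
  assert (th_diss : forall i, (i < 3)%nat -> L2_bounded time (th_at i) (sqrt_diss 2))
    by (intros k Hk; apply (Dw_bounded_th_diss 2 k Hk []); unfold order_le; simpl; lia).
  assert (a_diss : forall i, (i < 2)%nat -> L2_bounded time (K_at i 2) (sqrt_diss 2))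
    by (intros k Hk; apply (Dw_bounded_a_diss 2 k level_low Hk []); unfold order_le; simpl; lia).
  destruct i as [|[|i]]; [| |lia].
  - eapply L2_bounded_ext; [intros s x y z; apply (Dw_a0_equation s [] (time s) x y z (time_ok s))|].
    apply L2_bounded_add; [apply L2_bounded_sub; apply L2_bounded_scal; [apply th_diss; lia | apply a_diss; lia]|].
    apply L2_bounded_K_nonlinear; lia.
  - eapply L2_bounded_ext; [intros s x y z; apply (Dw_a1_equation s [] (time s) x y z (time_ok s))|].
    apply L2_bounded_add; [apply L2_bounded_sub; apply L2_bounded_scal; [apply a_diss; lia | apply th_diss; lia]|].
    apply L2_bounded_K_nonlinear; lia.
Qed.

Lemma time_word_order_2 w : (ord w <= 2)%nat -> In 0%nat w -> w = [0%nat].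
Proof.
  intros Hw I; destruct w as [|a [|b [|c w]]]; simpl in *.
  - destruct I.
  - destruct I as [->|[]]; reflexivity.
  - exfalso; destruct I as [E|[E|[]]]; subst; simpl in Hw; [destruct b | destruct a]; simpl in Hw; lia.
  - destruct a, b, c; simpl in Hw; lia.
Qed.

Lemma a_product_bigO w i (f g : State -> PField) : (ord w <= 2)%nat -> (i < 2)%nat ->
  Dw_bounded time (order_le 3) (sqrt_diss 2) f -> L2_bounded time g (sqrt_diss 2) ->
  sup_bounded time (fun s => D 0 (g s)) size_at ->
  bigO (fun s => inner (Dw w (K_at i 2 s)) (Dw w (f s * g s)%fld) (time s)) (fun s => size_at s * diss 2 s).
Proof.
  intros Hw Hi Hf Hg Hdg; assert (HM := M_ge).
  assert (Hsd : (fun s => size_at s * (sqrt_diss 2 s * sqrt_diss 2 s)) <~ (fun s => size_at s * diss 2 s))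
    by (apply lesssim_le; intros s; rewrite sqrt_diss_sqr; lra).
  assert (sup_a : forall v, (ord v + 3 <= 2 * M)%nat -> sup_bounded time (fun s => Dw v (K_at i 2 s)) size_at)
    by (intros v Hv; eapply sup_bounded_le; [apply K_sup; lia | apply sqrt_energy_size]).
  assert (Hnn := size_at_nonneg); assert (Hnd := sqrt_diss_nonneg 2).
  destruct (in_dec Nat.eq_dec 0%nat w) as [I|I].
  - rewrite (time_word_order_2 w Hw I).
    apply (bigO_ext _ (fun s => inner (D 0 (K_at i 2 s)) (D 0 (f s) * g s)%fld (time s)
      + inner (D 0 (g s)) (D 0 (K_at i 2 s) * f s)%fld (time s))).
    { intros s; change (Dw [0%nat] ?h) with (D 0 h); rewrite D_mul, inner_add_r; f_equal.
      replace (f s * D 0 (g s))%fld with (D 0 (g s) * f s)%fld by ring; apply inner_mul_swap. }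
    apply bigO_add; (eapply bigO_le; [|exact Hsd]).
    + apply (bigO_inner_mul time (fun s => D 0 (K_at i 2 s)) (fun s => D 0 (f s)) g); auto.
      * apply (sup_a [0%nat]); simpl; lia.
      * apply (Hf [0%nat]); unfold order_le; simpl; lia.
    + apply (bigO_inner_mul time (fun s => D 0 (g s)) (fun s => D 0 (K_at i 2 s)) f); auto.
      * apply L2_bounded_dt_a, Hi.
      * apply (Hf []); unfold order_le; simpl; lia.
  - eapply lesssim_ext; [intros s; apply (Rabs_inner_Dw w _ _ _ I)|].
    eapply bigO_le; [|exact Hsd].
    apply (bigO_inner_mul time (fun s => Dw (rev w) (Dw w (K_at i 2 s))) f g); auto;
      [|apply (Hf []); unfold order_le; simpl; lia].
    eapply sup_bounded_ext; [intros; rewrite <- Dw_app; reflexivity | apply (sup_a (rev w ++ w))].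
    rewrite ord_app, (ord_perm (rev w) w) by (symmetry; apply Permutation_rev); lia.
Qed.

Lemma low_transport_bigO : bigO (fun s : State => words_transport_a 2 s (time s)) (fun s => size_at s * diss 2 s).
Proof.
  assert (HM := M_ge).
  assert (Hnn : nonneg (fun s => size_at s * diss 2 s))
    by (apply nonneg_mul; [apply size_at_nonneg | apply diss_nonneg]).
  apply words_transport_a_bigO; [exact Hnn|]; intros w i Hw Hi.
  apply (remainder_K_bigO w (fun s => Dw w (K_at i 2 s))); try lia; [exact Hnn| |].
  - intros l k j Hl Hk Hj; apply a_product_bigO; auto.
    + apply (Dw_bounded_th_diss 2), Hl.
    + apply (Dw_bounded_K_diss 2 k j level_low Hk Hj []); unfold order_le; simpl; lia.
    + eapply sup_bounded_le; [exact (K_sup [0%nat] k j ltac:(simpl; lia) Hk Hj) | apply sqrt_energy_size].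
  - eapply bigO_ext.
    { intros s; unfold advF; rewrite Dw_Fsum3; apply inner_Fsum3_r. }
    apply (bigO_sum3 (fun k s => inner (Dw w (K_at i 2 s)) (Dw w (sol_u s k * D (S k) (K_at i 2 s))%fld) (time s))).
    intros k Hk; apply (a_product_bigO w i (u_at k) (fun s => D (S k) (K_at i 2 s))); auto.
    + apply (Dw_bounded_u_diss 2), Hk.
    + apply (Dw_bounded_a_diss 2 i level_low Hi [S k]); unfold order_le; simpl; lia.
    + eapply sup_bounded_le; [|apply sqrt_energy_size].
      exact (K_sup [0%nat; S k] i 2 ltac:(simpl; lia) ltac:(lia) ltac:(lia)).
Qed.

Lemma low_dissipation : exists c C, 0 < c /\ 0 <= C /\ forall s : State,
  lyapunov_dt 2 s (time s) <= - c * diss 2 s + C * (size_at s * diss 2 s).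
Proof.
  destruct (lyapunov_dt_le 2 level_low) as (c & C & Hc & HC & Hdt).
  destruct (bigO_lesssim _ _ (bigO_scal a_weight _ _ low_transport_bigO)) as (Ca & HCa & Ha).
  exists c, (C + Ca); split; [exact Hc|split; [lra|]].
  intros s; specialize (Hdt s); specialize (Ha s); cbv beta in Ha; lra.
Qed.

Definition a_Hdot_sq (k : nat) (s : State) : R := Hdot_sq k (K_at 0 2 s) (time s) + Hdot_sq k (K_at 1 2 s) (time s).

Lemma a_Hdot_sq_nonneg k : nonneg (a_Hdot_sq k).
Proof. intros s; apply Rplus_le_le_0_compat; apply Hdot_sq_nonneg. Qed.

Lemma a_Hdot_sq_interp m s rho : 0 < rho -> a_Hdot_sq 2 s <= rho * a_Hdot_sq 1 s + (/ rho) ^ m * a_Hdot_sq (m + 2) s.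
Proof.
  intros Hr; assert (interp0 := Hdot_sq_interp m (K_at 0 2 s) (time s) rho Hr).
  assert (interp1 := Hdot_sq_interp m (K_at 1 2 s) (time s) rho Hr); unfold a_Hdot_sq; lra.
Qed.

Lemma a_Hdot_sq_diss : a_Hdot_sq 1 <~ diss 2.
Proof.
  eapply lesssim_trans; [|apply sqrt_diss_sqr_lesssim].
  apply lesssim_add; (apply (Hdot_sq_lesssim time 1 1); [apply sqrt_diss_nonneg | lia |]);
    apply (Dw_bounded_a_diss 2); [apply level_low | lia | apply level_low | lia].
Qed.

Lemma a_Hdot_sq_energy k : (k <= 2 * M)%nat -> a_Hdot_sq k <~ energy.
Proof.
  intros Hk; eapply lesssim_trans; [|apply sqrt_energy_sqr_lesssim].
  apply lesssim_add; (apply (Hdot_sq_lesssim time k (2 * M));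
    [apply sqrt_energy_nonneg | exact Hk | apply Dw_bounded_a; lia]).
Qed.

Lemma low_words_normsq_lesssim : (fun s : State => words_normsq 2 s (time s)) <~ (fun s => diss 2 s + a_Hdot_sq 2 s).
Proof.
  set (B := fun s : State => diss 2 s + a_Hdot_sq 2 s).
  assert (Bdiss : diss 2 <~ B) by (apply lesssim_le; intros s; assert (h := a_Hdot_sq_nonneg 2 s); unfold B; lra).
  assert (HB : nonneg B) by (intros s; apply Rplus_le_le_0_compat; [apply diss_nonneg | apply a_Hdot_sq_nonneg]).
  assert (of_diss : forall f, L2_bounded time f (sqrt_diss 2) -> (fun s => normsq (f s) (time s)) <~ B).
  { intros f Hf; eapply lesssim_trans; [apply (normsq_lesssim time f); [apply sqrt_diss_nonneg | exact Hf]|].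
    eapply lesssim_trans; [apply sqrt_diss_sqr_lesssim | exact Bdiss]. }
  apply (lesssim_lsum (words 2) (fun w (s : State) => word_normsq s w (time s))); [exact HB|].
  intros w Hw; apply words_ord in Hw.
  apply (lesssim_ext _ (fun s => lsum (map (fun f => normsq (Dw w (f s)) (time s)) u_th_a_fields))); [reflexivity|].
  apply (lesssim_lsum u_th_a_fields (fun f s => normsq (Dw w (f s)) (time s))); [exact HB|].
  intros f Hf; apply in_app_or in Hf; destruct Hf as [Hf|Hf].
  { apply (of_diss (fun s => Dw w (f s))), (Dw_bounded_diss 2 f Hf); unfold order_le; lia. }
  assert (Ha : exists i, (i < 2)%nat /\ f = K_at i 2)
    by (destruct Hf as [<-|[<-|[]]]; [exists 0%nat | exists 1%nat]; auto).
  destruct Ha as (i & Hi & ->); destruct (in_dec Nat.eq_dec 0%nat w) as [I|I].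
  - rewrite (time_word_order_2 w Hw I); apply (of_diss (fun s => D 0 (K_at i 2 s))), L2_bounded_dt_a, Hi.
  - destruct (Nat.eq_dec (ord w) 2) as [Ho|Ho].
    + assert (Hlen : length w = 2%nat)
        by (clear - I Ho; destruct w as [|[|a] [|[|b] [|[|c] w]]]; simpl in *; try lia; tauto).
      apply lesssim_le; intros s; eapply Rle_trans; [apply normsq_le_Hdot_sq, I|]; rewrite Hlen; unfold B, a_Hdot_sq.
      assert (h0 := Hdot_sq_nonneg 2 (K_at 0 2 s) (time s)); assert (h1 := Hdot_sq_nonneg 2 (K_at 1 2 s) (time s)).
      assert (Hd := diss_nonneg 2 s); destruct i as [|[|i]]; [lra | lra | lia].
    + apply (of_diss (fun s => Dw w (K_at i 2 s))), (Dw_bounded_a_diss 2 i level_low Hi); unfold order_le; lia.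
Qed.

Lemma low_lyapunov_interp : exists C, 0 < C /\ forall (s : State) rho, 0 < rho ->
  lyapunov 2 s (time s) <= C * ((1 + rho) * diss 2 s + (/ rho) ^ (2 * M - 2) * energy s).
Proof.
  assert (HM := M_ge); assert (Hup := energy_upper_pos).
  destruct low_words_normsq_lesssim as (Cw & HCw & Hw); destruct a_Hdot_sq_diss as (Cd & HCd & Hd).
  destruct (a_Hdot_sq_energy (2 * M - 2 + 2) ltac:(lia)) as (Ce & HCe & He).
  set (C := energy_upper * Cw * (1 + Cd + Ce)).
  assert (HuC : 0 <= energy_upper * Cw) by (apply Rmult_le_pos; lra).
  assert (HC : 0 <= C) by (apply Rmult_le_pos; lra).
  exists (C + 1); split; [lra|]; intros s rho Hr.
  specialize (Hw s); specialize (Hd s); specialize (He s); cbv beta in Hw.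
  assert (Hint := a_Hdot_sq_interp (2 * M - 2) s rho Hr).
  set (q := (/ rho) ^ (2 * M - 2)) in *; assert (Hq : 0 <= q) by (apply pow_le; left; apply Rinv_0_lt_compat, Hr).
  set (d := diss 2 s) in *; set (e := energy s) in *.
  assert (d0 : 0 <= d) by apply diss_nonneg; assert (e0 : 0 <= e) by apply energy_nonneg.
  assert (rd : 0 <= rho * d) by (apply Rmult_le_pos; lra); assert (qe : 0 <= q * e) by (apply Rmult_le_pos; lra).
  apply Rle_trans with (C * ((1 + rho) * d + q * e)); [|apply Rmult_le_compat_r; lra].
  eapply Rle_trans; [apply lyapunov_bounds, time_ok|].
  apply Rle_trans with (energy_upper * Cw * (d + a_Hdot_sq 2 s)); [rewrite Rmult_assoc; apply Rmult_le_compat_l; lra|].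
  unfold C; rewrite (Rmult_assoc (energy_upper * Cw)); apply Rmult_le_compat_l; [exact HuC|].
  assert (rho * a_Hdot_sq 1 s <= rho * (Cd * d)) by (apply Rmult_le_compat_l; lra).
  assert (q * a_Hdot_sq (2 * M - 2 + 2) s <= q * (Ce * e)) by (apply Rmult_le_compat_l; lra).
  assert (0 <= Cd * d) by (apply Rmult_le_pos; lra); assert (0 <= Ce * d) by (apply Rmult_le_pos; lra).
  assert (0 <= Ce * (rho * d)) by (apply Rmult_le_pos; lra); assert (0 <= Cd * (q * e)) by (apply Rmult_le_pos; lra).
  lra.
Qed.

Lemma low_lyapunov_decay : exists e0 C, 0 < e0 /\ 0 < C /\ forall (S : Solution) E, sol_size S <= e0 ->
  (forall t, 0 <= t <= sol_T S -> Energy S t <= E) ->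
  forall t, 0 <= t <= sol_T S -> lyapunov 2 S t * (1 + t) ^ (2 * M - 2) <= C * (lyapunov 2 S 0 + E).
Proof.
  destruct low_dissipation as (c & C & Hc & HC & Hdiss); destruct low_lyapunov_interp as (Ci & HCi & Hint).
  destruct (algebraic_decay (c / 2) Ci (2 * M - 2) ltac:(lra) HCi) as (Cd & HCd & decay).
  exists (c / (2 * (C + 1))), Cd; split; [apply Rdiv_lt_0_compat; lra | split; [exact HCd|]].
  intros S E Hsize HE; assert (HT := sol_T_pos S).
  apply (decay (lyapunov 2 S) (lyapunov_dt 2 S) (Diss 2 S)).
  - eapply Rle_trans; [apply (Energy_nonneg S 0) | apply HE; lra].
  - apply lyapunov_nonneg.
  - apply lyapunov_derive.
  - intros r Hr; assert (Hle := Hdiss (mkState S r Hr)); unfold diss, size_at in Hle; cbn [sol time] in Hle.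
    assert (Habs := absorb_le C c (sol_size S) (Diss 2 S r) Hc HC (conj (proj1 (sol_size_bounds S)) Hsize)
      (Diss_nonneg 2 S r)).
    lra.
  - intros; apply Diss_nonneg.
  - intros r rho Hr Hrho; eapply Rle_trans; [apply (Hint (mkState S r Hr) rho Hrho)|].
    apply Rmult_le_compat_l; [lra|]; apply Rplus_le_compat_l, Rmult_le_compat_l; [|apply HE, Hr].
    apply pow_le; left; apply Rinv_0_lt_compat, Hrho.
Qed.

Lemma low_decay : exists e0 C, 0 < e0 /\ 0 < C /\ forall (S : Solution) E, sol_size S <= e0 ->
  (forall t, 0 <= t <= sol_T S -> Energy S t <= E) ->
  forall t, 0 <= t <= sol_T S -> words_normsq 2 S t * (1 + t) ^ (2 * M - 2) <= C * E.
Proof.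
  assert (HM := M_ge); assert (Hlow := energy_lower_pos); assert (Hup := energy_upper_pos).
  destruct low_lyapunov_decay as (e0 & C & He0 & HC & decay).
  destruct (words_lesssim_energy 2 ltac:(lia)) as (Cw & HCw & Hw).
  assert (HuC : 0 <= energy_upper * Cw) by (apply Rmult_le_pos; lra).
  exists e0, (/ energy_lower * (C * (energy_upper * Cw + 1))).
  split; [exact He0 | split; [apply Rmult_lt_0_compat; [apply Rinv_0_lt_compat, Hlow | apply Rmult_lt_0_compat; lra]|]].
  intros S E Hsize HE t Ht; assert (zero_ok : 0 <= 0 <= sol_T S) by lra.
  assert (Hp : 0 < (1 + t) ^ (2 * M - 2)) by (apply pow_lt; lra).
  assert (init : lyapunov 2 S 0 <= energy_upper * Cw * E).
  { eapply Rle_trans; [apply lyapunov_bounds, zero_ok|]; rewrite Rmult_assoc; apply Rmult_le_compat_l; [lra|].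
    eapply Rle_trans; [apply (Hw (mkState S 0 zero_ok))|].
    apply Rmult_le_compat_l; [exact HCw | apply (HE 0 zero_ok)]. }
  apply Rmult_le_reg_l with energy_lower; [exact Hlow|].
  replace (energy_lower * (/ energy_lower * (C * (energy_upper * Cw + 1)) * E)) with (C * (energy_upper * Cw * E + E))
    by (field; lra).
  rewrite <- Rmult_assoc; apply Rle_trans with (lyapunov 2 S t * (1 + t) ^ (2 * M - 2)).
  - apply Rmult_le_compat_r; [lra | apply lyapunov_bounds, Ht].
  - eapply Rle_trans; [apply (decay S E Hsize HE t Ht)|]; apply Rmult_le_compat_l; lra.
Qed.

End Low_order_decay.

(** * The high-order energy *)

Lemma inner_Fsum_r {A} (l : list A) (g : A -> PField) f t :
  inner f (Fsum (map g l)) t = lsum (map (fun a => inner f (g a) t) l).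
Proof.
  induction l as [|a l IH]; simpl; [apply inner_0_r | rewrite inner_add_r, IH; reflexivity].
Qed.

Lemma inner_advF_self u T f t : eq_on T (divF u) (Fconst 0) -> 0 <= t <= T -> inner f (advF u f) t = 0.
Proof.
  intros Hdiv Ht; unfold advF; rewrite inner_Fsum3_r.
  assert (parts : forall k, inner f (u k * D (S k) f)%fld t = - 1 / 2 * inner (D (S k) (u k)) (f * f)%fld t).
  { intros k; assert (E := inner_D k (u k) (f * f)%fld t); rewrite D_mul, inner_add_r in E.
    replace (f * D (S k) f)%fld with (D (S k) f * f)%fld in E by ring; rewrite inner_mul_swap.
    replace (f * D (S k) f)%fld with (D (S k) f * f)%fld by ring; lra. }
  rewrite (sum3_ext _ (fun k => - 1 / 2 * inner (D (S k) (u k)) (f * f)%fld t)) by (intros; apply parts).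
  rewrite sum3_scal, <- inner_Fsum3_l; fold (divF u).
  rewrite inner_sym, (inner_eq_on_r _ _ _ _ t Hdiv Ht), inner_0_r; ring.
Qed.

Lemma inner_Dw_advF u T f w t : eq_on T (divF u) (Fconst 0) -> 0 <= t <= T ->
  inner (Dw w f) (Dw w (advF u f)) t
  = sum3 (fun k => lsum (map (fun p => inner (Dw w f) (leibniz_term (u k) (D (S k) f) p) t) (proper_l_splits w))).
Proof.
  intros Hdiv Ht; assert (self := inner_advF_self u T (Dw w f) t Hdiv Ht); unfold advF in *.
  rewrite Dw_Fsum3, inner_Fsum3_r; rewrite inner_Fsum3_r in self.
  symmetry; rewrite <- (Rplus_0_l (sum3 _)), <- self, <- sum3_add; apply sum3_ext; intros k _.
  rewrite leibniz_commutator, inner_add_r, inner_Fsum_r, Dw_D; reflexivity.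
Qed.

Lemma word_order_1 w : ord w = 1%nat -> exists k, w = [S k].
Proof. intros Hw; destruct w as [|[|k] [|[|b] w]]; simpl in Hw; try lia; exists k; reflexivity. Qed.

Lemma Hdot_sq_lesssim_mul {X} (tm : X -> R) (f : X -> PField) (A B : X -> R) k : nonneg A -> nonneg B ->
  Dw_bounded tm (order_le 2) A f -> Dw_bounded tm (order_le 6) B f -> (k <= 4)%nat ->
  (fun s => Hdot_sq k (f s) (tm s)) <~ (fun s => A s * B s).
Proof.
  intros HA HB HfA HfB Hk.
  assert (low : forall j, (j <= 2)%nat -> (fun s => Hdot_sq j (f s) (tm s)) <~ (fun s => A s * A s))
    by (intros; apply (Hdot_sq_lesssim tm j 2); assumption).
  assert (high : forall j, (j <= 6)%nat -> (fun s => Hdot_sq j (f s) (tm s)) <~ (fun s => B s * B s))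
    by (intros; apply (Hdot_sq_lesssim tm j 6); assumption).
  assert (prod : forall a b, (a <= 2)%nat -> (b <= 6)%nat ->
    (fun s => Hdot_sq a (f s) (tm s) * Hdot_sq b (f s) (tm s)) <~ (fun s => (A s * B s) * (A s * B s))).
  { intros a b Ha Hb; eapply lesssim_trans; [apply lesssim_mul; [| |apply low, Ha | apply high, Hb];
      intros s; apply Hdot_sq_nonneg | apply lesssim_le; intros s; lra]. }
  apply lesssim_of_sqr; [intros s; apply Hdot_sq_nonneg | apply nonneg_mul; assumption|].
  destruct (Nat.le_gt_cases k 2) as [L|L]; [apply prod; lia|].
  assert (Hk' : k = 3%nat \/ k = 4%nat) by lia; destruct Hk' as [-> | ->].
  - eapply lesssim_trans; [|apply (prod 2%nat 4%nat); lia]; apply lesssim_le; intros s; apply (Hdot_sq_log_convex 2).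
  - eapply lesssim_trans; [|apply (prod 2%nat 6%nat); lia]; apply lesssim_le; intros s; apply Hdot_sq_4_interp.
Qed.

Section Transport_estimates.
Context {P : Coefficients}.

(* An H^4 norm: it decays faster than 1/t, hence integrably, and controls in the sup norm the coefficients of the
   transport terms that are not dissipated. *)
Definition lownorm_sq (s : State) : R :=
  lsum (map (fun f => sum_f_R0 (fun k => Hdot_sq k (f s) (time s)) 4) u_th_fields).
Definition lownorm (s : State) : R := sqrt (lownorm_sq s).

Lemma Hdot_sq_le_lownorm_sq f k s : In f u_th_fields -> (k <= 4)%nat -> Hdot_sq k (f s) (time s) <= lownorm_sq s.
Proof.
  intros Hf Hk; apply Rle_trans with (sum_f_R0 (fun k => Hdot_sq k (f s) (time s)) 4).
  - apply (sum_f_R0_term_le _ 4 k); [intros; apply Hdot_sq_nonneg | exact Hk | apply Rle_refl].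
  - apply (lsum_term u_th_fields (fun f => sum_f_R0 (fun k => Hdot_sq k (f s) (time s)) 4)); [|exact Hf].
    intros g; apply cond_pos_sum; intros; apply Hdot_sq_nonneg.
Qed.

Lemma lownorm_sq_nonneg : nonneg lownorm_sq.
Proof. intros s; apply lsum_nonneg; intros; apply cond_pos_sum; intros; apply Hdot_sq_nonneg. Qed.
Lemma lownorm_nonneg : nonneg lownorm.
Proof. intros s; apply sqrt_pos. Qed.

Lemma sup_bounded_lownorm f w : In f u_th_fields -> ~ In 0%nat w -> (length w <= 1)%nat ->
  sup_bounded time (fun s => Dw w (f s)) lownorm.
Proof.
  intros Hf Hw Hl; apply sup_bounded_sobolev; [apply lownorm_nonneg|]; intros v Hv.
  apply (L2_bounded_ext time _ (fun s => Dw (v ++ w) (f s))); [intros; rewrite Dw_app; reflexivity|].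
  apply L2_bounded_sqrt; [apply lownorm_sq_nonneg|]; apply lesssim_le; intros s.
  assert (Lv : (length v <= 3)%nat /\ ~ In 0%nat v)
    by (clear - Hv; repeat (destruct Hv as [<-|Hv]; [simpl; split; [lia | intuition discriminate]|]); destruct Hv).
  eapply Rle_trans; [apply normsq_le_Hdot_sq; intros I; apply in_app_or in I; tauto|].
  apply Hdot_sq_le_lownorm_sq; [exact Hf | rewrite length_app; lia].
Qed.

Lemma lownorm_sq_lesssim : lownorm_sq <~ (fun s => sqrt_words_normsq 2 s * sqrt_energy s).
Proof.
  assert (HM := M_ge).
  apply (lesssim_lsum u_th_fields (fun f s => sum_f_R0 (fun k => Hdot_sq k (f s) (time s)) 4));
    [apply nonneg_mul; [apply sqrt_words_normsq_nonneg | apply sqrt_energy_nonneg]|].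
  intros f Hf; apply (lesssim_sum_f_R0 (fun k s => Hdot_sq k (f s) (time s))); intros k Hk.
  assert (Hf' : In f u_th_a_fields) by (apply in_or_app; left; exact Hf).
  apply Hdot_sq_lesssim_mul; auto using sqrt_words_normsq_nonneg, sqrt_energy_nonneg, Dw_bounded_words_normsq.
  - apply (Dw_bounded_mono time (2 * M)); [lia | apply Dw_bounded_energy, Hf'].
Qed.

Definition transport_error (A B : State -> R) (s : State) : R := lownorm s * (A s * A s) + A s * B s.

Lemma transport_error_nonneg A B : nonneg A -> nonneg B -> nonneg (transport_error A B).
Proof.
  intros HA HB s; apply Rplus_le_le_0_compat; repeat apply Rmult_le_pos; auto; apply lownorm_nonneg.
Qed.

Lemma transport_error_lownorm A B : nonneg A -> nonneg B -> (fun s => lownorm s * (A s * A s)) <~ transport_error A B.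
Proof.
  intros HA HB; apply lesssim_le; intros s; assert (0 <= A s * B s) by (apply Rmult_le_pos; auto);
    unfold transport_error; lra.
Qed.

Lemma transport_error_mul A B : nonneg A -> (fun s => A s * B s) <~ transport_error A B.
Proof.
  intros HA; apply lesssim_le; intros s; unfold transport_error.
  assert (0 <= lownorm s * (A s * A s)) by (repeat apply Rmult_le_pos; auto; apply lownorm_nonneg); lra.
Qed.

Lemma rotation_bigO w (A B : State -> R) (f : State -> PField) l k m : nonneg A -> nonneg B -> (l < 3)%nat ->
  L2_bounded time f A -> L2_bounded time (fun s => Dw w (K_at k m s)) A ->
  L2_bounded time (fun s => Dw w (th_at l s * K_at k m s) - th_at l s * Dw w (K_at k m s))%fld B ->
  bigO (fun s => inner (f s) (Dw w (th_at l s * K_at k m s)%fld) (time s)) (transport_error A B).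
Proof.
  intros HA HB Hl Hf HK Hcomm.
  apply (bigO_ext _ (fun s => inner (th_at l s) (f s * Dw w (K_at k m s))%fld (time s)
    + inner (f s) (Dw w (th_at l s * K_at k m s) - th_at l s * Dw w (K_at k m s))%fld (time s))).
  { intros s; rewrite (inner_mul_swap (th_at l s)), <- inner_add_r; f_equal; ring. }
  apply bigO_add; [eapply bigO_le; [|apply transport_error_lownorm; assumption]
                  |eapply bigO_le; [|apply transport_error_mul; assumption]].
  - apply (bigO_inner_mul time (th_at l) f (fun s => Dw w (K_at k m s))); auto using lownorm_nonneg.
    apply (sup_bounded_lownorm (th_at l) []); [apply in_u_th_fields, Hl | intros [] | simpl; lia].
  - apply (bigO_inner time f (fun s => Dw w (th_at l s * K_at k m s) - th_at l s * Dw w (K_at k m s))%fld); assumption.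
Qed.

(* Only the terms where exactly one derivative falls on the velocity need pointwise decay. *)
Lemma advection_bigO w (A B : State -> R) (f : State -> PField) : nonneg A -> nonneg B ->
  L2_bounded time (fun s => Dw w (f s)) A ->
  (forall p k, In p (proper_l_splits w) -> ord (fst p) = 1%nat -> (k < 3)%nat ->
     L2_bounded time (fun s => Dw (S k :: snd p) (f s)) A) ->
  (forall p k, In p (proper_l_splits w) -> (2 <= ord (fst p))%nat -> (k < 3)%nat ->
     L2_bounded time (fun s => leibniz_term (u_at k s) (D (S k) (f s)) p) B) ->
  bigO (fun s => inner (Dw w (f s)) (Dw w (advF (sol_u s) (f s))) (time s)) (transport_error A B).
Proof.
  intros HA HB Hf Hone Hrest; assert (Herr := transport_error_nonneg A B HA HB).
  eapply bigO_ext; [intros s; apply (inner_Dw_advF (sol_u s) (sol_T s)); [apply sol_divergence | apply time_ok]|].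
  apply (bigO_sum3 (fun k s => lsum (map
    (fun p => inner (Dw w (f s)) (leibniz_term (sol_u s k) (D (S k) (f s)) p) (time s)) (proper_l_splits w)))).
  intros k Hk; apply (bigO_lsum (proper_l_splits w)
    (fun p s => inner (Dw w (f s)) (leibniz_term (sol_u s k) (D (S k) (f s)) p) (time s))); [exact Herr|]; intros p Hp.
  destruct (Nat.eq_dec (ord (fst p)) 1) as [Hord|Hord].
  - destruct (word_order_1 _ Hord) as (m & Em); eapply bigO_le; [|apply transport_error_lownorm; assumption].
    apply (bigO_ext _ (fun s => inner (D (S m) (u_at k s)) (Dw w (f s) * Dw (snd p) (D (S k) (f s)))%fld (time s))).
    { intros s; unfold leibniz_term; rewrite Em; apply inner_mul_swap. }
    apply (bigO_inner_mul time (fun s => D (S m) (u_at k s)) (fun s => Dw w (f s))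
      (fun s => Dw (snd p) (D (S k) (f s))));
      auto using lownorm_nonneg.
    + apply (sup_bounded_lownorm (u_at k) [S m]); [apply in_u_th_fields, Hk | intros [|[]]; discriminate | simpl; lia].
    + apply (L2_bounded_ext time _ (fun s => Dw (S k :: snd p) (f s)));
        [intros; rewrite Dw_D; reflexivity | apply Hone; assumption].
  - assert (Hge := proj2 (proper_l_splits_in _ _ Hp)); eapply bigO_le; [|apply transport_error_mul; assumption].
    apply (bigO_inner time (fun s => Dw w (f s)) (fun s => leibniz_term (u_at k s) (D (S k) (f s)) p)); auto.
    apply Hrest; auto; lia.
Qed.

End Transport_estimates.

Section High_order_energy.
Context {P : Coefficients}.

Definition high_error (s : State) : R := lownorm s * energy s + size_at s * diss (2 * M) s.

Lemma high_error_nonneg : nonneg high_error.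
Proof.
  intros s; apply Rplus_le_le_0_compat; apply Rmult_le_pos;
    [apply lownorm_nonneg | apply energy_nonneg | apply size_at_nonneg | apply diss_nonneg].
Qed.

Lemma transport_error_high :
  transport_error sqrt_energy (fun s => sqrt_diss (2 * M) s * sqrt_diss (2 * M) s) <~ high_error.
Proof.
  apply lesssim_le; intros s; unfold transport_error, high_error; rewrite sqrt_energy_sqr, sqrt_diss_sqr.
  apply Rplus_le_compat_l, Rmult_le_compat_r; [apply diss_nonneg | apply sqrt_energy_le_size].
Qed.

Lemma high_transport_bigO : bigO (fun s : State => words_transport_a (2 * M) s (time s)) high_error.
Proof.
  assert (HM := M_ge); assert (Hse := sqrt_energy_nonneg).
  assert (Hsd := sqrt_diss_nonneg (2 * M)); assert (Hdd := nonneg_mul _ _ Hsd Hsd).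
  apply words_transport_a_bigO; [apply high_error_nonneg|]; intros w i Hw Hi; eapply bigO_le;
    [|apply transport_error_high].
  assert (Ha := Dw_bounded_a i Hi).
  apply (remainder_K_bigO w (fun s => Dw w (K_at i 2 s))); [apply transport_error_nonneg; assumption | lia | lia | |].
  - intros l k m Hl Hk Hm; apply rotation_bigO;
      [exact Hse | exact Hdd | exact Hl | exact (Ha w Hw) | exact (Dw_bounded_K k m Hk Hm w Hw)|].
    apply (commutator_L2_bounded time (2 * M + 1) (2 * M - 1)); [exact Hsd | exact Hsd | apply Dw_bounded_th_diss, Hl
      | exact (Dw_bounded_K_diss (2 * M) k m level_high Hk Hm) | intros; lia].
  - apply advection_bigO; [exact Hse | exact Hdd | exact (Ha w Hw) | |]; intros p k Hp Ho Hk;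
      apply proper_l_splits_in in Hp; destruct Hp as [Hp _]; assert (Hs := splits_ord w p Hp).
    + apply Ha; unfold order_le; simpl; lia.
    + apply (L2_bounded_leibniz_term time (2 * M + 1) (2 * M - 2) _ _ (u_at k) (fun s => D (S k) (K_at i 2 s))).
      * exact Hsd.
      * exact Hsd.
      * apply Dw_bounded_u_diss, Hk.
      * apply (Dw_bounded_order_D time (2 * M - 1) (2 * M - 2) _ (S k) (K_at i 2));
          [simpl; lia | apply Dw_bounded_a_diss; [apply level_high | exact Hi]].
      * lia.
Qed.

Lemma high_dissipation : exists c C, 0 < c /\ 0 <= C /\ forall s : State,
  lyapunov_dt (2 * M) s (time s)
    <= - c * diss (2 * M) s + C * (size_at s * diss (2 * M) s) + C * (lownorm s * energy s).
Proof.
  destruct (lyapunov_dt_le (2 * M) level_high) as (c & C & Hc & HC & Hdt).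
  destruct (bigO_lesssim _ _ (bigO_scal a_weight _ _ high_transport_bigO)) as (Ca & HCa & Ha).
  exists c, (C + Ca); split; [exact Hc|split; [lra|]]; intros s; specialize (Hdt s); specialize (Ha s);
    unfold high_error in Ha.
  assert (0 <= C * (lownorm s * energy s))
    by (apply Rmult_le_pos; [exact HC | apply Rmult_le_pos; [apply lownorm_nonneg | apply energy_nonneg]]); lra.
Qed.

Definition lesssim_small (A B : State -> R) : Prop :=
  exists e0 C, 0 < e0 /\ 0 <= C /\ forall s : State, size_at s <= e0 -> A s <= C * B s.

Lemma lownorm_sq_decay : lesssim_small (fun s => lownorm_sq s * (1 + time s) ^ 3) (fun s => size_at s * size_at s).
Proof.
  destruct low_decay as (e0 & Cd & He0 & HCd & decay); destruct lownorm_sq_lesssim as (Ci & HCi & interp);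
    assert (HM := M_ge).
  exists e0, (Ci * sqrt Cd); split; [exact He0 | split; [apply Rmult_le_pos; [exact HCi | apply sqrt_pos]|]].
  intros s Hs; assert (Ht := time_ok s); assert (Hsize := size_at_nonneg s).
  assert (Hp : 0 <= (1 + time s) ^ 3) by (apply pow_le; lra).
  assert (Hlow : sqrt_words_normsq 2 s * (1 + time s) ^ 3 <= sqrt Cd * size_at s).
  { rewrite <- (sqrt_square ((1 + time s) ^ 3)), <- (sqrt_square (size_at s)) by assumption.
    assert (Hw := words_normsq_nonneg 2 s (time s)); assert (Hss := Rmult_le_pos _ _ Hsize Hsize).
    unfold sqrt_words_normsq; rewrite <- !sqrt_mult by (try apply Rmult_le_pos; lra); apply sqrt_le_1_alt.
    rewrite <- pow_add; eapply Rle_trans; [|apply (decay s _ Hs (fun t Ht => sol_energy s t Ht) (time s) Ht)].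
    apply Rmult_le_compat_l; [exact Hw | apply Rle_pow; [lra | lia]]. }
  apply Rle_trans with (Ci * ((sqrt_words_normsq 2 s * (1 + time s) ^ 3) * sqrt_energy s)).
  - replace (Ci * (sqrt_words_normsq 2 s * (1 + time s) ^ 3 * sqrt_energy s))
      with (Ci * (sqrt_words_normsq 2 s * sqrt_energy s) * (1 + time s) ^ 3) by ring.
    apply Rmult_le_compat_r; [exact Hp | apply interp].
  - rewrite (Rmult_assoc Ci), <- (Rmult_assoc (sqrt Cd)); apply Rmult_le_compat_l; [exact HCi|].
    apply Rmult_le_compat; [apply Rmult_le_pos; [apply sqrt_words_normsq_nonneg | exact Hp] | apply sqrt_energy_nonneg
                           |exact Hlow | apply sqrt_energy_le_size].
Qed.

Lemma lownorm_decay : lesssim_small lownorm (fun s => size_at s * decay_weight (time s)).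
Proof.
  destruct lownorm_sq_decay as (e0 & C & He0 & HC & decay); exists e0, (sqrt C); split;
    [exact He0 | split; [apply sqrt_pos|]].
  intros s Hs; specialize (decay s Hs); assert (Ht := time_ok s); assert (Hsize := size_at_nonneg s).
  assert (Hweight : 0 < (1 + time s) * sqrt (1 + time s)) by (apply Rmult_lt_0_compat; [lra | apply sqrt_lt_R0; lra]).
  apply Rmult_le_reg_r with ((1 + time s) * sqrt (1 + time s)); [exact Hweight|].
  unfold decay_weight; rewrite !Rmult_assoc, Rinv_l, Rmult_1_r by lra.
  rewrite <- (sqrt_square (1 + time s)) at 1 by lra; rewrite <- (sqrt_square (size_at s)) by exact Hsize.
  unfold lownorm; rewrite <- !sqrt_mult by (repeat apply Rmult_le_pos; try apply lownorm_sq_nonneg; lra).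
  apply sqrt_le_1_alt; eapply Rle_trans; [|exact decay]; apply Req_le; ring.
Qed.

Lemma energy_lesssim_lyapunov : energy <~ (fun s : State => lyapunov (2 * M) s (time s)).
Proof.
  eapply lesssim_trans; [apply energy_lesssim_words|]; assert (Hl := energy_lower_pos).
  exists (/ energy_lower); split; [left; apply Rinv_0_lt_compat, Hl|]; intros s.
  apply Rmult_le_reg_l with energy_lower; [exact Hl|]; rewrite <- Rmult_assoc, Rinv_r, Rmult_1_l by lra.
  apply lyapunov_bounds, time_ok.
Qed.

Lemma lyapunov_lesssim_energy : (fun s : State => lyapunov (2 * M) s (time s)) <~ energy.
Proof.
  eapply lesssim_trans; [|apply (words_lesssim_energy (2 * M)); lia].
  exists energy_upper; split; [left; apply energy_upper_pos|]; intros s; apply lyapunov_bounds, time_ok.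
Qed.

Lemma high_lyapunov_dt_le : exists e0 c, 0 < e0 /\ 0 < c /\ forall s : State, size_at s <= e0 ->
  lyapunov_dt (2 * M) s (time s) <= - c * diss (2 * M) s + 1 / 4 * decay_weight (time s) * lyapunov (2 * M) s (time s).
Proof.
  destruct high_dissipation as (c & C & Hc & HC & Hdt); destruct lownorm_decay as (e1 & Cd & He1 & HCd & decay).
  destruct energy_lesssim_lyapunov as (Ce & HCe & Hen); set (C' := C * Cd * Ce).
  assert (HC' : 0 <= C') by (repeat apply Rmult_le_pos; assumption).
  set (e2 := c / (2 * (C + 1))); set (e3 := 1 / 2 / (2 * (C' + 1))).
  assert (He2 : 0 < e2) by (apply Rdiv_lt_0_compat; lra); assert (He3 : 0 < e3) by (apply Rdiv_lt_0_compat; lra).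
  exists (Rmin e1 (Rmin e2 e3)), (c / 2); split; [repeat apply Rmin_pos; assumption | split; [lra|]].
  intros s Hs; assert (Hsize := size_at_nonneg s).
  assert (min1 := Rmin_l e1 (Rmin e2 e3)); assert (min23 := Rmin_r e1 (Rmin e2 e3)).
  assert (min2 := Rmin_l e2 e3); assert (min3 := Rmin_r e2 e3).
  specialize (Hdt s); specialize (decay s ltac:(lra)); specialize (Hen s); cbv beta in Hen.
  set (y := lyapunov (2 * M) s (time s)) in *; assert (Hy : 0 <= y) by apply lyapunov_nonneg, time_ok.
  set (wt := decay_weight (time s)) in *; assert (Hwt : 0 < wt) by (apply decay_weight_pos, time_ok).
  assert (absorb_diss : C * (size_at s * diss (2 * M) s) <= c / 2 * diss (2 * M) s)
    by (apply absorb_le; [exact Hc | exact HC | fold e2; lra | apply diss_nonneg]).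
  assert (absorb_lownorm : C * (lownorm s * energy s) <= 1 / 2 / 2 * (wt * y)).
  { apply Rle_trans with (C * ((Cd * (size_at s * wt)) * (Ce * y))).
    - apply Rmult_le_compat_l; [exact HC|].
      apply Rmult_le_compat; [apply lownorm_nonneg | apply energy_nonneg | exact decay | exact Hen].
    - replace (C * (Cd * (size_at s * wt) * (Ce * y))) with (C' * (size_at s * (wt * y))) by (unfold C'; ring).
      apply absorb_le; [lra | exact HC' | fold e3; lra | apply Rmult_le_pos; lra]. }
  lra.
Qed.

Lemma RInt_Diss_nonneg N S t : 0 <= t -> 0 <= RInt (Diss N S) 0 t.
Proof. intros Ht; apply RInt_ge_0; [exact Ht | apply ex_RInt_cont, Diss_continuous | intros; apply Diss_nonneg]. Qed.

Lemma high_energy :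
  lesssim_small (fun s => energy s + RInt (Diss (2 * M) s) 0 (time s)) (fun s => Energy s 0).
Proof.
  destruct high_lyapunov_dt_le as (e0 & c & He0 & Hc & Hdt).
  destruct energy_lesssim_lyapunov as (Ce & HCe & Hen); destruct lyapunov_lesssim_energy as (Cy & HCy & Hlyap).
  assert (Hc' : 0 < / c) by (apply Rinv_0_lt_compat, Hc).
  exists e0, ((Ce + / c) * (2 * Cy)); split; [exact He0 | split; [apply Rmult_le_pos; lra|]].
  intros [S t Ht] Hsize; assert (zero_ok : 0 <= 0 <= sol_T S) by lra; unfold energy; cbn [sol time].
  assert (gronwall := integrable_gronwall (lyapunov (2 * M) S) (lyapunov_dt (2 * M) S) (Diss (2 * M) S) (sol_T S) c
    ltac:(lra) (lyapunov_derive (2 * M) S) (lyapunov_nonneg (2 * M) S) (Diss_continuous (2 * M) S)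
    (Diss_nonneg (2 * M) S) (fun r Hr => Hdt (mkState S r Hr) Hsize) t Ht).
  assert (energy_le := Hen (mkState S t Ht)); assert (lyapunov_le := Hlyap (mkState S 0 zero_ok));
    unfold energy in energy_le, lyapunov_le; cbn [sol time] in energy_le, lyapunov_le.
  set (I := RInt (Diss (2 * M) S) 0 t) in *.
  assert (HI : 0 <= I) by (apply RInt_Diss_nonneg; lra).
  assert (Hy := lyapunov_nonneg (2 * M) S t Ht); set (y := lyapunov (2 * M) S) in *.
  assert (HcI : 0 <= c * I) by (apply Rmult_le_pos; lra).
  assert (energy_t : Energy S t <= Ce * (2 * y 0))
    by (eapply Rle_trans; [exact energy_le | apply Rmult_le_compat_l; lra]).
  assert (diss_t : I <= / c * (2 * y 0)).
  { apply Rmult_le_reg_l with c; [exact Hc|]; rewrite <- Rmult_assoc, Rinv_r, Rmult_1_l by lra; lra. }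
  apply Rle_trans with ((Ce + / c) * (2 * y 0)); [lra|].
  rewrite (Rmult_assoc _ (2 * Cy)), (Rmult_assoc 2); apply Rmult_le_compat_l; lra.
Qed.

End High_order_energy.

(** * Time derivatives of the inertia tensor *)

Fixpoint time_count (w : list nat) : nat :=
  match w with [] => O | O :: w => S (time_count w) | S _ :: w => time_count w end.
Fixpoint space_count (w : list nat) : nat :=
  match w with [] => O | O :: w => space_count w | S _ :: w => S (space_count w) end.

Lemma ord_counts w : ord w = (2 * time_count w + space_count w)%nat.
Proof. induction w as [|[|k] w IH]; simpl; lia. Qed.

Lemma time_count_perm w w' : Permutation w w' -> time_count w = time_count w'.
Proof. intros H; induction H as [|x| x y|]; simpl; try (destruct x); try (destruct y); congruence. Qed.

Lemma time_count_app w w' : time_count (w ++ w') = (time_count w + time_count w')%nat.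
Proof. induction w as [|[|k] w IH]; simpl; lia. Qed.

Lemma time_count_repeat n : time_count (repeat 0%nat n) = n.
Proof. induction n; simpl; lia. Qed.

Lemma time_count_spatial w : ~ In 0%nat w -> time_count w = 0%nat.
Proof.
  induction w as [|[|k] w IH]; simpl; intros H; [reflexivity | exfalso; apply H; left; reflexivity | apply IH; tauto].
Qed.

Lemma extract_time w : (0 < time_count w)%nat -> exists v, Permutation w (0%nat :: v).
Proof.
  induction w as [|[|k] w IH]; simpl; intros Hw; [lia | exists w; reflexivity|].
  destruct (IH Hw) as (v & Hv); exists (S k :: v); rewrite Hv; apply perm_swap.
Qed.

Lemma splits_time_count w p : In p (splits w) -> (time_count (fst p) + time_count (snd p) = time_count w)%nat.
Proof. intros Hp; rewrite <- time_count_app; apply time_count_perm, splits_perm, Hp. Qed.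

Definition mixed (n r : nat) (w : list nat) : Prop := time_count w = n /\ (space_count w <= r)%nat.

Section Mixed_derivatives.
Context {P : Coefficients}.

Definition K_mixed_bounded (n r : nat) (B : State -> R) : Prop :=
  forall i j, (i < 3)%nat -> (j < 3)%nat -> Dw_bounded time (mixed n r) B (K_at i j).

Lemma K_mixed_bounded_mono n r r' B : (r' <= r)%nat -> K_mixed_bounded n r B -> K_mixed_bounded n r' B.
Proof. intros Hr HK i j Hi Hj; apply (Dw_bounded_incl time (mixed n r));
  [unfold mixed; intros; lia | apply HK; assumption]. Qed.

Lemma K_mixed_bounded_of_order n B : (forall i j, (i < 3)%nat -> (j < 3)%nat ->
  Dw_bounded time (order_le n) B (K_at i j)) ->
  K_mixed_bounded 0 n B.
Proof.
  intros HK i j Hi Hj; apply (Dw_bounded_incl time (order_le n)); [|apply HK; assumption].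
  intros w [Ht Hx]; unfold order_le; rewrite ord_counts; lia.
Qed.

Lemma Dw_bounded_commF_omegaF Q B i j : (i < 3)%nat -> (j < 3)%nat ->
  (forall k l, (k < 3)%nat -> (l < 3)%nat -> Dw_bounded time Q B (K_at k l)) ->
  Dw_bounded time Q B (fun s => commF (tenF omegaF) (sol_K s) i j).
Proof.
  intros Hi Hj HQ; apply Dw_bounded_sub.
  - apply (Dw_bounded_Fsum3 time _ _ (fun k s => tenF omegaF i k * sol_K s k j)%fld); intros k Hk.
    rewrite tenF_omegaF; apply Dw_bounded_scal, HQ; assumption.
  - apply (Dw_bounded_Fsum3 time _ _ (fun k s => sol_K s i k * tenF omegaF k j)%fld); intros k Hk; rewrite tenF_omegaF.
    eapply Dw_bounded_ext; [intros s; apply (Rmul_comm PField_ring_theory)|]; apply Dw_bounded_scal, HQ; assumption.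
Qed.

Lemma Dw_bounded_tenF Q B (v : State -> nat -> PField) i j : nonneg B ->
  (forall k, (k < 3)%nat -> Dw_bounded time Q B (fun s => v s k)) ->
  Dw_bounded time Q B (fun s => tenF (v s) i j).
Proof.
  intros HB Hv; destruct i as [|[|[|i]]]; destruct j as [|[|[|j]]]; cbn [tenF];
    lazymatch goal with
    | |- Dw_bounded _ _ _ (fun s => - _)%fld => apply Dw_bounded_opp, Hv; lia
    | |- Dw_bounded _ _ _ (fun s => Fconst 0) => exact (Dw_bounded_zero time Q B HB)
    | _ => apply Hv; lia
    end.
Qed.

Section Step.
Context (n r N : nat) (B : State -> R) (HB : nonneg B) (Hnr : (2 * n + r <= N)%nat) (HN : (N <= 2 * M + 1)%nat).
Context (Hu : forall i, (i < 3)%nat -> Dw_bounded time (order_le N) B (u_at i)).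
Context (Hth : forall i, (i < 3)%nat -> Dw_bounded time (order_le N) B (th_at i)).
Context (HK : forall m, (m <= n)%nat -> K_mixed_bounded m (r + 1) B).

Lemma Dw_bounded_mixed_mul (f g : State -> PField) : Dw_bounded time (order_le N) B f ->
  (forall w, (ord w + 3 <= 2 * M)%nat -> sup_bounded time (fun s => Dw w (f s)) sqrt_energy) ->
  (forall w, (ord w + 4 <= 2 * M)%nat -> sup_bounded time (fun s => Dw w (g s)) sqrt_energy) ->
  (forall m, (m <= n)%nat -> Dw_bounded time (mixed m r) B g) ->
  Dw_bounded time (mixed n r) B (fun s => f s * g s)%fld.
Proof.
  intros Hf Hfs Hgs Hg w [Ht Hx]; assert (HM := M_ge).
  apply (L2_bounded_ext time _ (fun s => Fsum (map (fun p => leibniz_term (f s) (g s) p) (splits w))));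
    [intros; rewrite leibniz; reflexivity|].
  apply (L2_bounded_Fsum time (splits w) (fun p s => leibniz_term (f s) (g s) p)); [assumption|]; intros p Hp.
  assert (Ho := splits_ord w p Hp); assert (Htp := splits_time_count w p Hp); rewrite !ord_counts in Ho.
  destruct (Nat.le_gt_cases (ord (fst p) + 3) (2 * M)) as [L|L].
  - apply L2_bounded_mul_unit_l; [exact HB | eapply sup_bounded_le; [apply Hfs, L | apply sqrt_energy_one]|].
    apply (Hg (time_count (snd p))); [lia | split; [reflexivity | lia]].
  - rewrite ord_counts in L; apply L2_bounded_mul_unit_r;
      [exact HB | apply Hf; unfold order_le; rewrite ord_counts; lia|].
    eapply sup_bounded_le; [apply Hgs; rewrite ord_counts; lia | apply sqrt_energy_one].
Qed.

Lemma Dw_bounded_mixed_K_nonlinear i j : (i < 3)%nat -> (j < 3)%nat ->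
  Dw_bounded time (mixed n r) B (K_nonlinear_at i j).
Proof.
  intros Hi Hj; apply K_nonlinear_ind; auto.
  - apply Dw_bounded_zero, HB.
  - apply Dw_bounded_add.
  - apply Dw_bounded_opp.
  - intros l k m Hl Hk Hm; apply Dw_bounded_mixed_mul; auto.
    + intros w Hw; apply th_sup; assumption.
    + intros w Hw; apply K_sup; auto; lia.
    + intros q Hq; apply (K_mixed_bounded_mono q (r + 1) r B ltac:(lia) (HK q Hq) k m Hk Hm).
  - apply (Dw_bounded_Fsum3 time _ _ (fun k s => sol_u s k * D (S k) (K_at i j s))%fld); intros k Hk.
    apply (Dw_bounded_mixed_mul (u_at k) (fun s => D (S k) (K_at i j s))); auto.
    + intros w Hw; apply u_sup; assumption.
    + intros w Hw; apply (sup_bounded_ext time _ (fun s => Dw (w ++ [S k]) (K_at i j s)));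
        [intros; rewrite Dw_app; reflexivity|].
      apply K_sup; auto; rewrite ord_app; simpl; lia.
    + intros q Hq; apply (Dw_bounded_D time (mixed q (r + 1))); [|apply HK; assumption].
      intros w [Ht Hx]; split; simpl; lia.
Qed.

(* The transport equation trades a time derivative of [K] for a single space derivative, not two as in the parabolic
   count. *)
Lemma K_mixed_bounded_step : K_mixed_bounded (S n) r B.
Proof.
  intros i j Hi Hj w [Ht Hx].
  assert (Kn : forall k l, (k < 3)%nat -> (l < 3)%nat -> Dw_bounded time (mixed n r) B (K_at k l))
    by (intros k l Hk Hl; apply (K_mixed_bounded_mono n (r + 1) r B ltac:(lia) (HK n (le_n n)) k l Hk Hl)).
  assert (dt_K : Dw_bounded time (mixed n r) B (fun s => D 0 (K_at i j s))).
  { eapply Dw_bounded_eq_on; [intros s; apply (sol_inertia s i j Hi Hj)|].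
    apply Dw_bounded_add; [apply Dw_bounded_add|].
    - apply Dw_bounded_commF_omegaF; assumption.
    - eapply Dw_bounded_ext; [intros s; apply commF_tenF_Jeq; assumption|].
      apply Dw_bounded_scal, (Dw_bounded_tenF _ _ (fun s => sol_th s)); [exact HB|]; intros k Hk.
      apply (Dw_bounded_incl time (order_le N)); [|apply Hth, Hk].
      intros v [Hvt Hvx]; unfold order_le; rewrite ord_counts; lia.
    - apply Dw_bounded_mixed_K_nonlinear; assumption. }
  destruct (extract_time w) as (v & Hv); [lia|].
  assert (Htv := time_count_perm _ _ Hv); assert (Hov := ord_perm _ _ Hv); rewrite !ord_counts in Hov;
    simpl in Htv, Hov.
  apply (L2_bounded_ext time _ (fun s => Dw v (D 0 (K_at i j s)))).
  { intros; rewrite (Dw_perm _ _ _ Hv); change (Dw (0%nat :: v) ?f) with (D 0 (Dw v f)); rewrite Dw_D; reflexivity. }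
  apply dt_K; split; lia.
Qed.

End Step.

Lemma K_mixed_bounded_energy n r : (r + 2 * n <= 2 * M + 2)%nat -> (r + n <= 2 * M)%nat ->
  K_mixed_bounded n r sqrt_energy.
Proof.
  revert r; induction n as [n IH] using (well_founded_induction lt_wf); intros r Hp Hr; destruct n as [|n].
  - apply (K_mixed_bounded_mono 0 (2 * M)); [lia | apply K_mixed_bounded_of_order, Dw_bounded_K].
  - apply (K_mixed_bounded_step n r (2 * M)); try lia;
      [apply sqrt_energy_nonneg | apply Dw_bounded_u | apply Dw_bounded_th | intros; apply IH; lia].
Qed.

Lemma K_mixed_bounded_diss n r : (r + 2 * n <= 2 * M + 3)%nat -> (r + n <= 2 * M - 1)%nat ->
  K_mixed_bounded n r (sqrt_diss (2 * M)).
Proof.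
  revert r; induction n as [n IH] using (well_founded_induction lt_wf); intros r Hp Hr; destruct n as [|n].
  - apply (K_mixed_bounded_mono 0 (2 * M - 1)); [lia | apply K_mixed_bounded_of_order].
    intros i j; apply Dw_bounded_K_diss, level_high.
  - apply (K_mixed_bounded_step n r (2 * M + 1)); try lia;
      [apply sqrt_diss_nonneg | apply Dw_bounded_u_diss | apply Dw_bounded_th_diss | intros; apply IH; lia].
Qed.

Definition a_fields : list (State -> PField) := [K_at 0 2; K_at 1 2].
Definition K_fields : list (State -> PField) :=
  [K_at 0 0; K_at 0 1; K_at 0 2; K_at 1 0; K_at 1 1; K_at 1 2; K_at 2 0; K_at 2 1; K_at 2 2].

Lemma K_fields_entry f : In f K_fields -> exists i j, (i < 3)%nat /\ (j < 3)%nat /\ f = K_at i j.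
Proof. intros Hf; repeat (destruct Hf as [<-|Hf]; [do 2 eexists; split; [|split; [|reflexivity]]; lia|]); destruct Hf.
Qed.

Lemma a_fields_incl : incl a_fields K_fields.
Proof. intros f [<-|[<-|[]]]; simpl; auto 7. Qed.

Lemma sumN_Hs_sq_lesssim k n B l : nonneg B -> K_mixed_bounded n k B -> incl l K_fields ->
  (fun s : State => sumN (Hs_sq k) (dtl n (map field_fun (map (fun f => f s) l))) (time s)) <~ (fun s => B s * B s).
Proof.
  intros HB HK Hl.
  apply (lesssim_ext _ (fun s => sumN (Hs_sq k) (map field_fun (map (fun f => f s)
    (map (fun (f : State -> PField) s => Dw (repeat 0%nat n) (f s)) l))) (time s))).
  { intros s; rewrite dtl_Dw, !map_map; reflexivity. }
  apply sumN_lesssim; [intros s; apply Rle_0_sqr|]; intros g Hg; apply in_map_iff in Hg; destruct Hg as (f & <- & Hf).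
  destruct (K_fields_entry f (Hl f Hf)) as (i & j & Hi & Hj & ->).
  apply (Hs_sq_lesssim time k (fun s => Dw (repeat 0%nat n) (K_at i j s))); [intros s; apply Rle_0_sqr|];
    intros w Hw Hspace.
  apply (lesssim_ext _ (fun s => normsq (Dw (w ++ repeat 0%nat n) (K_at i j s)) (time s)));
    [intros s; rewrite Dw_app; reflexivity|].
  apply (normsq_lesssim time (fun s => Dw (w ++ repeat 0%nat n) (K_at i j s))); [exact HB|].
  apply HK; [exact Hi | exact Hj|]; assert (Hs := time_count_spatial w Hspace).
  assert (Ho := ord_app w (repeat 0%nat n)); rewrite ord_counts, time_count_app, time_count_repeat, ord_repeat in Ho.
  split; [rewrite time_count_app, time_count_repeat; lia | simpl in Ho; lia].
Qed.

Lemma EK_lesssim_energy : (fun s : State => EK M (fun i j => sol_K s i j) (time s)) <~ energy.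
Proof.
  assert (HM := M_ge); eapply lesssim_trans; [|apply sqrt_energy_sqr_lesssim].
  assert (comps : forall k n, (k + 2 * n <= 2 * M + 2)%nat -> (k + n <= 2 * M)%nat ->
    (fun s : State => sumN (Hs_sq k) (dtl n (compsK (fun i j => sol_K s i j))) (time s)) <~
      (fun s => sqrt_energy s * sqrt_energy s)).
  { intros k n Hk Hn; apply (sumN_Hs_sq_lesssim k n sqrt_energy K_fields);
      [apply sqrt_energy_nonneg | apply K_mixed_bounded_energy; assumption | apply incl_refl]. }
  apply lesssim_add; [apply lesssim_add; [apply lesssim_add|]|].
  - apply (comps (2 * M - 3)%nat 0%nat); lia.
  - apply comps; lia.
  - apply comps; lia.
  - apply (lesssim_sum_from (fun j (s : State) => sumN (Hs_sq (2 * M - 2 * j + 2))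
      (dtl j (compsK (fun i j => sol_K s i j))) (time s)));
      [intros s; apply Rle_0_sqr | intros j Hj; apply comps; lia].
Qed.

Lemma DM_lesssim_diss :
  (fun s : State => DM M (fun i => sol_u s i) (fun i => sol_th s i) (fun i j => sol_K s i j) (time s)) <~ diss (2 * M).
Proof.
  assert (HM := M_ge).
  assert (comps : forall k n, (k + 2 * n <= 2 * M + 3)%nat -> (k + n <= 2 * M - 1)%nat ->
    (fun s : State => sumN (Hs_sq k) (dtl n (aK (fun i j => sol_K s i j))) (time s)) <~ diss (2 * M)).
  { intros k n Hk Hn; eapply lesssim_trans; [|apply sqrt_diss_sqr_lesssim].
    apply (sumN_Hs_sq_lesssim k n (sqrt_diss (2 * M)) a_fields);
      [apply sqrt_diss_nonneg | apply K_mixed_bounded_diss; assumption | apply a_fields_incl]. }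
  apply lesssim_add; [apply lesssim_add|].
  - apply lesssim_le; intros s; apply Rle_refl.
  - apply (lesssim_sum_from (fun j (s : State) =>
      sumN (Hs_sq (2 * M - j - 1)) (dtl j (aK (fun i j => sol_K s i j))) (time s)));
      [apply diss_nonneg | intros j Hj; apply comps; lia].
  - apply (lesssim_sum_from (fun j (s : State) => sumN (Hs_sq (2 * M - 2 * j + 3))
      (dtl j (aK (fun i j => sol_K s i j))) (time s)));
      [apply diss_nonneg | intros j Hj; apply comps; lia].
Qed.

Lemma K_mixed_bounded_low n : (n <= 2)%nat -> K_mixed_bounded n (2 - n) (sqrt_words_normsq 2).
Proof.
  assert (HM := M_ge); assert (Hnn := sqrt_words_normsq_nonneg 2).
  assert (Hf : forall f, In f u_th_a_fields -> Dw_bounded time (order_le 2) (sqrt_words_normsq 2) f)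
    by apply Dw_bounded_words_normsq.
  assert (Hu : forall i, (i < 3)%nat -> Dw_bounded time (order_le 2) (sqrt_words_normsq 2) (u_at i))
    by (intros i Hi; apply Hf, in_or_app; left; apply in_u_th_fields, Hi).
  assert (Hth : forall i, (i < 3)%nat -> Dw_bounded time (order_le 2) (sqrt_words_normsq 2) (th_at i))
    by (intros i Hi; apply Hf, in_or_app; left; apply in_u_th_fields, Hi).
  assert (order0 : K_mixed_bounded 0 2 (sqrt_words_normsq 2)).
  { apply K_mixed_bounded_of_order, Dw_bounded_K_of_a; [lia | exact Hnn|].
    intros i Hi; apply Hf, in_or_app; right; destruct i as [|[|i]]; simpl; auto; lia. }
  assert (order1 : K_mixed_bounded 1 1 (sqrt_words_normsq 2)).
  { apply (K_mixed_bounded_step 0 1 2); auto; try lia; intros m Hm; replace m with 0%nat by lia; exact order0. }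
  assert (order2 : K_mixed_bounded 2 0 (sqrt_words_normsq 2)).
  { apply (K_mixed_bounded_step 1 0 2); auto; try lia; intros m Hm; destruct m as [|[|m]];
      [apply (K_mixed_bounded_mono 0 2); auto | exact order1 | lia]. }
  intros Hn; destruct n as [|[|[|n]]]; [exact order0 | exact order1 | exact order2 | lia].
Qed.

Lemma Elow_lesssim_words :
  (fun s : State => Elow (fun i => sol_u s i) (fun i => sol_th s i) (fun i j => sol_K s i j) (time s))
  <~ (fun s : State => words_normsq 2 s (time s)).
Proof.
  eapply lesssim_trans; [|apply lesssim_le; intros s; apply Req_le, sqrt_words_normsq_sqr].
  assert (Hnn := sqrt_words_normsq_nonneg 2).
  assert (comps : forall n, (n <= 2)%nat ->
    (fun s : State => sumN (Hs_sq (2 - n)) (dtl n (aK (fun i j => sol_K s i j))) (time s))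
    <~ (fun s => sqrt_words_normsq 2 s * sqrt_words_normsq 2 s)).
  { intros n Hn; apply (sumN_Hs_sq_lesssim (2 - n) n _ a_fields);
      [exact Hnn | apply K_mixed_bounded_low, Hn | apply a_fields_incl]. }
  apply lesssim_add; [apply lesssim_add|].
  - apply (sumN_Pk_sq_lesssim 2 _ u_th_a_fields); [exact Hnn | apply Dw_bounded_words_normsq].
  - apply (comps 1%nat); lia.
  - apply (comps 2%nat); lia.
Qed.

End Mixed_derivatives.

(** * Growth of the highest norm of the inertia tensor *)

Lemma sum33_inner_commF_tenF (v : nat -> PField) (X : nat -> nat -> PField) t :
  sum3 (fun i => sum3 (fun j => inner (X i j) (commF (tenF v) X i j) t)) = 0.
Proof.
  assert (E : Tint (Fsum3 (fun i => Fsum3 (fun j => X i j * commF (tenF v) X i j)%fld)) t = 0).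
  { rewrite <- (Tint_const 0 t); apply Tint_ext; intros x y z; unfold Fsum3, commF, Fsum3; cbn [tenF]; Feval; ring. }
  rewrite Tint_Fsum3 in E; rewrite <- E; apply sum3_ext; intros i _; rewrite Tint_Fsum3; reflexivity.
Qed.

Definition space_words (n : nat) : list (list nat) := filter (fun w => negb (existsb (Nat.eqb 0) w)) (words n).

Lemma space_words_spec w n : In w (space_words n) -> ~ In 0%nat w /\ (ord w <= n)%nat.
Proof.
  intros Hw; apply filter_In in Hw; destruct Hw as [Hw Hs]; split; [|apply words_ord, Hw].
  intros I; assert (E : existsb (Nat.eqb 0) w = true)
    by (apply existsb_exists; exists 0%nat; split; [assumption | reflexivity]).
  rewrite E in Hs; discriminate.
Qed.

Lemma sorted_word_in_space_words a1 a2 a3 n : (a1 + a2 + a3 <= n)%nat -> In (sorted_word 0 a1 a2 a3) (space_words n).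
Proof.
  intros Ha; apply filter_In; split; [apply sorted_word_in_words; lia|].
  destruct (existsb (Nat.eqb 0) (sorted_word 0 a1 a2 a3)) eqn:E; [|reflexivity].
  apply existsb_exists in E; destruct E as (k & Hk & E); apply Nat.eqb_eq in E; subst k.
  apply in_sorted_word in Hk; destruct Hk as [_ Hk]; specialize (Hk eq_refl); lia.
Qed.

Section Growth.
Context {P : Coefficients}.

Definition word_K_normsq (S : Solution) w t : R := sum3 (fun i => sum3 (fun j => normsq (Dw_K S w i j) t)).
Definition word_K_normsq_dt (S : Solution) w t : R :=
  sum3 (fun i => sum3 (fun j => 2 * inner (Dw_K S w i j) (D 0 (Dw_K S w i j)) t)).
Definition K_top (S : Solution) (t : R) : R := lsum (map (fun w => word_K_normsq S w t) (space_words (2 * M + 1))).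
Definition K_top_dt (S : Solution) (t : R) : R :=
  lsum (map (fun w => word_K_normsq_dt S w t) (space_words (2 * M + 1))).
Definition sqrt_K_top (s : State) : R := sqrt (K_top s (time s)).

Lemma word_K_normsq_nonneg S w t : 0 <= word_K_normsq S w t.
Proof. apply sum3_nonneg; intros; apply sum3_nonneg; intros; apply normsq_nonneg. Qed.
Lemma K_top_nonneg S t : 0 <= K_top S t.
Proof. apply lsum_nonneg; intros; apply word_K_normsq_nonneg. Qed.
Lemma sqrt_K_top_nonneg : nonneg sqrt_K_top.
Proof. intros s; apply sqrt_pos. Qed.
Lemma sqrt_K_top_sqr s : sqrt_K_top s * sqrt_K_top s = K_top s (time s).
Proof. apply sqrt_sqrt, K_top_nonneg. Qed.

Lemma K_top_derive S t : is_derive (K_top S) t (K_top_dt S t).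
Proof.
  apply (lsum_derive (space_words (2 * M + 1)) (word_K_normsq S)); intros w _.
  apply (sum3_derive (fun i t => sum3 (fun j => normsq (Dw_K S w i j) t))); intros i.
  apply (sum3_derive (fun j t => normsq (Dw_K S w i j) t)); intros j; apply normsq_derive.
Qed.

Lemma L2_bounded_K_top w i j : ~ In 0%nat w -> (ord w <= 2 * M + 1)%nat -> (i < 3)%nat -> (j < 3)%nat ->
  L2_bounded time (fun s => Dw w (K_at i j s)) sqrt_K_top.
Proof.
  intros Hw Ho Hi Hj; apply L2_bounded_sqrt; [intros s; apply K_top_nonneg|]; apply lesssim_le; intros s.
  destruct (Dw_sorted_word w) as (a0 & a1 & a2 & a3 & Eo & Ew & Ea0); specialize (Ea0 Hw); subst a0; rewrite Ew.
  set (v := sorted_word 0 a1 a2 a3); apply Rle_trans with (word_K_normsq s v (time s)).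
  - apply Rle_trans with (sum3 (fun j => normsq (Dw_K s v i j) (time s))).
    + apply (sum3_term (fun j => normsq (Dw_K s v i j) (time s))); [intros; apply normsq_nonneg | exact Hj].
    + apply (sum3_term (fun i => sum3 (fun j => normsq (Dw_K s v i j) (time s)))); [|exact Hi].
      intros; apply sum3_nonneg; intros; apply normsq_nonneg.
  - apply (lsum_term (space_words (2 * M + 1)) (fun w => word_K_normsq s w (time s)));
      [intros; apply word_K_normsq_nonneg | apply sorted_word_in_space_words; lia].
Qed.

Lemma word_K_normsq_dt_eq S w t : 0 <= t <= sol_T S ->
  word_K_normsq_dt S w t = sum3 (fun i => sum3 (fun j =>
    2 * (Jeq_diag j - Jeq_diag i) * inner (Dw_K S w i j) (tenF (Dw_th S w) i j) t
    + 2 * inner (Dw_K S w i j) (remainder_K S w i j) t)).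
Proof.
  intros Ht; symmetry; rewrite <- (Rplus_0_l (sum3 _)), <- (Rmult_0_r 2),
    <- (sum33_inner_commF_tenF omegaF (Dw_K S w) t).
  unfold word_K_normsq_dt; rewrite <- sum3_scal, <- sum3_add; apply sum3_ext; intros i Hi.
  rewrite <- sum3_scal, <- sum3_add; apply sum3_ext; intros j Hj.
  rewrite (inner_eq_on_r _ _ _ _ t (Dw_inertia S w i j Hi Hj) Ht), !inner_add_r, inner_scal_r; ring.
Qed.

Definition growth_error : State -> R := transport_error sqrt_K_top (sqrt_diss (2 * M)).

Lemma growth_error_nonneg : nonneg growth_error.
Proof. apply transport_error_nonneg; [apply sqrt_K_top_nonneg | apply sqrt_diss_nonneg]. Qed.

Lemma K_top_transport_bigO w i j : In w (space_words (2 * M + 1)) -> (i < 3)%nat -> (j < 3)%nat ->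
  bigO (fun s : State => inner (Dw_K s w i j) (remainder_K s w i j) (time s)) growth_error.
Proof.
  intros Hw Hi Hj; apply space_words_spec in Hw; destruct Hw as [Hspace Ho]; assert (HM := M_ge).
  assert (Hk := sqrt_K_top_nonneg); assert (Hd := sqrt_diss_nonneg (2 * M)).
  assert (scale : (fun s => sqrt_diss (2 * M) s * 1) <~ sqrt_diss (2 * M)) by (apply lesssim_le; intros; lra).
  assert (K_one : forall k l, (k < 3)%nat -> (l < 3)%nat -> Dw_bounded time (order_le (2 * M)) (fun _ => 1) (K_at k l))
    by (intros; eapply Dw_bounded_le; [apply sqrt_energy_one | apply Dw_bounded_K; assumption]).
  apply (remainder_K_bigO w (fun s => Dw w (K_at i j s))); [apply growth_error_nonneg | exact Hi | exact Hj | |].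
  - intros l k m Hl Hk' Hm; apply rotation_bigO; [exact Hk | exact Hd | exact Hl
      | exact (L2_bounded_K_top w i j Hspace Ho Hi Hj) | exact (L2_bounded_K_top w k m Hspace Ho Hk' Hm)|].
    eapply L2_bounded_le; [|exact scale].
    apply (commutator_L2_bounded time (2 * M + 1) (2 * M)); [exact Hd | apply one_nonneg | apply Dw_bounded_th_diss, Hl
      | exact (K_one k m Hk' Hm) | intros; lia].
  - apply advection_bigO; [exact Hk | exact Hd | exact (L2_bounded_K_top w i j Hspace Ho Hi Hj) | |];
      intros p k Hp Hop Hk';
      apply proper_l_splits_in in Hp; destruct Hp as [Hp _]; assert (Hs := splits_ord w p Hp).
    + apply L2_bounded_K_top; [|simpl; lia | exact Hi | exact Hj]; intros [I|I]; [discriminate|]; apply Hspace.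
      eapply Permutation_in; [apply (splits_perm w p Hp) | apply in_or_app; right; exact I].
    + eapply L2_bounded_le; [|exact scale].
      apply (L2_bounded_leibniz_term time (2 * M + 1) (2 * M - 1) _ _ (u_at k) (fun s => D (S k) (K_at i j s)));
        [exact Hd | apply one_nonneg | apply Dw_bounded_u_diss, Hk' | | lia].
      apply (Dw_bounded_order_D time (2 * M) (2 * M - 1) _ (S k) (K_at i j)); [simpl; lia | exact (K_one i j Hi Hj)].
Qed.

Lemma K_top_rotation_bigO w i j : In w (space_words (2 * M + 1)) -> (i < 3)%nat -> (j < 3)%nat ->
  bigO (fun s : State => inner (Dw_K s w i j) (tenF (Dw_th s w) i j) (time s)) growth_error.
Proof.
  intros Hw Hi Hj; apply space_words_spec in Hw; destruct Hw as [Hspace Ho].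
  eapply bigO_le; [|apply transport_error_mul, sqrt_K_top_nonneg].
  apply (bigO_inner time (fun s => Dw w (K_at i j s)) (fun s => tenF (Dw_th s w) i j));
    [apply sqrt_K_top_nonneg | apply sqrt_diss_nonneg | apply L2_bounded_K_top; assumption|].
  apply (L2_bounded_ext time _ (fun s => Dw w (tenF (sol_th s) i j))); [intros; rewrite Dw_tenF; reflexivity|].
  apply (Dw_bounded_tenF (order_le (2 * M + 1)) _ (fun s => sol_th s));
    [apply sqrt_diss_nonneg | apply Dw_bounded_th_diss | exact Ho].
Qed.

Lemma K_top_dt_lesssim : (fun s : State => K_top_dt s (time s)) <~ growth_error.
Proof.
  apply bigO_lesssim, (bigO_lsum (space_words (2 * M + 1)) (fun w (s : State) => word_K_normsq_dt s w (time s)));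
    [apply growth_error_nonneg|]; intros w Hw.
  eapply bigO_ext; [intros s; apply word_K_normsq_dt_eq, time_ok|].
  apply (bigO_sum3 (fun i (s : State) => sum3 (fun j =>
    2 * (Jeq_diag j - Jeq_diag i) * inner (Dw_K s w i j) (tenF (Dw_th s w) i j) (time s)
    + 2 * inner (Dw_K s w i j) (remainder_K s w i j) (time s)))); intros i Hi.
  apply (bigO_sum3 (fun j (s : State) =>
    2 * (Jeq_diag j - Jeq_diag i) * inner (Dw_K s w i j) (tenF (Dw_th s w) i j) (time s)
    + 2 * inner (Dw_K s w i j) (remainder_K s w i j) (time s))); intros j Hj.
  apply bigO_add; apply bigO_scal; [apply K_top_rotation_bigO | apply K_top_transport_bigO]; assumption.
Qed.

Lemma K_top_growth : lesssim_small (fun s => K_top s (time s))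
  (fun s => K_top s 0 + (1 + time s) * RInt (Diss (2 * M) s) 0 (time s)).
Proof.
  destruct K_top_dt_lesssim as (C & HC & Hdt); destruct lownorm_decay as (e1 & Cd & He1 & HCd & decay).
  assert (HC' : 0 <= C * Cd) by (apply Rmult_le_pos; assumption); set (e2 := 1 / 3 / (2 * (C * Cd + 1))).
  assert (He2 : 0 < e2) by (apply Rdiv_lt_0_compat; lra); assert (HCC : 0 <= C * C) by apply Rle_0_sqr.
  exists (Rmin e1 e2), (3 + 9 / 4 * (C * C)); split; [apply Rmin_pos; assumption | split; [lra|]].
  intros [S t Ht] Hs; cbn [sol time]; unfold size_at in Hs; cbn [sol] in Hs; assert (min1 := Rmin_l e1 e2);
    assert (min2 := Rmin_r e1 e2); assert (Hsize := proj1 (sol_size_bounds S)).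
  assert (growth : K_top S t <= 3 * K_top S 0 + 9 / 4 * C * C * (1 + t) * RInt (Diss (2 * M) S) 0 t).
  { apply (forced_growth (K_top S) (K_top_dt S)); [lra | intros; apply K_top_derive | intros; apply K_top_nonneg
      | apply Diss_continuous | apply Diss_nonneg | exact HC|].
    intros r Hr; assert (Hr' : 0 <= r <= sol_T S) by lra; set (s := mkState S r Hr').
    specialize (Hdt s); specialize (decay s ltac:(unfold size_at; simpl; lra));
      unfold growth_error, transport_error in Hdt.
    rewrite sqrt_K_top_sqr in Hdt; unfold size_at in decay; cbn [sol time s] in Hdt, decay.
    change (sqrt_K_top s) with (sqrt (K_top S r)) in Hdt;
      change (sqrt_diss (2 * M) s) with (sqrt (Diss (2 * M) S r)) in Hdt.
    assert (Hw : 0 < decay_weight r) by (apply decay_weight_pos; lra).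
    assert (absorb : C * lownorm s <= 1 / 3 / 2 * decay_weight r).
    { apply Rle_trans with (C * Cd * (sol_size S * decay_weight r)); [|apply absorb_le; try lra; fold e2; lra].
      rewrite (Rmult_assoc C); apply Rmult_le_compat_l; [exact HC | exact decay]. }
    assert (C * lownorm s * K_top S r <= 1 / 3 / 2 * decay_weight r * K_top S r)
      by (apply Rmult_le_compat_r; [apply K_top_nonneg | exact absorb]); lra. }
  assert (HI : 0 <= (1 + t) * RInt (Diss (2 * M) S) 0 t) by (apply Rmult_le_pos; [lra | apply RInt_Diss_nonneg; lra]).
  assert (Htop := Rmult_le_pos _ _ HCC (K_top_nonneg S 0)); lra.
Qed.

Lemma FM_lesssim : (fun s : State => FM M (fun i j => sol_K s i j) (time s)) <~ (fun s => K_top s (time s) + energy s).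
Proof.
  assert (HM := M_ge); set (B := fun s : State => sqrt (K_top s (time s) + energy s)).
  assert (Hsum : nonneg (fun s : State => K_top s (time s) + energy s))
    by (intros s; apply Rplus_le_le_0_compat; [apply K_top_nonneg | apply energy_nonneg]).
  assert (HB : nonneg B) by (intros s; apply sqrt_pos).
  eapply lesssim_trans; [|apply lesssim_le; intros s; apply Req_le, (sqrt_sqrt _ (Hsum s))].
  assert (top_le : sqrt_K_top <~ B)
    by (apply lesssim_le; intros s; apply sqrt_le_1_alt; assert (H := energy_nonneg s); lra).
  assert (energy_le : sqrt_energy <~ B)
    by (apply lesssim_le; intros s; apply sqrt_le_1_alt; assert (H := K_top_nonneg s (time s)); lra).
  assert (Hu : forall i, (i < 3)%nat -> Dw_bounded time (order_le (2 * M)) B (u_at i))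
    by (intros; eapply Dw_bounded_le; [exact energy_le | apply Dw_bounded_u; assumption]).
  assert (Hth : forall i, (i < 3)%nat -> Dw_bounded time (order_le (2 * M)) B (th_at i))
    by (intros; eapply Dw_bounded_le; [exact energy_le | apply Dw_bounded_th; assumption]).
  assert (order0 : K_mixed_bounded 0 (2 * M + 1) B).
  { intros i j Hi Hj w [Ht Hx]; eapply L2_bounded_le; [|exact top_le].
    apply L2_bounded_K_top; auto; [|rewrite ord_counts; lia].
    clear - Ht; intros I; induction w as [|[|k] w IH]; simpl in *;
      [destruct I | discriminate | destruct I as [I|I]; [discriminate | auto]]. }
  assert (order1 : K_mixed_bounded 1 (2 * M) B).
  { apply (K_mixed_bounded_step 0 (2 * M) (2 * M)); auto; try lia; intros m Hm; replace m with 0%nat by lia;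
      exact order0. }
  assert (order2 : K_mixed_bounded 2 (2 * M - 2) B).
  { apply (K_mixed_bounded_step 1 (2 * M - 2) (2 * M)); auto; try lia; intros m Hm; destruct m as [|[|m]];
      [apply (K_mixed_bounded_mono 0 (2 * M + 1)); [lia | exact order0] | apply (K_mixed_bounded_mono 1 (2 * M));
        [lia | exact order1] | lia]. }
  apply lesssim_add; [apply lesssim_add|].
  - exact (sumN_Hs_sq_lesssim (2 * M + 1) 0 B K_fields HB order0 (incl_refl _)).
  - exact (sumN_Hs_sq_lesssim (2 * M) 1 B K_fields HB order1 (incl_refl _)).
  - exact (sumN_Hs_sq_lesssim (2 * M - 2) 2 B K_fields HB order2 (incl_refl _)).
Qed.

Definition entries (A : nat -> nat -> PField) : list PField :=
  [A 0 0; A 0 1; A 0 2; A 1 0; A 1 1; A 1 2; A 2 0; A 2 1; A 2 2]%nat.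

Lemma sumN_Hs_sq_dtl_nonneg k n (l : list PField) t : 0 <= sumN (Hs_sq k) (dtl n (map field_fun l)) t.
Proof. rewrite dtl_Dw; apply sumN_nonneg; intros; apply Hs_sq_nonneg. Qed.

Lemma K_top_le_FM (S : Solution) t : K_top S t <= INR (length (space_words (2 * M + 1))) * FM M
  (fun i j => sol_K S i j) t.
Proof.
  rewrite <- lsum_const; apply lsum_le; intros w Hw; apply space_words_spec in Hw; destruct Hw as [Hspace Ho].
  assert (Hs : forall i j, normsq (Dw_K S w i j) t <= Hs_sq (2 * M + 1) (sol_K S i j) t)
    by (intros; apply normsq_le_Hs_sq; assumption).
  assert (dt_nonneg := sumN_Hs_sq_dtl_nonneg (2 * M) 1 (entries (sol_K S)) t).
  assert (dtt_nonneg := sumN_Hs_sq_dtl_nonneg (2 * M - 2) 2 (entries (sol_K S)) t).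
  change (map field_fun (entries (sol_K S))) with (compsK (fun i j => sol_K S i j)) in dt_nonneg, dtt_nonneg.
  apply Rle_trans with (sumN (Hs_sq (2 * M + 1)) (compsK (fun i j => sol_K S i j)) t); [|unfold FM; lra].
  apply Rle_trans with (sum3 (fun i => sum3 (fun j => Hs_sq (2 * M + 1) (sol_K S i j) t))).
  - apply sum3_le; intros i _; apply sum3_le; intros j _; apply Hs.
  - apply Req_le; unfold sum3, sumN, compsK; cbn [fold_right]; ring.
Qed.

End Growth.

(** * Norms and sizes *)

Lemma Rabs_le_of_Hs_sq k (f : PField) t x y z d : (3 <= k)%nat -> 0 <= d -> Hs_sq k f t <= d * d ->
  Rabs (f t x y z) <= 8 * d.
Proof.
  intros Hk Hd Hf; assert (Hsob := sobolev f t x y z).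
  assert (Hsum : lsum (map (fun w => normsq (Dw w f) t) (rev_subwords [1; 2; 3]%nat)) <= 8 * (d * d)).
  { replace (8 * (d * d)) with (lsum (map (fun _ => d * d) (rev_subwords [1; 2; 3]%nat)))
      by (rewrite lsum_const; simpl; ring).
    apply lsum_le; intros w Hw; eapply Rle_trans; [apply (normsq_le_Hs_sq w k) | exact Hf];
      repeat (destruct Hw as [<-|Hw]; [simpl; first [lia | intuition discriminate]|]); destruct Hw. }
  apply Rsqr_incr_0_var; [|lra]; rewrite <- Rsqr_abs; unfold Rsqr; simpl (_ ^ 2) in Hsob; lra.
Qed.

Section Nonnegativity.
Context {P : Coefficients}.

Lemma Ebar_nonneg (v w : nat -> PField) (A : nat -> nat ->
  PField) t : 0 <= Ebar M (fun i => v i) (fun i => w i) (fun i j => A i j) t.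
Proof.
  apply (sumN_nonneg (Pk_sq (2 * M)) [v 0; v 1; v 2; w 0; w 1; w 2; A 0 2; A 1 2]%nat); intros; apply Pk_sq_nonneg.
Qed.

Lemma RInt_Dbar_nonneg (v w : nat -> PField) r : 0 <= r -> 0 <= RInt (Dbar M (fun i => v i) (fun i => w i)) 0 r.
Proof.
  intros Hr; set (l := [v 0; v 1; v 2; w 0; w 1; w 2]%nat).
  change (0 <= RInt (sumN (Pk_sq (2 * M + 1)) (map field_fun l)) 0 r); apply RInt_ge_0; [exact Hr| |].
  - apply ex_RInt_cont; intros; apply sumN_continuous; intros; apply Pk_sq_continuous.
  - intros; apply sumN_nonneg; intros; apply Pk_sq_nonneg.
Qed.

Lemma FM_nonneg (K : nat -> nat -> PField) t : 0 <= FM M (fun i j => K i j) t.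
Proof.
  apply Rplus_le_le_0_compat; [apply Rplus_le_le_0_compat|].
  - exact (sumN_Hs_sq_dtl_nonneg (2 * M + 1) 0 (entries K) t).
  - exact (sumN_Hs_sq_dtl_nonneg (2 * M) 1 (entries K) t).
  - exact (sumN_Hs_sq_dtl_nonneg (2 * M - 2) 2 (entries K) t).
Qed.

Lemma Hs_sq_le_EK (K : nat -> nat -> PField) t i j : (i < 3)%nat -> (j < 3)%nat ->
  Hs_sq (2 * M - 3) (K i j) t <= EK M (fun i j => K i j) t.
Proof.
  intros Hi Hj.
  assert (le_sum : Hs_sq (2 * M - 3) (K i j) t <= sumN (Hs_sq (2 * M - 3)) (compsK (fun i j => K i j)) t).
  { apply (sumN_term (Hs_sq (2 * M - 3)) (entries K)); [intros; apply Hs_sq_nonneg|].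
    case_lt3 i; case_lt3 j; simpl; auto 10. }
  assert (dt_nonneg := sumN_Hs_sq_dtl_nonneg (2 * M - 3) 1 (entries K) t).
  assert (dtt_nonneg := sumN_Hs_sq_dtl_nonneg (2 * M - 3) 2 (entries K) t).
  assert (higher_nonneg : 0 <= sum_from 3 M
    (fun n => sumN (Hs_sq (2 * M - 2 * n + 2)) (dtl n (map field_fun (entries K))) t)).
  { apply cond_pos_sum; intros n; destruct (3 <=? n)%nat; [apply sumN_Hs_sq_dtl_nonneg | lra]. }
  change (map field_fun (entries K)) with (compsK (fun i j => K i j)) in dt_nonneg, dtt_nonneg, higher_nonneg;
    unfold EK; lra.
Qed.

Lemma EK_nonneg (K : nat -> nat -> PField) t : 0 <= EK M (fun i j => K i j) t.
Proof. eapply Rle_trans; [apply (Hs_sq_nonneg (2 * M - 3) (K 0%nat 0%nat)) | apply Hs_sq_le_EK; lia]. Qed.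

Lemma DM_continuous (u th : nat -> PField) (K : nat -> nat -> PField) t :
  continuous (DM M (fun i => u i) (fun i => th i) (fun i j => K i j)) t.
Proof.
  assert (Hdtl : forall k n, continuous (sumN (Hs_sq k) (dtl n (aK (fun i j => K i j)))) t).
  { intros k n; change (aK (fun i j => K i j)) with (map field_fun [K 0 2; K 1 2]%nat); rewrite dtl_Dw.
    apply sumN_continuous; intros; apply Hs_sq_continuous. }
  apply (continuous_plus (V := R_NormedModule)); [apply (continuous_plus (V := R_NormedModule))|].
  - apply (sumN_continuous (Pk_sq (2 * M + 1)) [u 0; u 1; u 2; th 0; th 1; th 2]%nat); intros; apply Pk_sq_continuous.
  - apply (sum_from_continuous 0 3 (fun n t => sumN (Hs_sq (2 * M - n - 1)) (dtl n (aK (fun i j => K i j))) t)); intros;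
      apply Hdtl.
  - apply (sum_from_continuous 4 M (fun n t => sumN (Hs_sq (2 * M - 2 * n + 3)) (dtl n (aK (fun i j => K i j))) t));
      intros; apply Hdtl.
Qed.

End Nonnegativity.

(** * The spectral constraint *)

Definition minors_sum (A : nat -> nat -> R) : R :=
  A 0%nat 0%nat * A 1%nat 1%nat - A 0%nat 1%nat * A 1%nat 0%nat +
    (A 0%nat 0%nat * A 2%nat 2%nat - A 0%nat 2%nat * A 2%nat 0%nat)
  + (A 1%nat 1%nat * A 2%nat 2%nat - A 1%nat 2%nat * A 2%nat 1%nat).

Lemma charpoly_coefficients (A : nat -> nat -> R) (l n : R) :
  (forall s, det3 (fun i j => (if (i =? j)%nat then s else 0) - A i j) = (s - l) ^ 2 * (s - n)) ->
  sum3 (fun i => A i i) = 2 * l + n /\ minors_sum A = l * l + 2 * l * n /\ det3 A = l * l * n.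
Proof.
  intros Hdet; assert (at0 := Hdet 0); assert (at1 := Hdet 1); assert (atN1 := Hdet (-1)).
  unfold sum3, minors_sum, det3 in *; cbn [Nat.eqb] in *; repeat split; lra.
Qed.

Definition spectral_product (A : nat -> nat -> R) (l n : R) (i j : nat) : R :=
  sum3 (fun k => (A i k - (if (i =? k)%nat then l else 0)) * (A k j - (if (k =? j)%nat then n else 0))).

(* The right-hand side is the sum of (x - l)^2 (x - n)^2 over the eigenvalues x, expressed by the power sums. *)
Lemma spectral_product_sqr (A : nat -> nat -> R) (l n : R) : (forall i j, (i < 3)%nat -> (j < 3)%nat ->
  A i j = A j i) ->
  let e1 := sum3 (fun i => A i i) in let e2 := minors_sum A in let e3 := det3 A in
  sum3 (fun i => sum3 (fun j => spectral_product A l n i j * spectral_product A l n i j))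
  = (e1 ^ 4 - 4 * e1 ^ 2 * e2 + 2 * e2 ^ 2 + 4 * e1 * e3) - 2 * (l + n) * (e1 ^ 3 - 3 * e1 * e2 + 3 * e3)
    + ((l + n) ^ 2 + 2 * l * n) * (e1 ^ 2 - 2 * e2) - 2 * l * n * (l + n) * e1 + 3 * l ^ 2 * n ^ 2.
Proof.
  intros Hsym; unfold spectral_product, minors_sum, det3, sum3; cbn [Nat.eqb].
  rewrite (Hsym 1%nat 0%nat), (Hsym 2%nat 0%nat), (Hsym 2%nat 1%nat) by lia; ring.
Qed.

Lemma sum33_sqr_zero (x : nat -> nat -> R) : sum3 (fun i => sum3 (fun j => x i j * x i j)) = 0 ->
  forall i j, (i < 3)%nat -> (j < 3)%nat -> x i j = 0.
Proof.
  intros Hx i j Hi Hj; assert (Hsq : forall i j, 0 <= x i j * x i j) by (intros; apply Rle_0_sqr).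
  assert (Hj' := sum3_term (fun j => x i j * x i j) j (fun j _ => Hsq i j) Hj).
  assert (Hi' := sum3_term (fun i => sum3 (fun j => x i j * x i j)) i
    (fun i _ => sum3_nonneg _ (fun j _ => Hsq i j)) Hi).
  specialize (Hsq i j); apply Rsqr_0_uniq; unfold Rsqr; cbv beta in *; lra.
Qed.

Lemma spectral_product_zero (A : nat -> nat -> R) (l n : R) :
  (forall i j, (i < 3)%nat -> (j < 3)%nat -> A i j = A j i) ->
  (forall s, det3 (fun i j => (if (i =? j)%nat then s else 0) - A i j) = (s - l) ^ 2 * (s - n)) ->
  forall i j, (i < 3)%nat -> (j < 3)%nat -> spectral_product A l n i j = 0.
Proof.
  intros Hsym Hdet; apply (sum33_sqr_zero (spectral_product A l n)).
  destruct (charpoly_coefficients A l n Hdet) as (Etrace & Eminors & Edet).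
  rewrite (spectral_product_sqr A l n Hsym), Etrace, Eminors, Edet; ring.
Qed.

Definition material_derivative (u : nat -> PField) (f : PField) : PField := (D 0 f + advF u f)%fld.

Lemma material_derivative_mul u f g : material_derivative u (f * g)%fld
  = (material_derivative u f * g + f * material_derivative u g)%fld.
Proof. unfold material_derivative, advF, Fsum3; rewrite !D_mul; ring. Qed.

Lemma material_derivative_add u f g : material_derivative u (f + g)%fld
  = (material_derivative u f + material_derivative u g)%fld.
Proof. unfold material_derivative, advF, Fsum3; rewrite !D_add; ring. Qed.

Lemma material_derivative_sub_const u f c : material_derivative u (f - Fconst c)%fld = material_derivative u f.
Proof. unfold material_derivative, advF, Fsum3; rewrite !D_sub, !D_const; ring. Qed.

Section System.
Context {P : Coefficients}.
Context (u : nat -> PField) (p : PField) (th : nat -> PField) (K : nat -> nat -> PField) (T : R) (HT : 0 < T).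
Context (Hsys : forall t x y z, 0 <= t <= T ->
  system_P mu kappa alpha beta gamma tau lam nu (fun i => u i) p (fun i => th i) (fun i j => K i j) t x y z).

Lemma D_D_fun k l (f : PField) : field_fun (D k (D l f)) = pd k (pd l f).
Proof. rewrite !D_fun; reflexivity. Qed.

Lemma div_divF (v : nat -> PField) : div (fun i => v i) = field_fun (divF v).
Proof. apply field_ext; intros; unfold div, divF, Fsum3, sum3, dx; Feval; rewrite !D_fun; reflexivity. Qed.

Ltac eval_system := unfold lap, curl, sum3, lapF, curlF, advF, Fsum3 in *; unfold dt, dx in *;
  cbv beta iota zeta in *; cbn [Nat.eqb] in *; Feval; rewrite ?D_D_fun, ?D_fun.

Lemma system_momentum i : (i < 3)%nat -> eq_on T (D 0 (u i))
  (Fconst (mu + kappa / 2) * lapF (u i) + Fconst kappa * curlF th i - D (S i) p - advF u (u i))%fld.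
Proof.
  intros Hi t x y z Ht; destruct (Hsys t x y z Ht) as (E & _); specialize (E i Hi); clear Hsys.
  case_lt3 i; eval_system; lra.
Qed.

Lemma system_divergence : eq_on T (divF u) (Fconst 0).
Proof.
  intros t x y z Ht; destruct (Hsys t x y z Ht) as (_ & E & _); rewrite div_divF in E; rewrite E, Fconst_eval;
    reflexivity.
Qed.

Lemma system_microrotation i : (i < 3)%nat -> eq_on T
  (Fconst (Jeq_diag i) * D 0 (th i) + Fsum3 (fun j => K i j * D 0 (th j)))%fld
  (Fconst kappa * curlF u i - Fconst (2 * kappa) * th i + Fconst (alpha_tilde - gamma_tilde) * D (S i) (divF th)
   + Fconst gamma_tilde * lapF (th i) - gyro_linear th K i - theta_nonlinear u th K i)%fld.
Proof.
  intros Hi t x y z Ht; destruct (Hsys t x y z Ht) as (_ & _ & E & _); specialize (E i Hi); clear Hsys.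
  rewrite div_divF in E.
  assert (grad_div : field_fun (D (S i) (divF th)) = pd (S i) (field_fun (divF th))) by apply D_fun.
  Feval; rewrite grad_div.
  change (dx i (field_fun (divF th)) t x y z) with (pd (S i) (field_fun (divF th)) t x y z) in E.
  fold alpha_tilde gamma_tilde in E; generalize dependent (pd (S i) (divF th) t x y z); intros gd E.
  unfold theta_nonlinear, gyro_nonlinear, gyro_linear, mvF, omegaF.
  case_lt3 i; unfold mv, cross, Jeq, omega_eq, Jeq_diag in *; cbn [Nat.eqb crossF] in *; eval_system;
    fold tau_tilde in E; unfold alpha_tilde, gamma_tilde, gap in *; lra.
Qed.

Lemma system_inertia i j : (i < 3)%nat -> (j < 3)%nat -> eq_on T (D 0 (K i j))
  (commF (tenF omegaF) K i j + commF (tenF th) JeqF i j + K_nonlinear u th K i j)%fld.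
Proof.
  intros Hi Hj t x y z Ht; destruct (Hsys t x y z Ht) as (_ & _ & _ & E & _); specialize (E i j Hi Hj); clear Hsys.
  unfold K_nonlinear, commF, JeqF, omegaF; unfold comm, mm, ten, Jeq, omega_eq in E.
  case_lt3 i; case_lt3 j; unfold Fsum3, sum3 in *; cbv beta in *; cbn [Nat.eqb tenF] in *; unfold Jeq; cbn [Nat.eqb];
    eval_system; fold tau_tilde in E; lra.
Qed.

Lemma system_K_sym i j : (i < 3)%nat -> (j < 3)%nat -> eq_on T (K i j) (K j i).
Proof. intros Hi Hj t x y z Ht; destruct (Hsys t x y z Ht) as (_ & _ & _ & _ & E); apply E; assumption. Qed.

Definition inertia (i j : nat) : PField := (JeqF i j + K i j)%fld.
Definition angular_velocity (i : nat) : PField := (omegaF i + th i)%fld.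
Definition spectral_defect (i j : nat) : PField :=
  Fsum3 (fun k => (inertia i k - Fconst (if (i =? k)%nat then lam else 0))
                  * (inertia k j - Fconst (if (k =? j)%nat then nu else 0)))%fld.

Lemma inertia_transport i j : (i < 3)%nat -> (j < 3)%nat ->
  eq_on T (material_derivative u (inertia i j)) (commF (tenF angular_velocity) inertia i j).
Proof.
  intros Hi Hj t x y z Ht; assert (E := system_inertia i j Hi Hj t x y z Ht).
  unfold inertia at 1, material_derivative, advF, Fsum3; rewrite !D_add; unfold JeqF at 1 2 3 4; rewrite !D_const;
    Feval.
  rewrite E; clear E; unfold K_nonlinear, advF, commF, Fsum3, angular_velocity, inertia, JeqF, omegaF; Feval.
  case_lt3 i; case_lt3 j; cbn [Nat.eqb tenF]; unfold Jeq; cbn [Nat.eqb]; Feval; ring.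
Qed.

(* A polynomial in the inertia tensor is transported by the same commutator equation. *)
Lemma spectral_defect_transport i j : (i < 3)%nat -> (j < 3)%nat ->
  eq_on T (material_derivative u (spectral_defect i j)) (commF (tenF angular_velocity) spectral_defect i j).
Proof.
  intros Hi Hj t x y z Ht; assert (E := fun i j Hi Hj => inertia_transport i j Hi Hj t x y z Ht); clear Hsys.
  assert (product_rule : material_derivative u (spectral_defect i j) t x y z
    = Fsum3 (fun k =>
        commF (tenF angular_velocity) inertia i k * (inertia k j - Fconst (if (k =? j)%nat then nu else 0))
        + (inertia i k - Fconst (if (i =? k)%nat then lam else 0)) * commF (tenF angular_velocity) inertia k j)%fld
        t x y z).
  { unfold spectral_defect, Fsum3 at 1; rewrite !material_derivative_add, !material_derivative_mul,
      !material_derivative_sub_const.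
    unfold Fsum3 at 1; repeat rewrite ?Fadd_eval, ?Fmul_eval; rewrite !E by lia; Feval; reflexivity. }
  rewrite product_rule; clear E product_rule; unfold spectral_defect, commF, Fsum3; Feval.
  case_lt3 i; case_lt3 j; cbn [Nat.eqb tenF]; Feval; ring.
Qed.

Lemma inner_spectral_defect_dt t : 0 <= t <= T ->
  sum3 (fun i => sum3 (fun j => inner (spectral_defect i j) (D 0 (spectral_defect i j)) t)) = 0.
Proof.
  intros Ht; rewrite <- (sum33_inner_commF_tenF angular_velocity spectral_defect t).
  apply sum3_ext; intros i Hi; apply sum3_ext; intros j Hj.
  rewrite <- (inner_eq_on_r _ _ _ _ t (spectral_defect_transport i j Hi Hj) Ht); unfold material_derivative.
  rewrite inner_add_r, (inner_advF_self u T _ t system_divergence Ht); ring.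
Qed.

Context (Hspec : forall x y z s, det3 (fun i j => (if (i =? j)%nat then s else 0) - (Jeq lam nu i j + K i j 0 x y z))
  = (s - lam) ^ 2 * (s - nu)).

Lemma spectral_defect_initial i j : (i < 3)%nat -> (j < 3)%nat -> normsq (spectral_defect i j) 0 = 0.
Proof.
  intros Hi Hj; rewrite (normsq_ext _ (Fconst 0)); [apply inner_0_r|]; intros x y z.
  unfold spectral_defect, Fsum3, inertia, JeqF; Feval.
  apply (spectral_product_zero (fun i j => Jeq lam nu i j + K i j 0 x y z) lam nu);
    [|apply Hspec | exact Hi | exact Hj].
  intros a b Ha Hb; rewrite (system_K_sym a b Ha Hb 0 x y z ltac:(lra)); f_equal; case_lt3 a; case_lt3 b; reflexivity.
Qed.

Lemma spectral_defect_zero i j : (i < 3)%nat -> (j < 3)%nat -> eq_on T (spectral_defect i j) (Fconst 0).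
Proof.
  intros Hi Hj t x y z Ht; rewrite Fconst_eval; apply normsq_zero_eval.
  assert (le_initial := derivative_le_affine
    (fun t => sum3 (fun i => sum3 (fun j => normsq (spectral_defect i j) t)))
    (fun t => 2 * sum3 (fun i => sum3 (fun j => inner (spectral_defect i j) (D 0 (spectral_defect i j)) t))) T 0).
  assert (Hsum : sum3 (fun i => sum3 (fun j => normsq (spectral_defect i j) t)) <= 0).
  { eapply Rle_trans; [apply le_initial; [| |exact Ht]|].
    - intros r _; rewrite <- sum3_scal; apply (sum3_derive (fun i r => sum3 (fun j => normsq (spectral_defect i j) r))).
      intros a; rewrite <- sum3_scal; apply (sum3_derive (fun j => normsq (spectral_defect a j))); intros b;
        apply normsq_derive.
    - intros r Hr; rewrite inner_spectral_defect_dt by exact Hr; lra.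
    - rewrite (sum3_ext _ (fun _ => 0)); [unfold sum3; lra|]; intros a Ha.
      rewrite (sum3_ext _ (fun _ => 0)); [unfold sum3; lra | intros b Hb; apply spectral_defect_initial; assumption]. }
  assert (Hnn : forall i j, 0 <= normsq (spectral_defect i j) t) by (intros; apply normsq_nonneg).
  assert (Hj' := sum3_term (fun j => normsq (spectral_defect i j) t) j (fun j _ => Hnn i j) Hj).
  assert (Hi' := sum3_term (fun i => sum3 (fun j => normsq (spectral_defect i j) t)) i
    (fun i _ => sum3_nonneg _ (fun j _ => Hnn i j)) Hi).
  specialize (Hnn i j); cbv beta in *; lra.
Qed.

Lemma system_K_block i j : (i < 2)%nat -> (j < 2)%nat ->
  eq_on T (Fconst gap * K i j)%fld (Fsum3 (fun k => K i k * K k j)%fld).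
Proof.
  intros Hi Hj t x y z Ht; assert (E := spectral_defect_zero i j ltac:(lia) ltac:(lia) t x y z Ht).
  unfold spectral_defect, Fsum3, inertia, JeqF in E; unfold Fsum3, gap; revert E; Feval; unfold Jeq.
  destruct i as [|[|i]]; [| |lia]; (destruct j as [|[|j]]; [| |lia]); cbn [Nat.eqb]; intros; lra.
Qed.

Lemma system_K_corner : eq_on T (Fconst gap * K 2%nat 2%nat)%fld (- Fsum3 (fun k => K 2%nat k * K k 2%nat)%fld)%fld.
Proof.
  intros t x y z Ht; assert (E := spectral_defect_zero 2 2 ltac:(lia) ltac:(lia) t x y z Ht).
  unfold spectral_defect, Fsum3, inertia, JeqF in E; unfold Fsum3, gap; revert E; Feval; unfold Jeq; cbn [Nat.eqb];
    intros; lra.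
Qed.

Context (Hmean : forall t, 0 <= t <= T -> forall i, (i < 3)%nat -> torus_int (u i) t = 0).
Context (d : R) (Hd : 0 <= d <= 1) (Hdthr : 8 * d <= K_threshold).
Context (HEM : forall t, 0 <= t <= T -> EM M (fun i => u i) (fun i => th i) (fun i j => K i j) t <= d * d).

Lemma system_u_mean t i : 0 <= t <= T -> (i < 3)%nat -> Tint (u i) t = 0.
Proof. intros Ht Hi; rewrite Tint_torus_int; apply Hmean; assumption. Qed.

Lemma system_K_small t x y z i j : 0 <= t <= T -> (i < 3)%nat -> (j < 3)%nat -> Rabs (K i j t x y z) <= K_threshold.
Proof.
  intros Ht Hi Hj; assert (HM := M_ge); eapply Rle_trans; [|exact Hdthr].
  apply (Rabs_le_of_Hs_sq (2 * M - 3)); [lia | apply Hd|]; eapply Rle_trans; [|apply (HEM t Ht)]; unfold EM.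
  assert (HE := Ebar_nonneg u th K t); assert (HK := Hs_sq_le_EK K t i j Hi Hj); lra.
Qed.

Lemma system_energy t : 0 <= t <= T -> Ebar M (fun i => u i) (fun i => th i) (fun i j => K i j) t <= d * d.
Proof. intros Ht; assert (HE := HEM t Ht); assert (HK := EK_nonneg K t); unfold EM in HE; lra. Qed.

Definition system_solution : Solution :=
  mkSolution u p th K T d HT system_momentum system_divergence system_microrotation system_inertia system_K_sym
    system_K_block system_K_corner system_u_mean system_K_small Hd system_energy.

End System.

(** * The a priori estimates *)

Section Estimates.
Context {P : Coefficients}.

Lemma lesssim_small_trans (A B C : State -> R) : A <~ B -> lesssim_small B C -> lesssim_small A C.
Proof.
  intros (c & Hc & HAB) (e0 & d & He0 & Hd & HBC); exists e0, (c * d); split;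
    [exact He0 | split; [apply Rmult_le_pos; assumption|]].
  intros s Hs; eapply Rle_trans; [apply HAB|]; rewrite Rmult_assoc; apply Rmult_le_compat_l; auto.
Qed.

Lemma lesssim_small_weaken (A B C : State -> R) : lesssim_small A B -> (forall s, B s <= C s) -> lesssim_small A C.
Proof.
  intros (e0 & c & He0 & Hc & HAB) HBC; exists e0, c; split; [exact He0 | split; [exact Hc|]].
  intros s Hs; eapply Rle_trans; [apply HAB, Hs | apply Rmult_le_compat_l; auto].
Qed.

Lemma lesssim_small_add (A B C : State -> R) : lesssim_small A C -> lesssim_small B C ->
  lesssim_small (fun s => A s + B s) C.
Proof.
  intros (e1 & c & He1 & Hc & HA) (e2 & d & He2 & Hd & HB); exists (Rmin e1 e2), (c + d).
  split; [apply Rmin_pos; assumption | split; [lra|]]; intros s Hs; assert (min1 := Rmin_l e1 e2);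
    assert (min2 := Rmin_r e1 e2).
  specialize (HA s ltac:(lra)); specialize (HB s ltac:(lra)); lra.
Qed.

Definition initial_energy (s : State) : R := Energy s 0.
Definition initial_data (s : State) : R := initial_energy s + FM M (fun i j => sol_K s i j) 0.

Lemma initial_energy_le_data s : initial_energy s <= initial_data s.
Proof. assert (H := FM_nonneg (sol_K s) 0); unfold initial_data; lra. Qed.

Lemma energy_lesssim_initial : lesssim_small energy initial_energy.
Proof.
  apply (lesssim_small_trans _ (fun s => energy s + RInt (Diss (2 * M) s) 0 (time s))); [|exact high_energy].
  apply lesssim_le; intros s; assert (H := RInt_Diss_nonneg (2 * M) s (time s) (proj1 (time_ok s))); lra.
Qed.

Lemma RInt_Diss_lesssim_initial : lesssim_small (fun s => RInt (Diss (2 * M) s) 0 (time s)) initial_energy.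
Proof.
  apply (lesssim_small_trans _ (fun s => energy s + RInt (Diss (2 * M) s) 0 (time s))); [|exact high_energy].
  apply lesssim_le; intros s; assert (H := energy_nonneg s); lra.
Qed.

Lemma Elow_decay : lesssim_small
  (fun s => Elow (fun i => sol_u s i) (fun i => sol_th s i) (fun i j => sol_K s i j) (time s)
    * (1 + time s) ^ (2 * M - 2))
  initial_energy.
Proof.
  apply (lesssim_small_trans _ (fun s => words_normsq 2 s (time s) * (1 + time s) ^ (2 * M - 2))).
  { destruct Elow_lesssim_words as (C & HC & Hlow); exists C; split; [exact HC|]; intros s; rewrite <- Rmult_assoc.
    apply Rmult_le_compat_r; [apply pow_le; assert (Ht := time_ok s); lra | apply Hlow]. }
  destruct low_decay as (e1 & C1 & He1 & HC1 & decay); destruct energy_lesssim_initial as (e2 & C2 & He2 & HC2 & Hen).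
  exists (Rmin e1 e2), (C1 * C2); split; [apply Rmin_pos; assumption | split; [apply Rmult_le_pos; lra|]].
  intros s Hs; assert (min1 := Rmin_l e1 e2); assert (min2 := Rmin_r e1 e2); rewrite Rmult_assoc.
  apply decay; [unfold size_at in Hs; lra| |apply time_ok].
  intros t Ht; apply (Hen (mkState s t Ht)); unfold size_at in *; cbn [sol]; lra.
Qed.

Lemma FM_growth : lesssim_small (fun s => FM M (fun i j => sol_K s i j) (time s) / (1 + time s)) initial_data.
Proof.
  apply (lesssim_small_trans _ (fun s => (K_top s (time s) + energy s) / (1 + time s))).
  { destruct FM_lesssim as (C & HC & HFM); exists C; split; [exact HC|]; intros s; assert (Ht := time_ok s).
    unfold Rdiv; rewrite <- Rmult_assoc; apply Rmult_le_compat_r; [left; apply Rinv_0_lt_compat; lra | apply HFM]. }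
  destruct K_top_growth as (e1 & C1 & He1 & HC1 & growth); destruct high_energy as (e2 & C2 & He2 & HC2 & Hen).
  set (N := INR (length (space_words (2 * M + 1)))); assert (HN : 0 <= N) by apply pos_INR.
  exists (Rmin e1 e2), (C1 * (N + C2) + C2); split; [apply Rmin_pos; assumption|].
  split; [apply Rplus_le_le_0_compat; [apply Rmult_le_pos|]; lra|].
  intros s Hs; assert (min1 := Rmin_l e1 e2); assert (min2 := Rmin_r e1 e2); assert (Ht := time_ok s).
  specialize (growth s ltac:(lra)); specialize (Hen s ltac:(lra)); cbv beta in growth, Hen.
  assert (HK := K_top_le_FM s 0); fold N in HK; fold (initial_energy s) in Hen.
  assert (HI := RInt_Diss_nonneg (2 * M) s (time s) (proj1 Ht)); assert (He := energy_nonneg s).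
  set (I := RInt (Diss (2 * M) s) 0 (time s)) in *; set (r := 1 + time s) in *; assert (Hr : 1 <= r) by (unfold r; lra).
  assert (Hdata := initial_energy_le_data s); assert (Hinit : 0 <= initial_energy s) by exact (Energy_nonneg s 0).
  assert (HFM : FM M (fun i j => sol_K s i j) 0 <= initial_data s) by (unfold initial_data; lra).
  set (q := initial_data s) in *; apply Rle_div_l; [lra|].
  assert (HNq : N * q <= N * q * r) by (rewrite <- (Rmult_1_r (N * q)) at 1; apply Rmult_le_compat_l;
    [apply Rmult_le_pos|]; lra).
  assert (HCq : C2 * q <= C2 * q * r) by (rewrite <- (Rmult_1_r (C2 * q)) at 1; apply Rmult_le_compat_l;
    [apply Rmult_le_pos|]; lra).
  assert (HNF : N * FM M (fun i j => sol_K s i j) 0 <= N * q) by (apply Rmult_le_compat_l; lra).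
  assert (HC2q : C2 * initial_energy s <= C2 * q) by (apply Rmult_le_compat_l; lra).
  assert (HrI : r * I <= r * (C2 * q)) by (apply Rmult_le_compat_l; lra).
  assert (C1 * (K_top s 0 + r * I) <= C1 * (N * q * r + r * (C2 * q))) by (apply Rmult_le_compat_l; lra); lra.
Qed.

Lemma DM_integral : lesssim_small
  (fun s => RInt (DM M (fun i => sol_u s i) (fun i => sol_th s i) (fun i j => sol_K s i j)) 0 (sol_T s)) initial_energy.
Proof.
  destruct DM_lesssim_diss as (C1 & HC1 & HDM); destruct RInt_Diss_lesssim_initial as (e0 & C2 & He0 & HC2 & Hint).
  exists e0, (C1 * C2); split; [exact He0 | split; [apply Rmult_le_pos; assumption|]]; intros s Hs.
  assert (HT : 0 <= sol_T s <= sol_T s) by (assert (H := sol_T_pos s); lra).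
  apply Rle_trans with (RInt (fun r => C1 * Diss (2 * M) s r) 0 (sol_T s)).
  - apply RInt_le; [apply HT | apply ex_RInt_cont, DM_continuous | |].
    + apply (ex_RInt_scal (V := R_NormedModule)), ex_RInt_cont, Diss_continuous.
    + intros r Hr; assert (Hr' : 0 <= r <= sol_T s) by lra; exact (HDM (mkState s r Hr')).
  - rewrite (RInt_scal (V := R_CompleteNormedModule)) by apply ex_RInt_cont, Diss_continuous.
    rewrite Rmult_assoc; apply Rmult_le_compat_l; [exact HC1 | exact (Hint (mkState s (sol_T s) HT) Hs)].
Qed.

Lemma energies_lesssim_initial : lesssim_small
  (fun s => let u := fun i => field_fun (sol_u s i) in let th := fun i => field_fun (sol_th s i) in
     let K := fun i j => field_fun (sol_K s i j) in
     Elow u th K (time s) * (1 + time s) ^ (2 * M - 2) + Ebar M u th K (time s) + FM M K (time s) / (1 + time s)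
     + RInt (DM M u th K) 0 (sol_T s)) initial_data.
Proof.
  assert (weaken : forall A, lesssim_small A initial_energy -> lesssim_small A initial_data)
    by (intros A HA; apply (lesssim_small_weaken _ _ _ HA initial_energy_le_data)).
  apply lesssim_small_add; [apply lesssim_small_add; [apply lesssim_small_add|]|].
  - apply weaken, Elow_decay.
  - apply weaken, energy_lesssim_initial.
  - apply FM_growth.
  - apply weaken, DM_integral.
Qed.

Lemma EK_lesssim_initial : lesssim_small (fun s => EK M (fun i j => sol_K s i j) (time s)) initial_energy.
Proof. eapply lesssim_small_trans; [exact EK_lesssim_energy | exact energy_lesssim_initial]. Qed.

Lemma system_estimates : exists delta C, 0 < delta <= 1 /\ 0 < C /\
  forall (u : nat -> PField) (p : PField) (th : nat -> PField) (K : nat -> nat -> PField) T, 0 < T ->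
  (forall t x y z, 0 <= t <= T ->
     system_P mu kappa alpha beta gamma tau lam nu (fun i => u i) p (fun i => th i) (fun i j => K i j) t x y z) ->
  (forall t, 0 <= t <= T -> forall i, (i < 3)%nat -> torus_int (u i) t = 0) ->
  (forall x y z s, det3 (fun i j => (if (i =? j)%nat then s else 0) - (Jeq lam nu i j + K i j 0 x y z))
     = (s - lam) ^ 2 * (s - nu)) ->
  (forall t, 0 <= t <= T ->
     EM M (fun i => u i) (fun i => th i) (fun i j => K i j) t
     + RInt (Dbar M (fun i => u i) (fun i => th i)) 0 T <= delta) ->
  (forall t, 0 <= t <= T ->
     Elow (fun i => u i) (fun i => th i) (fun i j => K i j) t * (1 + t) ^ (2 * M - 2)
     + Ebar M (fun i => u i) (fun i => th i) (fun i j => K i j) t + FM M (fun i j => K i j) t / (1 + t)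
     + RInt (DM M (fun i => u i) (fun i => th i) (fun i j => K i j)) 0 T
     <= C * (Ebar M (fun i => u i) (fun i => th i) (fun i j => K i j) 0 + FM M (fun i j => K i j) 0)) /\
  (forall t, 0 <= t <= T -> EK M (fun i j => K i j) t
     <= C * (EM M (fun i => u i) (fun i => th i) (fun i j => K i j) 0 + FM M (fun i j => K i j) 0)).
Proof.
  destruct energies_lesssim_initial as (e1 & C1 & He1 & HC1 & energies);
    destruct EK_lesssim_initial as (e2 & C2 & He2 & HC2 & HEK).
  assert (Hthr := K_threshold_pos); set (e3 := K_threshold / 8); set (d := Rmin (Rmin e1 e2) (Rmin e3 1)).
  assert (Hd : 0 < d) by (repeat apply Rmin_pos; unfold e3; lra).
  assert (d12 := Rmin_l (Rmin e1 e2) (Rmin e3 1)); assert (d34 := Rmin_r (Rmin e1 e2) (Rmin e3 1)); fold d in d12, d34.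
  assert (min1 := Rmin_l e1 e2); assert (min2 := Rmin_r e1 e2); assert (min3 := Rmin_l e3 1);
    assert (min4 := Rmin_r e3 1).
  exists (d * d), (C1 + C2 + 1); split; [split; [apply Rmult_lt_0_compat; assumption | nra] | split; [lra|]].
  intros u p th K T HT Hsys Hmean Hspec Hsmall; assert (HD := RInt_Dbar_nonneg u th T (Rlt_le _ _ HT)).
  assert (HEM : forall t, 0 <= t <= T -> EM M (fun i => u i) (fun i => th i) (fun i j => K i j) t <= d * d)
    by (intros t Ht; specialize (Hsmall t Ht); lra).
  set (S := system_solution u p th K T HT Hsys Hspec Hmean d ltac:(lra) ltac:(unfold e3 in *; lra) HEM).
  assert (Hinit := EK_nonneg K 0); assert (HF := FM_nonneg K 0); assert (HE := Ebar_nonneg u th K 0).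
  split; intros t Ht; set (s := mkState S t Ht).
  - eapply Rle_trans; [exact (energies s ltac:(unfold size_at; simpl; lra))|].
    change (initial_data s)
      with (Ebar M (fun i => u i) (fun i => th i) (fun i j => K i j) 0 + FM M (fun i j => K i j) 0).
    apply Rmult_le_compat_r; lra.
  - eapply Rle_trans; [exact (HEK s ltac:(unfold size_at; simpl; lra))|].
    change (initial_energy s) with (Ebar M (fun i => u i) (fun i => th i) (fun i j => K i j) 0); unfold EM.
    apply Rmult_le_compat; lra.
Qed.

End Estimates.

Definition bundle_vector (v : VField) (Hv : forall i, (i < 3)%nat ->
  smooth (v i) /\ periodic (v i)) (i : nat) : PField :=
  match le_lt_dec 3 i with
  | left _ => Fconst 0
  | right Hi => mkPField (v i) (proj1 (Hv i Hi)) (proj2 (Hv i Hi))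
  end.

Definition bundle_matrix (A : MField) (HA : forall i j, (i < 3)%nat -> (j < 3)%nat ->
  smooth (A i j) /\ periodic (A i j))
  (i j : nat) : PField :=
  match le_lt_dec 3 i with
  | left _ => Fconst 0
  | right Hi => bundle_vector (A i) (fun j Hj => HA i j Hi Hj) j
  end.

Lemma bundle_system_P mu kappa alpha beta gamma tau lam nu u Hu p th Hth K HK t x y z :
  system_P mu kappa alpha beta gamma tau lam nu u p th K t x y z ->
  system_P mu kappa alpha beta gamma tau lam nu (fun i => bundle_vector u Hu i) p (fun i => bundle_vector th Hth i)
    (fun i j => bundle_matrix K HK i j) t x y z.
Proof.
  intros (momentum & divergence & microrotation & inertia_eq & sym); split;
    [|split; [exact divergence | split; [|split]]].
  - intros i Hi; case_lt3 i; exact (momentum _ Hi).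
  - intros i Hi; case_lt3 i; exact (microrotation _ Hi).
  - intros i j Hi Hj; case_lt3 i; case_lt3 j; exact (inertia_eq _ _ Hi Hj).
  - intros i j Hi Hj; case_lt3 i; case_lt3 j; exact (sym _ _ Hi Hj).
Qed.

Theorem theorem4p33 (mu kappa alpha beta gamma tau lam nu : R) (M : nat) :
  0 < mu -> 0 < kappa -> 0 < alpha -> 0 < beta -> 0 < gamma -> 0 < tau ->
  0 < lam -> lam < nu -> (4 <= M)%nat ->
  exists eta_ap delta_ap C_ap : R,
    0 < eta_ap <= 1 /\ 0 < delta_ap <= 1 /\ 0 < C_ap /\
    forall (T : R) (u : VField) (p : Field) (th : VField) (K : MField),
      0 < T ->
      (forall i, (i < 3)%nat -> smooth (u i) /\ periodic (u i)) ->
      smooth p -> periodic p ->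
      (forall i, (i < 3)%nat -> smooth (th i) /\ periodic (th i)) ->
      (forall i j, (i < 3)%nat -> (j < 3)%nat -> smooth (K i j) /\ periodic (K i j)) ->
      (forall t x y z, 0 <= t <= T ->
         system_P mu kappa alpha beta gamma tau lam nu u p th K t x y z) ->
      (forall t, 0 <= t <= T -> forall i, (i < 3)%nat -> torus_int (u i) t = 0) ->
      (forall x y z s,
         det3 (fun i j => (if (i =? j)%nat then s else 0)
                          - (Jeq lam nu i j + K i j 0 x y z))
         = (s - lam) ^ 2 * (s - nu)) ->
      EM M u th K 0 + FM M K 0 <= eta_ap ->
      (forall t, 0 <= t <= T ->
         EM M u th K t + RInt (Dbar M u th) 0 T <= delta_ap) ->
      (forall t, 0 <= t <= T ->
         Elow u th K t * (1 + t) ^ (2 * M - 2) + Ebar M u th K t + FM M K t / (1 + t)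
         + RInt (DM M u th K) 0 T
         <= C_ap * (Ebar M u th K 0 + FM M K 0)) /\
      (forall t, 0 <= t <= T ->
         EK M K t <= C_ap * (EM M u th K 0 + FM M K 0)).
Proof.
  intros Hmu Hkappa Halpha Hbeta Hgamma Htau Hlam Hnu HM.
  destruct (@system_estimates (mkCoefficients mu kappa alpha beta gamma tau lam nu M
    Hmu Hkappa Halpha Hbeta Hgamma Htau Hlam Hnu HM)) as (delta & C & Hdelta & HC & estimates).
  exists 1, delta, C; split; [lra | split; [exact Hdelta | split; [exact HC|]]].
  intros T u p th K HT Hu Hp Hp' Hth HK Hsys Hmean Hspec _ Hsmall.
  apply (estimates (bundle_vector u Hu) (mkPField p Hp Hp') (bundle_vector th Hth) (bundle_matrix K HK) T HT).
  - intros t x y z Ht; apply bundle_system_P, Hsys, Ht.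
  - intros t Ht i Hi; case_lt3 i; exact (Hmean t Ht _ Hi).
  - exact Hspec.
  - exact Hsmall.
Qed.
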